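(* Let $m\ge2$ and let $(p:\mathcal P\to N,\omega)$ be a lightlike Cartan geometry with standard tractor bundle $(\mathcal T,\mathbf h,\nabla^{\mathcal T},\xi)$. Then $(p:\mathcal P\to N,\omega)$ is locally a fiber bundle of scales of a Riemannian conformal structure if and only if $$R^{\mathcal T}(Z^\omega,V)T=0\qquad\text{for every }V\in\mathfrak X(N)\text{ and }T\in\Gamma(\mathcal T),$$ where $R^{\mathcal T}$ denotes the curvature tensor of the tractor connection $\nabla^{\mathcal T}$.
   Context: Conventions. Manifolds are smooth, Hausdorff, connected, second countable. $\mathbb L^{m+2}$ is $\mathbb R^{m+2}$ with its Lorentzian inner product $\langle\,,\rangle$ of signature $(m+1,1)$ and a fixed basis $(\ell,e_1,\dots,e_m,n)$ with $\ell$ in the future lightlike cone, $\langle \ell,n\rangle=1$, $\langle e_i,e_j\rangle=\delta_{ij}$ and all other products of basis vectors zero. $G=O^+(m+1,1)$ is the group of linear isometries of $\mathbb L^{m+2}$ preserving the future lightlike cone, $H\subset G$ is the isotropy subgroup of $\ell$ and $P\supset H$ is the isotropy subgroup of the line $\mathbb R\ell$; $P/H\cong\mathbb R_{>0}$. In the fixed basis the Lie algebra $\mathfrak g$ of $G$ consists of the matrices $\begin{pmatrix} a&\zeta&0\\ X&A&-\zeta^t\\0&-X^t&-a\end{pmatrix}$ with $a\in\mathbb R$, $X\in\mathbb R^m$, $\zeta\in(\mathbb R^m)^*$, $A\in\mathfrak o(m)$, and the Lie algebra $\mathfrak h$ of $H$ is given by $a=0$, $X=0$; so $\mathfrak g/\mathfrak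 h\cong\mathbb R\times\mathbb R^m$ via $(a,X)$. For a closed subgroup $Q\subset G$ with Lie algebra $\mathfrak q$, a Cartan geometry of type $(G,Q)$ on a manifold $M$ is a principal $Q$-bundle $\pi:\mathcal G\to M$ with $\omega\in\Omega^1(\mathcal G,\mathfrak g)$ such that each $\omega(u):T_u\mathcal G\to\mathfrak g$ is a linear isomorphism, $(r^k)^*\omega=\mathrm{Ad}(k^{-1})\circ\omega$ for $k\in Q$, and $\omega(\zeta_X)=X$ for the fundamental vector field of each $X\in\mathfrak q$. Isomorphisms are principal bundle isomorphisms pulling back one Cartan connection to the other. A lightlike Cartan geometry is a Cartan geometry of type $(G,H)$. For it, with $u\in\mathcal P$, $x=p(u)$, let $\phi_u:T_xN\to\mathfrak g/\mathfrak h$ be the isomorphism with $\phi_u(T_up\cdot\zeta)=\omega(u)(\zeta)+\mathfrak h$, and $Z^\omega_x=\phi_u^{-1}(1,0)$ (independent of $u$). A Cartan geometry $(\mathcal G\to M,\omega')$ of type $(G,P)$ induces a Riemannian conformal structure on $M$; its correspondence space is $\mathcal G/H$, which is the bundle of scales (the bundle of rays formed by the metrics in the conformal class) of this conformal structure, and $(\mathcal G\to\mathcal G/H,\omega')$ is a lightlike Cartan geometry. A lightlike Cartan geometry $(p:\mathcal P\to N,\omega)$ is locally a fiber bundle of scales of a Riemannian conformal structure if every point of $N$ has an open neighbourhood $U$ such that $(p^{-1}(U)\to U,\omega|_{p^{-1}(U)})$ is isomorphic to the restriction of $(\mathcal G\to\mathcal G/H,\omega')$ to an open subset of $\mathcal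 G/H$, for some Cartan geometry $(\mathcal G\to M,\omega')$ of type $(G,P)$. The standard tractor bundle is $\mathcal T=\mathcal P\times_H\mathbb L^{m+2}$ with metric $\mathbf h([u,v_1],[u,v_2])=\langle v_1,v_2\rangle$, section $\xi_x=[u,\ell]$, and the $\mathbf h$-metric connection $\nabla^{\mathcal T}$ induced by the unique principal connection on $\mathcal P\times_HG$ restricting to $\omega$ on $\mathcal P$; locally $\nabla^{\mathcal T}_W[s,f]=[s,W(f)+\omega(Ts\cdot W)f]$ for a local section $s$ of $\mathcal P$ and an $\mathbb L^{m+2}$-valued function $f$. $R^{\mathcal T}(V,W)T=\nabla^{\mathcal T}_V\nabla^{\mathcal T}_WT-\nabla^{\mathcal T}_W\nabla^{\mathcal T}_VT-\nabla^{\mathcal T}_{[V,W]}T$. *)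

(* Defs.v *)
From mathcomp Require Import all_boot all_order all_algebra.
From mathcomp Require Import all_classical all_reals all_analysis.

Set Implicit Arguments.
Unset Strict Implicit.
Unset Printing Implicit Defensive.

Import Order.TTheory GRing.Theory Num.Theory.
Import numFieldNormedType.Exports.

Local Open Scope classical_set_scope.
Local Open Scope ring_scope.

(* C^oo on an open set [O]: all iterated directional derivatives of [f] are
   (Frechet) differentiable at every point of [O]. *)
Definition smooth_on (R : realType) (V W : normedModType R)
    (O : set V) (f : V -> W) : Prop :=
  forall (s : seq V) (x : V), O x ->
    differentiable (foldr (fun v (g : V -> W) y => 'D_v g y) f s) x.

Definition smooth_near (R : realType) (V W : normedModType R)
    (x : V) (f : V -> W) : Prop :=
  exists O : set V, [/\ open O, O x & smooth_on O f].

(* The values of [cmap] off [cdom] and of [cinv] off [cmap @` cdom] are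
   irrelevant. *)
Record chart (R : realType) (M : topologicalType) (n : nat) := Chart {
  cdom : set M;
  cmap : M -> 'rV[R]_n;
  cinv : 'rV[R]_n -> M;
  cdom_open : open cdom;
  cimg_open : open (cmap @` cdom);
  cmapK : {in cdom, cancel cmap cinv};
  cmap_cont : {within cdom, continuous cmap};
  cinv_cont : {within cmap @` cdom, continuous cinv} }.

(* The atlas is indexed by the points of the manifold: it consists of one
   preferred chart [chart_at x] around each point [x].  Connectedness is not
   part of the structure, because the total space of a principal bundle over a
   connected manifold need not be connected. *)
Record manifold (R : realType) := Manifold {
  mcarrier :> topologicalType;
  mdim : nat;
  chart_at : mcarrier -> chart R mcarrier mdim;
  chart_atP : forall x, cdom (chart_at x) x;
  chart_compat : forall x y,
    smooth_on (cmap (chart_at x) @` (cdom (chart_at x) `&` cdom (chart_at y)))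
              (cmap (chart_at y) \o cinv (chart_at x));
  manifold_hausdorff : hausdorff_space mcarrier;
  manifold_second_countable : @second_countable mcarrier }.

(* T_x M, identified with R^n by means of the chart [chart_at x]. *)
Definition tangent (R : realType) (M : manifold R) (x : M) : Type :=
  'rV[R]_(mdim M).

Definition coo (R : realType) (M : manifold R) (x : M) : 'rV[R]_(mdim M) :=
  cmap (chart_at x) x.

(* [U] is meant to be open. *)
Definition smooth_map_on (R : realType) (M M' : manifold R)
    (U : set M) (f : M -> M') : Prop :=
  forall x, U x -> {for x, continuous f} /\
    smooth_near (coo x) (cmap (chart_at (f x)) \o f \o cinv (chart_at x)).

Definition smooth_fun_on (R : realType) (M : manifold R) (W : normedModType R)
    (U : set M) (f : M -> W) : Prop :=
  forall x, U x -> smooth_near (coo x) (f \o cinv (chart_at x)).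

(* The tangent map T_x f : T_x M -> T_(f x) M'. *)
Definition tmap (R : realType) (M M' : manifold R) (f : M -> M')
    (x : M) (v : tangent x) : tangent (f x) :=
  'D_v (cmap (chart_at (f x)) \o f \o cinv (chart_at x)) (coo x).

(* The derivative w(f) of a vector-valued function along w in T_x M. *)
Definition dfun (R : realType) (M : manifold R) (W : normedModType R)
    (f : M -> W) (x : M) (w : tangent x) : W :=
  'D_w (f \o cinv (chart_at x)) (coo x).

Definition vfield (R : realType) (M : manifold R) : Type :=
  forall x : M, tangent x.

(* Coordinate expression of a vector field in an arbitrary chart [c]. *)
Definition vfield_in (R : realType) (M : manifold R)
    (c : chart R M (mdim M)) (V : vfield M) (y : 'rV[R]_(mdim M)) :
    'rV[R]_(mdim M) :=
  let x := cinv c y in 'D_(V x) (cmap c \o cinv (chart_at x)) (coo x).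

Definition smooth_vfield (R : realType) (M : manifold R) (V : vfield M) :
    Prop :=
  forall x, smooth_near (coo x) (vfield_in (chart_at x) V).

Definition lie_bracket (R : realType) (M : manifold R) (V W : vfield M) :
    vfield M :=
  fun x => 'D_(V x) (vfield_in (chart_at x) W) (coo x)
         - 'D_(W x) (vfield_in (chart_at x) V) (coo x).

(* A one-form with values in [W]: linear on each tangent space, and the
   functions omega(d/dy_i) of each chart are smooth. *)
Definition smooth_form (R : realType) (M : manifold R) (W : normedModType R)
    (omega : forall x : M, tangent x -> W) : Prop :=
  (forall x (a : R) (v w : 'rV[R]_(mdim M)),
     omega x (a *: v + w) = a *: omega x v + omega x w) /\
  (forall (x0 : M) (w : 'rV[R]_(mdim M)),
     smooth_near (coo x0) (fun y => let x := cinv (chart_at x0) y in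
       omega x ('D_w (cmap (chart_at x) \o cinv (chart_at x0)) y))).

(* Matrices and column vectors of L^(m+2) are written in the basis
   (l, e_1, ..., e_m, n), with blocks of sizes 1, m, 1. *)
Notation Lvec R m := 'cV[R]_(1 + (m + 1))%N.
Notation Lmat R m := 'M[R]_(1 + (m + 1))%N.

Definition gram (R : realType) (m : nat) : Lmat R m :=
  block_mx 0                   (row_mx 0 1%:M)
           (col_mx 0 1%:M)     (block_mx 1%:M 0 0 0).

Definition lorentz (R : realType) (m : nat) (v w : Lvec R m) : R :=
  (v^T *m gram R m *m w) 0 0.

Definition vec_l (R : realType) (m : nat) : Lvec R m :=
  col_mx 1%:M 0.
Definition vec_n (R : realType) (m : nat) : Lvec R m :=
  col_mx 0 (col_mx 0 1%:M).

(* As <l, n> = 1, the vector l - n is timelike and lies in the same time cone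
   as l; a nonzero null vector v is future-directed iff <v, l - n> < 0. *)
Definition future_cone (R : realType) (m : nat) : set (Lvec R m) :=
  [set v | lorentz v v = 0 /\ lorentz v (vec_l R m - vec_n R m) < 0].

(* O^+(m+1,1) *)
Definition grpG (R : realType) (m : nat) : set (Lmat R m) :=
  [set g | (forall v w : Lvec R m,
              lorentz (g *m v : Lvec R m) (g *m w : Lvec R m) = lorentz v w) /\
           (forall v : Lvec R m,
              future_cone (g *m v : Lvec R m) <-> future_cone v)].

Definition grpH (R : realType) (m : nat) : set (Lmat R m) :=
  [set g | grpG g /\ g *m vec_l R m = vec_l R m].

Definition grpP (R : realType) (m : nat) : set (Lmat R m) :=
  [set g | grpG g /\ exists c : R, g *m vec_l R m = c *: vec_l R m].

Definition lie_elt (R : realType) (m : nat)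
    (a : R) (X : 'cV[R]_m) (zeta : 'rV[R]_m) (A : 'M[R]_m) : Lmat R m :=
  block_mx a%:M            (row_mx zeta 0)
           (col_mx X 0)    (block_mx A       (- zeta^T)
                                     (- X^T) (- a%:M)).

Definition lie_g (R : realType) (m : nat) : set (Lmat R m) :=
  [set Y | exists a X zeta A, A^T = - A /\ Y = lie_elt a X zeta A].

Definition lie_h (R : realType) (m : nat) : set (Lmat R m) :=
  [set Y | exists zeta A, A^T = - A /\ Y = lie_elt 0 0 zeta A].

(* [Q] is a closed subgroup of G, hence an embedded submanifold of the space of
   matrices; only the values [act u k] with [k] in [Q] matter, and smoothness
   on [E * Q] means the local existence of smooth extensions to [E * Lmat]. *)
Definition smooth_action (R : realType) (m : nat) (Q : set (Lmat R m))
    (E : manifold R) (act : E -> Lmat R m -> E) : Prop :=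
  [/\ forall u, act u 1%:M = u,
      forall u k k', Q k -> Q k' -> act (act u k) k' = act u (k *m k')
    & forall u k, Q k ->
        exists (O : set ('rV[R]_(mdim E) * Lmat R m)%type)
               (F : ('rV[R]_(mdim E) * Lmat R m)%type -> 'rV[R]_(mdim E)),
        [/\ open O, O (coo u, k), smooth_on O F &
            forall y g, O (y, g) -> Q g ->
              let w := act (cinv (chart_at u) y) g in
              cdom (chart_at (act u k)) w /\
              cmap (chart_at (act u k)) w = F (y, g)]].

Definition local_section (R : realType) (E M : manifold R) (pi : E -> M)
    (U : set M) (s : M -> E) : Prop :=
  [/\ open U, smooth_map_on U s & forall y, U y -> pi (s y) = y].

(* The conditions on [s] and [tau] say that (y, k) |-> s(y) k is an equivariant
   diffeomorphism U * Q -> pi^-1(U) over U, with inverse (pi, tau). *)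
Definition principal_bundle (R : realType) (m : nat) (Q : set (Lmat R m))
    (E M : manifold R) (pi : E -> M) (act : E -> Lmat R m -> E) : Prop :=
  [/\ smooth_map_on [set: E] pi,
      smooth_action Q act,
      forall u k, Q k -> pi (act u k) = pi u
    & forall x : M, exists (U : set M) (s : M -> E) (tau : E -> Lmat R m),
        [/\ U x, local_section pi U s, smooth_fun_on (pi @^-1` U) tau,
            forall u, U (pi u) -> Q (tau u) /\ act (s (pi u)) (tau u) = u
          & forall y k, U y -> Q k -> tau (act (s y) k) = k]].

(* In the last condition [gamma] runs over the smooth curves of [Q] through the
   identity: X = gamma'(0) runs over the Lie algebra of [Q], and the velocity
   of u gamma(t) at t = 0 is the fundamental vector field of X at [u]. *)
Definition cartan_geometry (R : realType) (m : nat) (Q : set (Lmat R m))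
    (E M : manifold R) (pi : E -> M) (act : E -> Lmat R m -> E)
    (omega : forall u : E, tangent u -> Lmat R m) : Prop :=
  [/\ principal_bundle Q pi act,
      smooth_form omega,
      forall u, injective (omega u) /\ range (omega u) = @lie_g R m,
      forall u k (v : tangent u), Q k ->
        omega (act u k) (tmap (fun u' => act u' k) v)
          = invmx k *m omega u v *m k
    & forall (gamma : R^o -> Lmat R m) u,
        smooth_on setT gamma -> (forall t, Q (gamma t)) -> gamma 0 = 1%:M ->
        omega u ('D_1 (fun t : R^o => cmap (chart_at u) (act u (gamma t))) 0)
          = 'D_1 gamma 0].

(* Z^omega_x = phi_u^-1(1, 0) for any u over x. *)
Definition Zfield (R : realType) (m : nat) (P N : manifold R) (p : P -> N)
    (omega : forall u : P, tangent u -> Lmat R m) : vfield N :=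
  fun x => xget 0 [set z : 'rV[R]_(mdim N) |
    exists u (v : tangent u), [/\ p u = x, tmap p v = z
      & lie_h (omega u v - lie_elt 1 0 0 0)]].

(* [q : E -> S] exhibits [S] as the quotient manifold E/H: it is a principal
   bundle for the action of H obtained by restricting the action of P.  This
   determines the smooth manifold [S] up to unique diffeomorphism. *)
Definition correspondence_space (R : realType) (m : nat) (E S : manifold R)
    (q : E -> S) (act : E -> Lmat R m -> E) : Prop :=
  principal_bundle (@grpH R m) q act.

(* Isomorphism between the restrictions of (p : P -> N, omega) to the open set
   [U] and of (q : E -> S, omega') to the open set [W], both with structure
   group [Q]; [f] is the bundle map, [f'] its inverse, [b] and [b'] the
   induced maps of the bases. *)
Definition cartan_iso_on (R : realType) (m : nat) (Q : set (Lmat R m))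
    (P N : manifold R) (p : P -> N) (act : P -> Lmat R m -> P)
    (omega : forall u : P, tangent u -> Lmat R m) (U : set N)
    (E S : manifold R) (q : E -> S) (act' : E -> Lmat R m -> E)
    (omega' : forall u : E, tangent u -> Lmat R m) (W : set S) : Prop :=
  exists (f : P -> E) (f' : E -> P) (b : N -> S) (b' : S -> N),
  [/\ [/\ smooth_map_on (p @^-1` U) f, smooth_map_on (q @^-1` W) f',
          (forall u, U (p u) -> f' (f u) = u)
        & (forall e, W (q e) -> f (f' e) = e)],
      [/\ smooth_map_on U b, smooth_map_on W b',
          (forall x, U x -> W (b x) /\ b' (b x) = x)
        & (forall y, W y -> U (b' y) /\ b (b' y) = y)],
      [/\ (forall u, U (p u) -> q (f u) = b (p u))
        & (forall e, W (q e) -> p (f' e) = b' (q e))],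
      (forall u k, U (p u) -> Q k -> f (act u k) = act' (f u) k)
    & (forall u (v : tangent u), U (p u) ->
         omega' (f u) (tmap f v) = omega u v)].

Definition locally_bundle_of_scales (R : realType) (m : nat)
    (P N : manifold R) (p : P -> N) (act : P -> Lmat R m -> P)
    (omega : forall u : P, tangent u -> Lmat R m) : Prop :=
  forall x : N, exists U : set N, [/\ open U, U x &
    exists (E M S : manifold R) (pi : E -> M) (q : E -> S)
           (act' : E -> Lmat R m -> E)
           (omega' : forall u : E, tangent u -> Lmat R m) (W : set S),
    [/\ connected [set: M],
        cartan_geometry (@grpP R m) pi act' omega',
        correspondence_space q act',
        open W
      & cartan_iso_on (@grpH R m) p act omega U q act' omega' W]].

(* The class [u, v], as a set of representatives.  It is the graph over the
   fiber p^-1(p u) of an equivariant L^(m+2)-valued function. *)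
Definition tclass (R : realType) (m : nat) (P : manifold R)
    (act : P -> Lmat R m -> P) (u : P) (v : Lvec R m) :
    set (P * Lvec R m)%type :=
  [set w | exists2 h, grpH h & w = (act u h, invmx h *m v)].

(* The vector v with t = [u, v]. *)
Definition tcoord (R : realType) (m : nat) (P : manifold R)
    (t : set (P * Lvec R m)%type) (u : P) : Lvec R m :=
  xget 0 [set v | t (u, v)].

Definition tsub (R : realType) (m : nat) (P : manifold R)
    (t1 t2 : set (P * Lvec R m)%type) : set (P * Lvec R m)%type :=
  [set w | exists v1 v2, [/\ t1 (w.1, v1), t2 (w.1, v2) & w.2 = v1 - v2]].

Definition tzero (R : realType) (m : nat) (P N : manifold R) (p : P -> N)
    (x : N) : set (P * Lvec R m)%type :=
  [set w | p w.1 = x /\ w.2 = 0].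

(* Smooth sections T: [T x] belongs to the fiber over [x], and T = [s, f] with
   f smooth for each local section s of P. *)
Definition tractor_section (R : realType) (m : nat) (P N : manifold R)
    (p : P -> N) (act : P -> Lmat R m -> P)
    (T : N -> set (P * Lvec R m)%type) : Prop :=
  (forall x, exists u v, p u = x /\ T x = tclass act u v) /\
  (forall U s, local_section p U s ->
     smooth_fun_on U (fun y => tcoord (T y) (s y))).

(* nabla_W [s, f] = [s, W(f) + omega(Ts W) f].  The class on the right does not
   depend on the local section s, so the union over all s is that class. *)
Definition nabla (R : realType) (m : nat) (P N : manifold R) (p : P -> N)
    (act : P -> Lmat R m -> P) (omega : forall u : P, tangent u -> Lmat R m)
    (W : vfield N) (T : N -> set (P * Lvec R m)%type) :
    N -> set (P * Lvec R m)%type :=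
  fun x => [set w | exists U s, [/\ U x, local_section p U s &
    let f y := tcoord (T y) (s y) in
    tclass act (s x)
      (dfun f (W x) + omega (s x) (tmap s (W x)) *m f x) w]].

Definition tractor_curvature (R : realType) (m : nat) (P N : manifold R)
    (p : P -> N) (act : P -> Lmat R m -> P)
    (omega : forall u : P, tangent u -> Lmat R m)
    (V W : vfield N) (T : N -> set (P * Lvec R m)%type) :
    N -> set (P * Lvec R m)%type :=
  let D := nabla p act omega in
  fun x => tsub (tsub (D V (D W T) x) (D W (D V T) x))
                (D (lie_bracket V W) T x).

(* Main.v *)
(* Both conditions say that the vector field Z inserted into the curvature matrix
   d omega_s + omega_s /\ omega_s of the pull-back omega_s of omega along every local section s
   gives zero.  The tractor curvature acts by this matrix in the frame given by s.  On a
   correspondence space E/H -> E/P the field Z is tangent to the fibers; up to a P-valued gauge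
   transformation omega_s is pulled back from E/P, so its curvature is horizontal.

   Conversely, straighten Z to d/dt in coordinates (t, x).  Since omega_s(Z) l = l, parallel
   transport K along the t-lines, started at K = 1 on t = 0, takes values in P and satisfies
   K l = e^t l.  The gauge transform of omega_s by K annihilates d/dt, and by the curvature condition
   it does not depend on t.  It is thus a form on R^m, which defines a Cartan geometry of type (G, P)
   on R^m * P, and s(z) h |-> (x, K(z) h) is the required isomorphism. *)

Require Import Defs.
From HB Require Import structures.
From mathcomp Require Import all_boot all_order all_algebra.
From mathcomp Require Import all_classical all_reals all_analysis.
From mathcomp Require Import ring lra.

Set Implicit Arguments.
Unset Strict Implicit.
Unset Printing Implicit Defensive.

Import Order.TTheory GRing.Theory Num.Theory.
Import numFieldNormedType.Exports.

Local Open Scope classical_set_scope.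
Local Open Scope ring_scope.

(** * Smooth maps between normed spaces *)

(** The analytic core is a flow depending smoothly on time and starting point. It is the limit of
    Euler polygons with 2^k steps, because Euler's method commutes exactly with passing to tangent
    maps: the derivative of a polygon is a polygon of the tangent field. Convergence of all
    derivatives thus reduces to convergence for another field, and smoothness follows by
    coinduction, without a variational equation. Both the straightening of Z and the parallel
    transport K are instances of this flow.

    Flows are built for fields of at most linear growth on the whole of R^n. Local data are
    therefore composed with a bounded smooth map that is the identity on a ball before they are
    integrated, and the conclusions are used on that ball only.

    The curvature condition concerns global vector fields and tractor sections, while the
    construction works with a single local section; cut-off functions on N bridge this gap. The
    geometry of type (G, P) has to live on an actual manifold: P receives its charts from the Cayley
    transform, which is rational with rational inverse. *)

Section FrechetCalculus.
Context {R : realType}.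
Implicit Types V W : normedModType R.

Lemma is_diff_eps V W (f : V -> W) (L : {linear V -> W}) x :
  continuous L ->
  (forall e, 0 < e -> \forall h \near (0 : V),
     `|f (h + x) - f x - L h| <= e * `|h|) ->
  is_diff x f L.
Proof.
move=> cL H.
have E : f \o shift x = cst (f x) + L +o_ 0 id.
  apply/eqaddoP => e e0 /=; near=> h.
  rewrite -[(_ - _) h]/(f (h + x) - (f x + L h)) opprD addrA.
  by near: h; exact: H.
have dE := diff_unique cL E.
apply: DiffDef => //; apply/diff_locallyP; split; first by rewrite dE.
by rewrite dE.
Unshelve. all: by end_near. Qed.

Lemma is_diff_near V W (f g : V -> W) (df : V -> W) x :
  (\forall y \near x, f y = g y) -> is_diff x f df -> is_diff x g df.
Proof.
move=> fg dfx.
have fx : differentiable f x by [].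
have -> : df = 'd f x by rewrite diff_val.
apply: is_diff_eps; first exact: diff_continuous.
move=> e e0.
have fgx := nbhs_singleton fg.
have /eqaddoP/(_ _ e0) He := diff_locally fx.
have H2 : \forall h \near (0 : V), f (h + x) = g (h + x).
  have : (h + x) @[h --> (0:V)] --> x.
    rewrite -[X in _ --> X]add0r; apply: cvgD; [exact: cvg_id | exact: cvg_cst].
  by move/(_ _ fg).
near=> h.
have E : f (h + x) = g (h + x) by near: h.
rewrite -E -fgx.
have : `|(f \o shift x - (cst (f x) + 'd f x)) h| <= e * `|h| by near: h.
by rewrite -[(_ - _) h]/(f (h + x) - (f x + 'd f x h)) opprD addrA.
Unshelve. all: by end_near. Qed.

Lemma is_diff_derive V W (f df : V -> W) x v :
  is_diff x f df -> 'D_v f x = df v.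
Proof. by move=> H; rewrite deriveE // diff_val. Qed.

Lemma is_diff_diff V W (f df : V -> W) x : is_diff x f df -> differentiable f x.
Proof. by []. Qed.

Lemma is_diff_der V W (f : V -> W) x :
  differentiable f x -> is_diff x f (fun v => 'D_v f x).
Proof.
move=> H; apply: DiffDef => //; apply/funext => v; by rewrite deriveE.
Qed.

Lemma derive_comp V V' W (f : V -> V') (g : V' -> W) x v :
  differentiable f x -> differentiable g (f x) ->
  'D_v (g \o f) x = 'D_('D_v f x) g (f x).
Proof.
move=> df dg; rewrite !deriveE //; last exact: differentiable_comp.
by rewrite diff_comp.
Qed.

Lemma derive_lin V W (f : V -> W) x (a : R) v w : differentiable f x ->
  'D_(a *: v + w) f x = a *: 'D_v f x + 'D_w f x.
Proof. by move=> df; rewrite !deriveE // linearP. Qed.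

Lemma derive_addv V W (f : V -> W) x v w : differentiable f x ->
  'D_(v + w) f x = 'D_v f x + 'D_w f x.
Proof. by move=> df; rewrite !deriveE // linearD. Qed.

Lemma derive_scalev V W (f : V -> W) x (a : R) v : differentiable f x ->
  'D_(a *: v) f x = a *: 'D_v f x.
Proof. by move=> df; rewrite !deriveE // linearZ. Qed.

Lemma derive_sumv V W (f : V -> W) x (I : Type) (r : seq I) (v : I -> V) :
  differentiable f x ->
  'D_(\sum_(i <- r) v i) f x = \sum_(i <- r) 'D_(v i) f x.
Proof. by move=> df; rewrite !deriveE // linear_sum; apply: eq_bigr => i _; rewrite deriveE. Qed.

Definition mklin V W (f : V -> W) (h : linear f) : {linear V -> W} :=
  HB.pack f (GRing.isLinear.Build R V W _ f h).

Lemma is_diff_lin V W (f : V -> W) x : linear f -> continuous f -> is_diff x f f.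
Proof.
move=> lf cf; pose L := mklin lf.
have cL : continuous L by [].
apply: DiffDef; first by rewrite -[f]/(L : V -> W); exact: linear_differentiable.
by rewrite -[f]/(L : V -> W) diff_lin.
Qed.

End FrechetCalculus.

(** * Smooth maps on open sets and coinduction *)

Section SmoothOn.
Context {R : realType}.
Implicit Types V W : normedModType R.

Notation iterD s f := (foldr (fun v g y => 'D_v g y) f s).

Lemma iterD_eq V W (O : set V) (f g : V -> W) s : open O ->
  (forall x, O x -> f x = g x) -> forall x, O x -> iterD s f x = iterD s g x.
Proof.
move=> oO fg; elim: s => //= v s IH x Ox.
by apply: near_eq_derive; apply: filterS (open_nbhs_nbhs (conj oO Ox)).
Qed.

Lemma smooth_on_eq V W (O : set V) (f g : V -> W) : open O ->
  (forall x, O x -> f x = g x) -> smooth_on O f -> smooth_on O g.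
Proof.
move=> oO fg sf s x Ox.
have H : \forall y \near x, iterD s f y = iterD s g y.
  by apply: filterS (open_nbhs_nbhs (conj oO Ox)) => y; exact: iterD_eq.
by have := is_diff_near H (is_diff_der (sf s x Ox)).
Qed.

Lemma smooth_on_diff V W (O : set V) (f : V -> W) x :
  smooth_on O f -> O x -> differentiable f x.
Proof. by move=> sf Ox; exact: (sf [::] x Ox). Qed.

Lemma smooth_on_D V W (O : set V) (f : V -> W) v :
  smooth_on O f -> smooth_on O (fun x => 'D_v f x).
Proof. by move=> sf s x Ox; have := sf (rcons s v) x Ox; rewrite foldr_rcons. Qed.

Lemma smooth_on_sub V W (O O' : set V) (f : V -> W) :
  O' `<=` O -> smooth_on O f -> smooth_on O' f.
Proof. by move=> s' sf s x /s'; exact: sf. Qed.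

(** The last entry of the list of directions is the derivative taken first. Replacing it by a member
    of [S] that agrees with it on [O] shortens the list, so induction on the list suffices. Most
    closure properties of smooth maps come from a class [S] suited to the purpose. *)
Lemma smooth_coind V W (O : set V) (S : (V -> W) -> Prop) : open O ->
  (forall f, S f -> forall x, O x -> differentiable f x) ->
  (forall f v, S f -> exists g, S g /\ forall x, O x -> 'D_v f x = g x) ->
  forall f, S f -> smooth_on O f.
Proof.
move=> oO dS cS f Sf s; elim/last_ind: s f Sf => [|s v IH] f Sf x Ox.
  exact: dS Sf x Ox.
rewrite foldr_rcons; have [g [Sg Hg]] := cS f v Sf.
have H : \forall y \near x, iterD s g y = iterD s (fun y => 'D_v f y) y.
  apply: filterS (open_nbhs_nbhs (conj oO Ox)) => y Oy.
  by apply: (iterD_eq _ oO) => // z Oz; rewrite Hg.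
by have := is_diff_near H (is_diff_der (IH g Sg x Ox)).
Qed.

Lemma smooth_cst V W (O : set V) (a : W) : open O -> smooth_on O (fun=> a).
Proof.
move=> oO; apply: (@smooth_coind _ _ _ (fun f => exists a, f = cst a)) => //.
- by move=> _ [b ->] x _.
- move=> _ v [b ->]; exists (cst 0); split; first by exists 0.
  by move=> x _; rewrite derive_cst.
- by exists a.
Qed.

Lemma smooth_lin V W (O : set V) (f : V -> W) : open O ->
  linear f -> continuous f -> smooth_on O f.
Proof.
move=> oO lf cf.
apply: (@smooth_coind _ _ _ (fun g => g = f \/ exists a, g = cst a)) => //.
- move=> _ [->|[b ->]] x _ //.
  by have := is_diff_lin x lf cf.
- move=> _ v [->|[b ->]]; [exists (cst (f v))|exists (cst 0)]; split.
  + by right; exists (f v).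
  + by move=> x _; rewrite (is_diff_derive _ (is_diff_lin x lf cf)).
  + by right; exists 0.
  + by move=> x _; rewrite derive_cst.
- by left.
Qed.

Lemma is_diff_addf V W (f g : V -> W) df dg x :
  is_diff x f df -> is_diff x g dg ->
  is_diff x (fun y => f y + g y) (fun v => df v + dg v).
Proof. by move=> ? ?; exact: is_diffD. Qed.

Lemma smooth_add V W (O : set V) (f g : V -> W) : open O ->
  smooth_on O f -> smooth_on O g -> smooth_on O (fun x => f x + g x).
Proof.
move=> oO sf sg.
apply: (@smooth_coind _ _ _ (fun h => exists f g, [/\ smooth_on O f,
  smooth_on O g & h = fun x => f x + g x])) => //; last by exists f, g.
- move=> _ [{}f [{}g [{}sf {}sg ->]]] x Ox.
  apply: differentiableD; exact: smooth_on_diff Ox.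
- move=> _ v [{}f [{}g [{}sf {}sg ->]]].
  exists (fun x => 'D_v f x + 'D_v g x); split.
    by do 2 eexists; split; [apply: smooth_on_D sf|apply: smooth_on_D sg|].
  move=> x Ox; apply: (@deriveD _ _ _ f g); apply: diff_derivable; exact: smooth_on_diff Ox.
Qed.

Lemma smooth_sum V W (O : set V) I (r : seq I) (f : I -> V -> W) : open O ->
  (forall i, smooth_on O (f i)) -> smooth_on O (fun x => \sum_(i <- r) f i x).
Proof.
move=> oO sf; elim: r => [|i r IH].
  apply: (smooth_on_eq oO _ (smooth_cst 0 oO)) => x _; by rewrite big_nil.
apply: (smooth_on_eq oO _ (smooth_add oO (sf i) IH)) => x _; by rewrite big_cons.
Qed.

End SmoothOn.

(** * Products and compositions of smooth maps *)

Section SmoothProducts.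
Context {R : realType}.
Implicit Types V W : normedModType R.

Lemma is_diff_scale V W (a : V -> R) (f : V -> W) (da : V -> R) (df : V -> W) x :
  is_diff x a da -> is_diff x f df ->
  is_diff x (fun y => a y *: f y) (fun v => da v *: f x + a x *: df v).
Proof.
move=> ha hf.
have bil : bilinear_for (GRing.Scale.Law.clone _ _ *:%R _)
    (GRing.Scale.Law.clone _ _ *:%R _) (@GRing.scale R W : R -> W -> W).
  split=> [u' | u] b y z /=; first by rewrite scalerDl scalerA.
  by rewrite scalerDr !scalerA mulrC.
pose B : {bilinear R -> W -> W} := HB.pack (@GRing.scale R W)
   (bilinear_isBilinear.Build R R W W _ _ (@GRing.scale R W) bil).
have cB : continuous (fun p : R * W => B p.1 p.2) by move=> ?; exact: scale_continuous.
have d1 : differentiable (fun y => (a y, f y)) x by exact: differentiable_pair.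
have d2 : differentiable (fun p : R * W => B p.1 p.2) (a x, f x).
  by apply: differentiable_bilin.
apply: DiffDef; first exact: (differentiable_comp d1 d2).
rewrite (diff_comp d1 d2) diff_bilin// diff_pair// !diff_val; apply/funext => v /=.
by rewrite addrC.
Qed.

Lemma derive_scale V W (a : V -> R) (f : V -> W) x v :
  differentiable a x -> differentiable f x ->
  'D_v (fun y => a y *: f y) x = 'D_v a x *: f x + a x *: 'D_v f x.
Proof.
move=> da df.
by rewrite (is_diff_derive _ (is_diff_scale (is_diff_der da) (is_diff_der df))).
Qed.

(* Contains [a f], consists of differentiable functions and is closed under directional
   derivatives: hence all of its elements are smooth. *)
Inductive scale_span V W (O : set V) : (V -> W) -> Prop :=
| ScaleSpan0 : scale_span O (fun=> 0)
| ScaleSpanS a f h : smooth_on O (a : V -> R) -> smooth_on O f ->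
    scale_span O h -> scale_span O (fun x => a x *: f x + h x).

Lemma smooth_scale V W (O : set V) (a : V -> R) (f : V -> W) : open O ->
  smooth_on O a -> smooth_on O f -> smooth_on O (fun x => a x *: f x).
Proof.
move=> oO sa sf.
have dS (g : V -> W) : scale_span O g -> forall x, O x -> differentiable g x.
  elim=> [x _|b k h sb sk Sh IH x Ox]; first exact: differentiable_cst.
  have := is_diff_addf (is_diff_scale (is_diff_der (smooth_on_diff sb Ox))
    (is_diff_der (smooth_on_diff sk Ox))) (is_diff_der (IH x Ox)).
  by move=> ?.
have cS (g : V -> W) v : scale_span O g ->
    exists h, scale_span O h /\ forall x, O x -> 'D_v g x = h x.
  elim=> [|b k h sb sk Sh [h' [Sh' Eh]]].
    by exists (fun=> 0); split; [exact: ScaleSpan0|move=> x _; rewrite derive_cst].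
  exists (fun x => 'D_v b x *: k x + (b x *: 'D_v k x + h' x)); split.
    apply: ScaleSpanS => //; first exact: smooth_on_D.
    by apply: ScaleSpanS => //; exact: smooth_on_D.
  move=> x Ox.
  have := is_diff_addf (is_diff_scale (is_diff_der (smooth_on_diff sb Ox))
    (is_diff_der (smooth_on_diff sk Ox))) (is_diff_der (dS _ Sh x Ox)).
  by move=> H; rewrite (is_diff_derive _ H) Eh// addrA.
have H := smooth_coind oO dS cS (ScaleSpanS sa sf (@ScaleSpan0 _ _ O)).
apply: (smooth_on_eq oO _ H) => x _; by rewrite addr0.
Qed.

Lemma smooth_opp V W (O : set V) (f : V -> W) : open O ->
  smooth_on O f -> smooth_on O (fun x => - f x).
Proof.
move=> oO sf; apply: (smooth_on_eq oO _ (smooth_scale oO (smooth_cst (-1:R) oO) sf)).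
by move=> x _; rewrite scaleN1r.
Qed.

Lemma smooth_sub V W (O : set V) (f g : V -> W) : open O ->
  smooth_on O f -> smooth_on O g -> smooth_on O (fun x => f x - g x).
Proof. by move=> oO sf sg; apply: smooth_add => //; exact: smooth_opp. Qed.

Lemma smooth_mul V (O : set V) (f g : V -> R) : open O ->
  smooth_on O f -> smooth_on O g -> smooth_on O (fun x => f x * g x).
Proof. exact: smooth_scale. Qed.

Lemma smooth_prod V (O : set V) I (r : seq I) (f : I -> V -> R) : open O ->
  (forall i, smooth_on O (f i)) -> smooth_on O (fun x => \prod_(i <- r) f i x).
Proof.
move=> oO sf; elim: r => [|i r IH].
  by apply: (smooth_on_eq oO _ (smooth_cst (1:R) oO)) => x _; rewrite big_nil.
by apply: (smooth_on_eq oO _ (smooth_mul oO (sf i) IH)) => x _; rewrite big_cons.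
Qed.

(** Finite dimension is expressed by a spanning family [e] and continuous linear functionals [c]
    that reconstruct each vector. This is the form in which derivatives along arbitrary vectors are
    expanded. *)
Definition fdim V := exists n (e : 'I_n -> V) (c : 'I_n -> V -> R),
  (forall i, linear (c i) /\ continuous (c i)) /\
  forall v, v = \sum_i c i v *: e i.

(** The class to which [smooth_coind] is applied for g o f. By the chain rule the derivative of a (g
    o f) is (D_v a) (g o f) plus the sum over i of a c_i(D_v f) ((D_{e_i} g) o f); as [V'] is
    finite-dimensional, this is a finite sum of terms of the same kind. *)
Inductive comp_span V V' W (O : set V) (O' : set V') (f : V -> V') :
    (V -> W) -> Prop :=
| CompSpan0 : comp_span O O' f (fun=> 0)
| CompSpanS a g h : smooth_on O (a : V -> R) -> smooth_on O' g ->
    comp_span O O' f h -> comp_span O O' f (fun x => a x *: g (f x) + h x).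

Lemma smooth_comp V V' W (O : set V) (O' : set V') (f : V -> V') (g : V' -> W) :
  fdim V' -> open O -> open O' -> (forall x, O x -> O' (f x)) ->
  smooth_on O f -> smooth_on O' g -> smooth_on O (fun x => g (f x)).
Proof.
move=> [n [e [c [lc Ec]]]] oO oO' fO sf sg.
have dS (k : V -> W) : comp_span O O' f k -> forall x, O x -> differentiable k x.
  elim=> [x _|b k' h sb sk Sh IH x Ox]; first exact: differentiable_cst.
  have dk := differentiable_comp (smooth_on_diff sf Ox) (smooth_on_diff sk (fO _ Ox)).
  have := is_diff_addf (is_diff_scale (is_diff_der (smooth_on_diff sb Ox))
    (is_diff_der dk)) (is_diff_der (IH x Ox)).
  by move=> ?.
have S_sum (r : seq 'I_n) (a : 'I_n -> V -> R) (k : 'I_n -> V' -> W) h :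
    (forall i, smooth_on O (a i)) -> (forall i, smooth_on O' (k i)) ->
    comp_span O O' f h ->
    comp_span O O' f (fun x => \sum_(i <- r) a i x *: k i (f x) + h x).
  move=> sa sk Sh; elim: r => [|i r IH].
    rewrite (_ : (fun _ => _) = h)//; apply/funext => x; by rewrite big_nil add0r.
  rewrite (_ : (fun _ => _) = fun x => a i x *: k i (f x) +
     (\sum_(i <- r) a i x *: k i (f x) + h x)); first exact: CompSpanS.
  by apply/funext => x; rewrite big_cons addrA.
have cS (k : V -> W) v : comp_span O O' f k ->
    exists h, comp_span O O' f h /\ forall x, O x -> 'D_v k x = h x.
  elim=> [|b k' h sb sk Sh [h' [Sh' Eh]]].
    by exists (fun=> 0); split; [exact: CompSpan0|move=> x _; rewrite derive_cst].
  exists (fun x => 'D_v b x *: k' (f x) +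
    (\sum_i (b x * c i ('D_v f x)) *: 'D_(e i) k' (f x) + h' x)); split.
    apply: CompSpanS => //; first exact: smooth_on_D.
    apply: (@S_sum _ (fun i x => b x * c i ('D_v f x)) (fun i y => 'D_(e i) k' y)) => // i.
      apply: smooth_mul => //; have [li ci] := lc i.
      have sDf := smooth_on_D v sf.
      apply: (smooth_coind oO (S := fun h => exists u, smooth_on O u /\ h = fun x => c i (u x))).
      - move=> _ [u [su ->]] x Ox.
        apply: differentiable_comp; first exact: smooth_on_diff su Ox.
        by have := is_diff_lin (u x) li ci.
      - move=> _ w [u [su ->]]; exists (fun x => c i ('D_w u x)); split.
          by exists (fun x => 'D_w u x); split=> //; exact: smooth_on_D.
        move=> x Ox; rewrite (derive_comp _ (smooth_on_diff su Ox)).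
          by rewrite (is_diff_derive _ (is_diff_lin _ li ci)).
        by have := is_diff_lin (u x) li ci.
      - by eexists; split; [exact: sDf|].
    exact: smooth_on_D.
  move=> x Ox.
  have dk := differentiable_comp (smooth_on_diff sf Ox) (smooth_on_diff sk (fO _ Ox)).
  have := is_diff_addf (is_diff_scale (is_diff_der (smooth_on_diff sb Ox))
    (is_diff_der dk)) (is_diff_der (dS _ Sh x Ox)).
  move=> H; rewrite (is_diff_derive _ H) Eh// (@derive_comp _ _ _ _ f k'); first last.
  - exact: smooth_on_diff sk (fO _ Ox).
  - exact: smooth_on_diff sf Ox.
  have E2 : 'D_('D_v f x) k' (f x) = \sum_i c i ('D_v f x) *: 'D_(e i) k' (f x).
    rewrite {1}(Ec ('D_v f x)) derive_sumv; last exact: smooth_on_diff sk (fO _ Ox).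
    apply: eq_bigr => i _; apply: derive_scalev; exact: smooth_on_diff sk (fO _ Ox).
  rewrite E2 scaler_sumr addrA; congr (_ + _ + _); apply: eq_bigr => i _.
  by rewrite scalerA.
have H := smooth_coind oO dS cS (CompSpanS (smooth_cst (1:R) oO) sg (@CompSpan0 _ _ W O O' f)).
apply: (smooth_on_eq oO _ H) => x _; by rewrite addr0 scale1r.
Qed.

End SmoothProducts.

(** * Bilinear maps, matrix products and matrix inversion *)

Section FiniteDimensional.
Context {R : realType}.
Implicit Types V W : normedModType R.

Lemma fdimR : fdim (R : normedModType R).
Proof.
exists 1%N, (fun=> 1), (fun=> id); split.
  by move=> _; split => // x; exact: cvg_id.
by move=> v; rewrite big_ord1 [RHS]mulr1.
Qed.

Lemma fdim_mx a b : fdim ('M[R]_(a, b) : normedModType R).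
Proof.
exists #|{: 'I_a * 'I_b}|,
  (fun i : 'I_#|{: 'I_a * 'I_b}| => delta_mx (enum_val i).1 (enum_val i).2),
  (fun (i : 'I_#|{: 'I_a * 'I_b}|) (M : 'M[R]_(a, b)) =>
     M (enum_val i).1 (enum_val i).2); split.
  by move=> i; split; [move=> k u v; rewrite !mxE|exact: coord_continuous].
move=> v; rewrite {1}(matrix_sum_delta v) pair_big /=.
rewrite (reindex (fun i : 'I_#|{: 'I_a * 'I_b}| => enum_val i)) /=.
  by apply: eq_bigr.
by apply: onW_bij; exact: enum_val_bij.
Qed.

Lemma fdim_lin_cont V W (f : V -> W) : fdim V -> linear f -> continuous f.
Proof.
move=> [n [e [c [lc Ec]]]] lf.
have -> : f = fun v => \sum_i c i v *: f (e i).
  apply/funext => v; rewrite {1}(Ec v).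
  rewrite -[f]/(mklin lf : V -> W) linear_sum; apply: eq_bigr => i _; by rewrite linearZ.
elim: (index_enum _) => [|i r IH] v.
  rewrite (_ : (fun _ => _) = cst 0); first exact: cvg_cst.
  by apply/funext => u; rewrite big_nil.
rewrite (_ : (fun _ => _) = fun v => c i v *: f (e i) + \sum_(i <- r) c i v *: f (e i)).
  by apply: cvgD; [apply: cvgZr_tmp; exact: (lc i).2|exact: IH].
by apply/funext => u; rewrite big_cons.
Qed.

Lemma is_diff_linF V W (f : V -> W) x : fdim V -> linear f -> is_diff x f f.
Proof. by move=> fV lf; apply: is_diff_lin => //; exact: fdim_lin_cont. Qed.

Lemma smooth_linF V W (O : set V) (f : V -> W) : fdim V -> open O ->
  linear f -> smooth_on O f.
Proof. by move=> fV oO lf; apply: smooth_lin => //; exact: fdim_lin_cont. Qed.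

Lemma fdim_pair V W : fdim V -> fdim W -> fdim (V * W)%type.
Proof.
move=> [n [e [c [lc Ec]]]] [n' [e' [c' [lc' Ec']]]].
exists (n + n')%N, (fun i => match fintype.split i with inl j => (e j, 0) | inr j => (0, e' j) end),
  (fun i p => match fintype.split i with inl j => c j p.1 | inr j => c' j p.2 end); split.
  move=> i; case: (fintype.split i) => j; split.
  - by move=> k u v; rewrite (lc j).1.
  - by move=> p; apply: cvg_comp; [exact: cvg_fst|exact: (lc j).2].
  - by move=> k u v; rewrite (lc' j).1.
  - by move=> p; apply: cvg_comp; [exact: cvg_snd|exact: (lc' j).2].
case=> v w; rewrite big_split_ord /=.
under eq_bigr do rewrite (unsplitK (inl _)).
under [X in _ + X]eq_bigr do rewrite (unsplitK (inr _)).
apply: injective_projections => /=.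
  rewrite !raddf_sum /=.
  rewrite [X in _ = _ + X]big1 ?addr0; last by move=> i _; rewrite scaler0.
  exact: Ec.
rewrite !raddf_sum /=.
rewrite [X in _ = X + _]big1 ?add0r; last by move=> i _; rewrite scaler0.
exact: Ec'.
Qed.

Lemma smooth_comp_lin V V' W (O : set V) (L : V' -> W) (f : V -> V') :
  fdim V' -> open O -> linear L -> smooth_on O f -> smooth_on O (fun x => L (f x)).
Proof.
move=> fV oO lL sf; apply: (@smooth_comp _ _ _ _ O setT f L) => //; first exact: openT.
by apply: smooth_linF => //; exact: openT.
Qed.

Lemma derive_comp_lin V V' W (L : V' -> W) (f : V -> V') x v :
  fdim V' -> linear L -> differentiable f x ->
  'D_v (fun y => L (f y)) x = L ('D_v f x).
Proof.
move=> fV lL df; have dL := is_diff_linF (f x) fV lL.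
by rewrite (@derive_comp _ _ _ _ f L)// (is_diff_derive _ dL).
Qed.

Section Bilinear.
Variables (V1 V2 W : normedModType R) (B : V1 -> V2 -> W).
Hypotheses (f1 : fdim V1) (f2 : fdim V2).
Hypotheses (lB1 : forall y, linear (B^~ y)) (lB2 : forall x, linear (B x)).

(** Expanding the first argument by its coefficient functionals writes [B] as a sum of scalar
    functions times linear maps of the second argument, and the product rule for scalar multiples
    applies to each summand. *)
Lemma is_diff_bilinF V (f : V -> V1) (g : V -> V2) df dg x :
  is_diff x f df -> is_diff x g dg ->
  is_diff x (fun y => B (f y) (g y)) (fun v => B (df v) (g x) + B (f x) (dg v)).
Proof.
move: f1 => [n [e [c [lc Ec]]]] hf hg.
have BE u w : B u w = \sum_i c i u *: B (e i) w.
  rewrite {1}(Ec u) -[B _ w]/((mklin (lB1 w)) _) linear_sum.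
  by apply: eq_bigr => i _; rewrite linearZ.
have H i : is_diff x (fun y => c i (f y) *: B (e i) (g y))
   (fun v => c i (df v) *: B (e i) (g x) + c i (f x) *: B (e i) (dg v)).
  apply: is_diff_scale.
    exact: is_diff_comp hf (is_diff_lin (f x) (lc i).1 (lc i).2).
  exact: is_diff_comp hg (is_diff_linF (g x) f2 (lB2 (e i))).
have HS (r : seq 'I_n) : is_diff x (fun y => \sum_(i <- r) c i (f y) *: B (e i) (g y))
   (fun v => \sum_(i <- r) (c i (df v) *: B (e i) (g x) + c i (f x) *: B (e i) (dg v))).
  elim: r => [|i r IH].
    rewrite [X in is_diff _ X _](_ : _ = cst 0); last by apply/funext=> y; rewrite big_nil.
    rewrite [X in is_diff _ _ X](_ : _ = 0); last by apply/funext=> y; rewrite big_nil.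
    exact: is_diff_cst.
  rewrite [X in is_diff _ X _](_ : _ = fun y => c i (f y) *: B (e i) (g y) +
    \sum_(i <- r) c i (f y) *: B (e i) (g y)); last by apply/funext=> y; rewrite big_cons.
  rewrite [X in is_diff _ _ X](_ : _ = fun v => (c i (df v) *: B (e i) (g x) + c i (f x) *: B (e i) (dg v)) +
    \sum_(i <- r) (c i (df v) *: B (e i) (g x) + c i (f x) *: B (e i) (dg v))).
    exact: is_diff_addf (H i) IH.
  by apply/funext=> y; rewrite big_cons.
have := HS (index_enum _).
rewrite [X in is_diff _ X _](_ : _ = fun y => B (f y) (g y)); last by apply/funext=> y; rewrite BE.
rewrite [X in is_diff _ _ X](_ : _ = fun v => B (df v) (g x) + B (f x) (dg v))//.
by apply/funext => v; rewrite !BE big_split.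
Qed.

Lemma derive_bilinF V (f : V -> V1) (g : V -> V2) x v :
  differentiable f x -> differentiable g x ->
  'D_v (fun y => B (f y) (g y)) x = B ('D_v f x) (g x) + B (f x) ('D_v g x).
Proof.
move=> hf hg.
by rewrite (is_diff_derive _ (is_diff_bilinF (is_diff_der hf) (is_diff_der hg))).
Qed.

Lemma smooth_bilinF V (O : set V) (f : V -> V1) (g : V -> V2) : open O ->
  smooth_on O f -> smooth_on O g -> smooth_on O (fun y => B (f y) (g y)).
Proof.
move: f1 => [n [e [c [lc Ec]]]] oO sf sg.
have BE u w : B u w = \sum_i c i u *: B (e i) w.
  rewrite {1}(Ec u) -[B _ w]/((mklin (lB1 w)) _) linear_sum.
  by apply: eq_bigr => i _; rewrite linearZ.
suff H : smooth_on O (fun y => \sum_i c i (f y) *: B (e i) (g y)).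
  by apply: (smooth_on_eq oO _ H) => x _; rewrite -BE.
apply: smooth_sum => // i; apply: smooth_scale => //.
  exact: (@smooth_comp_lin _ _ _ _ (c i) f f1 oO (lc i).1).
exact: (@smooth_comp_lin _ _ _ _ (B (e i)) g f2 oO (lB2 _)).
Qed.

End Bilinear.

Lemma linear_mulmxl a b c (A : 'M[R]_(a, b)) : linear (fun B : 'M[R]_(b, c) => A *m B).
Proof. by move=> k u v; rewrite linearP. Qed.

Lemma linear_mulmxr a b c (B : 'M[R]_(b, c)) : linear (fun A : 'M[R]_(a, b) => A *m B).
Proof. by move=> k u v; rewrite mulmxDl scalemxAl. Qed.

Lemma derive_mulmx V a b c (f : V -> 'M[R]_(a, b)) (g : V -> 'M[R]_(b, c)) x v :
  differentiable f x -> differentiable g x ->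
  'D_v (fun y => f y *m g y) x = 'D_v f x *m g x + f x *m 'D_v g x.
Proof.
move=> df dg.
exact: (derive_bilinF (@fdim_mx _ _) (@fdim_mx _ _) (@linear_mulmxr _ _ _)
  (@linear_mulmxl _ _ _)).
Qed.

Lemma diff_mulmx V a b c (f : V -> 'M[R]_(a, b)) (g : V -> 'M[R]_(b, c)) x :
  differentiable f x -> differentiable g x -> differentiable (fun y => f y *m g y) x.
Proof.
move=> df dg.
by have := (is_diff_bilinF (@fdim_mx _ _) (@fdim_mx _ _) (@linear_mulmxr _ _ _)
  (@linear_mulmxl _ _ _) (is_diff_der df) (is_diff_der dg)).
Qed.

Lemma smooth_mulmx V (O : set V) a b c (f : V -> 'M[R]_(a, b)) (g : V -> 'M[R]_(b, c)) :
  open O -> smooth_on O f -> smooth_on O g -> smooth_on O (fun y => f y *m g y).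
Proof.
move=> oO sf sg.
exact: (smooth_bilinF (@fdim_mx _ _) (@fdim_mx _ _) (@linear_mulmxr _ _ _)
  (@linear_mulmxl _ _ _)).
Qed.

Lemma linear_coord a b i j : linear (fun M : 'M[R]_(a, b) => M i j : R).
Proof. by move=> k u v; rewrite !mxE. Qed.

Lemma smooth_coord V (O : set V) a b (f : V -> 'M[R]_(a, b)) i j : open O ->
  smooth_on O f -> smooth_on O (fun x => f x i j).
Proof.
move=> oO sf.
exact: (@smooth_comp_lin _ _ _ _ (fun M : 'M[R]_(a, b) => M i j : R) f (@fdim_mx _ _) oO (@linear_coord _ _ _ _)).
Qed.

Lemma derive_coord V a b (f : V -> 'M[R]_(a, b)) i j x v : differentiable f x ->
  'D_v (fun x => f x i j) x = 'D_v f x i j.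
Proof.
by move=> df; apply: (@derive_comp_lin _ _ _ (fun M : 'M[R]_(a, b) => M i j : R) f x v (@fdim_mx _ _) (@linear_coord _ _ _ _)).
Qed.

Lemma smooth_mx V (O : set V) a b (f : V -> 'M[R]_(a, b)) : open O ->
  (forall i j, smooth_on O (fun x => f x i j)) -> smooth_on O f.
Proof.
move=> oO sf.
suff H : smooth_on O (fun x => \sum_i \sum_j f x i j *: delta_mx i j).
  by apply: (smooth_on_eq oO _ H) => x _; rewrite -matrix_sum_delta.
apply: smooth_sum => // i; apply: smooth_sum => // j.
by apply: smooth_scale => //; exact: smooth_cst.
Qed.

Lemma is_diff_invX n (x : R) : x != 0 ->
  is_diff x (fun y : R => y ^- n) (fun v : R => - n%:R * v * x ^- n.+1).
Proof.
move=> x0; have n0 : x ^+ n != 0 by rewrite expf_neq0.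
have dX : differentiable (fun y : R => y ^+ n) x.
  by apply/derivable1_diffP; exact: exprn_derivable.
have dV := differentiableV dX n0.
have -> : (fun v : R => - n%:R * v * x ^- n.+1) =
    (fun v : R => 'D_v (fun y : R => y ^- n) x).
  apply/funext => v; apply: esym.
  have E := @deriveV R R (fun y : R => y ^+ n) x v n0 (@exprn_derivable R n x v).
  apply: (etrans E).
  have E2 := @exp_derive R n x v.
  apply: (etrans (congr1 _ E2)); rewrite /GRing.scale /=.
  case: n {dX dV E E2} n0 => [|n] n0; first by rewrite /= expr0 !(oppr0, mul0r, mulr0).
  by rewrite /= !exprS; field; rewrite x0 expf_neq0.
exact: is_diff_der.
Qed.

(** The functions c y^-n, for all [n] and [c], are differentiable away from 0 and form a class
    closed under differentiation. *)
Lemma smooth_invr : smooth_on [set y : R | y != 0] (fun y : R => y^-1).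
Proof.
have o0 : open [set y : R | y != 0] by exact: open_neq.
have H : forall k : R -> R, (exists n (c : R), k = fun y => c * y ^- n) ->
    smooth_on [set y : R | y != 0] k.
  apply: smooth_coind => //.
    move=> _ [n [c ->]] x x0.
    by have := is_diff_scale (is_diff_cst c x) (is_diff_invX n x0).
  move=> _ v [n [c ->]]; exists (fun y => (- c * n%:R * v) * y ^- n.+1); split.
    by exists n.+1, (- c * n%:R * v).
  move=> x /= x0.
  apply: (etrans (is_diff_derive v (is_diff_scale (is_diff_cst c x) (is_diff_invX n x0)))).
  by rewrite scale0r add0r /GRing.scale /=; ring.
by apply: H; exists 1%N, 1; apply/funext => y; rewrite mul1r.
Qed.

Lemma smooth_inv V (O : set V) (f : V -> R) : open O -> smooth_on O f ->
  (forall x, O x -> f x != 0) -> smooth_on O (fun x => (f x)^-1).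
Proof.
move=> oO sf f0.
have o0 : open [set y : R | y != 0] by exact: open_neq.
apply: (@smooth_comp _ _ _ _ O [set y : R | y != 0] f (fun y => y^-1)) => //.
- exact: fdimR.
- exact: smooth_invr.
Qed.

Lemma smooth_det V (O : set V) n (f : V -> 'M[R]_n) : open O ->
  smooth_on O f -> smooth_on O (fun x => \det (f x)).
Proof.
move=> oO sf; apply: smooth_sum => // s; apply: smooth_mul => //; first exact: smooth_cst.
apply: smooth_prod => // i; exact: smooth_coord.
Qed.

(** Cramer's rule: the inverse is the adjugate divided by the determinant, and both are polynomial
    in the entries. *)
Lemma smooth_invmx V (O : set V) n (f : V -> 'M[R]_n) : open O ->
  smooth_on O f -> (forall x, O x -> f x \in unitmx) ->
  smooth_on O (fun x => invmx (f x)).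
Proof.
move=> oO sf fu.
suff H : smooth_on O (fun x => (\det (f x))^-1 *: \adj (f x)).
  by apply: (smooth_on_eq oO _ H) => x Ox; rewrite /invmx fu.
apply: smooth_scale => //.
  by apply: smooth_inv => //; [exact: smooth_det|move=> x /fu; rewrite unitmxE unitfE].
apply: smooth_mx => // i j.
apply: (@smooth_on_eq _ _ _ _ (fun x => cofactor (f x) j i)) => //.
  by move=> x _; rewrite !mxE.
apply: smooth_mul => //; first exact: smooth_cst.
apply: smooth_det => //; apply: smooth_mx => // k l.
apply: (@smooth_on_eq _ _ _ _ (fun x => f x (lift j k) (lift i l))) => //.
  by move=> x _; rewrite !mxE.
exact: smooth_coord.
Qed.

(** The identity f f^-1 = 1 near [x] is differentiated and solved for the derivative of the
    inverse. *)
Lemma derive_invmx V n (f : V -> 'M[R]_n) x v : differentiable f x ->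
  f x \in unitmx -> (\forall y \near x, f y \in unitmx) ->
  differentiable (fun y => invmx (f y)) x ->
  'D_v (fun y => invmx (f y)) x = - (invmx (f x) *m 'D_v f x *m invmx (f x)).
Proof.
move=> df fu fun_ di.
have E : 'D_v (fun y => f y *m invmx (f y)) x = 0.
  rewrite -(derive_cst (1%:M : 'M[R]_n) x v); apply: near_eq_derive.
  by apply: filterS fun_ => y yu; rewrite mulmxV.
rewrite derive_mulmx // in E.
have := congr1 (mulmx (invmx (f x))) E.
rewrite mulmx0 mulmxDr (mulmxA (invmx (f x)) (f x)) mulVmx// mul1mx => /eqP.
by rewrite addrC addr_eq0 -mulmxA => /eqP ->.
Qed.

End FiniteDimensional.

(** * Mean value estimates and symmetry of second derivatives *)

Section MeanValue.
Context {R : realType}.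
Implicit Types V W : normedModType R.

Lemma is_diff_line V W (f : V -> W) x h (t : R) : differentiable f (x + t *: h) ->
  is_diff t (fun s : R => f (x + s *: h)) (fun u => u *: 'D_h f (x + t *: h)).
Proof.
move=> df.
have dl : is_diff t (fun s : R => x + s *: h) (fun u : R => 0 + (u *: h)).
  have l1 : is_diff t (fun s : R => s *: h) (fun u : R => u *: h).
    by apply: is_diff_linF; [exact: fdimR|move=> k u v; rewrite scalerDl scalerA].
  exact: (is_diff_addf (is_diff_cst x t) l1).
have H := is_diff_comp dl (is_diff_der df).
have -> : (fun u : R => u *: 'D_h f (x + t *: h)) =
    ((fun v => 'D_v f (x + t *: h)) \o (fun u : R => 0 + u *: h)).
  by apply/funext => u /=; rewrite add0r derive_scalev.
exact: H.
Qed.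

Lemma mvt_line V (f : V -> R) x h :
  (forall t : R, 0 <= t <= 1 -> differentiable f (x + t *: h)) ->
  exists2 t : R, 0 <= t <= 1 & f (x + h) - f x = 'D_h f (x + t *: h).
Proof.
move=> df.
have dg t : 0 <= t <= 1 -> is_derive (t : R) 1 (fun s : R => f (x + s *: h)) ('D_h f (x + t *: h)).
  move=> /df /is_diff_line H; split; first by apply: diff_derivable.
  by rewrite (is_diff_derive _ H) scale1r.
have [||t t01 E] := @MVT R (fun s : R => f (x + s *: h)) (fun t => 'D_h f (x + t *: h)) 0 1 ltr01.
- by move=> t; rewrite in_itv /= => /andP[t0 t1]; apply: dg; rewrite !ltW.
- apply: derivable_within_continuous => t; rewrite in_itv /= => /dg H; exact: ex_derive.
exists t; first by move: t01; rewrite in_itv /= => /andP[t0 t1]; rewrite !ltW.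
by move: E; rewrite scale1r scale0r addr0 subr0 mulr1.
Qed.

Lemma mx_norm_entry a b (M : 'M[R]_(a, b)) i j : `|M i j| <= `|M|.
Proof. by rewrite [leRHS]/Num.Def.normr /= mx_normrE; exact: (le_bigmax _ _ (i, j)). Qed.

Lemma mx_norm_le a b (M : 'M[R]_(a, b)) c : 0 <= c ->
  (forall i j, `|M i j| <= c) -> `|M| <= c.
Proof.
move=> c0 H; rewrite [leLHS]/Num.Def.normr /= mx_normrE; apply: bigmax_le => // i _; exact: H.
Qed.

(** The norm of a matrix is the maximum of its entries, so the mean value theorem may be applied to
    each entry with its own intermediate point. *)
Lemma mvt_norm V a b (f : V -> 'M[R]_(a, b)) x h C : 0 <= C ->
  (forall t : R, 0 <= t <= 1 -> differentiable f (x + t *: h)) ->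
  (forall t : R, 0 <= t <= 1 -> `|'D_h f (x + t *: h)| <= C) ->
  `|f (x + h) - f x| <= C.
Proof.
move=> C0 df bf; apply: mx_norm_le => // i j.
have dc M := is_diff_linF M (@fdim_mx R a b) (@linear_coord R a b i j).
have [t t01] := @mvt_line _ (fun y => f y i j) x h (fun t t01 =>
  differentiable_comp (df t t01) (ex_diff (is_diff_def := dc (f (x + t *: h))))).
rewrite !mxE => ->.
by rewrite derive_coord; [exact: le_trans (mx_norm_entry _ _ _) (bf t t01)|exact: df].
Qed.

Lemma diff_eps V W (f : V -> W) x (e : R) : 0 < e -> differentiable f x ->
  exists2 d : R, 0 < d & forall h : V, `|h| < d ->
    `|f (x + h) - f x - 'D_h f x| <= e * `|h|.
Proof.
move=> e0 df; have /eqaddoP/(_ _ e0) := diff_locally df.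
move=> /nbhs_ballP [d d0 H]; exists d => // h hd.
have := H h; rewrite -ball_normE /= sub0r normrN => /(_ hd).
rewrite deriveE // -[(_ - _) h]/(f (h + x) - (f x + 'd f x h)).
by rewrite opprD addrA addrC -addrC [h + x]addrC.
Qed.

Lemma nbhs_norm V (x : V) (P : set V) : (\forall y \near x, P y) ->
  exists2 d : R, 0 < d & forall y, `|y - x| < d -> P y.
Proof.
by move=> /nbhs_ballP [d d0 H]; exists d => // y yx; apply: H; rewrite -ball_normE /= distrC.
Qed.

Lemma norm_nbhs V (x : V) (P : set V) d : 0 < d ->
  (forall y, `|y - x| < d -> P y) -> \forall y \near x, P y.
Proof.
move=> d0 H; apply/nbhs_ballP; exists d => // y; rewrite -ball_normE /= distrC; exact: H.
Qed.

(** For F(y) = f(y + s w) - f(y) the mean value theorem along s v turns the second difference into s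
    times the difference of D_v f at the points x + t s v + s w and x + t s v. Differentiability of
    D_v f at [x] is used at both points; the contributions of t s v cancel and s^2 D_w D_v f
    remains. *)
Lemma second_difference V (f : V -> R) x v w (e : R) : 0 < e ->
  (\forall y \near x, differentiable f y) ->
  differentiable (fun y => 'D_v f y) x ->
  exists2 d : R, 0 < d & forall s : R, 0 < s < d ->
    `|f (x + s *: v + s *: w) - f (x + s *: v) - f (x + s *: w) + f x
      - s ^+ 2 * 'D_w (fun y => 'D_v f y) x| <= e * s ^+ 2.
Proof.
move=> e0 /nbhs_norm [d1 d10 H1] dv.
(* The displacements t s v + s w and t s v have norms adding up to at most s (2 |v| + |w|). The
   additional 1 makes [K] positive and keeps the points strictly inside the balls of radius [d1] and
   [d2]. *)
pose K := 2 * `|v| + `|w| + 1.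
have K0 : 0 < K by rewrite /K ltr_wpDl// addr_ge0// mulr_ge0.
have [d2 d20 H2] := diff_eps (divr_gt0 e0 K0) dv.
exists (Num.min (d1 / K) (d2 / K)); first by rewrite lt_min !divr_gt0.
move=> s /andP[s0]; rewrite lt_min !ltr_pdivlMr// => /andP[sd1 sd2].
have bnd (t r : R) : 0 <= t <= 1 -> 0 <= r <= 1 ->
    `|t *: (s *: v) + r *: (s *: w)| <= s * K - s.
  move=> /andP[t0 t1] /andP[r0 r1].
  rewrite !scalerA; apply: le_trans (ler_normD _ _) _.
  rewrite !normrZ (ger0_norm t0) (ger0_norm r0) (gtr0_norm s0).
  have := normr_ge0 v; have := normr_ge0 w; rewrite /K => w0 v0.
  have h1 : t * s * `|v| <= s * `|v| by rewrite ler_wpM2r// ler_piMl// ltW.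
  have h2 : r * s * `|w| <= s * `|w| by rewrite ler_wpM2r// ler_piMl// ltW.
  have := mulr_ge0 (ltW s0) v0; lra.
pose F y := f (y + s *: w) - f y.
have dF (t : R) : 0 <= t <= 1 -> is_diff (x + t *: (s *: v)) F
   (fun u => 'D_u f (x + t *: (s *: v) + s *: w) - 'D_u f (x + t *: (s *: v))).
  move=> t01.
  have d1' : differentiable f (x + t *: (s *: v)).
    apply: H1; rewrite addrAC subrr add0r.
    have := bnd t 0 t01; rewrite lexx ler01 scale0r addr0 => /(_ isT); lra.
  have d2' : differentiable f (x + t *: (s *: v) + s *: w).
    apply: H1; rewrite -(addrA x) addrAC subrr add0r.
    have := bnd t 1 t01; rewrite lexx ler01 scale1r => /(_ isT); lra.
  apply: is_diff_addf; last by apply: is_diffN; exact: is_diff_der.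
  have dl : is_diff (x + t *: (s *: v)) (fun y => y + s *: w) (fun u => u + 0).
    exact: (is_diff_addf (is_diff_id _) (is_diff_cst _ _)).
  have E : ((fun u => 'D_u f (x + t *: (s *: v) + s *: w)) \o (fun u => u + 0)) =
      (fun u => 'D_u f (x + t *: (s *: v) + s *: w)).
    by apply/funext => u /=; rewrite addr0.
  by have := is_diff_comp dl (is_diff_der d2'); rewrite E.
have [t t01] := @mvt_line _ F x (s *: v) (fun t t01 => ex_diff (is_diff_def := dF t t01)).
rewrite (is_diff_derive _ (dF t t01)) /F => E.
have -> : f (x + s *: v + s *: w) - f (x + s *: v) - f (x + s *: w) + f x =
   f (x + s *: v + s *: w) - f (x + s *: v) - (f (x + s *: w) - f x) by ring.
rewrite E.
have b1 : `|t *: (s *: v) + s *: w| <= s * K - s.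
  by have := bnd t 1 t01; rewrite lexx ler01 scale1r => /(_ isT).
have b2 : `|t *: (s *: v)| <= s * K - s.
  by have := bnd t 0 t01; rewrite lexx ler01 scale0r addr0 => /(_ isT).
have := H2 (t *: (s *: v)); have := H2 (t *: (s *: v) + s *: w).
have Ks : s * K - s < d1 /\ s * K - s < d2 by split; clear -s0 sd1 sd2; lra.
have L1 := le_lt_trans b1 Ks.2; have L2 := le_lt_trans b2 Ks.2.
move=> /(_ L1) h1 /(_ L2) h2.
rewrite !derive_scalev; last first.
- by apply: H1; rewrite -(addrA x) addrAC subrr add0r; exact: le_lt_trans b1 Ks.1.
- by apply: H1; rewrite addrAC subrr add0r; exact: le_lt_trans b2 Ks.1.
rewrite -(addrA x); rewrite derive_addv // !derive_scalev // in h1 h2.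
have b3 : `|t *: (s *: v) + s *: w| + `|t *: (s *: v)| <= s * K.
  move: t01 => /andP[t0 t1].
  apply: le_trans (lerD (ler_normD _ _) (lexx _)) _.
  rewrite !normrZ !(ger0_norm t0, gtr0_norm s0).
  have h3 : t * (s * `|v|) <= s * `|v| by rewrite ler_piMl// mulr_ge0// ltW.
  rewrite /K; have := normr_ge0 w; clear -h3 s0; move: h3; set a := t * _; lra.
have key (A B C D D' n1 n2 : R) : `|B - C - (t * (s * D') + s * D)| <= e / K * n1 ->
    `|A - C - t * (s * D')| <= e / K * n2 -> n1 + n2 <= s * K ->
    `|s * B - s * A - s ^+ 2 * D| <= e * s ^+ 2.
  clear -s0 e0 K0 => k1 k2 k3.
  have -> : s * B - s * A - s ^+ 2 * D =
    s * ((B - C - (t * (s * D') + s * D)) - (A - C - t * (s * D'))) by ring.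
  rewrite normrM gtr0_norm // [leRHS](_ : _ = s * (s * e)); last by ring.
  apply: ler_wpM2l; first exact: ltW.
  apply: le_trans (ler_normB _ _) _; apply: le_trans (lerD k1 k2) _; rewrite -mulrDr.
  apply: le_trans (ler_wpM2l _ k3) _; first by rewrite divr_ge0 ?ltW.
  by rewrite le_eqVlt; apply/orP; left; apply/eqP; field; rewrite gt_eqF.
exact: key h1 h2 b3.
Qed.

(** The second difference is symmetric in [v] and [w], and after division by s^2 it tends to both
    iterated derivatives. *)
Lemma schwarz_real V (f : V -> R) x v w :
  (\forall y \near x, differentiable f y) ->
  differentiable (fun y => 'D_v f y) x -> differentiable (fun y => 'D_w f y) x ->
  'D_w (fun y => 'D_v f y) x = 'D_v (fun y => 'D_w f y) x.
Proof.
move=> df dv dw; apply/eqP; rewrite -subr_eq0 -normr_le0; apply/ler_addgt0Pl => e e0.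
have e20 : 0 < e / 2 by rewrite divr_gt0.
have [d1 d10 H1] := second_difference w e20 df dv.
have [d2 d20 H2] := second_difference v e20 df dw.
pose s := Num.min d1 d2 / 2.
have s0 : 0 < s by rewrite divr_gt0// lt_min d10.
have m0 : s < Num.min d1 d2 by rewrite /s ltr_pdivrMr// mulr_natr mulr2n ltrDl lt_min d10.
move: m0; rewrite lt_min => /andP[sd1 sd2].
have := H1 s; have := H2 s; rewrite s0 sd1 sd2 => /(_ isT) h2 /(_ isT) h1.
rewrite (addrAC x) in h2.
rewrite addr0 -(ler_pM2l (exprn_gt0 2 s0)).
rewrite -[leLHS](ger0_norm (mulr_ge0 (ltW (exprn_gt0 2 s0)) (normr_ge0 _))).
rewrite normrM normr_id -normrM.
set Z := f (x + s *: v + s *: w) in h1 h2; set Z1 := f (x + s *: v) in h1 h2.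
set Z2 := f (x + s *: w) in h1 h2.
set A := 'D_w _ x in h1 *; set B := 'D_v _ x in h2 *.
have -> : s ^+ 2 * (A - B) = (Z - Z2 - Z1 + f x - s ^+ 2 * B) - (Z - Z1 - Z2 + f x - s ^+ 2 * A) by ring.
apply: le_trans (ler_normB _ _) _; apply: le_trans (lerD h2 h1) _.
by rewrite le_eqVlt; apply/orP; left; apply/eqP; field.
Qed.

Lemma schwarz V a b (f : V -> 'M[R]_(a, b)) (O : set V) x v w :
  open O -> O x -> smooth_on O f ->
  'D_w (fun y => 'D_v f y) x = 'D_v (fun y => 'D_w f y) x.
Proof.
move=> oO Ox sf; apply/matrixP => i j.
have sij := smooth_coord i j oO sf.
have nO := open_nbhs_nbhs (conj oO Ox).
have E u u' : 'D_u (fun y => 'D_u' f y) x i j = 'D_u (fun y => 'D_u' (fun z => f z i j) y) x.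
  rewrite -derive_coord; last exact: smooth_on_diff (smooth_on_D _ sf) Ox.
  apply: near_eq_derive; apply: filterS nO => y Oy.
  by rewrite -derive_coord //; exact: smooth_on_diff sf Oy.
apply: etrans (E _ _) (etrans _ (esym (E _ _))); apply: schwarz_real.
- by apply: filterS nO => y Oy; exact: smooth_on_diff sij Oy.
- exact: smooth_on_diff (smooth_on_D _ sij) Ox.
- exact: smooth_on_diff (smooth_on_D _ sij) Ox.
Qed.

End MeanValue.

(** * Flows of vector fields *)

Ltac mxring := apply/matrixP => ? ?; rewrite !mxE; ring.

Section Euler.
Context {R : realType}.

(** The mean value estimate is applied to [f] minus its differential at [x]. *)
Lemma mvt_norm2 (V : normedModType R) a b (f : V -> 'M[R]_(a, b)) x h (M : R) : 0 <= M ->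
  (forall y, differentiable f y) -> fdim V ->
  (forall t : R, 0 <= t <= 1 -> `|'D_h f (x + t *: h) - 'D_h f x| <= M) ->
  `|f (x + h) - f x - 'D_h f x| <= M.
Proof.
move=> M0 df fV HM.
have lL : linear (fun v => 'D_v f x) by move=> k u v; exact: derive_lin.
have dg y : is_diff y (fun y => f y - 'D_y f x) (fun v => 'D_v f y - 'D_v f x).
  have A := is_diff_linF y fV lL.
  exact: (is_diff_addf (is_diff_der (df y)) (is_diffN A)).
have := @mvt_norm R V a b (fun y => f y - 'D_y f x) x h M M0.
have -> : f (x + h) - 'D_(x + h) f x - (f x - 'D_x f x) = f (x + h) - f x - 'D_h f x.
  rewrite derive_addv //.
  by move: (f (x + h)) (f x) ('D_x f x) ('D_h f x) => A B C D; mxring.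
apply; first by move=> t _; have := dg (x + t *: h).
by move=> t t01; rewrite (is_diff_derive _ (dg _)); exact: HM.
Qed.

Section OneField.
Variable (n : nat) (W : 'rV[R]_n -> 'rV[R]_n).

Definition lip_ball (m : nat) (f : 'rV[R]_n -> 'rV[R]_m) := forall r : R,
  exists2 L : R, 0 <= L & forall x y, `|x| <= r -> `|y| <= r ->
    `|f x - f y| <= L * `|x - y|.

Definition estep (h : R) (y : 'rV[R]_n) := y + h *: W y.
Definition euler (h : R) (j : nat) (y : 'rV[R]_n) := iter j (estep h) y.

(** An a priori bound that stands in for completeness of the field: polygons of dyadic step over a
    time of at most 1, started in a ball, remain in a ball independent of the step. *)
Definition bounded_iter := forall r : R, exists2 B : R, 0 <= B &
  forall k j x, (j <= 2 ^ k)%N -> `|x| <= r -> `|euler (2 ^- k) j x| <= B.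

Definition eulerN (k : nat) (y : 'rV[R]_n) := euler (2 ^- k) (2 ^ k) y.

Lemma le_exp_growth (h L : R) j : 0 <= h -> 0 <= L -> h * j%:R <= 1 ->
  (1 + h * L) ^+ j <= expR L.
Proof.
move=> h0 L0 hj.
apply: (@le_trans _ _ (expR (h * L) ^+ j)).
  by apply: lerXn2r; rewrite ?nnegrE ?expR_ge0 ?addr_ge0 ?mulr_ge0// expR_ge1Dx.
by rewrite -expRM_natl ler_expR -mulr_natl mulrA [_ * h]mulrC ler_piMl// mulr1.
Qed.

(** A discrete Gronwall estimate: each step multiplies the accumulated error by at most 1 + h L and
    adds at most [d], and (1 + h L)^N is bounded by e^L since h N is at most 1. *)
Lemma approx_orbit (h L B d : R) (w : nat -> 'rV[R]_n) N :
  0 <= h -> 0 <= L -> 0 <= d -> h * N%:R <= 1 ->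
  (forall x y, `|x| <= B -> `|y| <= B -> `|W x - W y| <= L * `|x - y|) ->
  (forall j, (j <= N)%N -> `|w j| <= B) ->
  (forall j, (j <= N)%N -> `|euler h j (w 0%N)| <= B) ->
  (forall j, (j < N)%N -> `|w j.+1 - estep h (w j)| <= d) ->
  `|w N - euler h N (w 0%N)| <= N%:R * d * expR L.
Proof.
move=> h0 L0 d0 hN LW wB eB wd.
have G j : (j <= N)%N -> `|w j - euler h j (w 0%N)| <= j%:R * d * (1 + h * L) ^+ j.
  elim: j => [|j IH] jN; first by rewrite subrr normr0 mul0r mul0r.
  have jN' := ltnW jN; have {IH} := IH jN'.
  set e := euler h j (w 0%N) => IH.
  have -> : w j.+1 - euler h j.+1 (w 0%N) =
     (w j.+1 - estep h (w j)) + ((w j - e) + h *: (W (w j) - W e)).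
    rewrite /euler iterS -/(euler h j (w 0%N)) -/e /estep.
    by mxring.
  have g1 : 1 <= 1 + h * L by rewrite lerDl mulr_ge0.
  have gj : 1 <= (1 + h * L) ^+ j.+1 by rewrite exprn_ege1.
  have a1 : `|w j - e + h *: (W (w j) - W e)| <= (1 + h * L) * `|w j - e|.
    apply: le_trans (ler_normD _ _) _; rewrite normrZ (ger0_norm h0) mulrDl mul1r lerD2l.
    by rewrite -mulrA ler_wpM2l// LW// ?wB// eB.
  have a2 : (1 + h * L) * `|w j - e| <= j%:R * d * (1 + h * L) ^+ j.+1.
    by rewrite exprS mulrCA ler_wpM2l// (le_trans _ g1).
  have a3 : d <= d * (1 + h * L) ^+ j.+1 by rewrite ler_peMr.
  apply: le_trans (ler_normD _ _) _.
  rewrite -natr1 mulrDl mul1r mulrDl addrC.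
  by apply: lerD; [exact: le_trans a1 a2|exact: le_trans (wd _ jN) a3].
apply: le_trans (G N (leqnn _)) _; rewrite ler_wpM2l ?mulr_ge0//; exact: le_exp_growth.
Qed.

Lemma euler_lip (h L B : R) x y N : 0 <= h -> 0 <= L -> h * N%:R <= 1 ->
  (forall x y, `|x| <= B -> `|y| <= B -> `|W x - W y| <= L * `|x - y|) ->
  (forall j, (j <= N)%N -> `|euler h j x| <= B) ->
  (forall j, (j <= N)%N -> `|euler h j y| <= B) ->
  `|euler h N x - euler h N y| <= expR L * `|x - y|.
Proof.
move=> h0 L0 hN LW xB yB.
have G j : (j <= N)%N -> `|euler h j x - euler h j y| <= (1 + h * L) ^+ j * `|x - y|.
  elim: j => [|j IH] jN; first by rewrite expr0 mul1r.
  have jN' := ltnW jN; have {IH} := IH jN'.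
  have := LW _ _ (xB _ jN') (yB _ jN').
  rewrite /euler !iterS /estep -!/(euler h j _).
  move: (euler h j x) (euler h j y) => a b LWab IH.
  have -> : a + h *: W a - (b + h *: W b) = (a - b) + h *: (W a - W b).
    by rewrite scalerBr opprD addrACA.
  apply: le_trans (ler_normD _ _) _; rewrite normrZ (ger0_norm h0).
  apply: (@le_trans _ _ ((1 + h * L) * `|a - b|)).
    by rewrite mulrDl mul1r lerD2l -mulrA ler_wpM2l.
  by rewrite exprS -mulrA ler_wpM2l// addr_ge0// mulr_ge0.
apply: le_trans (G N (leqnn _)) _; rewrite ler_wpM2r//; exact: le_exp_growth.
Qed.

Lemma pow2_ge0 k : 0 <= (2 : R) ^- k. Proof. by rewrite invr_ge0 exprn_ge0. Qed.
Lemma pow2_mul k : (2 : R) ^- k * (2 ^ k)%:R = 1.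
Proof. by rewrite natrX mulVf// expf_neq0. Qed.

Lemma le_pow2_mul k j : (j <= 2 ^ k)%N -> (2 : R) ^- k * j%:R <= 1.
Proof. by move=> jk; rewrite -[leRHS](pow2_mul k) ler_wpM2l ?pow2_ge0// ler_nat. Qed.

Lemma lip_ball_bounded m (f : 'rV[R]_n -> 'rV[R]_m) : lip_ball f -> forall r : R, 
  exists2 B : R, 0 <= B & forall x, `|x| <= r -> `|f x| <= B.
Proof.
move=> lf r; have [L L0 HL] := lf r; exists (`|f 0| + L * `|r|).
  by rewrite addr_ge0// mulr_ge0.
move=> x xr; have r0 := le_trans (normr_ge0 _) xr.
rewrite -[f x](subrK (f 0)) addrC (le_trans (ler_normD _ _))// lerD2l.
have := HL x 0 xr; rewrite normr0 subr0 => /(_ r0) h; apply: le_trans h _.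
by rewrite ler_wpM2l// (ger0_norm r0).
Qed.

(** Telescoping: the increments from index [k] on add up to at most 2 C 2^-k, which bounds the
    distance to the limit. *)
Lemma geom_cauchy (u : nat -> 'rV[R]_n) (C : R) : 0 <= C ->
  (forall k, `|u k.+1 - u k| <= C * 2 ^- k) ->
  forall k, `|u k - lim (u @ \oo)| <= 2 * C * 2 ^- k.
Proof.
move=> C0 H.
have G k m : `|u (k + m)%N - u k| <= 2 * C * (2 ^- k - 2 ^- (k + m)).
  elim: m => [|m IH]; first by rewrite addn0 !subrr normr0 mulr0.
  rewrite addnS -[u _.+1](subrK (u (k + m)%N)) -addrA (le_trans (ler_normD _ _))//.
  have := H (k + m)%N; rewrite exprS invfM; move: IH.
  set p := _ ^- (k + m); set q := _ ^- k; lra.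
have G' k m : (k <= m)%N -> `|u m - u k| <= 2 * C * 2 ^- k.
  move=> km; rewrite -(subnKC km); apply: le_trans (G _ _) _.
  by rewrite ler_wpM2l ?mulr_ge0// gerBl pow2_ge0.
have e2 (e : R) : 0 < e -> exists k, 2 * C * 2 ^- k < e.
  move=> e0.
  have C1 : 0 < 2 * C + 1 by rewrite ltr_wpDl// mulr_ge0.
  pose k := Num.bound ((2 * C + 1) / e).
  exists k; rewrite ltr_pdivrMr ?exprn_gt0//.
  have h1 : (2 * C + 1) / e < k%:R by apply: archi_boundP; rewrite divr_ge0 ?ltW.
  rewrite ltr_pdivrMr// in h1.
  have h2 : k%:R <= (2 : R) ^+ k by rewrite -natrX ler_nat ltnW// ltn_expl.
  have h3 : k%:R * e <= e * 2 ^+ k by rewrite mulrC ler_wpM2l// ltW.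
  lra.
have cu : cvg (u @ \oo).
  apply/cauchy_cvgP/cauchy_ballP => e e0.
  have [k Hk] := e2 _ (divr_gt0 e0 (ltr0n _ 2)).
  exists ([set x | exists2 m, (k <= m)%N & x = u m],
          [set x | exists2 m, (k <= m)%N & x = u m]) => /=.
    by split; exists k => // m /= km; exists m.
  move=> [_ _] /= [[m1 k1 ->] [m2 k2 ->]]; rewrite -ball_normE /=.
  rewrite -[u m1](subrK (u k)) -addrA (le_lt_trans (ler_normD _ _))//.
  have := G' _ _ k1; have := G' _ _ k2; rewrite (distrC (u m2)).
  by move=> /le_lt_trans/(_ Hk) ? /le_lt_trans/(_ Hk) ?; lra.
move=> k.
apply/ler_addgt0Pr => e e0.
move/cvgrPdist_lt: cu => /(_ e e0) [N _ HN].
have := HN (maxn N k) (leq_maxl _ _); have := G' _ _ (leq_maxr N k).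
rewrite (distrC (u (maxn N k))) (distrC (lim _)) => h1 /ltW h2.
have -> : u k - lim (u @ \oo) = (u k - u (maxn N k)) + (u (maxn N k) - lim (u @ \oo)).
  by rewrite addrA subrK.
by apply: le_trans (ler_normD _ _) _; exact: lerD.
Qed.

Lemma le_pow2_lim (a b C : R) : 0 <= C -> (forall k, a <= b + C * 2 ^- k) -> a <= b.
Proof.
move=> C0 H; apply/ler_addgt0Pr => e e0.
pose k := Num.bound (C / e).
have h1 : C / e < k%:R by apply: archi_boundP; rewrite divr_ge0// ltW.
apply: le_trans (H k) _; rewrite lerD2l ler_pdivrMr ?exprn_gt0//.
rewrite ltr_pdivrMr// in h1.
have h2 : k%:R <= (2 : R) ^+ k by rewrite -natrX ler_nat ltnW// ltn_expl.
by apply: le_trans (ltW h1) _; rewrite mulrC ler_wpM2l// ltW.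
Qed.

Lemma eq_pow2_lim (m : nat) (a b : 'rV[R]_m) C : 0 <= C ->
  (forall k, `|a - b| <= C * 2 ^- k) -> a = b.
Proof.
move=> C0 H; apply/eqP; rewrite -subr_eq0 -normr_le0; apply: (le_pow2_lim C0) => k.
by rewrite add0r.
Qed.

(* The time-one map of the flow of [W], as the limit of Euler's method with 2^k steps. *)
Definition eflow (y : 'rV[R]_n) := lim ((fun k => eulerN k y) @ \oo).

Hypotheses (lW : lip_ball W) (bW : bounded_iter).

(** Two steps of length h/2 differ from one step of length h by at most h^2 L D, with [L] and [D]
    the Lipschitz constant and the bound of [W] on a ball containing all polygons. Over 2^k steps
    the discrete Gronwall estimate leaves a total error of order 2^-k. *)
Lemma eulerN_succ (r : R) : exists2 C : R, 0 <= C & forall k x, `|x| <= r ->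
  `|eulerN k.+1 x - eulerN k x| <= C * 2 ^- k.
Proof.
have [B B0 HB] := bW r.
have [L L0 HL] := lW B.
have [D D0 HD] := lip_ball_bounded lW B.
exists (L * D * expR L); first by rewrite !mulr_ge0// expR_ge0.
move=> k x xr.
have h0 := pow2_ge0 k; have h0' := pow2_ge0 k.+1.
have h2 : (2 : R) ^- k.+1 = 2 ^- k / 2 by rewrite exprS invfM mulrC.
(* The even vertices of the finer polygon, regarded as an approximate polygon of step 2^-k. *)
pose w j := euler (2 ^- k.+1) (j * 2) x.
have E1 : eulerN k.+1 x = w (2 ^ k)%N by rewrite /w -expnSr.
have j2 j : (j <= 2 ^ k)%N -> (j * 2 <= 2 ^ k.+1)%N by rewrite expnSr leq_mul2r.
rewrite E1 -[x in eulerN k x]/(w 0%N).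
apply: le_trans (@approx_orbit _ L B ((2 ^- k) ^+ 2 * L * D) w (2 ^ k) _ _ _ _ HL _ _ _) _ => //.
- by rewrite !mulr_ge0 ?exprn_ge0.
- by rewrite pow2_mul.
- by move=> j /j2 jk; exact: HB.
- by move=> j jk; exact: HB.
- move=> j jk.
  have b1 : `|w j| <= B by apply: HB => //; exact/j2/ltnW.
  have b2 : `|estep (2 ^- k.+1) (w j)| <= B.
    have j3 : ((j * 2).+1 <= 2 ^ k.+1)%N by apply: leq_trans (j2 j.+1 jk); exact: leqnSn.
    exact: (HB k.+1 (j * 2).+1 x j3 xr).
  have -> : w j.+1 = estep (2 ^- k.+1) (estep (2 ^- k.+1) (w j)) by rewrite /w mulSn.
  move: b2; rewrite {2}/estep; set y := estep _ (w j) => b2.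
  have -> : estep (2 ^- k.+1) y - estep (2 ^- k) (w j) = 2 ^- k.+1 *: (W y - W (w j)).
    rewrite /y /estep h2; move: (W (w j)) (W _) => a b; apply/matrixP => p q; rewrite !mxE; field.
    by rewrite expf_neq0.
  rewrite normrZ ger0_norm//.
  apply: (@le_trans _ _ (2 ^- k * (L * (2 ^- k * D)))); last first.
    by rewrite le_eqVlt; apply/orP; left; apply/eqP; ring.
  apply: ler_pM => //; first by rewrite h2 ler_pdivrMr// ler_peMr// ler1n.
  apply: le_trans (HL _ _ b2 b1) _; rewrite ler_wpM2l//.
  rewrite /y /estep addrAC subrr add0r normrZ ger0_norm// ler_pM//.
    by rewrite h2 ler_pdivrMr// ler_peMr// ler1n.
  exact: HD.
have -> : (2 ^ k)%:R * (2 ^- k ^+ 2 * L * D) * expR L = (2 ^- k * (2 ^ k)%:R) * (L * D * expR L * 2 ^- k) by ring.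
by rewrite pow2_mul mul1r.
Qed.

Lemma eulerN_cvg (r : R) : exists2 C : R, 0 <= C & forall k x, `|x| <= r ->
  `|eulerN k x - eflow x| <= C * 2 ^- k.
Proof.
have [C C0 HC] := eulerN_succ r; exists (2 * C); first by rewrite mulr_ge0.
move=> k x xr; apply: (@geom_cauchy (fun k => eulerN k x) C C0) => i; exact: HC.
Qed.

Lemma eulerN_lip (r : R) : exists2 C : R, 0 <= C & forall k x y, `|x| <= r -> `|y| <= r ->
  `|eulerN k x - eulerN k y| <= C * `|x - y|.
Proof.
have [B B0 HB] := bW r; have [L L0 HL] := lW B.
exists (expR L); first exact: expR_ge0.
move=> k x y xr yr; apply: (@euler_lip _ L B) => //; [by rewrite pow2_mul| |].
- by move=> j jk; exact: HB.
- by move=> j jk; exact: HB.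
Qed.

(** Approximate polygons whose local error is quadratic in the step have the same limit as the exact
    ones, by [approx_orbit]. This permits a guess for the value of a flow to be verified step by
    step, as in [derive_eflow_rescaled]. *)
Lemma eflow_approx (z l : 'rV[R]_n) (w : nat -> nat -> 'rV[R]_n) (B C C' : R) :
  0 <= C -> 0 <= C' ->
  (forall k, w k 0%N = z) ->
  (forall k j, (j <= 2 ^ k)%N -> `|w k j| <= B) ->
  (forall k j, (j < 2 ^ k)%N -> `|w k j.+1 - estep (2 ^- k) (w k j)| <= C * (2 ^- k) ^+ 2) ->
  (forall k, `|w k (2 ^ k)%N - l| <= C' * 2 ^- k) ->
  l = eflow z.
Proof.
move=> C0 C'0 w0 wB ws wl.
have [B' B'0 HB'] := bW `|z|.
pose B2 := Num.max B B'.
have [L L0 HL] := lW B2.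
have [C2 C20 HC2] := eulerN_cvg `|z|.
apply: (@eq_pow2_lim _ _ _ (C' + C * expR L + C2)).
  by rewrite !addr_ge0 ?mulr_ge0 ?expR_ge0.
move=> k.
have h1 : `|w k (2 ^ k)%N - eulerN k z| <= C * expR L * 2 ^- k.
  rewrite -(w0 k).
  apply: le_trans (@approx_orbit (2 ^- k) L B2 (C * (2 ^- k) ^+ 2) (w k) (2 ^ k) _ _ _ _ HL _ _ _) _ => //.
  - by rewrite mulr_ge0// exprn_ge0// pow2_ge0.
  - by rewrite pow2_mul.
  - by move=> j jk; rewrite le_max wB.
  - by move=> j jk; rewrite le_max HB' ?orbT// w0.
  - exact: ws.
  have -> : (2 ^ k)%:R * (C * 2 ^- k ^+ 2) * expR L = (2 ^- k * (2 ^ k)%:R) * (C * expR L * 2 ^- k) by ring.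
  by rewrite pow2_mul mul1r.
have h2 := HC2 k z (lexx _).
have -> : l - eflow z = (l - w k (2 ^ k)%N) + ((w k (2 ^ k)%N - eulerN k z) + (eulerN k z - eflow z)).
  by rewrite !addrA !subrK.
have h3 := wl k; rewrite distrC in h3.
rewrite !mulrDl -[leRHS]addrA.
apply: le_trans (ler_normD _ _) _; apply: lerD => //.
by apply: le_trans (ler_normD _ _) _; apply: lerD.
Qed.

End OneField.

Lemma cont_bounded_ball n m (f : 'rV[R]_n -> 'rV[R]_m) : continuous f -> forall r : R,
  exists2 B : R, 0 <= B & forall x, `|x| <= r -> `|f x| <= B.
Proof.
move=> cf r.
have cK : compact [set x : 'rV[R]_n | `|x| <= r].
  apply: bounded_closed_compact.
    by exists r; split; [exact: num_real|move=> x rx y /= yr; exact: le_trans yr (ltW rx)].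
  apply: (@preimage_closed _ _ (fun x : 'rV[R]_n => `|x|) [set y : R | y <= r]); last exact: closed_le.
  by move=> x _; exact: norm_continuous.
have cfK : compact (f @` [set x : 'rV[R]_n | `|x| <= r]).
  by apply: continuous_compact => //; exact: continuous_subspaceT.
have [M [_ HM]] := compact_bounded cfK.
exists (Num.max 0 (M + 1)); first by rewrite le_max lexx.
move=> x xr; apply: (@le_trans _ _ (M + 1)); last by rewrite le_max lexx orbT.
by apply: HM; [rewrite ltrDl|exists x].
Qed.

Lemma smooth_cont (V W : normedModType R) (f : V -> W) : smooth_on setT f -> continuous f.
Proof. by move=> sf x; apply: differentiable_continuous; exact: smooth_on_diff sf _. Qed.

Lemma derive_row_sum n (W : normedModType R) (f : 'rV[R]_n -> W) x v : differentiable f x ->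
  'D_v f x = \sum_i v 0 i *: 'D_(delta_mx 0 i) f x.
Proof.
move=> df; rewrite {1}(row_sum_delta v) derive_sumv//; apply: eq_bigr => i _.
exact: derive_scalev.
Qed.

Lemma derive_bound_ball n m (f : 'rV[R]_n -> 'rV[R]_m) : smooth_on setT f -> forall r : R,
  exists2 B : R, 0 <= B & forall x v, `|x| <= r -> `|'D_v f x| <= B * `|v|.
Proof.
move=> sf r.
have H i := cont_bounded_ball (smooth_cont (smooth_on_D (delta_mx 0 i) sf)) r.
pose b i := s2val (cid2 (H i)).
have b0 i : 0 <= b i by rewrite /b; case: (cid2 _).
have Hb i x : `|x| <= r -> `|'D_(delta_mx 0 i) f x| <= b i by rewrite /b; case: (cid2 _) => c ? h /h.
exists (\sum_i b i); first exact: sumr_ge0.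
move=> x v xr; rewrite derive_row_sum; last exact: smooth_on_diff sf _.
rewrite mulr_suml; apply: le_trans (ler_norm_sum _ _ _) _; apply: ler_sum => i _.
by rewrite normrZ mulrC ler_pM// ?Hb// mx_norm_entry.
Qed.

Lemma smooth_lip n m (f : 'rV[R]_n -> 'rV[R]_m) : smooth_on setT f -> lip_ball f.
Proof.
move=> sf r; have [B B0 HB] := derive_bound_ball sf r; exists B => // x y xr yr.
have -> : f x - f y = f (y + (x - y)) - f y by rewrite (addrC y) subrK.
apply: mvt_norm; [by rewrite mulr_ge0|by move=> t _; exact: smooth_on_diff sf _|].
move=> t /andP[t0 t1]; apply: HB.
have -> : y + t *: (x - y) = (1 - t) *: y + t *: x by mxring.
apply: le_trans (ler_normD _ _) _; rewrite !normrZ ger0_norm ?subr_ge0// ger0_norm//.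
have -> : r = (1 - t) * r + t * r by ring.
by apply: lerD; rewrite ler_wpM2l// subr_ge0.
Qed.

Lemma smooth_row_mx (V : normedModType R) (O : set V) n m (f : V -> 'rV[R]_n) (g : V -> 'rV[R]_m) :
  open O -> smooth_on O f -> smooth_on O g -> smooth_on O (fun x => row_mx (f x) (g x)).
Proof.
move=> oO sf sg.
have l1 : linear (fun u : 'rV[R]_n => row_mx u (0 : 'rV[R]_m)).
  by move=> k u v; rewrite scale_row_mx add_row_mx scaler0 addr0.
have l2 : linear (fun u : 'rV[R]_m => row_mx (0 : 'rV[R]_n) u).
  by move=> k u v; rewrite scale_row_mx add_row_mx scaler0 addr0.
have s1 := smooth_comp_lin (@fdim_mx R 1 n) oO l1 sf.
have s2 := smooth_comp_lin (@fdim_mx R 1 m) oO l2 sg.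
by apply: (smooth_on_eq oO _ (smooth_add oO s1 s2)) => x _; rewrite add_row_mx addr0 add0r.
Qed.

Lemma derive_row_mx (V : normedModType R) n m (f : V -> 'rV[R]_n) (g : V -> 'rV[R]_m) x v :
  differentiable f x -> differentiable g x ->
  'D_v (fun x => row_mx (f x) (g x)) x = row_mx ('D_v f x) ('D_v g x).
Proof.
move=> df dg.
have l1 : linear (fun u : 'rV[R]_n => row_mx u (0 : 'rV[R]_m)).
  by move=> k u w; rewrite scale_row_mx add_row_mx scaler0 addr0.
have l2 : linear (fun u : 'rV[R]_m => row_mx (0 : 'rV[R]_n) u).
  by move=> k u w; rewrite scale_row_mx add_row_mx scaler0 addr0.
have d1 := is_diff_comp (is_diff_der df) (is_diff_linF (f x) (@fdim_mx R 1 n) l1).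
have d2 := is_diff_comp (is_diff_der dg) (is_diff_linF (g x) (@fdim_mx R 1 m) l2).
have := is_diff_addf d1 d2.
have -> : (fun y => ((fun u : 'rV[R]_n => row_mx u (0 : 'rV[R]_m)) \o f) y +
  ((fun u : 'rV[R]_m => row_mx (0 : 'rV[R]_n) u) \o g) y) = (fun x => row_mx (f x) (g x)).
  by apply/funext => y /=; rewrite add_row_mx addr0 add0r.
by move=> H; rewrite (is_diff_derive _ H) /= add_row_mx addr0 add0r.
Qed.

Lemma linear_lsubmx n m : linear (@lsubmx R 1 n m).
Proof. by move=> k u v; rewrite linearP. Qed.
Lemma linear_rsubmx n m : linear (@rsubmx R 1 n m).
Proof. by move=> k u v; rewrite linearP. Qed.
Lemma norm_row_mx_le n m (a : 'rV[R]_n) (b : 'rV[R]_m) (c : R) :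
  `|a| <= c -> `|b| <= c -> `|row_mx a b| <= c.
Proof.
move=> ac bc; apply: mx_norm_le; first exact: le_trans ac.
move=> i j; rewrite mxE; case: fintype.split => k; exact: le_trans (mx_norm_entry _ _ _) _.
Qed.

Lemma norm_lsubmx n m (z : 'rV[R]_(n + m)) : `|lsubmx z| <= `|z|.
Proof. by apply: mx_norm_le => // i j; rewrite mxE; exact: mx_norm_entry. Qed.
Lemma norm_rsubmx n m (z : 'rV[R]_(n + m)) : `|rsubmx z| <= `|z|.
Proof. by apply: mx_norm_le => // i j; rewrite mxE; exact: mx_norm_entry. Qed.

Lemma smooth_linmx (V : normedModType R) (O : set V) n m (f : V -> 'rV[R]_n)
  (L : 'rV[R]_n -> 'rV[R]_m) :
  open O -> linear L -> smooth_on O f -> smooth_on O (fun x => L (f x)).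
Proof. by move=> oO lL sf; exact: (smooth_comp_lin (@fdim_mx R 1 n) oO lL sf). Qed.

Lemma smooth_compT (V : normedModType R) n (W : normedModType R) (f : V -> 'rV[R]_n) (g : 'rV[R]_n -> W)
  (O : set V) :
  open O -> smooth_on O f -> smooth_on setT g -> smooth_on O (fun x => g (f x)).
Proof.
move=> oO sf sg; apply: (@smooth_comp _ _ _ _ O setT f g) => //; first exact: fdim_mx.
exact: openT.
Qed.

(** * Smoothness of the time-one map *)

Section TangentField.
Variables (n : nat) (W : 'rV[R]_n -> 'rV[R]_n).

(* The time-one map of [tfield] is the tangent map of that of [W]; iterating this gives the
   smoothness of the flow. *)
Definition tfield (z : 'rV[R]_(n + n)) : 'rV[R]_(n + n) :=
  row_mx (W (lsubmx z)) ('D_(rsubmx z) W (lsubmx z)).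

Hypothesis sW : smooth_on setT W.

Let dW x : differentiable W x. Proof. exact: smooth_on_diff sW _. Qed.

Lemma smooth_derive_var (V : normedModType R) m k (O : set V) (f : 'rV[R]_m -> 'rV[R]_k) (a b : V -> 'rV[R]_m) :
  open O -> smooth_on setT f -> smooth_on O a -> smooth_on O b ->
  smooth_on O (fun x => 'D_(a x) f (b x)).
Proof.
move=> oO sf sa sb.
suff H : smooth_on O (fun x => \sum_i a x 0 i *: 'D_(delta_mx 0 i) f (b x)).
  apply: (smooth_on_eq oO _ H) => x _; rewrite -derive_row_sum//; exact: smooth_on_diff sf _.
apply: smooth_sum => // i; apply: smooth_scale => //; first exact: smooth_coord.
by apply: (@smooth_compT _ _ _ b (fun y => 'D_(delta_mx 0 i) f y)) => //; exact: smooth_on_D.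
Qed.

Lemma smooth_tfield : smooth_on setT tfield.
Proof.
have oT : open [set: 'rV[R]_(n + n)] by exact: openT.
have sl : smooth_on setT (@lsubmx R 1 n n).
  by apply: smooth_linF => //; [exact: fdim_mx|exact: linear_lsubmx].
have sr : smooth_on setT (@rsubmx R 1 n n).
  by apply: smooth_linF => //; [exact: fdim_mx|exact: linear_rsubmx].
apply: smooth_row_mx => //; first exact: smooth_compT.
exact: smooth_derive_var.
Qed.

Lemma is_diff_estep h x : is_diff x (estep W h) (fun v => v + h *: 'D_v W x).
Proof. exact: (is_diff_addf (is_diff_id x) (is_diffZ h (is_diff_der (dW x)))). Qed.

Lemma diff_estep h x : differentiable (estep W h) x.
Proof. exact: (is_diff_diff (is_diff_estep h x)). Qed.

Lemma diff_euler h j x : differentiable (euler W h j) x.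
Proof.
elim: j x => [|j IH] x; first exact: (is_diff_diff (is_diff_id x)).
have -> : euler W h j.+1 = estep W h \o euler W h j by apply/funext.
exact: (differentiable_comp (IH x) (diff_estep _ _)).
Qed.

Lemma estep_tfield h a b : estep tfield h (row_mx a b) =
  row_mx (estep W h a) (b + h *: 'D_b W a).
Proof. by rewrite /estep /tfield row_mxKl row_mxKr scale_row_mx add_row_mx. Qed.

(** The chain rule for one Euler step of [W] is one Euler step of [tfield]. The identity is
    therefore exact at every finite stage, before any limit is taken. *)
Lemma euler_tfield h j x v :
  euler tfield h j (row_mx x v) = row_mx (euler W h j x) ('D_v (euler W h j) x).
Proof.
elim: j => [|j IH]; first by rewrite /euler /= (is_diff_derive _ (is_diff_id x)).
have E : euler W h j.+1 = estep W h \o euler W h j by apply/funext.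
rewrite [LHS]/euler iterS -/(euler _ _ _ _) IH estep_tfield E; congr row_mx.
rewrite (derive_comp _ (diff_euler h j x) (diff_estep _ _)).
by rewrite (is_diff_derive _ (is_diff_estep _ _)).
Qed.

(** While the base polygon stays in the ball of radius [B], the vector component obeys a linear
    recursion with factor at most 1 + 2^-k D, hence grows by at most e^D. *)
Lemma bounded_iter_tfield : bounded_iter W -> bounded_iter tfield.
Proof.
move=> bW r; have [B B0 HB] := bW r; have [D D0 HD] := derive_bound_ball sW B.
exists (Num.max B (expR D * `|r|)); first by rewrite le_max B0.
move=> k j z jk zr; rewrite -[z]hsubmxK euler_tfield.
have lr := le_trans (norm_lsubmx z) zr; have rr := le_trans (norm_rsubmx z) zr.
apply: norm_row_mx_le; first by rewrite le_max HB.
rewrite le_max; apply/orP; right.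
have h0 := pow2_ge0 k.
have G i : (i <= j)%N -> `|'D_(rsubmx z) (euler W (2 ^- k) i) (lsubmx z)| <=
    (1 + 2 ^- k * D) ^+ i * `|r|.
  elim: i => [|i IH] ij.
    by rewrite /euler /= (is_diff_derive _ (is_diff_id _)) expr0 mul1r; apply: le_trans rr (ler_norm _).
  have -> : euler W (2 ^- k) i.+1 = estep W (2 ^- k) \o euler W (2 ^- k) i by apply/funext.
  rewrite (derive_comp _ (diff_euler _ _ _) (diff_estep _ _)).
  rewrite (is_diff_derive _ (is_diff_estep _ _)).
  have {}IH := IH (ltnW ij).
  have ik : (i <= 2 ^ k)%N by exact: leq_trans (ltnW ij) jk.
  have := HD _ ('D_(rsubmx z) (euler W (2 ^- k) i) (lsubmx z)) (HB k i (lsubmx z) ik lr).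
  move: IH; set a := 'D_(rsubmx z) _ _; set b := 'D_a W _ => IH ba.
  apply: le_trans (ler_normD _ _) _; rewrite normrZ ger0_norm//.
  apply: (@le_trans _ _ ((1 + 2 ^- k * D) * `|a|)).
    by rewrite mulrDl mul1r lerD2l -mulrA ler_wpM2l.
  by rewrite exprS -mulrA ler_wpM2l// addr_ge0// mulr_ge0.
apply: le_trans (G j (leqnn _)) _; rewrite ler_wpM2r//.
by apply: le_exp_growth => //; exact: le_pow2_mul.
Qed.

(** The derivatives of the polygons at [x] are polygons of [tfield], so they converge, and the limit
    [G] is linear in the direction. The polygons satisfy a quadratic Taylor estimate whose constant
    [CL] does not depend on the number of steps; it passes to the limit. *)
Lemma is_diff_eflow x : bounded_iter W ->
  is_diff x (eflow W) (fun v => rsubmx (eflow tfield (row_mx x v))).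
Proof.
move=> bW; have lW := smooth_lip sW; have sT := smooth_tfield.
have lT := smooth_lip sT; have bT := bounded_iter_tfield bW.
pose G v := rsubmx (eflow tfield (row_mx x v)).
have gk k v : 'D_v (eulerN W k) x = rsubmx (eulerN tfield k (row_mx x v)).
  by rewrite /eulerN euler_tfield row_mxKr.
have cG r : exists2 C : R, 0 <= C & forall k v, `|v| <= r -> `|'D_v (eulerN W k) x - G v| <= C * 2 ^- k.
  have [C C0 HC] := eulerN_cvg lT bT (Num.max `|x| r).
  exists C => // k v vr; rewrite gk /G -linearB.
  apply: le_trans (norm_rsubmx _) (HC _ _ _).
  by apply: norm_row_mx_le; rewrite le_max ?lexx// vr orbT.
have lG : linear G.
  move=> a u v.
  have [C1 C10 H1] := cG `|a *: u + v|; have [C2 C20 H2] := cG `|u|; have [C3 C30 H3] := cG `|v|.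
  apply: (@eq_pow2_lim _ _ _ (C1 + `|a| * C2 + C3)).
    by rewrite !addr_ge0// mulr_ge0.
  move=> k; have h1 := H1 k _ (lexx _); have h2 := H2 k _ (lexx _); have h3 := H3 k _ (lexx _).
  rewrite derive_lin in h1; last exact: diff_euler.
  move: h1 h2 h3; move: ('D_u _ _) ('D_v _ _) (G (_ + _)) (G u) (G v) => A B g g1 g2 h1 h2 h3.
  have -> : g - (a *: g1 + g2) = - (a *: A + B - g) + (a *: (A - g1) + (B - g2)) by mxring.
  rewrite !mulrDl -[leRHS]addrA; apply: le_trans (ler_normD _ _) _; rewrite normrN; apply: lerD => //.
  apply: le_trans (ler_normD _ _) _; apply: lerD => //.
  by rewrite normrZ -mulrA ler_wpM2l.
rewrite -/G -[G]/(mklin lG : _ -> _).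
have [CL CL0 HL] := eulerN_lip lT bT (`|x| + 1).
have key h : `|h| <= 1 -> `|eflow W (x + h) - eflow W x - G h| <= CL * `|h| ^+ 2.
  move=> h1.
  have [C1 C10 H1] := cG 1; have [C2 C20 H2] := eulerN_cvg lW bW (`|x| + 1).
  apply: (@le_pow2_lim _ _ (C2 + C2 + C1)); first by rewrite !addr_ge0.
  move=> k.
  have xh t : 0 <= t <= 1 -> `|x + t *: h| <= `|x| + 1.
    move=> /andP[t0 t1]; apply: le_trans (ler_normD _ _) _; rewrite lerD2l normrZ ger0_norm//.
    by apply: le_trans (ler_piMl _ t1) _.
  have K : `|eulerN W k (x + h) - eulerN W k x - 'D_h (eulerN W k) x| <= CL * `|h| ^+ 2.
    apply: mvt_norm2.
    - by rewrite mulr_ge0// exprn_ge0.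
    - by move=> y; exact: diff_euler.
    - exact: fdim_mx.
    move=> t t01.
    have [h00|hn0] := eqVneq `|h| 0.
      move/eqP: h00; rewrite normr_eq0 => /eqP ->.
      by rewrite !derive0 subrr !normr0 expr0n mulr0.
    have hp : 0 < `|h| by rewrite lt_def hn0 normr_ge0.
    (* Passing to the unit vector [e] yields the square of |h|: one factor comes from linearity of
       the derivative in its direction, the other from the Lipschitz bound between the base points x
       + t h and x. *)
    pose e := `|h|^-1 *: h.
    have he : h = `|h| *: e by rewrite scalerA mulfV// scale1r.
    have e1 : `|e| = 1 by rewrite normrZ normfV normr_id mulVf.
    have Dh y : 'D_h (eulerN W k) y = `|h| *: 'D_e (eulerN W k) y.
      by rewrite -derive_scalev -?he//; exact: diff_euler.
    rewrite !Dh -scalerBr normrZ normr_id [CL * _]mulrC expr2 -mulrA ler_wpM2l// mulrC.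
    rewrite /eulerN -[X in `|X - _|](row_mxKr (eulerN W k (x + t *: h))).
    rewrite -[X in `|_ - X|](row_mxKr (eulerN W k x)) -!euler_tfield -linearB.
    apply: le_trans (norm_rsubmx _) _.
    apply: le_trans (HL k (row_mx (x + t *: h) e) (row_mx x e) _ _) _.
    - by apply: norm_row_mx_le; [exact: xh|rewrite e1 lerDr].
    - by apply: norm_row_mx_le; [rewrite lerDl|rewrite e1 lerDr].
    rewrite ler_wpM2l// opp_row_mx add_row_mx subrr addrAC subrr add0r.
    move: t01 => /andP[t0 t1].
    apply: norm_row_mx_le; last by rewrite normr0.
    by rewrite normrZ ger0_norm// ler_piMl.
  have k1 := H2 k (x + h); rewrite -[h in x + h]scale1r in k1.
  have {}k1 := k1 (xh 1 _); rewrite ler01 lexx scale1r in k1; have {}k1 := k1 isT.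
  have k2 := H2 k x; have {}k2 : `|eulerN W k x - eflow W x| <= C2 * 2 ^- k by apply: k2; rewrite lerDl.
  have k3 := H1 k h h1.
  move: K k1 k2 k3; move: (eulerN W k (x + h)) (eulerN W k x) ('D_h _ x) (eflow W (x + h)) (eflow W x) (G h) => a b c a' b' c' K k1 k2 k3.
  have -> : a' - b' - c' = (a - b - c) + (- (a - a') + (b - b') + (c - c')) by mxring.
  apply: le_trans (ler_normD _ _) _; apply: lerD => //; rewrite !mulrDl.
  apply: le_trans (ler_normD _ _) _; apply: lerD => //.
  by apply: le_trans (ler_normD _ _) _; rewrite normrN; apply: lerD.
apply: is_diff_eps; first by apply: fdim_lin_cont => //; exact: fdim_mx.
move=> e e0.
have CL1 : 0 < CL + 1 by rewrite ltr_wpDl.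
apply: (@norm_nbhs _ _ _ _ (Num.min 1 (e / (CL + 1)))); first by rewrite lt_min ltr01 divr_gt0.
move=> h; rewrite subr0 lt_min => /andP[/ltW h1 h2]; rewrite [h + x]addrC.
apply: le_trans (key h h1) _; rewrite expr2 mulrA ler_wpM2r//.
rewrite ltr_pdivlMr// in h2.
by have := normr_ge0 h; clear -h2 CL0; nra.
Qed.

End TangentField.

(** The coinduction class consists of l o [eflow W'] o (affine map), for fields [W'] in arbitrary
    dimension. A directional derivative doubles the dimension, replaces [W'] by [tfield W'], and
    stores the fixed direction in the constant part of the affine map. *)
Lemma smooth_eflow n (W : 'rV[R]_n -> 'rV[R]_n) : smooth_on setT W -> bounded_iter W ->
  smooth_on setT (eflow W).
Proof.
move=> sW bW.
have oT : open [set: 'rV[R]_n] by exact: openT.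
pose S (f : 'rV[R]_n -> 'rV[R]_n) := exists N (W' : 'rV[R]_N -> 'rV[R]_N)
   (A : 'rV[R]_n -> 'rV[R]_N) (b : 'rV[R]_N) (l : 'rV[R]_N -> 'rV[R]_n),
   [/\ smooth_on setT W', bounded_iter W', linear A, linear l & f = fun x => l (eflow W' (A x + b))].
have dS N (W' : 'rV[R]_N -> 'rV[R]_N) (A : 'rV[R]_n -> 'rV[R]_N) (b : 'rV[R]_N) (l : 'rV[R]_N -> 'rV[R]_n) x :
   smooth_on setT W' -> bounded_iter W' -> linear A -> linear l ->
   is_diff x (fun x => l (eflow W' (A x + b)))
     (fun v => l (rsubmx (eflow (tfield W') (row_mx (A x + b) (A v + 0))))).
  move=> sW' bW' lA ll.
  have dA : is_diff x (fun x => A x + b) (fun v => A v + 0).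
    exact: (is_diff_addf (is_diff_linF x (@fdim_mx R 1 n) lA) (is_diff_cst b x)).
  have dF := is_diff_eflow sW' (A x + b) bW'.
  exact: (is_diff_comp (is_diff_comp dA dF) (is_diff_linF _ (@fdim_mx R 1 N) ll)).
apply: (@smooth_coind _ _ _ setT S oT).
- by move=> f [N [W' [A [b [l [sW' bW' lA ll ->]]]]]] x _; exact: (is_diff_diff (dS _ _ _ _ _ _ sW' bW' lA ll)).
- move=> f v [N [W' [A [b [l [sW' bW' lA ll ->]]]]]].
  exists (fun x => l (rsubmx (eflow (tfield W') (row_mx (A x) 0 + row_mx b (A v))))); split.
    exists (N + N)%N, (tfield W'), (fun x => row_mx (A x) 0), (row_mx b (A v)), (fun z => l (rsubmx z)).
    split=> //; first exact: smooth_tfield.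
    + exact: bounded_iter_tfield.
    + by move=> k u w; rewrite lA scale_row_mx add_row_mx scaler0 addr0.
    + by move=> k u w; rewrite linear_rsubmx ll.
  move=> x _; rewrite (is_diff_derive _ (dS _ _ _ _ _ x sW' bW' lA ll)).
  by rewrite add_row_mx add0r addr0.
exists n, W, id, 0, id; split => //.
by apply/funext => x; rewrite addr0.
Qed.

Lemma taylor2 n m (W : 'rV[R]_n -> 'rV[R]_m) : smooth_on setT W -> forall r : R,
  exists2 M : R, 0 <= M & forall y v, `|y| <= r -> `|y + v| <= r ->
    `|W (y + v) - W y - 'D_v W y| <= M * `|v| ^+ 2.
Proof.
move=> sW r.
have H i := smooth_lip (smooth_on_D (delta_mx 0 i) sW) r.
pose b i := s2val (cid2 (H i)).
have b0 i : 0 <= b i by rewrite /b; case: (cid2 _).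
have Hb i x y : `|x| <= r -> `|y| <= r ->
    `|'D_(delta_mx 0 i) W x - 'D_(delta_mx 0 i) W y| <= b i * `|x - y|.
  by rewrite /b; case: (cid2 _) => c ? h; exact: h.
have dW y : differentiable W y by exact: smooth_on_diff sW _.
exists (\sum_i b i); first exact: sumr_ge0.
move=> y v yr yvr; apply: mvt_norm2 => //.
- by rewrite mulr_ge0 ?exprn_ge0// sumr_ge0.
- exact: fdim_mx.
move=> t /andP[t0 t1].
rewrite derive_row_sum// (derive_row_sum v (dW y)) -sumrB mulr_suml.
apply: le_trans (ler_norm_sum _ _ _) _; apply: ler_sum => i _.
rewrite -scalerBr normrZ expr2 mulrCA; apply: ler_pM => //; first exact: mx_norm_entry.
have ytv : `|y + t *: v| <= r.
  have -> : y + t *: v = (1 - t) *: y + t *: (y + v) by mxring.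
  apply: le_trans (ler_normD _ _) _; rewrite !normrZ ger0_norm ?subr_ge0// ger0_norm//.
  have -> : r = (1 - t) * r + t * r by ring.
  by apply: lerD; rewrite ler_wpM2l// subr_ge0.
apply: le_trans (Hb i _ _ ytv yr) _; rewrite ler_wpM2l//.
by rewrite addrAC subrr add0r normrZ ger0_norm// ler_piMl.
Qed.

(** * Flows of fields of linear growth, with time as a variable *)

Section Flow.
Variables (n : nat) (W : 'rV[R]_n -> 'rV[R]_n) (C : R).
Hypotheses (sW : smooth_on setT W) (C0 : 0 <= C).
Hypothesis gW : forall y, `|W y| <= C * (1 + `|y|).

Let dW x : differentiable W x. Proof. exact: smooth_on_diff sW _. Qed.

(* Time as a parameter: the time-one map of [rescaled] sends (t, y) to (t, y'), where y' is the
   value at time t of the flow of [W] starting at y. *)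
Definition rescaled (z : 'rV[R]_(1 + n)) : 'rV[R]_(1 + n) :=
  row_mx 0 (lsubmx z 0 0 *: W (rsubmx z)).

Lemma smooth_rescaled : smooth_on setT rescaled.
Proof.
have oT : open [set: 'rV[R]_(1 + n)] by exact: openT.
have sl : smooth_on setT (@lsubmx R 1 1 n).
  by apply: smooth_linF => //; [exact: fdim_mx|exact: linear_lsubmx].
have sr : smooth_on setT (@rsubmx R 1 1 n).
  by apply: smooth_linF => //; [exact: fdim_mx|exact: linear_rsubmx].
apply: smooth_row_mx => //; first exact: smooth_cst.
apply: smooth_scale => //; first exact: smooth_coord.
exact: smooth_compT.
Qed.

Lemma euler_rescaled h j (t : R) y : euler rescaled h j (row_mx t%:M y) =
  row_mx t%:M (euler (fun x => t *: W x) h j y).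
Proof.
elim: j => [|j IH] //.
rewrite [LHS]/euler iterS -/(euler _ _ _ _) IH [euler _ h j.+1 y]/euler iterS -/(euler _ h j y).
rewrite /estep /rescaled row_mxKl row_mxKr mxE eqxx mulr1n.
by rewrite scale_row_mx add_row_mx scaler0 addr0.
Qed.

Lemma row1_scalar (z : 'rV[R]_(1 + n)) : z = row_mx (lsubmx z 0 0)%:M (rsubmx z).
Proof. by rewrite -mx11_scalar hsubmxK. Qed.

Lemma norm_scalar1 (t : R) : `|t%:M : 'rV[R]_1| = `|t|.
Proof.
apply/eqP; rewrite eq_le; apply/andP; split.
  by apply: mx_norm_le => // i j; rewrite !ord1 mxE eqxx mulr1n.
by have := mx_norm_entry (t%:M : 'rV[R]_1) 0 0; rewrite mxE eqxx mulr1n.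
Qed.

(** By linear growth each step multiplies 1 + |y| by at most 1 + 2^-k |r| C, as the time component
    [t] is bounded by |r| and never changes. *)
Lemma bounded_iter_rescaled : bounded_iter rescaled.
Proof.
move=> r; exists (expR (`|r| * C) * (1 + `|r|)).
  by rewrite mulr_ge0 ?expR_ge0// addr_ge0.
move=> k j z jk zr; rewrite (row1_scalar z).
set t := lsubmx z 0 0; set y := rsubmx z; rewrite euler_rescaled.
have tr : `|t| <= `|r|.
  apply: le_trans (mx_norm_entry _ _ _) (le_trans (norm_lsubmx _) _).
  exact: le_trans zr (ler_norm _).
have yr : `|y| <= `|r| by apply: le_trans (norm_rsubmx _) _; exact: le_trans zr (ler_norm _).
have h0 := pow2_ge0 k.
have e1 : 1 <= expR (`|r| * C) by apply: le_trans (expR_ge1Dx _); rewrite lerDl mulr_ge0.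
apply: norm_row_mx_le.
  by rewrite norm_scalar1; apply: le_trans tr _; apply: (@le_trans _ _ (1 + `|r|)); [rewrite lerDr|rewrite ler_peMl// addr_ge0].
have G i : 1 + `|euler (fun x => t *: W x) (2 ^- k) i y| <= (1 + 2 ^- k * (`|r| * C)) ^+ i * (1 + `|r|).
  elim: i => [|i IH]; first by rewrite expr0 mul1r lerD2l.
  rewrite [euler _ _ i.+1 y]/euler iterS -/(euler _ _ i y) /estep.
  move: IH; set e := euler _ _ i y => IH.
  apply: (@le_trans _ _ ((1 + 2 ^- k * (`|r| * C)) * (1 + `|e|))); last first.
    by rewrite exprS -mulrA ler_wpM2l// addr_ge0// !mulr_ge0.
  rewrite mulrDl mul1r -addrA lerD2l; apply: le_trans (ler_normD _ _) _; rewrite lerD2l.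
  rewrite !normrZ ger0_norm// -!mulrA ler_wpM2l// ler_pM//.
apply: (@le_trans _ _ (1 + `|euler (fun x => t *: W x) (2 ^- k) j y|)); first by rewrite lerDr.
apply: le_trans (G j) _; rewrite ler_wpM2r ?addr_ge0//.
by apply: le_exp_growth => //; [rewrite mulr_ge0|exact: le_pow2_mul].
Qed.

Definition flow (t : R) (y : 'rV[R]_n) : 'rV[R]_n := rsubmx (eflow rescaled (row_mx t%:M y)).

Lemma eflow_rescaled (t : R) y : eflow rescaled (row_mx t%:M y) = row_mx t%:M (flow t y).
Proof.
rewrite -[LHS]hsubmxK -/(flow t y); congr row_mx; apply: esym.
have lT := smooth_lip smooth_rescaled; have bT := bounded_iter_rescaled.
have [D D0 HD] := eulerN_cvg lT bT `|row_mx (t%:M : 'rV[R]_1) y|.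
apply: (eq_pow2_lim D0) => k.
have := le_trans (norm_lsubmx _) (HD k _ (lexx _)).
by rewrite linearB /= /eulerN euler_rescaled row_mxKl.
Qed.

Lemma flow0 y : flow 0 y = y.
Proof.
have lT := smooth_lip smooth_rescaled; have bT := bounded_iter_rescaled.
rewrite /flow; suff <- : row_mx (0%:M : 'rV[R]_1) y = eflow rescaled (row_mx 0%:M y).
  by rewrite row_mxKr.
have [D D0 HD] := eulerN_cvg lT bT `|row_mx (0%:M : 'rV[R]_1) y|.
apply: (eq_pow2_lim D0) => k; have := HD k _ (lexx _).
rewrite /eulerN euler_rescaled.
suff -> : euler (fun x => 0 *: W x) (2 ^- k) (2 ^ k) y = y by [].
elim: (2 ^ k)%N => // j IH; rewrite /euler iterS -/(euler _ _ j y) IH /estep.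
by rewrite scale0r scaler0 addr0.
Qed.

Lemma derive_rescaled (t : R) y (c : R) z :
  'D_(row_mx c%:M z) rescaled (row_mx t%:M y) = row_mx 0 (c *: W y + t *: 'D_z W y).
Proof.
set u := row_mx _ z; set x := row_mx _ y.
have dl := is_diff_linF x (@fdim_mx R 1 (1 + n)) (@linear_lsubmx 1 n).
have dr := is_diff_linF x (@fdim_mx R 1 (1 + n)) (@linear_rsubmx 1 n).
have d1 := is_diff_comp dl (is_diff_linF (lsubmx x) (@fdim_mx R 1 1) (@linear_coord R 1 1 0 0)).
have d2 := is_diff_comp dr (is_diff_der (dW (rsubmx x))).
have d3 := is_diff_scale d1 d2.
rewrite derive_row_mx; [|exact: differentiable_cst|exact: (is_diff_diff d3)].
congr row_mx; first exact: derive_cst.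
apply: etrans (is_diff_derive u d3) _ => /=.
by rewrite /u /x !row_mxKl !row_mxKr !mxE eqxx !mulr1n.
Qed.

(** In these particular directions the tangent flow is explicit: along the orbit the vector stays a
    multiple of [W], with a coefficient growing from b to c + b over unit time. Taking (c, b) = (1,
    0) gives the flow equation, and (0, 1) the invariance of [W] under its flow. *)
Lemma derive_eflow_rescaled (t c b : R) y :
  'D_(row_mx c%:M (b *: W y)) (eflow rescaled) (row_mx t%:M y) =
  row_mx c%:M ((c + b) *: W (flow t y)).
Proof.
have sT := smooth_rescaled; have lT := smooth_lip sT; have bT := bounded_iter_rescaled.
set z := row_mx t%:M y; set eta := row_mx c%:M _.
rewrite (is_diff_derive _ (is_diff_eflow sT z bT)).
suff <- : row_mx (eflow rescaled z) (row_mx c%:M ((c + b) *: W (flow t y))) =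
    eflow (tfield rescaled) (row_mx z eta) by rewrite row_mxKr.
have [B B0 HB] := bT `|z|.
pose ye k j := euler (fun x => t *: W x) (2 ^- k) j y.
(* The guessed coefficient of [W] at time j 2^-k. *)
pose a k j := 2 ^- k * j%:R * c + b : R.
have yB k j : (j <= 2 ^ k)%N -> `|ye k j| <= B.
  move=> jk; have := HB k j z jk (lexx _); rewrite euler_rescaled; apply: le_trans.
  by rewrite -{1}(row_mxKr (t%:M : 'rV[R]_1) (ye k j)); exact: norm_rsubmx.
have aB k j : (j <= 2 ^ k)%N -> `|a k j| <= `|c| + `|b|.
  move=> jk; apply: le_trans (ler_normD _ _) _; rewrite lerD2r normrM ler_piMl// ger0_norm ?mulr_ge0 ?pow2_ge0//.
  exact: le_pow2_mul.
have [M M0 HM] := taylor2 sW B.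
have [D D0 HD] := derive_bound_ball sW B.
have [E E0 HE] := lip_ball_bounded (smooth_lip sW) B.
have [L L0 HL] := smooth_lip sW (Num.max B `|flow t y|).
have [G G0 HG] := eulerN_cvg lT bT `|z|.
pose w k j := row_mx (row_mx (t%:M : 'rV[R]_1) (ye k j)) (row_mx (c%:M : 'rV[R]_1) (a k j *: W (ye k j))).
have yS k j : ye k j.+1 = ye k j + (2 ^- k * t) *: W (ye k j).
  by rewrite /ye /euler iterS /estep scalerA.
apply: (@eflow_approx _ (tfield rescaled) _ _ _ _ w
   (Num.max B (Num.max `|t| (Num.max `|c| ((`|c| + `|b|) * E))))
   ((`|c| + `|b|) * (M * (`|t| * E) ^+ 2) + `|c| * `|t| * (D * E))
   (G + `|c + b| * (L * G))).
- exact: smooth_lip (smooth_tfield sT).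
- exact: bounded_iter_tfield.
- by rewrite addr_ge0// !mulr_ge0// ?exprn_ge0 ?mulr_ge0// addr_ge0.
- by rewrite addr_ge0// !mulr_ge0.
- by move=> k; rewrite /w /ye /a mulr0 mul0r add0r.
- move=> k j jk; apply: norm_row_mx_le; apply: norm_row_mx_le.
  + by rewrite norm_scalar1 !le_max lexx orbT.
  + by rewrite !le_max yB.
  + by rewrite norm_scalar1 !le_max lexx !orbT.
  + by rewrite !le_max normrZ ler_pM ?orbT// ?aB// HE// yB.
- move=> k j jk; have h0 := pow2_ge0 k.
  rewrite /w estep_tfield /estep.
  rewrite derive_rescaled /rescaled row_mxKl row_mxKr mxE eqxx mulr1n.
  rewrite !scale_row_mx !add_row_mx !scaler0 !addr0 !opp_row_mx !add_row_mx.
  rewrite scalerA -yS !subrr.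
  have c0 : 0 <= `|c| + `|b| by rewrite addr_ge0.
  set rhs := (X in _ <= X).
  have r0 : 0 <= rhs by rewrite /rhs mulr_ge0 ?exprn_ge0// addr_ge0// !mulr_ge0// ?exprn_ge0 ?mulr_ge0.
  apply: norm_row_mx_le; first by rewrite row_mx0 normr0.
  apply: norm_row_mx_le; first by rewrite normr0.
  have yj := yB k j (ltnW jk); have yj1 := yB k j.+1 jk.
  have aj1 := aB k j.+1 jk.
  have := HM (ye k j) ((2 ^- k * t) *: W (ye k j)) yj; rewrite -yS => /(_ yj1).
  rewrite derive_scalev// derive_scalev// => T2.
  have DW := HD (ye k j) (W (ye k j)) yj; have WE := HE _ yj.
  have aS : a k j.+1 = a k j + 2 ^- k * c by rewrite /a -natr1; ring.
  move: T2 DW WE; set D1 := 'D_(W _) W _; set W0 := W (ye k j); set W1 := W (ye k j.+1) => T2 DW WE.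
  have -> : a k j.+1 *: W1 - (a k j *: W0 + 2 ^- k *: (c *: W0 + t *: (a k j *: D1))) =
    a k j.+1 *: (W1 - W0 - (2 ^- k * t) *: D1) + (2 ^- k * c * (2 ^- k * t)) *: D1.
    rewrite aS; clear; move: (2 ^- k) (a k j) => h a'; mxring.
  apply: le_trans (ler_normD _ _) _; rewrite !normrZ.
  have -> : rhs = (`|c| + `|b|) * (M * (2 ^- k * `|t| * E) ^+ 2) + 2 ^- k * `|c| * (2 ^- k * `|t|) * (D * E).
    by rewrite /rhs; ring.
  apply: lerD; apply: ler_pM => //.
  + apply: le_trans T2 _; rewrite ler_wpM2l// lerXn2r ?nnegrE ?mulr_ge0//.
    by rewrite normrZ normrM ger0_norm// ler_wpM2l// mulr_ge0.
  + by rewrite !(ger0_norm h0).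
  + by apply: le_trans DW _; rewrite ler_wpM2l.
- move=> k; rewrite /w opp_row_mx add_row_mx.
  have := HG k z (lexx _); rewrite /eulerN euler_rescaled -/(ye k _) => HGk.
  have h0 := pow2_ge0 k.
  have yN : `|ye k (2 ^ k)%N - flow t y| <= G * 2 ^- k.
    move: HGk; rewrite eflow_rescaled opp_row_mx add_row_mx subrr; apply: le_trans.
    by rewrite -{1}(row_mxKr (0 : 'rV[R]_1) (_ - _)); exact: norm_rsubmx.
  apply: norm_row_mx_le.
    by apply: le_trans HGk _; rewrite ler_wpM2r// lerDl !mulr_ge0.
  rewrite opp_row_mx add_row_mx subrr; apply: norm_row_mx_le; first by rewrite normr0 mulr_ge0// addr_ge0// !mulr_ge0.
  have -> : a k (2 ^ k)%N = c + b by rewrite /a pow2_mul mul1r.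
  rewrite -scalerBr normrZ mulrDl; apply: ler_wpDl; first by rewrite mulr_ge0.
  rewrite -mulrA ler_wpM2l//.
  apply: le_trans (HL _ _ _ _) _; first by rewrite le_max yB.
    by rewrite le_max lexx orbT.
  by rewrite -mulrA ler_wpM2l.
Qed.

Lemma smooth_flow (V : normedModType R) (O : set V) (t : V -> R) (y : V -> 'rV[R]_n) :
  open O -> smooth_on O t -> smooth_on O y -> smooth_on O (fun x => flow (t x) (y x)).
Proof.
move=> oO st sy; apply: smooth_linmx => //; first exact: linear_rsubmx.
apply: (@smooth_compT _ _ _ (fun x => row_mx (t x)%:M (y x))) => //; last first.
  by apply: smooth_eflow; [exact: smooth_rescaled|exact: bounded_iter_rescaled].
apply: smooth_row_mx => //; apply: smooth_mx => // i j.
by apply: (smooth_on_eq oO _ st) => x _; rewrite !ord1 mxE eqxx mulr1n.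
Qed.

Lemma derive_flow (V : normedModType R) (t : V -> R) (y : V -> 'rV[R]_n) x v (c b : R) :
  differentiable t x -> differentiable y x ->
  'D_v t x = c -> 'D_v y x = b *: W (y x) ->
  'D_v (fun x => flow (t x) (y x)) x = (c + b) *: W (flow (t x) (y x)).
Proof.
move=> dt dy Et Ey.
have sE := smooth_eflow smooth_rescaled bounded_iter_rescaled.
have lsc : linear (fun u : R => u%:M : 'rV[R]_1).
  by move=> k u w; apply/matrixP => i j; rewrite !ord1 !mxE eqxx !mulr1n.
have dt1 := is_diff_comp (is_diff_der dt) (is_diff_linF (t x) (@fdimR R) lsc).
have dz : is_diff x (fun x => row_mx (t x)%:M (y x)) (fun v => row_mx ('D_v t x)%:M ('D_v y x)).
  have l1 : linear (fun u : 'rV[R]_1 => row_mx u (0 : 'rV[R]_n)).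
    by move=> k u w; rewrite scale_row_mx add_row_mx scaler0 addr0.
  have l2 : linear (fun u : 'rV[R]_n => row_mx (0 : 'rV[R]_1) u).
    by move=> k u w; rewrite scale_row_mx add_row_mx scaler0 addr0.
  have e1 := is_diff_comp dt1 (is_diff_linF (t x)%:M (@fdim_mx R 1 1) l1).
  have e2 := is_diff_comp (is_diff_der dy) (is_diff_linF (y x) (@fdim_mx R 1 n) l2).
  have := is_diff_addf e1 e2.
  rewrite (_ : (fun y0 => _) = (fun x => row_mx (t x)%:M (y x))); last first.
    by apply/funext => u /=; rewrite add_row_mx addr0 add0r.
  rewrite [X in is_diff _ _ X](_ : _ = (fun v => row_mx ('D_v t x)%:M ('D_v y x)))//.
  by apply/funext => u /=; rewrite add_row_mx addr0 add0r.
have dE := smooth_on_diff sE (I : setT (row_mx (t x)%:M (y x))).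
have dd := is_diff_comp dz (is_diff_der dE).
have := is_diff_comp dd (is_diff_linF _ (@fdim_mx R 1 (1 + n)) (@linear_rsubmx 1 n)).
move=> H; rewrite (is_diff_derive _ H) /= Et Ey derive_eflow_rescaled row_mxKr.
by [].
Qed.

End Flow.
End Euler.

(** * Cut-off functions *)

Section Bump.
Context {R : realType}.

Lemma is_derive_diff (f : R -> R) (x d : R) : is_derive x 1 f d ->
  is_diff x f (fun v : R => v * d).
Proof.
move=> H; have df : differentiable f x by apply/derivable1_diffP.
have -> : (fun v : R => v * d) = (fun v : R => 'D_v f x).
  apply/funext => v; rewrite -[v in RHS]mulr1 (derive_scalev v (1 : R) df).
  by rewrite derive_val.
exact: is_diff_der.
Qed.

Lemma is_diff_expR (x : R) : is_diff x expR (fun v : R => v * expR x).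
Proof. by apply: is_derive_diff; exact: is_derive_expR. Qed.

Lemma smooth_expR : smooth_on [set: R] (@expR R).
Proof.
have oT : open [set: R] by exact: openT.
have H : forall k : R -> R, (exists c : R, k = fun y => c * expR y) -> smooth_on [set: R] k.
  apply: smooth_coind => //.
    move=> _ [c ->] x _.
    exact: (is_diff_diff (is_diff_scale (is_diff_cst c x) (is_diff_expR x))).
  move=> _ v [c ->]; exists (fun y => (c * v) * expR y); split; first by exists (c * v).
  move=> x _; apply: etrans (is_diff_derive v (is_diff_scale (is_diff_cst c x) (is_diff_expR x))) _.
  by rewrite scale0r add0r /GRing.scale /= mulrA.
by apply: H; exists 1; apply/funext => y; rewrite mul1r.
Qed.

Lemma smooth_ln : smooth_on [set x : R | 0 < x] (@ln R).
Proof.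
have o0 : open [set x : R | 0 < x] by exact: open_gt.
have dln (x : R) : 0 < x -> is_diff x (@ln R) (fun v : R => v * x^-1).
  by move=> x0; apply: is_derive_diff; exact: is_derive1_ln.
have si : smooth_on [set x : R | 0 < x] (fun x : R => x^-1).
  by apply: smooth_on_sub (@smooth_invr R) => x /= x0; rewrite gt_eqF.
apply: (smooth_coind o0 (S := fun f => f = @ln R \/ smooth_on [set x : R | 0 < x] f)).
- move=> f [->|sf] x x0; first exact: is_diff_diff (dln x x0).
  exact: smooth_on_diff sf x0.
- move=> f v [->|sf].
    exists (fun x => v * x^-1); split.
      right; apply: smooth_mul => //; exact: smooth_cst.
    by move=> x x0; rewrite (is_diff_derive _ (dln x x0)).
  by exists (fun x => 'D_v f x); split => //; right; exact: smooth_on_D.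
- by left.
Qed.

(** The factor x^-n makes the family stable under differentiation up to linear combinations, which
    is the form required by [smooth_coind]. *)
Definition flat_fun n (x : R) : R := if 0 < x then x ^- n * expR (- x^-1) else 0.

(** The exponential series gives (1/x)^(n+2) <= (n+2)! e^(1/x). The resulting quadratic bound
    provides the vanishing derivative at 0. *)
Lemma flat_fun_le n (x : R) : `|flat_fun n x| <= (n.+2)`!%:R * x ^+ 2.
Proof.
rewrite /flat_fun; case: ltP => x0; last by rewrite normr0 mulr_ge0// exprn_even_ge0.
have xi : 0 < x^-1 by rewrite invr_gt0.
have xn : 0 < x ^- n by rewrite invr_gt0 exprn_gt0.
rewrite ger0_norm ?mulr_ge0 ?expR_ge0 ?(ltW xn)//.
rewrite expRN ler_pdivrMr ?expR_gt0// -[leLHS]mulr1 ler_pdivrMl ?exprn_gt0//.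
have f0 : 0 < (n.+2)`!%:R :> R by rewrite ltr0n fact_gt0.
have h := expR_ge1Dxn n.+1 (ltW xi).
have {}h : (x^-1) ^+ n.+2 <= (n.+2)`!%:R * expR x^-1.
  rewrite -ler_pdivrMl// mulrC; apply: le_trans h; by rewrite lerDr.
apply: (@le_trans _ _ (x ^+ n.+2 * ((n.+2)`!%:R * expR x^-1))).
  by rewrite -ler_pdivrMl ?exprn_gt0// mulr1 -exprVn.
by rewrite le_eqVlt; apply/orP; left; apply/eqP; rewrite !exprS expr0; ring.
Qed.

Lemma is_diff_flat n (x : R) :
  is_diff x (flat_fun n) (fun v => v * (flat_fun n.+2 x - n%:R * flat_fun n.+1 x)).
Proof.
have [x0|x0|x0] := ltrgt0P x.
- rewrite /flat_fun x0.
  apply: (@is_diff_near _ _ _ (fun y : R => y ^- n * expR (- y^-1))).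
    apply: (norm_nbhs x0) => y; rewrite ltr_norml => /andP[h _].
    by case: ltP => // y0; move: h; rewrite ltrBrDr; lra.
  have xn0 : x != 0 by rewrite gt_eqF.
  have d1 := is_diffN (is_diff_invX 1 xn0).
  have d2 := is_diff_comp d1 (is_diff_expR (- x^-1)).
  have := is_diff_scale (is_diff_invX n xn0) d2.
  rewrite [X in is_diff _ _ X -> _](_ : _ = (fun v : R => v * (x ^- n.+2 * expR (- x^-1) - n%:R * (x ^- n.+1 * expR (- x^-1)))))//.
  apply/funext => v.
  transitivity (- n%:R * v * x ^- n.+1 * expR (- x^-1) + x ^- n * (- (- 1%:R * v * x ^- 2) * expR (- x^-1))) => //.
  by rewrite !exprS expr0; field; rewrite expf_neq0.
- have -> : (fun v : R => v * (flat_fun n.+2 x - n%:R * flat_fun n.+1 x)) = cst 0.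
    by apply/funext => v; rewrite /flat_fun ltNge (ltW x0) /= mulr0 subr0 mulr0.
  apply: (@is_diff_near _ _ _ (cst 0)).
    have x0' : 0 < - x by rewrite oppr_gt0.
    apply: (norm_nbhs x0') => y; rewrite ltr_norml => /andP[_ h].
    by rewrite /flat_fun; case: ltP => // y0; move: h; lra.
- rewrite x0.
  have -> : (fun v : R => v * (flat_fun n.+2 0 - n%:R * flat_fun n.+1 0)) = (\0 : {linear R -> R}).
    by apply/funext => v; rewrite /flat_fun ltxx mulr0 subr0 mulr0.
  apply: is_diff_eps; first by move=> y; exact: cvg_cst.
  move=> e e0; have f0 : 0 < (n.+2)`!%:R :> R by rewrite ltr0n fact_gt0.
  apply: (norm_nbhs (divr_gt0 e0 f0)) => h; rewrite subr0 ltr_pdivlMr// => he.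
  rewrite addr0 [flat_fun n 0]/flat_fun ltxx !subr0.
  apply: le_trans (flat_fun_le n h) _; rewrite -real_normK ?num_real// expr2 mulrA ler_wpM2r// mulrC.
  exact: ltW.
Qed.

Inductive flat_span : (R -> R) -> Prop :=
| FlatSpan0 : flat_span (fun=> 0)
| FlatSpanS (c : R) n h : flat_span h -> flat_span (fun x => c * flat_fun n x + h x).

Lemma smooth_flat n : smooth_on [set: R] (flat_fun n).
Proof.
have oT : open [set: R] by exact: openT.
have dS (f : R -> R) x : flat_span f -> differentiable f x.
  elim=> [|c k h Sh IH]; first exact: differentiable_cst.
  exact: (is_diff_diff (is_diff_addf (is_diff_scale (is_diff_cst c x) (is_diff_flat k x)) (is_diff_der IH))).
have H : forall f, flat_span f -> smooth_on [set: R] f.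
  apply: smooth_coind => //; first by move=> f Sf x _; exact: dS.
  move=> f v; elim=> [|c k h Sh [g [Sg Eg]]].
    by exists (fun=> 0); split; [exact: FlatSpan0|move=> x _; exact: derive_cst].
  exists (fun x => (c * v) * flat_fun k.+2 x + ((- c * v * k%:R) * flat_fun k.+1 x + g x)); split.
    by do 2 apply: FlatSpanS.
  move=> x _; apply: etrans (is_diff_derive v (is_diff_addf (is_diff_scale (is_diff_cst c x) (is_diff_flat k x)) (is_diff_der (dS _ _ Sh)))) _.
  by rewrite scale0r add0r Eg// /GRing.scale /=; ring.
have := H _ (FlatSpanS 1 n FlatSpan0).
by congr (smooth_on _ _); apply/funext => x; rewrite mul1r addr0.
Qed.

Definition step_fun (x : R) : R := flat_fun 0 x / (flat_fun 0 x + flat_fun 0 (1 - x)).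

Lemma flat0_ge0 (x : R) : 0 <= flat_fun 0 x.
Proof. by rewrite /flat_fun; case: ifP => // _; rewrite mulr_ge0 ?expR_ge0// invr_ge0. Qed.

Lemma flat0_gt0 (x : R) : 0 < x -> 0 < flat_fun 0 x.
Proof. by move=> x0; rewrite /flat_fun x0 mulr_gt0 ?expR_gt0// invr_gt0. Qed.

Lemma flat0_eq0 (x : R) : x <= 0 -> flat_fun 0 x = 0.
Proof. by move=> x0; rewrite /flat_fun ltNge x0. Qed.

Lemma step_den_gt0 (x : R) : 0 < flat_fun 0 x + flat_fun 0 (1 - x).
Proof.
have [x0|x0] := ltP 0 x; first by rewrite ltr_wpDr ?flat0_ge0// flat0_gt0.
rewrite ltr_wpDl ?flat0_ge0// flat0_gt0//; lra.
Qed.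

Lemma smooth_step : smooth_on [set: R] step_fun.
Proof.
have oT : open [set: R] by exact: openT.
have s1 : smooth_on [set: R] (fun x => flat_fun 0 (1 - x)).
  apply: (@smooth_comp _ _ _ _ setT setT (fun x : R => 1 - x) (flat_fun 0)) => //; first exact: fdimR.
    apply: smooth_sub => //; first exact: smooth_cst.
    by apply: smooth_linF => //; exact: fdimR.
  exact: smooth_flat.
apply: smooth_mul => //; first exact: smooth_flat.
apply: smooth_inv => //; first by apply: smooth_add => //; exact: smooth_flat.
by move=> x _; rewrite gt_eqF// step_den_gt0.
Qed.

Lemma step_fun01 x : 0 <= step_fun x <= 1.
Proof.
apply/andP; split; first by rewrite divr_ge0 ?flat0_ge0// ltW// step_den_gt0.
by rewrite ler_pdivrMr ?step_den_gt0// mul1r lerDl flat0_ge0.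
Qed.

Lemma step_fun0 (x : R) : x <= 0 -> step_fun x = 0.
Proof. by move=> x0; rewrite /step_fun flat0_eq0// mul0r. Qed.

Lemma step_fun1 (x : R) : 1 <= x -> step_fun x = 1.
Proof.
move=> x1; rewrite /step_fun (flat0_eq0 (x := 1 - x)); last by lra.
by rewrite addr0 divff// gt_eqF// flat0_gt0//; lra.
Qed.

Definition bump1 (x : R) : R := step_fun (2 - x) * step_fun (2 + x).

Lemma smooth_bump1 : smooth_on [set: R] bump1.
Proof.
have oT : open [set: R] by exact: openT.
have sid : smooth_on [set: R] (id : R -> R) by apply: smooth_linF => //; exact: fdimR.
have s2 : smooth_on [set: R] (fun=> (2 : R)) by exact: smooth_cst.
apply: smooth_mul => //.
  apply: (@smooth_comp _ _ _ _ setT setT (fun x : R => 2 - x)) => //; [exact: fdimR|exact: smooth_sub|exact: smooth_step].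
apply: (@smooth_comp _ _ _ _ setT setT (fun x : R => 2 + x)) => //; [exact: fdimR|exact: smooth_add|exact: smooth_step].
Qed.

Lemma bump1_1 (x : R) : `|x| <= 1 -> bump1 x = 1.
Proof. by rewrite ler_norml => /andP[? ?]; rewrite /bump1 !step_fun1 ?mulr1//; lra. Qed.

Lemma bump1_0 (x : R) : 2 <= `|x| -> bump1 x = 0.
Proof.
rewrite ler_normr => /orP[h|h]; rewrite /bump1.
  by rewrite step_fun0 ?mul0r//; lra.
by rewrite [step_fun (2 + x)]step_fun0 ?mulr0//; lra.
Qed.

Lemma bump1_01 x : 0 <= bump1 x <= 1.
Proof.
rewrite /bump1; have /andP[a b] := step_fun01 (2 - x); have /andP[c d] := step_fun01 (2 + x).
by apply/andP; split; [rewrite mulr_ge0|rewrite mulr_ile1].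
Qed.

Lemma smooth_bump_comp (V : normedModType R) (O : set V) (f : V -> R) : open O ->
  smooth_on O f -> smooth_on O (fun x => bump1 (f x)).
Proof.
move=> oO sf; apply: (@smooth_comp _ _ _ _ O setT f bump1) => //; first exact: fdimR.
  exact: openT.
exact: smooth_bump1.
Qed.

(** A product over the coordinates, in accordance with the maximum norm on row vectors. *)
Definition bump n (r : R) (y : 'rV[R]_n) : R := \prod_i bump1 (y 0 i / r).

Lemma smooth_bump n r (O : set 'rV[R]_n) : open O -> smooth_on O (@bump n r).
Proof.
move=> oO; apply: smooth_prod => // i; apply: smooth_bump_comp => //.
apply: smooth_mul => //; last exact: smooth_cst.
by apply: smooth_linF => //; [exact: fdim_mx|exact: linear_coord].
Qed.

Lemma bump_1 n r (y : 'rV[R]_n) : 0 < r -> `|y| <= r -> bump r y = 1.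
Proof.
move=> r0 yr; apply: big1 => i _; apply: bump1_1.
rewrite normrM normfV (gtr0_norm r0) ler_pdivrMr// mul1r.
exact: le_trans (mx_norm_entry _ _ _) yr.
Qed.

Lemma bump_0 n r (y : 'rV[R]_n) : 0 < r -> 2 * r <= `|y| -> bump r y = 0.
Proof.
move=> r0 yr; have [i yi] : exists i, 2 * r <= `|y 0 i|.
  apply: contrapT => /forallNP H.
  have ri : forall i, `|y 0 i| < 2 * r by move=> i; rewrite ltNge; apply/negP/H.
  suff : `|y| < 2 * r by rewrite ltNge yr.
  rewrite [ltLHS]/Num.Def.normr /= mx_normrE.
  by apply: bigmax_lt => [|[p q] _]; [rewrite mulr_gt0|rewrite /= ord1].
rewrite /bump (bigD1 i)//= bump1_0 ?mul0r//.
by rewrite normrM normfV (gtr0_norm r0) ler_pdivlMr.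
Qed.

(* The identity on the ball of radius [r]; composition with it extends maps defined near that
   ball to the whole space. *)
Definition retract n (r : R) (y : 'rV[R]_n) : 'rV[R]_n := \row_i (bump1 (y 0 i / r) * y 0 i).

Lemma smooth_retract n r : smooth_on setT (@retract n r).
Proof.
have oT : open [set: 'rV[R]_n] by exact: openT.
apply: smooth_mx => // i j.
have sc : smooth_on setT (fun y : 'rV[R]_n => y 0 j).
  by apply: smooth_linF => //; [exact: fdim_mx|exact: linear_coord].
apply: (@smooth_on_eq _ _ _ _ (fun y : 'rV[R]_n => bump1 (y 0 j / r) * y 0 j)) => //.
  by move=> y _; rewrite mxE.
apply: smooth_mul => //; apply: smooth_bump_comp => //; apply: smooth_mul => //; exact: smooth_cst.
Qed.

Lemma retract_id n r (y : 'rV[R]_n) : 0 < r -> `|y| <= r -> retract r y = y.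
Proof.
move=> r0 yr; apply/rowP => i; rewrite mxE bump1_1 ?mul1r//.
rewrite normrM normfV (gtr0_norm r0) ler_pdivrMr// mul1r.
exact: le_trans (mx_norm_entry _ _ _) yr.
Qed.

Lemma retract_le n r (y : 'rV[R]_n) : 0 < r -> `|retract r y| <= 2 * r.
Proof.
move=> r0; apply: mx_norm_le; first by rewrite mulr_ge0// ltW.
move=> i j; rewrite mxE normrM.
have [h|/ltW h] := leP (2 * r) `|y 0 j|.
  rewrite bump1_0 ?normr0 ?mul0r ?mulr_ge0 ?(ltW r0)//.
  by rewrite normrM normfV (gtr0_norm r0) ler_pdivlMr.
have /andP[a b] := bump1_01 (y 0 j / r).
by rewrite (ger0_norm a); apply: le_trans h; rewrite ler_piMl.
Qed.

End Bump.

(** * Flow boxes *)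

Section FlowBox.
Context {R : realType}.

Lemma derive_zero_const m (f : R -> 'rV[R]_m) :
  (forall t, differentiable f t) -> (forall t : R, 'D_1 f t = 0) -> forall t, f t = f 0.
Proof.
move=> df d0 t; apply/eqP; rewrite -subr_eq0 -normr_le0 -{1}[t]add0r.
apply: mvt_norm => // s s01.
have -> : 'D_t f (0 + s *: t) = t *: 'D_1 f (0 + s *: t) by rewrite -derive_scalev// [t *: 1]mulr1.
by rewrite d0 scaler0 normr0.
Qed.

Lemma open_setT (V : normedModType R) : open [set: V]. Proof. exact: openT. Qed.
Hint Resolve open_setT : core.

Lemma smooth_idR : smooth_on [set: R] (id : R -> R).
Proof. by apply: smooth_linF => //; exact: fdimR. Qed.

Lemma linear_scalar1 : linear (fun u : R => u%:M : 'rV[R]_1).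
Proof. by move=> k u w; apply/matrixP => i j; rewrite !ord1 !mxE eqxx !mulr1n. Qed.

Lemma smooth_scalar_mx (V : normedModType R) (O : set V) (f : V -> R) : open O ->
  smooth_on O f -> smooth_on O (fun x => (f x)%:M : 'rV[R]_1).
Proof.
move=> oO; apply: (@smooth_comp_lin _ _ _ _ _ (fun u : R => u%:M : 'rV[R]_1)) => //.
  exact: fdimR.
exact: linear_scalar1.
Qed.

Lemma derive_scalar_mx (V : normedModType R) (f : V -> R) (x v : V) : differentiable f x ->
  'D_v (fun x => (f x)%:M : 'rV[R]_1) x = ('D_v f x)%:M.
Proof.
move=> df; apply: (@derive_comp_lin _ _ _ _ (fun u : R => u%:M : 'rV[R]_1)) => //.
  exact: fdimR.
exact: linear_scalar1.
Qed.

Lemma derive_idR (t : R) : 'D_1 (id : R -> R) t = 1.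
Proof. exact: derive_id. Qed.

Lemma derive_oppf (V W : normedModType R) (f : V -> W) x v : differentiable f x ->
  'D_v (fun y => - f y) x = - 'D_v f x.
Proof. by move=> df; apply: deriveN; exact: diff_derivable. Qed.

Lemma derive_subf (V W : normedModType R) (f g : V -> W) x v : differentiable f x ->
  differentiable g x -> 'D_v (fun y => f y - g y) x = 'D_v f x - 'D_v g x.
Proof. by move=> df dg; apply: deriveB; exact: diff_derivable. Qed.

Lemma derive_addf (V W : normedModType R) (f g : V -> W) x v : differentiable f x ->
  differentiable g x -> 'D_v (fun y => f y + g y) x = 'D_v f x + 'D_v g x.
Proof. by move=> df dg; apply: deriveD; exact: diff_derivable. Qed.

Lemma derive_oppR (s : R) : 'D_1 (fun t : R => - t) s = -1.
Proof.
have := @derive_oppf _ _ (id : R -> R) s 1 (is_diff_diff (is_diff_id s)).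
by rewrite derive_idR.
Qed.

Section Group.
Variables (n : nat) (W : 'rV[R]_n -> 'rV[R]_n) (C : R).
Hypotheses (sW : smooth_on setT W) (C0 : 0 <= C).
Hypothesis gW : forall y, `|W y| <= C * (1 + `|y|).

Lemma derive_flow_time (t : R) y : 'D_1 (fun t => flow W t y) t = W (flow W t y).
Proof.
have := @derive_flow R n W C sW C0 gW _ id (cst y) t 1 1 0 _ _ (derive_idR t).
rewrite addr0 scale1r scale0r; apply.
- exact: (is_diff_diff (is_diff_id t)).
- exact: differentiable_cst.
- exact: derive_cst.
Qed.

Lemma smooth_flow_time y : smooth_on [set: R] (fun t => flow W t y).
Proof.
by apply: (smooth_flow sW C0 gW) => //; [exact: smooth_idR|exact: smooth_cst].
Qed.

Lemma flow_time_comp m (f : 'rV[R]_n -> 'rV[R]_m) y (t : R) : smooth_on setT f ->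
  'D_1 (fun t => f (flow W t y)) t = 'D_(W (flow W t y)) f (flow W t y).
Proof.
move=> sf; rewrite (@derive_comp _ _ _ _ (fun t => flow W t y) f).
- by rewrite derive_flow_time.
- exact: smooth_on_diff (smooth_flow_time y) _.
- exact: smooth_on_diff sf _.
Qed.

(** As a function of [t] the left-hand side has derivative (1 - 1) [W] = 0 by [derive_flow], and its
    value at 0 is [y]. *)
Lemma flowK t y : flow W t (flow W (- t) y) = y.
Proof.
have sN : smooth_on [set: R] (fun t : R => - t) by apply: smooth_opp => //; exact: smooth_idR.
have sy : smooth_on [set: R] (fun t => flow W (- t) y).
  by apply: (smooth_flow sW C0 gW) => //; exact: smooth_cst.
have DN (s : R) : 'D_1 (fun t : R => - t) s = -1.
  exact: derive_oppR.
have Dy (s : R) : 'D_1 (fun t => flow W (- t) y) s = -1 *: W (flow W (- s) y).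
  rewrite (@derive_flow R n W C sW C0 gW _ (fun t => - t) (cst y) s 1 (-1) 0) ?addr0//.
  by rewrite scale0r; exact: derive_cst.
rewrite (@derive_zero_const n (fun t => flow W t (flow W (- t) y))).
- by rewrite oppr0 !(flow0 sW C0 gW).
- move=> s; apply: smooth_on_diff (I : setT s).
  by apply: (smooth_flow sW C0 gW) => //; exact: smooth_idR.
- move=> s; rewrite (@derive_flow R n W C sW C0 gW _ id (fun t => flow W (- t) y) s 1 1 (-1)).
  + by rewrite subrr scale0r.
  + exact: (is_diff_diff (is_diff_id s)).
  + exact: smooth_on_diff sy _.
  + exact: derive_idR.
  + exact: Dy.
Qed.

Lemma first_integral m (f : 'rV[R]_n -> 'rV[R]_m) y t : smooth_on setT f ->
  (forall y, 'D_(W y) f y = 0) -> f (flow W t y) = f y.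
Proof.
move=> sf Df; rewrite (@derive_zero_const m (fun t => f (flow W t y))).
- by rewrite (flow0 sW C0 gW).
- move=> s; apply: smooth_on_diff (I : setT s).
  by apply: (@smooth_compT _ _ _ _ (fun t => flow W t y) f) => //; exact: smooth_flow_time.
- by move=> s; rewrite flow_time_comp.
Qed.

End Group.

Definition coord0 m (y : 'rV[R]_(1 + m)) : R := lsubmx y 0 0.

Lemma linear_coord0 m : linear (@coord0 m).
Proof. by move=> k u v; rewrite /coord0 linearP !mxE. Qed.

Lemma smooth_coord0 m (V : normedModType R) (O : set V) (f : V -> 'rV[R]_(1 + m)) : open O ->
  smooth_on O f -> smooth_on O (fun x => coord0 (f x)).
Proof. by move=> oO; apply: smooth_comp_lin => //; [exact: fdim_mx|exact: linear_coord0]. Qed.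

Section GlobalBox.
Variables (m : nat) (Z : 'rV[R]_(1 + m) -> 'rV[R]_(1 + m)) (C : R).
Hypotheses (sZ : smooth_on setT Z) (C0 : 0 <= C).
Hypothesis bZ : forall y, `|Z y| <= C.
Hypothesis lZ : forall y, 2^-1 <= coord0 (Z y).

Let c y := (coord0 (Z y))^-1.
Let l0 y : 0 < coord0 (Z y). Proof. by apply: lt_le_trans (lZ y); rewrite invr_gt0. Qed.
Let c0 y : 0 < c y. Proof. by rewrite invr_gt0. Qed.
Let c2 y : c y <= 2. Proof. by rewrite -[leRHS]invrK lef_pV2 ?posrE ?invr_gt0. Qed.
Let sc : smooth_on setT c.
Proof. by apply: smooth_inv => //; [exact: smooth_coord0|move=> y _; rewrite gt_eqF]. Qed.

(* Along the rescaled field the first coordinate grows at unit speed, so the time needed to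
   reach the slice {coord0 = 0} is explicit and no inverse function theorem is needed. *)
Let Y y := c y *: Z y.
(** The additional coordinate is a clock: unit time along [Y] amounts to time [c] along [Z], so
    integrating [c] over an orbit of [Y] measures the time that [Z] takes. *)
Let Y2 (z : 'rV[R]_(1 + m + 1)) : 'rV[R]_(1 + m + 1) := row_mx (Y (lsubmx z)) (c (lsubmx z))%:M.

Let gZ y : `|Z y| <= C * (1 + `|y|).
Proof. by apply: le_trans (bZ y) _; rewrite ler_peMr// lerDl. Qed.

Let bY y : `|Y y| <= 2 * C.
Proof. by rewrite normrZ gtr0_norm// ler_pM// ltW. Qed.

Let sY : smooth_on setT Y. Proof. exact: smooth_scale. Qed.

Let C20 : 0 <= 2 * C. Proof. by rewrite mulr_ge0. Qed.
Let gY y : `|Y y| <= 2 * C * (1 + `|y|).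
Proof. by apply: le_trans (bY y) _; rewrite ler_peMr// lerDl. Qed.

Let C30 : 0 <= Num.max (2 * C) 2. Proof. by rewrite le_max C20. Qed.

Let sl : smooth_on setT (@lsubmx R 1 (1 + m) 1).
Proof. by apply: smooth_linF => //; [exact: fdim_mx|exact: linear_lsubmx]. Qed.
Let sr : smooth_on setT (@rsubmx R 1 (1 + m) 1).
Proof. by apply: smooth_linF => //; [exact: fdim_mx|exact: linear_rsubmx]. Qed.

Let sY2 : smooth_on setT Y2.
Proof.
apply: smooth_row_mx => //; first by apply: (@smooth_compT _ _ _ _ (fun z => lsubmx z) Y).
apply: smooth_scalar_mx => //; exact: (@smooth_compT _ _ _ _ (fun z => lsubmx z) c).
Qed.

Let gY2 z : `|Y2 z| <= Num.max (2 * C) 2 * (1 + `|z|).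
Proof.
apply: (@le_trans _ _ (Num.max (2 * C) 2)); last by rewrite ler_peMr// lerDl.
apply: norm_row_mx_le; first by rewrite le_max bY.
by rewrite norm_scalar1 gtr0_norm// le_max c2 orbT.
Qed.

Let dZ_dY k (f : 'rV[R]_(1 + m) -> 'rV[R]_k) y : smooth_on setT f ->
  'D_(Z y) f y = coord0 (Z y) *: 'D_(Y y) f y.
Proof.
move=> sf; rewrite -derive_scalev; last exact: smooth_on_diff sf _.
by rewrite /Y scalerA mulfV ?scale1r// gt_eqF.
Qed.

Let lamY y : coord0 (Y y) = 1.
Proof. by rewrite /Y /coord0 linearZ /= mxE mulVf// gt_eqF. Qed.

Let phi := flow Z.
Let phiY := flow Y.
Let sid : smooth_on setT (id : 'rV[R]_(1 + m) -> _).
Proof. by apply: smooth_linF => //; exact: fdim_mx. Qed.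
Let slam : smooth_on setT (@coord0 m).
Proof. exact: smooth_coord0 sid. Qed.
Let dlam y v : 'D_v (@coord0 m) y = coord0 v.
Proof. exact: (is_diff_derive v (is_diff_linF y (@fdim_mx R 1 (1 + m)) (@linear_coord0 m))). Qed.

(** The point where the orbit through [y] meets the slice: along [Y] the first coordinate reaches 0
    after time - coord0 y. *)
Let xs y := phiY (- coord0 y) y.
Let sxs : smooth_on setT xs.
Proof. by apply: (smooth_flow sY C20 gY) => //; exact: smooth_opp. Qed.

Let Dxs y : 'D_(Y y) xs y = 0.
Proof.
rewrite /xs (@derive_flow R _ Y _ sY C20 gY _ (fun y => - coord0 y) id y (Y y) (-1) 1) ?addNr ?scale0r//.
- exact: smooth_on_diff (smooth_opp (open_setT _) slam) _.
- by rewrite derive_oppf ?dlam ?lamY//; exact: smooth_on_diff slam _.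
- by rewrite scale1r derive_id.
Qed.

Let lam_phiY t y : coord0 (phiY t y) = coord0 y + t.
Proof.
have sf : smooth_on setT (fun y : 'rV[R]_(1 + m) => (coord0 y)%:M : 'rV[R]_1).
  exact: smooth_scalar_mx.
have st : smooth_on [set: R] (fun t : R => t%:M : 'rV[R]_1).
  by apply: smooth_scalar_mx => //; exact: smooth_idR.
have sg : smooth_on [set: R] (fun t => (coord0 (phiY t y))%:M : 'rV[R]_1).
  apply: (@smooth_compT _ _ _ _ (fun t => phiY t y) (fun y => (coord0 y)%:M : 'rV[R]_1)) => //.
  exact: (smooth_flow_time sY C20 gY).
have := @derive_zero_const 1 (fun t => (coord0 (phiY t y))%:M - t%:M) _ _ t.
rewrite /phiY (flow0 sY C20 gY) => H.
suff : (coord0 (flow Y t y))%:M - t%:M = (coord0 y)%:M - 0%:M :> 'rV[R]_1.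
  by move/matrixP/(_ 0 0); rewrite !mxE !eqxx !mulr1n subr0 => <-; rewrite subrK.
apply: H.
  by move=> s; apply: smooth_on_diff (smooth_sub (open_setT _) sg st) _.
move=> s; have d1 := smooth_on_diff sg (I : setT s); have d2 := smooth_on_diff st (I : setT s).
rewrite derive_subf//.
rewrite (flow_time_comp sY C20 gY _ _ sf) !derive_scalar_mx ?derive_idR; last exact: (is_diff_diff (is_diff_id s)).
  by rewrite dlam lamY subrr.
exact: smooth_on_diff slam _.
Qed.

Let phiY_xs y : phiY (coord0 y) (xs y) = y.
Proof. exact: (flowK sY C20 gY). Qed.

Let lam_xs y : coord0 (xs y) = 0.
Proof. by rewrite /xs lam_phiY subrr. Qed.

Let xs_slice y : coord0 y = 0 -> xs y = y.
Proof. by move=> y0; rewrite /xs y0 oppr0 /phiY (flow0 sY C20 gY). Qed.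

Let phi2 := flow Y2.
(** The first component of [phi2] solves the equation of [Y], so moving it back by [phiY] for the
    same time has derivative zero. This replaces an appeal to uniqueness of solutions. *)
Let lsub_phi2 t z : lsubmx (phi2 t z) = phiY t (lsubmx z).
Proof.
have sp : smooth_on [set: R] (fun t => lsubmx (phi2 t z)).
  by apply: (@smooth_compT _ _ _ _ (fun t => phi2 t z) (@lsubmx R 1 (1 + m) 1)) => //; exact: (smooth_flow_time sY2 C30 gY2).
have Dp (s : R) : 'D_1 (fun t => lsubmx (phi2 t z)) s = 1 *: Y (lsubmx (phi2 s z)).
  rewrite (flow_time_comp sY2 C30 gY2 _ _ sl) scale1r.
  rewrite (is_diff_derive _ (is_diff_linF _ (@fdim_mx R 1 _) (@linear_lsubmx R _ _))).
  by rewrite /Y2 row_mxKl.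
have sN : smooth_on [set: R] (fun t : R => - t) by apply: smooth_opp => //; exact: smooth_idR.
have K s : phiY (- s) (lsubmx (phi2 s z)) = lsubmx z.
  rewrite (@derive_zero_const _ (fun s => phiY (- s) (lsubmx (phi2 s z)))).
  - by rewrite oppr0 /phiY /phi2 (flow0 sY C20 gY) (flow0 sY2 C30 gY2).
  - by move=> u; apply: smooth_on_diff (I : setT u); exact: (smooth_flow sY C20 gY).
  - move=> u; rewrite (@derive_flow R _ Y _ sY C20 gY _ (fun t => - t) _ u 1 (-1) 1) ?addNr ?scale0r//.
    + exact: smooth_on_diff sp _.
    + exact: derive_oppR.
by rewrite -(K t) /phiY (flowK sY C20 gY).
Qed.

(** The time along [Z] from the slice to [y], read off the clock of [Y2]. *)
Let T y := rsubmx (phi2 (coord0 y) (row_mx (xs y) 0)).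
Let sT : smooth_on setT T.
Proof.
apply: (@smooth_compT _ _ _ _ (fun y => phi2 (coord0 y) (row_mx (xs y) 0)) (@rsubmx R 1 (1 + m) 1)) => //.
apply: (smooth_flow sY2 C30 gY2) => //.
by apply: smooth_row_mx => //; exact: smooth_cst.
Qed.

Let DT y : 'D_(Y y) T y = (c y)%:M.
Proof.
have s0 : smooth_on setT (fun y => row_mx (xs y) (0 : 'rV[R]_1)).
  by apply: smooth_row_mx => //; exact: smooth_cst.
have D0 : 'D_(Y y) (fun y => row_mx (xs y) (0 : 'rV[R]_1)) y = 0.
  rewrite derive_row_mx; [|exact: smooth_on_diff sxs _|exact: differentiable_cst].
  rewrite Dxs (_ : 'D_(Y y) _ y = 0) ?row_mx0//; exact: derive_cst.
have sP : smooth_on setT (fun y => phi2 (coord0 y) (row_mx (xs y) 0)).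
  exact: (smooth_flow sY2 C30 gY2).
rewrite (@derive_comp_lin _ _ _ _ (@rsubmx R 1 (1 + m) 1)); [|exact: fdim_mx|exact: linear_rsubmx|exact: smooth_on_diff sP _].
rewrite (@derive_flow R _ Y2 _ sY2 C30 gY2 _ (@coord0 m) _ y (Y y) 1 0).
- rewrite addr0 scale1r /Y2 row_mxKr -/phi2 lsub_phi2 row_mxKl phiY_xs.
  by [].
- exact: smooth_on_diff slam _.
- exact: smooth_on_diff s0 _.
- by rewrite dlam lamY.
- by rewrite D0 scale0r.
Qed.

Let T_slice y : coord0 y = 0 -> T y = 0.
Proof. by move=> y0; rewrite /T y0 /phi2 (flow0 sY2 C30 gY2) row_mxKr. Qed.

Let DZT y : 'D_(Z y) T y = 1%:M.
Proof. by rewrite dZ_dY// DT scale_scalar_mx mulfV// gt_eqF. Qed.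

Let DZxs y : 'D_(Z y) xs y = 0.
Proof. by rewrite dZ_dY// Dxs scaler0. Qed.

Let T_phi t y : coord0 y = 0 -> T (phi t y) = t%:M.
Proof.
move=> y0.
have st : smooth_on [set: R] (fun t : R => t%:M : 'rV[R]_1).
  by apply: smooth_scalar_mx => //; exact: smooth_idR.
have Dt (s : R) : 'D_1 (fun t : R => t%:M : 'rV[R]_1) s = 1%:M.
  by rewrite derive_scalar_mx ?derive_idR//; exact: (is_diff_diff (is_diff_id s)).
have sg : smooth_on [set: R] (fun t => T (phi t y)).
  by apply: (@smooth_compT _ _ _ _ (fun t => phi t y) T) => //; exact: (smooth_flow_time sZ C0 gZ).
have := @derive_zero_const 1 (fun t => T (phi t y) - t%:M) _ _ t.
rewrite /phi (flow0 sZ C0 gZ) (T_slice y0) => H.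
suff : T (flow Z t y) - t%:M = 0 - 0%:M by rewrite (raddf0 (@scalar_mx R 1)) subr0 => /eqP; rewrite subr_eq0 => /eqP.
apply: H; first by move=> s; apply: smooth_on_diff (smooth_sub (open_setT _) sg st) _.
move=> s; have d1 := smooth_on_diff sg (I : setT s); have d2 := smooth_on_diff st (I : setT s).
rewrite derive_subf// Dt.
by rewrite (flow_time_comp sZ C0 gZ _ _ sT) DZT subrr.
Qed.

Let xs_phi t y : coord0 y = 0 -> xs (phi t y) = y.
Proof. by move=> y0; rewrite /phi (first_integral sZ C0 gZ _ _ sxs DZxs) xs_slice. Qed.

(** Moving [y] back by time [T y] along [Z] defines a map [q] that is constant along [Z], hence
    along [Y]. At [xs y], where [T] vanishes, [q] is the identity; thus q y = xs y. *)
Let phi_T_xs y : phi (T y 0 0) (xs y) = y.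
Proof.
pose q y := phi (- T y 0 0) y.
have sT0 : smooth_on setT (fun y => - T y 0 0) by apply: smooth_opp => //; exact: smooth_coord.
have sq : smooth_on setT q by apply: (smooth_flow sZ C0 gZ).
have Dq z : 'D_(Z z) q z = 0.
  rewrite /q (@derive_flow R _ Z _ sZ C0 gZ _ (fun y => - T y 0 0) id z (Z z) (-1) 1) ?addNr ?scale0r//.
  - exact: smooth_on_diff sT0 _.
  - have d1 := smooth_on_diff (smooth_coord 0 0 (open_setT _) sT) (I : setT z).
    rewrite derive_oppf// derive_coord; last exact: smooth_on_diff sT _.
    by rewrite DZT mxE.
  - by rewrite scale1r derive_id.
have DqY z : 'D_(Y z) q z = 0.
  have := Dq z; rewrite dZ_dY// => /eqP; rewrite scaler_eq0 gt_eqF//= => /eqP ->.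
  by [].
have qx : q y = xs y.
  rewrite -{1}(phiY_xs y) /phiY (first_integral sY C20 gY _ _ sq DqY) /q.
  by rewrite T_slice// mxE oppr0 /phi (flow0 sZ C0 gZ).
by rewrite -qx /q /phi (flowK sZ C0 gZ).
Qed.

Lemma global_flow_box : exists (psi chi : 'rV[R]_(1 + m) -> 'rV[R]_(1 + m)),
  [/\ smooth_on setT psi, smooth_on setT chi, cancel psi chi, cancel chi psi &
      psi 0 = 0 /\ forall z, 'D_(row_mx 1%:M 0) psi z = Z (psi z)].
Proof.
have srm : smooth_on setT (@rsubmx R 1 1 m).
  by apply: smooth_linF => //; [exact: fdim_mx|exact: linear_rsubmx].
have ss : smooth_on setT (fun z : 'rV[R]_(1 + m) => row_mx (0 : 'rV[R]_1) (rsubmx z)).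
  by apply: smooth_row_mx => //; exact: smooth_cst.
have s0 (z : 'rV[R]_m) : coord0 (row_mx (0 : 'rV[R]_1) z) = 0 by rewrite /coord0 row_mxKl mxE.
exists (fun z => phi (coord0 z) (row_mx 0 (rsubmx z))), (fun y => row_mx (T y) (rsubmx (xs y))); split.
- exact: (smooth_flow sZ C0 gZ).
- by apply: smooth_row_mx => //; apply: (@smooth_compT _ _ _ _ xs (@rsubmx R 1 1 m)).
- move=> z /=; rewrite T_phi// xs_phi// row_mxKr -[RHS]hsubmxK; congr row_mx.
  by rewrite [RHS]mx11_scalar.
- move=> y /=; rewrite row_mxKr.
  have -> : row_mx 0 (rsubmx (xs y)) = xs y.
    rewrite -[RHS]hsubmxK; congr row_mx; rewrite [RHS]mx11_scalar.
    by have := lam_xs y; rewrite /coord0 => ->; rewrite raddf0.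
  by rewrite /coord0 row_mxKl phi_T_xs.
split; first by rewrite /coord0 !linear0 mxE row_mx0 /phi (flow0 sZ C0 gZ).
move=> z; rewrite (@derive_flow R _ Z _ sZ C0 gZ _ (@coord0 m) _ z _ 1 0).
  + by rewrite addr0 scale1r.
  + exact: smooth_on_diff slam _.
  + exact: smooth_on_diff ss _.
  + by rewrite dlam /coord0 row_mxKl mxE.
  + rewrite scale0r derive_row_mx; [|exact: differentiable_cst|exact: smooth_on_diff srm _].
    rewrite (is_diff_derive _ (is_diff_linF z (@fdim_mx R 1 (1 + m)) (@linear_rsubmx R 1 m))) row_mxKr.
    by rewrite (_ : 'D__ _ z = 0) ?row_mx0//; exact: derive_cst.
Qed.

End GlobalBox.

Lemma smooth_extend n k (O : set 'rV[R]_n) (f : 'rV[R]_n -> 'rV[R]_k) : open O -> O 0 ->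
  smooth_on O f -> exists2 r0 : R, 0 < r0 & forall r : R, 0 < r <= r0 ->
  [/\ forall y, O (retract r y), smooth_on setT (fun y => f (retract r y))
    & exists2 B : R, 0 <= B & forall y, `|f (retract r y)| <= B].
Proof.
move=> oO O0 sf; have [d d0 Hd] := nbhs_norm (open_nbhs_nbhs (conj oO O0)).
have sr r : 0 < r -> r <= d / 3 -> forall y, O (@retract R n r y).
  move=> r0' rd y; apply: Hd; rewrite subr0; apply: le_lt_trans (retract_le _ r0') _; lra.
have sfr r : 0 < r -> r <= d / 3 -> smooth_on setT (fun y => f (retract r y)).
  move=> r0' rd; apply: (@smooth_comp _ _ _ _ setT O (@retract R n r) f) => //.
  - exact: fdim_mx.
  - by move=> y _; exact: sr.
  - exact: smooth_retract.
(* The bound for [f] is obtained with [retract (2 * r)], which is the identity on the ball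
   containing all values of [retract r]. It requires 2 r <= d/3, so that these doubled retractions
   also take values in [O]. *)
exists (d / 6); first by rewrite divr_gt0.
move=> r /andP[r0' rd]; have rd3 : r <= d / 3 by lra.
split; [exact: sr|exact: sfr|].
have r20 : 0 < 2 * r by rewrite mulr_gt0.
have rd6 : 2 * r <= d / 3 by lra.
have [B B0 HB] := cont_bounded_ball (smooth_cont (sfr _ r20 rd6)) (2 * r).
exists B => // y.
by have := HB _ (retract_le y r0'); rewrite [X in f X]retract_id//; exact: retract_le.
Qed.

(** Composing [Z] with [retract r] gives a bounded field on the whole space whose first coordinate
    stays at least 1/2. Both fields agree on the ball of radius [r], so [psi] is a global
    diffeomorphism that straightens the given [Z] where its values lie in this ball. *)
Theorem flow_box m (O : set 'rV[R]_(1 + m)) (Z : 'rV[R]_(1 + m) -> 'rV[R]_(1 + m)) :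
  open O -> O 0 -> smooth_on O Z -> coord0 (Z 0) = 1 ->
  exists (psi chi : 'rV[R]_(1 + m) -> 'rV[R]_(1 + m)) (e : R),
  [/\ smooth_on setT psi, smooth_on setT chi, cancel psi chi, cancel chi psi &
   [/\ psi 0 = 0, 0 < e, forall y, `|y| < e -> O y
     & forall z, `|psi z| < e -> 'D_(row_mx 1%:M 0) psi z = Z (psi z)]].
Proof.
move=> oO O0 sZ Z0.
have cl : continuous (@coord0 m).
  by apply: fdim_lin_cont; [exact: fdim_mx|exact: linear_coord0].
have cZ0 : {for 0, continuous Z} by apply: differentiable_continuous; exact: smooth_on_diff sZ O0.
have c0 : {for 0, continuous (fun y => coord0 (Z y))}.
  by apply: continuous_comp => //; exact: cl.
have [d d0 Hd] : exists2 d : R, 0 < d & forall y, `|y - 0| < d -> O y /\ 2^-1 <= coord0 (Z y).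
  apply: nbhs_norm; apply: filterI; first exact: open_nbhs_nbhs.
  have h2 : (0 : R) < 2^-1 by rewrite invr_gt0.
  move/cvgrPdist_lt : c0 => /(_ _ h2); apply: filterS => y /=; rewrite Z0.
  by rewrite ltr_norml => /andP[_ h]; lra.
have [r0 r00 Hr] := smooth_extend oO O0 sZ.
pose r := Num.min r0 (d / 3).
have rp : 0 < r by rewrite lt_min r00 divr_gt0.
have rr0 : 0 < r <= r0 by rewrite rp ge_min lexx.
have [rO sZr [B B0 HB]] := Hr r rr0.
have lZ y : 2^-1 <= coord0 (Z (retract r y)).
  apply: (Hd _ _).2; rewrite subr0; apply: le_lt_trans (retract_le _ rp) _.
  have : r <= d / 3 by rewrite ge_min lexx orbT.
  by move=> h; lra.
have [psi [chi [s1 s2 k1 k2 [p0 D]]]] := global_flow_box sZr B0 HB lZ.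
exists psi, chi, r; split => //; split => //.
- move=> y yr; apply: (Hd _ _).1; rewrite subr0; apply: lt_le_trans yr _.
  by rewrite ge_min; apply/orP; right; lra.
- by move=> z zr; rewrite D retract_id// ltW.
Qed.

End FlowBox.

(** * Manifolds and tangent maps *)

Section Germs.
Context {R : realType}.
Implicit Types V W : normedModType R.

Lemma near_open (T : topologicalType) (x : T) (P : set T) : (\forall y \near x, P y) ->
  exists U : set T, [/\ open U, U x & forall y, U y -> P y].
Proof. by rewrite -[X in X -> _]/(nbhs x P) nbhsE => -[U [oU Ux] UP]; exists U. Qed.

Lemma smooth_near_on V W (O : set V) (f : V -> W) x : open O -> O x -> smooth_on O f ->
  smooth_near x f.
Proof. by move=> *; exists O. Qed.

Lemma smooth_near_near V W (f : V -> W) x : smooth_near x f -> \forall y \near x, smooth_near y f.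
Proof.
move=> [A [oA Ax sf]]; apply: filterS (open_nbhs_nbhs (conj oA Ax)) => y Ay.
by exists A.
Qed.

Lemma smooth_near_diff V W (f : V -> W) x : smooth_near x f -> differentiable f x.
Proof. by move=> [A [oA Ax sf]]; exact: smooth_on_diff sf Ax. Qed.

Lemma smooth_near_cont V W (f : V -> W) x : smooth_near x f -> {for x, continuous f}.
Proof. by move=> /smooth_near_diff; exact: differentiable_continuous. Qed.

Lemma smooth_near_eq V W (f g : V -> W) x : (\forall y \near x, f y = g y) ->
  smooth_near x f -> smooth_near x g.
Proof.
move=> /near_open [U [oU Ux fg]] [A [oA Ax sf]]; exists (A `&` U); split; [exact: openI|by []|].
apply: (@smooth_on_eq _ _ _ _ f); first exact: openI.
  by move=> y [_ Uy]; exact: fg.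
by apply: smooth_on_sub sf => y [].
Qed.

Lemma smooth_near_D V W (f : V -> W) x v : smooth_near x f -> smooth_near x (fun y => 'D_v f y).
Proof. by move=> [A [oA Ax sf]]; exists A; split => //; exact: smooth_on_D. Qed.

Lemma smooth_near_comp V V' W (f : V -> V') (g : V' -> W) x : fdim V' ->
  smooth_near x f -> smooth_near (f x) g -> smooth_near x (fun y => g (f y)).
Proof.
move=> fV [A [oA Ax sf]] [A' [oA' Afx sg]].
have : \forall y \near x, A' (f y).
  apply: (smooth_near_cont (x := x)); first by exists A.
  exact: open_nbhs_nbhs.
move=> /near_open [U [oU Ux fg]].
exists (A `&` U); split; [exact: openI|by []|].
apply: (@smooth_comp _ _ _ _ (A `&` U) A' f g) => //; first exact: openI.
  by move=> y [_]; exact: fg.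
by apply: smooth_on_sub sf => y [].
Qed.

Lemma smooth_near2 V W1 W2 W3 (f : V -> W1) (g : V -> W2) (h : V -> W3) x :
  (forall O, open O -> smooth_on O f -> smooth_on O g -> smooth_on O h) ->
  smooth_near x f -> smooth_near x g -> smooth_near x h.
Proof.
move=> H [A [oA Ax sf]] [A' [oA' Afx sg]]; exists (A `&` A'); split; [exact: openI|by []|].
apply: H; [exact: openI|apply: smooth_on_sub sf|apply: smooth_on_sub sg]; by move=> y [].
Qed.

Lemma smooth_near1 V W1 W3 (f : V -> W1) (h : V -> W3) x :
  (forall O, open O -> smooth_on O f -> smooth_on O h) ->
  smooth_near x f -> smooth_near x h.
Proof. by move=> H [A [oA Ax sf]]; exists A; split => //; exact: H. Qed.

Lemma smooth_near_cst V W (a : W) (x : V) : smooth_near x (fun=> a).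
Proof. by exists setT; split => //; [exact: openT|apply: smooth_cst; exact: openT]. Qed.

Lemma smooth_near_lin V W (f : V -> W) (x : V) : fdim V -> linear f -> smooth_near x f.
Proof. by move=> fV lf; exists setT; split => //; [exact: openT|apply: smooth_linF => //; exact: openT]. Qed.

Lemma smooth_near_pair V W1 W2 (f : V -> W1) (g : V -> W2) x : fdim W1 -> fdim W2 ->
  smooth_near x f -> smooth_near x g -> smooth_near x (fun y => (f y, g y)).
Proof.
move=> f1 f2; apply: smooth_near2 => O oO sf sg.
have l1 : linear (fun u : W1 => (u, 0 : W2)).
  by move=> k u v; apply: injective_projections => //=; rewrite scaler0 addr0.
have l2 : linear (fun u : W2 => (0 : W1, u)).
  by move=> k u v; apply: injective_projections => //=; rewrite scaler0 addr0.
have s1 := smooth_comp_lin f1 oO l1 sf; have s2 := smooth_comp_lin f2 oO l2 sg.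
apply: (smooth_on_eq oO _ (smooth_add oO s1 s2)) => y _.
by apply: injective_projections => /=; rewrite ?addr0 ?add0r.
Qed.

Lemma derive_near_eq V W (f g : V -> W) x v : (\forall y \near x, f y = g y) -> 'D_v f x = 'D_v g x.
Proof. by move=> H; apply: near_eq_derive. Qed.

End Germs.

(** * Second countability of initial topologies *)

Section SecondCountable.
Context {R : realType}.

(** Combinations of the spanning family with rational coefficients are dense, and [pickle]
    enumerates them. *)
Lemma fdim_dense_seq (V : normedModType R) : fdim V ->
  exists (D : nat -> V), forall x (e : R), 0 < e -> exists i, `|x - D i| < e.
Proof.
move=> [n [e [c [lc Ec]]]].
pose F (q : {ffun 'I_n -> rat}) : V := \sum_i ratr (q i) *: e i.
pose D i := odflt 0 (omap F (unpickle i)).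
exists D => x eps e0.
pose K := \sum_i `|e i| + 1.
have K0 : 0 < K by rewrite /K ltr_wpDl// sumr_ge0.
have H i : exists q : rat, `|c i x - ratr q| < eps / K.
  have h : c i x < c i x + eps / K by rewrite ltrDl divr_gt0.
  have [q] := rat_in_itvoo h; rewrite in_itv /= => /andP[q1 q2]; exists q.
  by rewrite ltr_norml; apply/andP; split; lra.
pose q : {ffun 'I_n -> rat} := [ffun i => sval (cid (H i))].
have qP i : `|c i x - ratr (q i)| < eps / K by rewrite ffunE; case: cid.
exists (pickle q); rewrite /D pickleK /= {1}(Ec x) -sumrB.
apply: le_lt_trans (ler_norm_sum _ _ _) _.
apply: (@le_lt_trans _ _ (eps / K * \sum_i `|e i|)).
  rewrite mulr_sumr; apply: ler_sum => i _; rewrite -scalerBl normrZ ler_wpM2r//.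
  exact/ltW/qP.
rewrite mulrAC ltr_pdivrMr// ltr_pM2l// /K ltrDl; exact: ltr01.
Qed.

(** The last hypothesis says that the topology of [T] is induced by [f]. Preimages of balls with
    centres in a dense sequence and radii 1/(k+1) then form a countable base. *)
Lemma second_countable_initial (T : topologicalType) (V : normedModType R) (f : T -> V) :
  fdim V -> continuous f ->
  (forall (x : T) A, nbhs x A -> exists2 B, nbhs (f x) B & f @^-1` B `<=` A) ->
  @second_countable T.
Proof.
move=> /fdim_dense_seq [D HD] cf Hf.
pose b (p : nat * nat) := f @^-1` (ball (D p.1) (p.2.+1%:R^-1 : R)).
exists (range b); first exact: sub_countable (card_image_le b setT) (countableP setT).
split.
  move=> _ [p _ <-]; apply: open_comp; first by move=> x _; exact: cf.
  exact: ball_open.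
move=> x A /Hf [B /nbhs_ballP [e e0 eB] BA].
pose k := Num.bound (2 / e).
have hk : 2 / e < k.+1%:R.
  apply: lt_trans (_ : k%:R < _); last by rewrite ltr_nat.
  by apply: archi_boundP; rewrite divr_ge0// ltW.
have k0 : 0 < (k.+1%:R : R)^-1 by rewrite invr_gt0.
have [i Hi] := HD (f x) _ k0.
exists (b (i, k)); first by split; [exists (i, k)|rewrite /b /= -ball_normE /= distrC].
move=> y; rewrite /b /= -ball_normE /= => yi; apply/BA/eB.
rewrite -ball_normE /= -[f x](subrK (D i)) -addrA.
apply: le_lt_trans (ler_normD _ _) _.
have : k.+1%:R^-1 < e / 2 by rewrite -[ltRHS]invrK ltf_pV2 ?posrE ?invr_gt0 ?divr_gt0// invf_div.
move=> h; rewrite [ltRHS]splitr; apply: ltrD; [exact: lt_trans Hi h|exact: lt_trans yi h].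
Qed.

End SecondCountable.

(** * Charts, and smooth maps and tangent maps at a point *)

Section Charts.
Context {R : realType} {M : topologicalType} {n : nat}.
Variable c : chart R M n.

Lemma chartK z : cdom c z -> cinv c (cmap c z) = z.
Proof. by move=> cz; apply: (cmapK (c := c)); rewrite inE. Qed.

Lemma chart_img z : cdom c z -> (cmap c @` cdom c) (cmap c z).
Proof. by move=> cz; exists z. Qed.

Lemma chart_imgV y : (cmap c @` cdom c) y -> cdom c (cinv c y) /\ cmap c (cinv c y) = y.
Proof. by move=> [z cz <-]; rewrite chartK. Qed.

Lemma chart_cont z : cdom c z -> {for z, continuous (cmap c)}.
Proof.
move=> cz; have := @cmap_cont _ _ _ c.
rewrite continuous_open_subspace; last exact: cdom_open.
by apply; rewrite inE.
Qed.

Lemma chart_icont z : cdom c z -> {for cmap c z, continuous (cinv c)}.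
Proof.
move=> cz; have := @cinv_cont _ _ _ c.
rewrite continuous_open_subspace; last exact: cimg_open.
by apply; rewrite inE; exact: chart_img.
Qed.

Lemma near_cinv z (A : set M) : cdom c z -> (\forall z' \near z, A z') ->
  \forall y \near cmap c z, A (cinv c y).
Proof. move=> cz nA.
have H : cinv c @ (cmap c z) --> cinv c (cmap c z) := chart_icont cz.
by rewrite chartK // in H; exact: H. Qed.

Lemma near_cmap z (B : set 'rV[R]_n) : cdom c z -> (\forall y \near cmap c z, B y) ->
  \forall z' \near z, B (cmap c z').
Proof. by move=> cz nB; have := chart_cont cz; apply. Qed.

Lemma near_dom z : cdom c z -> \forall z' \near z, cdom c z'.
Proof. by move=> cz; apply: open_nbhs_nbhs; split => //; exact: cdom_open. Qed.

Lemma near_img z : cdom c z -> \forall y \near cmap c z, (cmap c @` cdom c) y.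
Proof. by move=> cz; apply: open_nbhs_nbhs; split; [exact: cimg_open|exact: chart_img]. Qed.

End Charts.

Section ManifoldMaps.
Context {R : realType}.
Implicit Types M : manifold R.

Lemma coo_dom M (x : M) : cdom (chart_at x) x. Proof. exact: chart_atP. Qed.
Hint Resolve coo_dom : core.

Lemma cooK M (x : M) : cinv (chart_at x) (coo x) = x. Proof. exact: chartK. Qed.

Lemma near_coo M (x : M) (A : set M) : (\forall z \near x, A z) ->
  \forall y \near coo x, A (cinv (chart_at x) y).
Proof. by move=> nA; apply: near_cinv. Qed.

Lemma transition_smooth M (x x' z : M) : cdom (chart_at x) z -> cdom (chart_at x') z ->
  smooth_near (cmap (chart_at x) z) (cmap (chart_at x') \o cinv (chart_at x)).
Proof.
move=> dz dz'.
have H : \forall y \near cmap (chart_at x) z, (cmap (chart_at x) @` cdom (chart_at x)) y /\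
    (cdom (chart_at x) `&` cdom (chart_at x')) (cinv (chart_at x) y).
  by apply: filterI (near_img dz) (near_cinv dz _); apply: filterI; exact: near_dom.
have [U [oU Uz UP]] := near_open H; exists U; split => //.
apply: (smooth_on_sub _ (chart_compat (x := x) (y := x'))) => y /UP [[w dw <-]].
by rewrite chartK// => -[_ ?]; exists w.
Qed.

(** Together with [smooth_funat], the pointwise form of smoothness; it composes without any
    bookkeeping of open domains. *)
Definition smooth_at M M' (f : M -> M') (x : M) := {for x, continuous f} /\
  smooth_near (coo x) (cmap (chart_at (f x)) \o f \o cinv (chart_at x)).

Definition smooth_funat M (W : normedModType R) (F : M -> W) (x : M) :=
  smooth_near (coo x) (F \o cinv (chart_at x)).

Lemma smooth_map_onP M M' (U : set M) (f : M -> M') :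
  smooth_map_on U f <-> forall x, U x -> smooth_at f x.
Proof. by []. Qed.

Lemma smooth_funat_cont M (W : normedModType R) (F : M -> W) x : smooth_funat F x ->
  {for x, continuous F}.
Proof.
move=> /smooth_near_cont cF A; rewrite /= -[X in F X]cooK => nA.
have := near_cmap (coo_dom x) (cF A nA); apply: filter_app.
by apply: filterS (near_dom (coo_dom x)) => z dz /=; rewrite chartK.
Qed.

Lemma near_map M (T : topologicalType) (f : M -> T) x (A : set T) : {for x, continuous f} ->
  (\forall y \near f x, A y) -> \forall z \near x, A (f z).
Proof. by move=> cf; apply: cf. Qed.

Lemma funat_comp_near M M' (W : normedModType R) (f : M -> M') (F : M' -> W) x :
  {for x, continuous f} ->
  \forall y \near coo x, (F \o cinv (chart_at (f x))) ((cmap (chart_at (f x)) \o f \o cinv (chart_at x)) y) =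
    (F \o f \o cinv (chart_at x)) y.
Proof.
move=> cf; have := near_coo (near_map cf (near_dom (coo_dom (f x)))).
by apply: filterS => y dy /=; rewrite chartK.
Qed.

Lemma smooth_funat_comp M M' (W : normedModType R) (f : M -> M') (F : M' -> W) x :
  smooth_at f x -> smooth_funat F (f x) -> smooth_funat (F \o f) x.
Proof.
move=> [cf sf] sF; apply: smooth_near_eq (funat_comp_near F cf) _.
apply: (smooth_near_comp (g := F \o cinv (chart_at (f x)))) => //; first exact: fdim_mx.
by rewrite /= cooK.
Qed.

Lemma dfun_comp M M' (W : normedModType R) (f : M -> M') (F : M' -> W) x (v : tangent x) :
  smooth_at f x -> smooth_funat F (f x) -> dfun (F \o f) v = dfun F (tmap f v).
Proof.
move=> [cf sf] sF; rewrite /dfun /tmap -(derive_near_eq v (funat_comp_near F cf)).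
have E : (cmap (chart_at (f x)) \o f \o cinv (chart_at x)) (coo x) = coo (f x) by rewrite /= cooK.
rewrite (@derive_comp _ _ _ _ (cmap (chart_at (f x)) \o f \o cinv (chart_at x)) (F \o cinv (chart_at (f x)))).
- by rewrite E.
- exact: smooth_near_diff sf.
- by rewrite E; exact: smooth_near_diff sF.
Qed.

Lemma smooth_at_comp M M' M'' (f : M -> M') (g : M' -> M'') x :
  smooth_at f x -> smooth_at g (f x) -> smooth_at (g \o f) x.
Proof.
move=> sf [cg sg]; split; first by apply: continuous_comp => //; exact: sf.1.
exact: (smooth_funat_comp sf (F := cmap (chart_at (g (f x))) \o g)).
Qed.

Lemma tmap_comp M M' M'' (f : M -> M') (g : M' -> M'') x (v : tangent x) :
  smooth_at f x -> smooth_at g (f x) -> tmap (g \o f) v = tmap g (tmap f v).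
Proof.
move=> sf [cg sg]; exact: (dfun_comp (F := cmap (chart_at (g (f x))) \o g)).
Qed.

Lemma tmap_linear M M' (f : M -> M') x (a : R) (v w : 'rV[R]_(mdim M)) : smooth_at f x ->
  @tmap R M M' f x (a *: v + w) = a *: (@tmap R M M' f x v : 'rV[R]_(mdim M')) + @tmap R M M' f x w.
Proof. by move=> [_ /smooth_near_diff df]; exact: derive_lin. Qed.

Lemma dfun_linear M (W : normedModType R) (F : M -> W) x (a : R) (v w : 'rV[R]_(mdim M)) : smooth_funat F x ->
  @dfun R M W F x (a *: v + w) = a *: @dfun R M W F x v + @dfun R M W F x w.
Proof. by move=> /smooth_near_diff df; exact: derive_lin. Qed.

Lemma dfun_near_eq M (W : normedModType R) (F G : M -> W) x (v : tangent x) :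
  (\forall z \near x, F z = G z) -> dfun F v = dfun G v.
Proof. by move=> H; apply: derive_near_eq; exact: near_coo H. Qed.

Lemma smooth_funat_near_eq M (W : normedModType R) (F G : M -> W) x :
  (\forall z \near x, F z = G z) -> smooth_funat F x -> smooth_funat G x.
Proof. by move=> H; apply: smooth_near_eq; exact: (near_coo H). Qed.

Lemma tmap_near_eq M M' (f g : M -> M') x (v : tangent x) : (\forall z \near x, f z = g z) ->
  (tmap f v : 'rV[R]_(mdim M')) = tmap g v.
Proof.
move=> H; have E := nbhs_singleton H; rewrite /tmap -E; apply: derive_near_eq.
by apply: filterS (near_coo H) => y /= ->.
Qed.

Lemma tmap_id M x (v : tangent (x : M)) : tmap id v = v.
Proof.
rewrite /tmap -[RHS](derive_id (coo x) v); apply: derive_near_eq.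
by apply: filterS (near_img (coo_dom x)) => y /chart_imgV [].
Qed.

Lemma smooth_funat_post M (W W' : normedModType R) (F : M -> W) (G : W -> W') x : fdim W ->
  smooth_funat F x -> smooth_near (F x) G -> smooth_funat (G \o F) x.
Proof.
move=> fW sF sG; apply: (smooth_near_comp (f := F \o cinv (chart_at x)) (g := G)) => //.
by rewrite /= cooK.
Qed.

End ManifoldMaps.

(** * The coordinate space R^n as a manifold *)

Section Rman.
Context {R : realType}.
Variable n : nat.

Let T := 'rV[R]_n.
Let Tid : {in [set: T], cancel (id : T -> T) id}. Proof. by []. Qed.
Let Tcont : {within [set: T], continuous (id : T -> T)}.
Proof. by apply: continuous_subspaceT => x; exact: cvg_id. Qed.
Let Timg : id @` [set: T] = setT. Proof. exact: image_id. Qed.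
Let Topen : open (id @` [set: T]). Proof. by rewrite Timg; exact: openT. Qed.
Let Ticont : {within id @` [set: T], continuous (id : T -> T)}.
Proof. by rewrite Timg. Qed.

Definition Rchart : chart R 'rV[R]_n n := @Chart R 'rV[R]_n n setT id id openT Topen Tid Tcont Ticont.

Let Tcompat : forall x y : T,
  smooth_on (cmap Rchart @` (cdom Rchart `&` cdom Rchart)) (cmap Rchart \o cinv Rchart).
Proof.
move=> _ _; rewrite /= setIid Timg; apply: smooth_linF => //; [exact: fdim_mx|exact: openT].
Qed.

Let Tsc : @second_countable T.
Proof.
apply: (@second_countable_initial R T T id); [exact: fdim_mx|by move=> x; exact: cvg_id|].
by move=> x A nA; exists A.
Qed.

(** All points share the identity chart, so [tmap] and [dfun] on this manifold unfold to directional
    derivatives. Maps between charts and manifolds are thereby covered by the same chain rule. *)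
Definition Rman : manifold R := @Manifold R 'rV[R]_n n (fun=> Rchart) (fun=> I) Tcompat
  (@norm_hausdorff R _) Tsc.

End Rman.

Section CoordinateMaps.
Context {R : realType}.
Implicit Types M : manifold R.

Lemma smooth_at_Rman M n (f : M -> 'rV[R]_n) x : smooth_funat f x -> smooth_at (f : M -> Rman n) x.
Proof. by move=> sf; split => //; exact: smooth_funat_cont sf. Qed.

Lemma smooth_Rman_funat n (W : normedModType R) (F : 'rV[R]_n -> W) (y : 'rV[R]_n) :
  smooth_near y F -> smooth_funat (F : Rman n -> W) y.
Proof. by []. Qed.

Lemma smooth_at_chart M (x z : M) : cdom (chart_at x) z ->
  smooth_at (cmap (chart_at x) : M -> Rman (mdim M)) z.
Proof.
by move=> dz; apply: smooth_at_Rman; apply: transition_smooth => //; exact: coo_dom.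
Qed.

Lemma smooth_at_cinv M (x : M) (y : 'rV[R]_(mdim M)) : (cmap (chart_at x) @` cdom (chart_at x)) y ->
  smooth_at (cinv (chart_at x) : Rman (mdim M) -> M) y.
Proof.
move=> [z dz <-]; split; first exact: chart_icont.
rewrite chartK//; exact: (transition_smooth dz (coo_dom z)).
Qed.

(** [smooth_form] gives smoothness on coordinate fields of a chart only. In the fixed chart at s(y0)
    the velocity of [s] is expanded in such fields, with smooth coefficients, and [wc i] is the
    value of [omega] on the i-th of them. *)
Lemma pullback_form_smooth (P : manifold R) (W : normedModType R) (omega : forall u : P, tangent u -> W)
  k (s : 'rV[R]_k -> P) (y0 : 'rV[R]_k) (w : 'rV[R]_k) :
  smooth_form omega -> (\forall y \near y0, smooth_at (s : Rman k -> P) y) ->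
  smooth_near y0 (fun y => omega (s y) (tmap (s : Rman k -> P) (w : tangent (y : Rman k)))).
Proof.
move=> [lw sw] ns.
have [c0 s0] := nbhs_singleton ns.
pose u0 := s y0; pose g : 'rV[R]_k -> 'rV[R]_(mdim P) := cmap (chart_at u0) \o s.
have sg : smooth_near y0 g by exact: s0.
pose wc i z := let x := cinv (chart_at u0) z in
  omega x ('D_(delta_mx 0 i) (cmap (chart_at x) \o cinv (chart_at u0)) z).
have nd : \forall y \near y0, cdom (chart_at u0) (s y).
  by apply: c0; apply: near_dom; exact: coo_dom.
have H : \forall y \near y0, \sum_i 'D_w g y 0 i *: wc i (g y) =
    omega (s y) (tmap (s : Rman k -> P) (w : tangent (y : Rman k))).
  near=> y.
  have dy : cdom (chart_at u0) (s y) by near: y.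
  have sy : smooth_at (s : Rman k -> P) y by near: y.
  have sgy : smooth_near y g by near: y; exact: (smooth_near_near sg).
  have Ey : cinv (chart_at u0) (g y) = s y by rewrite /g /= chartK.
  have st : smooth_near (g y) (cmap (chart_at (s y)) \o cinv (chart_at u0)).
    by apply: transition_smooth => //; exact: coo_dom.
  have -> : tmap (s : Rman k -> P) (w : tangent (y : Rman k)) =
     'D_('D_w g y) (cmap (chart_at (s y)) \o cinv (chart_at u0)) (g y).
    rewrite -(@derive_comp _ _ _ _ g (cmap (chart_at (s y)) \o cinv (chart_at u0))); first last.
    - exact: smooth_near_diff st.
    - exact: smooth_near_diff sgy.
    apply: derive_near_eq.
    have : \forall y' \near y, cdom (chart_at u0) (s y').
      by apply: sy.1; exact: near_dom.
    by apply: filterS => y' dy' /=; rewrite chartK.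
  rewrite (derive_row_sum ('D_w g y) (smooth_near_diff st)).
  have lin : linear (fun v : 'rV[R]_(mdim P) => omega (s y) v) by move=> a u v; exact: lw.
  rewrite -[RHS]/((mklin lin) _) linear_sum; apply: eq_bigr => i _.
  rewrite linearZ /=; congr (_ *: _); rewrite /wc /=.
  by rewrite Ey.
apply: (smooth_near_eq H).
have swc i : smooth_near y0 (fun y => wc i (g y)).
  by apply: smooth_near_comp => //; [exact: fdim_mx|exact: (sw u0 (delta_mx 0 i))].
have sD i : smooth_near y0 (fun y => 'D_w g y 0 i).
  by apply: smooth_near1 (smooth_near_D w sg) => A oA; exact: smooth_coord.
elim: (index_enum _) => [|i r IH].
  by apply: smooth_near_eq (smooth_near_cst 0 y0); near=> y; rewrite big_nil.
apply: (@smooth_near_eq _ _ _ (fun y => 'D_w g y 0 i *: wc i (g y) + \sum_(i <- r) 'D_w g y 0 i *: wc i (g y))).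
  by near=> y; rewrite big_cons.
apply: smooth_near2 IH; first by move=> A oA; exact: smooth_add.
by apply: smooth_near2 (swc i); [move=> A oA; exact: smooth_scale|exact: sD].
Unshelve. all: by end_near. Qed.

End CoordinateMaps.

(** * The groups G, P, H and their Lie algebras *)

Section LorentzGroup.
Context {R : realType} {m : nat}.
Local Notation J := (gram R m).
Local Notation L := (vec_l R m).
Implicit Types k g Y : Lmat R m.

Definition skew Y := Y^T *m J + J *m Y = 0.
Definition isoJ k := k^T *m J *m k = J.
Definition lie_p Y := skew Y /\ exists a : R, Y *m L = a *: L.

Lemma gram_mul (a : 'M[R]_1) (z : 'rV[R]_m) (b : 'M[R]_1) (X : 'cV[R]_m) (c : 'M[R]_1) (A : 'M[R]_m) (e : 'cV[R]_m)
  (f : 'rV[R]_m) (d : 'M[R]_1) :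
  J *m block_mx a (row_mx z b) (col_mx X c) (block_mx A e f d) =
  block_mx c (row_mx f d) (col_mx X a) (block_mx A e z b).
Proof.
rewrite /gram mulmx_block; congr block_mx.
- by rewrite mul0mx add0r mul_row_col mul0mx add0r mul1mx.
- by rewrite mul0mx add0r mul_row_block !mul0mx !add0r !mul1mx.
- rewrite mul_col_mx mul0mx mul1mx mul_block_col mul1mx !mul0mx !addr0 add_col_mx.
  by rewrite add0r addr0.
- rewrite mul_col_mx mul0mx mul1mx mulmx_block !mul1mx !mul0mx !addr0 /block_mx add_col_mx.
  by rewrite add0r row_mx0 addr0.
Qed.

Lemma tr_gram : J^T = J.
Proof.
by rewrite /gram tr_block_mx tr_row_mx tr_col_mx tr_block_mx !trmx0 !trmx1.
Qed.

Lemma gram_sq : J *m J = 1%:M.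
Proof.
by rewrite {2}/gram gram_mul row_mx0 col_mx0 -!scalar_mx_block.
Qed.

Lemma mat1_tr (a : 'M[R]_1) : a^T = a. Proof. by apply/matrixP => i j; rewrite !ord1 mxE. Qed.

Lemma mat1_skew (a : 'M[R]_1) : a^T = - a -> a = 0.
Proof.
rewrite mat1_tr => /matrixP/(_ 0 0); rewrite mxE => h.
by apply/matrixP => i j; rewrite !ord1 mxE; lra.
Qed.

Lemma skewE Y : skew Y <-> (J *m Y)^T = - (J *m Y).
Proof.
rewrite /skew trmx_mul tr_gram; split=> [/eqP|->]; last by rewrite addNr.
by rewrite addr_eq0 => /eqP.
Qed.

(** Left multiplication by [J] exchanges the first and the last block rows, so the block pattern of
    [lie_elt] is the antisymmetry of [J *m Y] read off block by block. *)
Lemma lie_gP Y : lie_g Y <-> skew Y.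
Proof.
rewrite skewE; split=> [[a [X [z [A [HA ->]]]]]|].
  rewrite /lie_elt gram_mul tr_block_mx tr_row_mx tr_col_mx tr_block_mx HA !linearN /= !trmxK !trmx0 tr_scalar_mx.
  by rewrite !opp_block_mx !opp_row_mx !opp_col_mx !oppr0 !opprK.
rewrite -[Y]submxK -[ursubmx Y]hsubmxK -[dlsubmx Y]vsubmxK -[drsubmx Y]submxK.
move: (lsubmx (ursubmx Y)) (rsubmx (ursubmx Y)) (usubmx (dlsubmx Y)) (dsubmx (dlsubmx Y))
  (ulsubmx (drsubmx Y)) (ursubmx (drsubmx Y)) (dlsubmx (drsubmx Y)) (drsubmx (drsubmx Y)) (ulsubmx Y).
move=> z b X c A e f d a.
rewrite gram_mul tr_block_mx tr_row_mx tr_col_mx tr_block_mx.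
rewrite !opp_block_mx !opp_row_mx !opp_col_mx.
move=> /eq_block_mx [/mat1_skew -> /eq_row_mx [Xf ad] _ /eq_block_mx [AA ze _ /mat1_skew ->]].
exists (a 0 0), X, z, A; split => //; rewrite /lie_elt -mx11_scalar; congr block_mx.
by rewrite ze opprK Xf opprK -(mat1_tr a) ad opprK.
Qed.

Lemma mul_lie_elt_l a X (z : 'rV[R]_m) A : lie_elt a X z A *m L = col_mx a%:M (col_mx X 0).
Proof.
by rewrite /lie_elt /vec_l mul_block_col !mulmx0 !addr0 mulmx1 mul_col_mx mulmx1 mul0mx.
Qed.

Lemma vec_l_scale (a : R) : a *: L = col_mx a%:M (col_mx 0 0).
Proof. by rewrite /vec_l scale_col_mx scale_scalar_mx mulr1 col_mx0 scaler0. Qed.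

Lemma lie_hP Y : lie_h Y <-> skew Y /\ Y *m L = 0.
Proof.
split=> [[z [A [HA ->]]]|[/lie_gP [a [X [z [A [HA ->]]]]]]].
  split; first by apply/lie_gP; exists 0, 0, z, A.
  by rewrite mul_lie_elt_l raddf0 !col_mx0.
rewrite mul_lie_elt_l => /eqP; rewrite !col_mx_eq0 => /and3P[/eqP /matrixP/(_ 0 0)].
by rewrite !mxE eqxx mulr1n => -> /eqP -> _; exists z, A.
Qed.

Lemma lorentzE (v w : Lvec R m) : lorentz v w = (v^T *m J *m w) 0 0.
Proof. by []. Qed.

Lemma lorentz_scaler (c : R) (v w : Lvec R m) : lorentz v (c *: w) = c * lorentz v w.
Proof. by rewrite !lorentzE -scalemxAr mxE. Qed.

Lemma isoJP g : (forall v w : Lvec R m, lorentz (g *m v : Lvec R m) (g *m w : Lvec R m) = lorentz v w) <-> isoJ g.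
Proof.
rewrite /isoJ; split=> [H|H v w].
  apply/matrixP => i j; have := H (delta_mx i 0) (delta_mx j 0).
  rewrite !lorentzE trmx_mul -!mulmxA; rewrite !mulmxA -colE -(mulmxA _ _ (delta_mx j 0)) -colE.
  by rewrite trmx_delta -!mulmxA -!rowE !mxE.
by rewrite !lorentzE trmx_mul -!mulmxA (mulmxA J) (mulmxA g^T) (mulmxA g^T) H.
Qed.

Lemma isoJ_left k : isoJ k -> (J *m k^T *m J) *m k = 1%:M.
Proof. by rewrite /isoJ => H; rewrite -!mulmxA (mulmxA k^T) H gram_sq. Qed.

Lemma isoJ_unit k : isoJ k -> k \in unitmx.
Proof. by move=> /isoJ_left /mulmx1_unit []. Qed.

Lemma isoJ_inv k : isoJ k -> invmx k = J *m k^T *m J.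
Proof.
move=> H; rewrite -[RHS]mulmx1 -(mulmxV (isoJ_unit H)) mulmxA isoJ_left//.
by rewrite mul1mx.
Qed.

Lemma isoJ1 : isoJ 1%:M. Proof. by rewrite /isoJ trmx1 mul1mx mulmx1. Qed.

Lemma isoJ_mul k k' : isoJ k -> isoJ k' -> isoJ (k *m k').
Proof.
rewrite /isoJ => H H'; rewrite trmx_mul -[RHS]H' -[in RHS]H.
by rewrite !mulmxA.
Qed.

Lemma isoJ_invmx k : isoJ k -> isoJ (invmx k).
Proof.
move=> H; have u := isoJ_unit H; rewrite /isoJ -{1}H.
rewrite trmx_inv mulmxA mulmxA mulVmx ?unitmx_tr// mul1mx -mulmxA mulmxV//.
by rewrite mulmx1.
Qed.

Lemma lorentz_col (a : 'M[R]_1) (w : 'cV[R]_m) (b : 'M[R]_1) (a' : 'M[R]_1) (w' : 'cV[R]_m) (b' : 'M[R]_1) :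
  lorentz (col_mx a (col_mx w b)) (col_mx a' (col_mx w' b')) =
  a 0 0 * b' 0 0 + (w^T *m w') 0 0 + b 0 0 * a' 0 0.
Proof.
rewrite lorentzE -mulmxA.
have -> : J *m col_mx a' (col_mx w' b') = col_mx b' (col_mx w' a').
  rewrite /gram mul_block_col mul0mx add0r mul_row_col mul0mx add0r mul1mx mul_col_mx mul0mx mul1mx.
  by rewrite mul_block_col !mul0mx mul1mx !addr0 add_col_mx !add0r addr0.
rewrite !tr_col_mx mul_row_col mul_row_col !mat1_tr !mxE !big_ord1 addrA.
by [].
Qed.

Lemma lvec_decomp (v : Lvec R m) : exists (a b : R) (w : 'cV[R]_m), v = col_mx a%:M (col_mx w b%:M).
Proof.
exists (usubmx v 0 0), (dsubmx (dsubmx v) 0 0), (usubmx (dsubmx v)).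
by rewrite -!mx11_scalar !vsubmxK.
Qed.

Lemma lorentz_l (a b : R) (w : 'cV[R]_m) : lorentz (col_mx a%:M (col_mx w b%:M)) L = b.
Proof.
rewrite /vec_l -(@col_mx0 _ m 1 1) lorentz_col !mxE eqxx !mulr1n.
by rewrite big1 ?mulr0 ?mulr1 ?addr0 ?add0r// => i _; rewrite !mxE mulr0.
Qed.

Lemma lorentz_ln (a b : R) (w : 'cV[R]_m) :
  lorentz (col_mx a%:M (col_mx w b%:M)) (L - vec_n R m) = b - a.
Proof.
rewrite /vec_l /vec_n -(@col_mx0 _ m 1 1) opp_col_mx add_col_mx opp_col_mx add_col_mx.
rewrite lorentz_col !mxE eqxx !mulr1n.
rewrite big1 => [|i _]; last by rewrite !mxE subrr mulr0.
by ring.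
Qed.

Lemma sum_sq_ge0 (w : 'cV[R]_m) : 0 <= (w^T *m w) 0 0.
Proof. by rewrite mxE; apply: sumr_ge0 => i _; rewrite mxE -expr2 sqr_ge0. Qed.

Lemma sum_sq_eq0 (w : 'cV[R]_m) : (w^T *m w) 0 0 = 0 -> w = 0.
Proof.
rewrite mxE => /eqP; rewrite psumr_eq0; last by move=> i _; rewrite mxE -expr2 sqr_ge0.
move=> /allP H; apply/matrixP => i j; rewrite ord1 mxE.
have := H i (mem_index_enum _); rewrite /= mxE mulf_eq0 => /orP[] /eqP //.
Qed.

(** The n-coordinate b of a vector is its product with [L], so [g] divides it by [c] and preserves
    its sign. For a null vector 2 a b + |w|^2 = 0: the case b > 0 contradicts being future-directed,
    b < 0 forces a' >= 0 for the image, and b = 0 leaves positive multiples of [L]. *)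
Lemma cone_imp g (c : R) (v : Lvec R m) : isoJ g -> 0 < c -> g *m L = c *: L ->
  future_cone v -> future_cone (g *m v : Lvec R m).
Proof.
move=> /isoJP iso c0 gL [v0 vl]; split; first by rewrite iso.
have [a [b [w Ev]]] := lvec_decomp v; have [a' [b' [w' Ev']]] := lvec_decomp (g *m v).
have Eb : c * b' = b.
  by have := iso v L; rewrite gL lorentz_scaler Ev' lorentz_l Ev lorentz_l.
have n0 : 2 * (a * b) + (w^T *m w) 0 0 = 0.
  by rewrite -v0 Ev lorentz_col !mxE eqxx !mulr1n; ring.
have n0' : 2 * (a' * b') + (w'^T *m w') 0 0 = 0.
  by rewrite -v0 -iso Ev' lorentz_col !mxE eqxx !mulr1n; ring.
move: vl; rewrite {1}Ev Ev' !lorentz_ln => ba.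
have s0 := sum_sq_ge0 w; have s0' := sum_sq_ge0 w'.
have [b0|b0|b0] := ltrgt0P b.
- have : 0 < a * b by apply: mulr_gt0 => //; lra.
  lra.
- have b'0 : b' < 0 by rewrite -(pmulr_rlt0 _ c0) Eb.
  have a'0 : 0 <= a' by rewrite -(nmulr_lle0 _ b'0); lra.
  lra.
- have b'0 : b' = 0 by apply/eqP; move: Eb; rewrite b0 => /eqP; rewrite mulf_eq0 gt_eqF.
  have w0 : w = 0 by apply: sum_sq_eq0; move: n0; rewrite b0 mulr0 mulr0 add0r.
  have : a' = c * a.
    have : g *m v = (a * c) *: L.
      rewrite -scalerA -gL scalemxAr Ev w0 b0 vec_l_scale raddf0.
      by [].
    rewrite Ev' vec_l_scale => /eq_col_mx [/matrixP/(_ 0 0)]; rewrite !mxE eqxx !mulr1n => -> _.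
    by rewrite mulrC.
  move=> ->; rewrite b'0 sub0r oppr_lt0 mulr_gt0//; lra.
Qed.

Lemma future_l : future_cone L.
Proof.
have E : L = col_mx 1%:M (col_mx 0 0%:M) by rewrite /vec_l raddf0 col_mx0.
split; first by rewrite {1 2}E lorentz_col !mxE eqxx !mulr1n big1 ?mulr0 ?mul0r ?addr0// => i _; rewrite !mxE mulr0.
by rewrite {1}E lorentz_ln sub0r oppr_lt0.
Qed.

Lemma grpG_isoJ g : grpG g -> isoJ g. Proof. by move=> [/isoJP]. Qed.

Lemma grpG_intro g (c : R) : isoJ g -> 0 < c -> g *m L = c *: L -> grpG g.
Proof.
move=> iso c0 gL; split; first by apply/isoJP.
move=> v; split; last exact: cone_imp gL.
move=> H; have u := isoJ_unit iso.
rewrite -[v]mul1mx -(mulVmx u) -mulmxA; apply: (@cone_imp _ c^-1) H; first exact: isoJ_invmx.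
  by rewrite invr_gt0.
apply: (can_inj (mulKmx u)); rewrite mulmxA mulmxV// mul1mx -scalemxAr gL scalerA mulVf ?scale1r//.
by rewrite gt_eqF.
Qed.

(** As [L] is future-directed, preserving the future cone makes the factor of [L] positive;
    conversely [cone_imp] recovers the cone condition. Afterwards membership in P is algebraic. *)
Lemma grpPP g : grpP g <-> isoJ g /\ exists2 c : R, 0 < c & g *m L = c *: L.
Proof.
split=> [[gG [c gL]]|[iso [c c0 gL]]]; last by split; [exact: grpG_intro gL|exists c].
split; first exact: grpG_isoJ.
exists c => //; have [_] := (gG.2 L).2 future_l; rewrite gL vec_l_scale -(raddf0 (@scalar_mx R 1)).
by rewrite lorentz_ln sub0r oppr_lt0.
Qed.

Lemma grpHP g : grpH g <-> isoJ g /\ g *m L = L.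
Proof.
split=> [[gG gL]|[iso gL]]; first by split => //; exact: grpG_isoJ.
by split => //; apply: (@grpG_intro _ 1) => //; rewrite gL scale1r.
Qed.

Lemma grpH_P g : grpH g -> grpP g.
Proof. by move=> /grpHP [iso gL]; apply/grpPP; split => //; exists 1; rewrite ?gL ?scale1r. Qed.

Lemma grpP_mul g h : grpP g -> grpP h -> grpP (g *m h).
Proof.
move=> /grpPP [ig [c c0 gL]] /grpPP [ih [d d0 hL]]; apply/grpPP; split; first exact: isoJ_mul.
by exists (d * c); [exact: mulr_gt0|rewrite -mulmxA hL -scalemxAr gL scalerA].
Qed.

Lemma grpP_inv g : grpP g -> grpP (invmx g).
Proof.
move=> /grpPP [ig [c c0 gL]]; apply/grpPP; split; first exact: isoJ_invmx.
have u := isoJ_unit ig.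
exists c^-1; first by rewrite invr_gt0.
apply: (can_inj (mulKmx u)); rewrite mulmxA mulmxV// mul1mx -scalemxAr gL scalerA mulVf ?scale1r//.
by rewrite gt_eqF.
Qed.

Lemma grpH1 : grpH (1%:M : Lmat R m). Proof. by apply/grpHP; split; [exact: isoJ1|rewrite mul1mx]. Qed.

Lemma grpH_mul g h : grpH g -> grpH h -> grpH (g *m h).
Proof.
move=> /grpHP [ig gL] /grpHP [ih hL]; apply/grpHP; split; first exact: isoJ_mul.
by rewrite -mulmxA hL gL.
Qed.

Lemma grpH_inv g : grpH g -> grpH (invmx g).
Proof.
move=> /grpHP [ig gL]; apply/grpHP; split; first exact: isoJ_invmx.
by rewrite -[in LHS]gL mulmxA mulVmx ?mul1mx//; exact: isoJ_unit.
Qed.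

Lemma grpP_unit g : grpP g -> g \in unitmx.
Proof. by move=> /grpPP [/isoJ_unit]. Qed.

Lemma grpH_unit g : grpH g -> g \in unitmx.
Proof. by move=> /grpH_P /grpP_unit. Qed.

End LorentzGroup.

(** * The Cayley transform and curves in P and H *)

Section LieCurves.
Context {R : realType} {m : nat}.
Local Notation J := (gram R m).
Local Notation L := (vec_l R m).
Local Notation Mat := (Lmat R m).

Definition closed_group (Q : set Mat) :=
  [/\ Q 1%:M, forall g h, Q g -> Q h -> Q (g *m h), forall g, Q g -> Q (invmx g)
    & forall g, Q g -> g \in unitmx].

(* A closed subgroup [Q] with Lie algebra [q], in the form in which it is used: derivatives of
   Q-valued functions lie in [q], and elements of [q] are velocities of curves in [Q]. *)
Definition lie_group (Q : set Mat) (q : set Mat) :=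
  [/\ closed_group Q,
      forall (V : normedModType R) (h : V -> Mat) (x v : V), differentiable h x ->
        (\forall y \near x, Q (h y)) -> q (invmx (h x) *m 'D_v h x)
    & forall Y, q Y -> exists gamma : R -> Mat,
        [/\ smooth_on [set: R] gamma, forall t, Q (gamma t), gamma 0 = 1%:M & 'D_1 gamma 0 = Y]].

Lemma derive_mulmx_cst (V : normedModType R) a b c (f : V -> 'M[R]_(a, b)) (B : 'M[R]_(b, c)) x v :
  differentiable f x -> 'D_v (fun y => f y *m B) x = 'D_v f x *m B.
Proof.
move=> df; apply: (@derive_comp_lin _ _ _ _ (fun A : 'M[R]_(a, b) => A *m B)) => //; first exact: fdim_mx.
exact: linear_mulmxr.
Qed.

Lemma derive_cst_mulmx (V : normedModType R) a b c (f : V -> 'M[R]_(b, c)) (B : 'M[R]_(a, b)) x v :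
  differentiable f x -> 'D_v (fun y => B *m f y) x = B *m 'D_v f x.
Proof.
move=> df; apply: (@derive_comp_lin _ _ _ _ (fun A : 'M[R]_(b, c) => B *m A)) => //; first exact: fdim_mx.
exact: linear_mulmxl.
Qed.

Lemma diff_cst_mulmx (V : normedModType R) a b c (f : V -> 'M[R]_(b, c)) (B : 'M[R]_(a, b)) x :
  differentiable f x -> differentiable (fun y => B *m f y) x.
Proof. by move=> df; apply: diff_mulmx => //; exact: differentiable_cst. Qed.

Lemma diff_mulmx_cst (V : normedModType R) a b c (f : V -> 'M[R]_(a, b)) (B : 'M[R]_(b, c)) x :
  differentiable f x -> differentiable (fun y => f y *m B) x.
Proof. by move=> df; apply: diff_mulmx => //; exact: differentiable_cst. Qed.

Lemma linear_trmx a b : linear (@trmx R a b).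
Proof. by move=> k u w; rewrite linearP. Qed.

Lemma derive_trmx (V : normedModType R) a b (f : V -> 'M[R]_(a, b)) x v :
  differentiable f x -> 'D_v (fun y => (f y)^T) x = ('D_v f x)^T.
Proof.
move=> df; apply: (@derive_comp_lin _ _ _ _ (@trmx R a b)) => //; first exact: fdim_mx.
exact: linear_trmx.
Qed.

Lemma diff_trmx (V : normedModType R) a b (f : V -> 'M[R]_(a, b)) x :
  differentiable f x -> differentiable (fun y => (f y)^T) x.
Proof.
move=> df.
exact: (is_diff_diff (is_diff_comp (is_diff_der df) (is_diff_linF (f x) (@fdim_mx R a b) (@linear_trmx a b)))).
Qed.

(** The identity h^T J h = J is differentiated and rewritten in terms of Y = h^-1 D_v h. *)
Lemma isoJ_derive (V : normedModType R) (h : V -> Mat) (x v : V) : differentiable h x ->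
  (\forall y \near x, isoJ (h y)) -> skew (invmx (h x) *m 'D_v h x).
Proof.
move=> dh ih; have ihx := nbhs_singleton ih; have u := isoJ_unit ihx.
have E : 'D_v (fun y => (h y)^T *m J *m h y) x = 0.
  rewrite -(derive_cst (J : Mat) x v); apply: derive_near_eq; exact: ih.
have dT := diff_trmx dh.
rewrite derive_mulmx // in E; last by apply: diff_mulmx => //; exact: differentiable_cst.
rewrite derive_mulmx_cst // derive_trmx // in E.
move: E; set D := 'D_v h x => E.
have hD : D = h x *m (invmx (h x) *m D) by rewrite mulmxA mulmxV// mul1mx.
rewrite /skew; set Y := invmx (h x) *m D in hD *.
move: E; rewrite hD trmx_mul => E.
by rewrite -[X in Y^T *m X]ihx -[X in X *m Y]ihx -[RHS]E !mulmxA.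
Qed.

Ltac mxfield := apply/matrixP => ? ?; rewrite !mxE; field.

(** The Cayley transform (1 - Y/2)^-1 (1 + Y/2) takes the role of the exponential map: it sends
    infinitesimal isometries to isometries, has the identity as derivative at 0 owing to the factor
    1/2, and has the explicit inverse [icay], all by rational formulas. *)
Definition cayU (Y : Mat) : Mat := 1%:M - 2^-1 *: Y.
Definition cayV (Y : Mat) : Mat := 1%:M + 2^-1 *: Y.
Definition cay (Y : Mat) : Mat := invmx (cayU Y) *m cayV Y.
Definition icay (k : Mat) : Mat := 2 *: ((k - 1%:M) *m invmx (k + 1%:M)).

Lemma cayUV Y : cayU Y *m cayV Y = cayV Y *m cayU Y.
Proof.
rewrite /cayU /cayV !(mulmxDl, mulmxDr, mulmxBl, mulmxBr, mulmxN, mulNmx, mul1mx, mulmx1).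
by move: (_ *m _) => A; mxring.
Qed.

Lemma cayE Y : cayU Y \in unitmx -> cayU Y *m cay Y = cayV Y /\ cay Y *m cayU Y = cayV Y.
Proof.
move=> u; rewrite /cay mulmxA mulmxV// mul1mx; split => //.
by rewrite -mulmxA -cayUV mulmxA mulVmx// mul1mx.
Qed.

Lemma cay_isoJ Y : skew Y -> cayU Y \in unitmx -> isoJ (cay Y).
Proof.
move=> sY u; have [Uk kU] := cayE u.
have sY' : Y^T *m J = - (J *m Y) by apply/eqP; rewrite -addr_eq0; apply/eqP.
have UT : (cayU Y)^T *m J = J *m cayV Y.
  rewrite /cayU /cayV linearB linearZ /= trmx1 mulmxBl mulmxDr mul1mx mulmx1.
  by rewrite -scalemxAl sY' -scalemxAr scalerN opprK.
have VT : (cayV Y)^T *m J = J *m cayU Y.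
  rewrite /cayU /cayV linearD linearZ /= trmx1 mulmxDl mulmxBr mul1mx mulmx1.
  by rewrite -scalemxAl sY' -scalemxAr scalerN.
have uT : (cayU Y)^T \in unitmx by rewrite unitmx_tr.
apply: (can_inj (mulKmx uT)); apply: (can_inj (mulmxK u)).
have -> : (cayU Y)^T *m ((cay Y)^T *m J *m cay Y) *m cayU Y = (cay Y *m cayU Y)^T *m J *m (cay Y *m cayU Y).
  by rewrite (trmx_mul (cay Y)) !mulmxA.
by rewrite kU VT UT -!mulmxA cayUV.
Qed.

Lemma cay_l Y (a : R) : cayU Y \in unitmx -> Y *m L = a *: L -> 0 < (1 - a / 2) * (1 + a / 2) ->
  cay Y *m L = ((1 + a / 2) / (1 - a / 2)) *: L.
Proof.
move=> u YL a0; have [Uk _] := cayE u.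
have a1 : 1 - a / 2 != 0 by apply: contraTneq a0 => ->; rewrite mul0r ltxx.
apply: (can_inj (mulKmx u)); rewrite mulmxA Uk -scalemxAr /cayU /cayV.
rewrite mulmxDl mulmxBl mul1mx -!scalemxAl YL !scalerA -{1 3}[L]scale1r -scalerDl -scalerBl scalerA.
by congr (_ *: _); rewrite (mulrC 2^-1 a) divfK// (mulrC 2^-1).
Qed.

(** Positivity of the product means |a| < 2. It makes the factor (1 + a/2) / (1 - a/2) of [L]
    positive, as membership in P demands. *)
Lemma cay_P Y (a : R) : skew Y -> cayU Y \in unitmx -> Y *m L = a *: L ->
  0 < (1 - a / 2) * (1 + a / 2) -> grpP (cay Y).
Proof.
move=> sY u YL a0; apply/grpPP; split; first exact: cay_isoJ.
eexists; last exact: (cay_l u YL a0).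
have a1 : 1 - a / 2 != 0 by apply: contraTneq a0 => ->; rewrite mul0r ltxx.
have q0 : 0 < (1 - a / 2) ^+ 2 by rewrite exprn_even_gt0.
have := divr_gt0 a0 q0.
suff -> : (1 - a / 2) * (1 + a / 2) / (1 - a / 2) ^+ 2 = (1 + a / 2) / (1 - a / 2) by [].
by move: (1 - a / 2) (1 + a / 2) a1 => b c b0; field.
Qed.

Lemma cay_H Y : skew Y -> cayU Y \in unitmx -> Y *m L = 0 -> grpH (cay Y).
Proof.
move=> sY u YL; apply/grpHP; split; first exact: cay_isoJ.
have YL0 : Y *m L = 0 *: L by rewrite scale0r.
by rewrite (cay_l u YL0) mul0r subr0 addr0 ?mulr1 ?divr1 ?scale1r.
Qed.

Lemma cayU_plus1 Y : cayU Y \in unitmx -> cay Y + 1%:M = 2 *: invmx (cayU Y).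
Proof.
move=> u; have [Uk _] := cayE u; apply: (can_inj (mulKmx u)).
rewrite mulmxDr Uk mulmx1 -scalemxAr mulmxV// /cayU /cayV addrACA subrr addr0.
by rewrite -mulr2n scaler_nat.
Qed.

Lemma cayK Y : cayU Y \in unitmx -> cay Y + 1%:M \in unitmx /\ icay (cay Y) = Y.
Proof.
move=> u; have E := cayU_plus1 u; have [_ kU] := cayE u.
have u1 : cay Y + 1%:M \in unitmx by rewrite E unitmxZ ?unitmx_inv// unitfE.
split => //; rewrite /icay E invmxZ ?invmxK -?E// -scalemxAr scalerA divff// scale1r.
by rewrite mulmxBl kU mul1mx /cayU /cayV; mxfield.
Qed.

Lemma icayK k : k + 1%:M \in unitmx -> cayU (icay k) = 2 *: invmx (k + 1%:M) /\
  cayU (icay k) \in unitmx /\ cay (icay k) = k.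
Proof.
move=> u; have E : cayU (icay k) = 2 *: invmx (k + 1%:M).
  apply: (can_inj (mulmxK u)); rewrite /cayU /icay scalerA mulVf// scale1r mulmxBl mul1mx.
  rewrite -mulmxA mulVmx// mulmx1 -scalemxAl mulVmx// opprB addrC -addrA addrA.
  by rewrite addrA subrK scaler_nat.
have E' : cayV (icay k) = 2 *: (k *m invmx (k + 1%:M)).
  apply: (can_inj (mulmxK u)); rewrite /cayV /icay scalerA mulVf// scale1r mulmxDl mul1mx.
  by rewrite -mulmxA mulVmx// mulmx1 -scalemxAl -mulmxA mulVmx// mulmx1 addrACA subrr addr0 scaler_nat.
have uU : cayU (icay k) \in unitmx by rewrite E unitmxZ ?unitmx_inv// unitfE.
split => //; split => //; apply: (can_inj (mulmxK uU)); rewrite (cayE uU).2 E' E.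
by rewrite scalemxAr.
Qed.

Lemma icay_skew k : isoJ k -> k + 1%:M \in unitmx -> skew (icay k).
Proof.
move=> iso u; rewrite /skew.
have uT : (k + 1%:M)^T \in unitmx by rewrite unitmx_tr.
apply: (can_inj (mulKmx uT)); apply: (can_inj (mulmxK u)).
have h1 : icay k *m (k + 1%:M) = 2 *: (k - 1%:M) by rewrite /icay -scalemxAl -mulmxA mulVmx// mulmx1.
have h2 : (k + 1%:M)^T *m (icay k)^T = 2 *: (k - 1%:M)^T by rewrite -trmx_mul h1 linearZ.
have -> : (k + 1%:M)^T *m ((icay k)^T *m J + J *m icay k) *m (k + 1%:M) =
    ((k + 1%:M)^T *m (icay k)^T) *m J *m (k + 1%:M) + (k + 1%:M)^T *m J *m (icay k *m (k + 1%:M)).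
  by move: (k + 1%:M) => B; rewrite mulmxDr mulmxDl !mulmxA.
rewrite h1 h2 mulmx0 mul0mx -!scalemxAl -scalemxAr -scalerDr.
have tD : (k + 1%:M)^T = k^T + 1%:M by rewrite linearD /= trmx1.
have tB : (k - 1%:M)^T = k^T - 1%:M by rewrite linearB /= trmx1.
rewrite tD tB !(mulmxDl, mulmxDr, mulmxBl, mulmxBr, mul1mx, mulmx1, mulmxN, mulNmx) iso.
by move: (k^T *m J) (J *m k) => A B; mxring.
Qed.

Lemma icay_l k (c : R) : k + 1%:M \in unitmx -> 0 < c -> k *m L = c *: L ->
  icay k *m L = (2 * (c - 1) / (c + 1)) *: L.
Proof.
move=> u c0 kL; have c1 : c + 1 != 0 by rewrite gt_eqF// ltr_wpDl// ltW.
have E : (k + 1%:M) *m L = (c + 1) *: L by rewrite mulmxDl mul1mx kL scalerDl scale1r.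
have E2 : invmx (k + 1%:M) *m L = (c + 1)^-1 *: L.
  by apply: (can_inj (mulKmx u)); rewrite mulmxA mulmxV// mul1mx -scalemxAr E scalerA mulVf// scale1r.
rewrite /icay -scalemxAl -mulmxA E2 -scalemxAr mulmxBl mul1mx kL -{2}[L]scale1r -scalerBl !scalerA.
by congr (_ *: _); field.
Qed.

Lemma smooth_cay (V : normedModType R) (O : set V) (f : V -> Mat) : open O -> smooth_on O f ->
  (forall y, O y -> cayU (f y) \in unitmx) -> smooth_on O (fun y => cay (f y)).
Proof.
move=> oO sf hu; have sh : smooth_on O (fun y => 2^-1 *: f y) by apply: smooth_scale => //; exact: smooth_cst.
apply: smooth_mulmx => //; last by apply: smooth_add => //; exact: smooth_cst.
by apply: smooth_invmx => //; apply: smooth_sub => //; exact: smooth_cst.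
Qed.

Lemma smooth_icay (V : normedModType R) (O : set V) (f : V -> Mat) : open O -> smooth_on O f ->
  (forall y, O y -> f y + 1%:M \in unitmx) -> smooth_on O (fun y => icay (f y)).
Proof.
move=> oO sf hu; apply: smooth_scale => //; first exact: smooth_cst.
apply: smooth_mulmx => //; first by apply: smooth_sub => //; exact: smooth_cst.
by apply: smooth_invmx => //; apply: smooth_add => //; exact: smooth_cst.
Qed.

Lemma near_unitmx (V : normedModType R) n (f : V -> 'M[R]_n) x : smooth_near x f ->
  f x \in unitmx -> \forall y \near x, f y \in unitmx.
Proof.
move=> sf fu; have sd : smooth_near x (fun y => \det (f y)).
  by apply: smooth_near1 sf => O oO; exact: smooth_det.
have fx : \det (f x) != 0 by rewrite -unitfE -unitmxE.
have H : \forall y \near x, \det (f y) != 0 := smooth_near_cont sd (open_nbhs_nbhs (conj (@open_neq R 0) fx)).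
by apply: filterS H => y h; rewrite unitmxE unitfE.
Qed.

Lemma near_gt0 (V : normedModType R) (f : V -> R) x : smooth_near x f ->
  0 < f x -> \forall y \near x, 0 < f y.
Proof. by move=> sf fx; have := smooth_near_cont sf (open_nbhs_nbhs (conj (@open_gt R 0) fx)). Qed.

(* A curve [cay (f t *: Y)] with [f t = t] near [0] and [f] so small that it stays in the domain
   of the Cayley transform. *)
Lemma cay_curve (Y : Mat) (a : R) : exists f : R -> R,
  [/\ smooth_on [set: R] (fun t => cay (f t *: Y)), cay (f 0 *: Y) = 1%:M,
      'D_1 (fun t => cay (f t *: Y)) 0 = Y &
      forall t, cayU (f t *: Y) \in unitmx /\ 0 < (1 - f t * a / 2) * (1 + f t * a / 2)].
Proof.
have oT : open [set: R] by exact: openT.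
have scY : smooth_on [set: R] (fun t => t *: Y).
  by apply: smooth_scale => //; [exact: smooth_idR|exact: smooth_cst].
have nU : \forall t \near (0 : R), cayU (t *: Y) \in unitmx.
  apply: (@near_unitmx _ _ (fun t : R => cayU (t *: Y))); last by rewrite scale0r /cayU scaler0 subr0 unitmx1.
  apply: (smooth_near_on oT) => //; apply: smooth_sub => //; first exact: smooth_cst.
  by apply: smooth_scale => //; exact: smooth_cst.
have np : \forall t \near (0 : R), 0 < (1 - t * a / 2) * (1 + t * a / 2).
  apply: (@near_gt0 _ (fun t : R => (1 - t * a / 2) * (1 + t * a / 2))); last by rewrite !mul0r subr0 addr0 mulr1.
  have s1 : smooth_on [set: R] (fun t : R => t * a / 2).
    by do 2 (apply: smooth_mul => //; last exact: smooth_cst); exact: smooth_idR.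
  apply: (smooth_near_on oT) => //.
  by apply: smooth_mul => //; [apply: smooth_sub|apply: smooth_add] => //; exact: smooth_cst.
have [d d0 H] := nbhs_norm (filterI nU np).
(* The cut-off vanishes from |t| = 2 r = d on, so |f t| < d holds for every [t]. *)
pose r := d / 2; have r0 : 0 < r by rewrite divr_gt0.
pose f (t : R) := t * bump1 (t / r).
have sf : smooth_on [set: R] f.
  apply: smooth_mul => //; first exact: smooth_idR.
  apply: smooth_bump_comp => //; apply: smooth_mul => //; first exact: smooth_idR.
  exact: smooth_cst.
have fd t : `|f t - 0| < d.
  rewrite subr0 /f; have [h|h] := ltP `|t / r| 2.
    apply: le_lt_trans (_ : `|t| < _); last first.
      by move: h; rewrite normf_div (gtr0_norm r0) ltr_pdivrMr// /r mulrC divfK.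
    rewrite normrM ler_piMr//; have /andP[b0 b1] := bump1_01 (t / r).
    by rewrite ger0_norm.
  by rewrite bump1_0// mulr0 normr0.
have f0 : f 0 = 0 by rewrite /f mul0r.
have scay : smooth_on [set: R] (fun t => cay (f t *: Y)).
  apply: smooth_cay => //; last by move=> t _; have [] := H _ (fd t).
  by apply: smooth_scale => //; exact: smooth_cst.
have cay0 : cay 0 = 1%:M by rewrite /cay /cayU /cayV scaler0 subr0 addr0 invmx1 mul1mx.
exists f; split => //; [by rewrite f0 scale0r| |by move=> t; exact: H _ (fd t)].
have -> : 'D_1 (fun t => cay (f t *: Y)) 0 = 'D_1 (fun t : R => cay (t *: Y)) 0.
  apply: derive_near_eq; apply: (norm_nbhs r0) => t; rewrite subr0 => tr.
  by rewrite /f bump1_1 ?mulr1// normf_div (gtr0_norm r0) ler_pdivrMr// mul1r ltW.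
have dY : differentiable (fun t : R => t *: Y) 0 by exact: smooth_on_diff scY _.
have shY : smooth_on [set: R] (fun t : R => 2^-1 *: (t *: Y)).
  by apply: smooth_scale => //; exact: smooth_cst.
have DhY : 'D_1 (fun t : R => 2^-1 *: (t *: Y)) 0 = 2^-1 *: Y.
  rewrite (@derive_comp_lin _ _ _ _ (fun t : R => 2^-1 *: (t *: Y)) (fun t : R => t)) ?derive_idR ?scale1r//.
  - exact: fdimR.
  - move=> k u v; rewrite scalerDl scalerDr !scalerA; congr (_ *: _ + _).
    by rewrite -[k *: u]/(k * u); ring.
have sU : smooth_on [set: R] (fun t => cayU (t *: Y)).
  apply: smooth_sub => //; first exact: smooth_cst.
have DU : 'D_1 (fun t : R => cayU (t *: Y)) 0 = - (2^-1 *: Y).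
  rewrite /cayU derive_subf ?derive_cst ?sub0r ?DhY//; apply: (smooth_on_diff shY).
have DV : 'D_1 (fun t : R => cayV (t *: Y)) 0 = (2^-1 *: Y).
  rewrite /cayV derive_addf ?derive_cst ?add0r ?DhY//; apply: (smooth_on_diff shY).
have dU : differentiable (fun t : R => cayU (t *: Y)) 0 by exact: smooth_on_diff sU _.
have dV : differentiable (fun t : R => cayV (t *: Y)) 0.
  apply: (smooth_on_diff (O := [set: R])) => //; apply: smooth_add => //; first exact: smooth_cst.
have U0 : cayU (0 *: Y) = 1%:M by rewrite scale0r /cayU scaler0 subr0.
have V0 : cayV (0 *: Y) = 1%:M by rewrite scale0r /cayV scaler0 addr0.
have dI : differentiable (fun t : R => invmx (cayU (t *: Y))) 0.
  apply: smooth_near_diff; have [A [oA A0 HA]] := near_open nU; apply: (smooth_near_on oA A0).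
  by apply: smooth_invmx => //; apply: smooth_on_sub sU.
rewrite /cay derive_mulmx// derive_invmx//; last by rewrite U0 unitmx1.
by rewrite DU DV U0 V0 invmx1 mulmx1 mul1mx mulmx1 mul1mx opprK; mxfield.
Qed.

Lemma vec_l00 : L 0 0 = 1.
Proof.
have -> : (0 : 'I_(1 + (m + 1))) = lshift (m + 1) (0 : 'I_1) by apply: val_inj.
by rewrite col_mxEu mxE.
Qed.

Lemma lie_group_H : lie_group (@grpH R m) (@lie_h R m).
Proof.
split.
- by split; [exact: grpH1|exact: grpH_mul|exact: grpH_inv|exact: grpH_unit].
- move=> V h x v dh hH; have [iso hL] := (grpHP (h x)).1 (nbhs_singleton hH).
  apply/lie_hP; split.
    by apply: isoJ_derive => //; apply: filterS hH => y /grpHP [].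
  rewrite -mulmxA -derive_mulmx_cst//.
  have -> : 'D_v (fun y => h y *m L) x = 'D_v (cst L) x.
    by apply: derive_near_eq; apply: filterS hH => y /grpHP [].
  by rewrite derive_cst mulmx0.
move=> Y /lie_hP [sY YL]; have [f [s1 s2 s3 s4]] := cay_curve Y 0.
exists (fun t => cay (f t *: Y)); split => // t; apply: cay_H.
- by rewrite /skew linearZ /= -scalemxAl -scalemxAr -scalerDr sY scaler0.
- exact: (s4 t).1.
- by rewrite -scalemxAl YL scaler0.
Qed.

Lemma lie_group_P : lie_group (@grpP R m) (@lie_p R m).
Proof.
split.
- split; [by apply: grpH_P; exact: grpH1|exact: grpP_mul|exact: grpP_inv|exact: grpP_unit].
- move=> V h x v dh hP; have [iso [c c0 hL]] := (grpPP (h x)).1 (nbhs_singleton hP).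
  split; first by apply: isoJ_derive => //; apply: filterS hP => y /grpPP [].
  have E : 'D_v (fun y => h y *m L) x = ('D_v (fun y => (h y *m L) 0 0) x) *: L.
    (* A linear projection onto the line of [L]. It fixes h y [L] whenever h y lies in P, hence also
       the derivative. *)
    pose T (A : Lvec R m) := A 0 0 *: L.
    have lT : linear T by move=> k A B; rewrite /T !mxE scalerDl scalerA.
    have dhL := diff_mulmx_cst L dh.
    have -> : 'D_v (fun y => (h y *m L) 0 0) x *: L = T ('D_v (fun y => h y *m L) x) by rewrite /T derive_coord.
    transitivity ('D_v (fun y => T (h y *m L)) x).
      apply: derive_near_eq; apply: filterS hP => y /grpPP [_ [d _ dL]].
      by rewrite /T dL mxE vec_l00 mulr1.
    by rewrite (@derive_comp_lin _ _ _ _ T)//; exact: fdim_mx.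
  rewrite derive_mulmx_cst// in E; exists (c^-1 * ('D_v (fun y => (h y *m L) 0 0) x)).
  rewrite -mulmxA E -scalemxAr mulrC -scalerA; congr (_ *: _).
  apply: (can_inj (mulKmx (isoJ_unit iso))); rewrite mulmxA mulmxV ?(isoJ_unit iso)// mul1mx.
  by rewrite -scalemxAr hL scalerA mulVf ?scale1r// gt_eqF.
move=> Y [sY [a YL]]; have [f [s1 s2 s3 s4]] := cay_curve Y a.
exists (fun t => cay (f t *: Y)); split => // t; apply: (@cay_P _ (f t * a)).
- by rewrite /skew linearZ /= -scalemxAl -scalemxAr -scalerDr sY scaler0.
- exact: (s4 t).1.
- by rewrite -scalemxAl YL scalerA.
- exact: (s4 t).2.
Qed.

End LieCurves.

(** * Curvature of Cartan connections *)

Section Curvature.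
Context {R : realType}.
Implicit Types n k : nat.

Lemma derive_linfam n k (W : normedModType R) (L : 'rV[R]_n -> 'rV[R]_k -> W) (X : 'rV[R]_n -> 'rV[R]_k) y v :
  (\forall z \near y, linear (L z)) -> (forall w, differentiable (fun z => L z w) y) ->
  differentiable X y ->
  'D_v (fun z => L z (X z)) y = 'D_v (fun z => L z (X y)) y + L y ('D_v X y).
Proof.
move=> lL dL dX; have ly := nbhs_singleton lL.
have expand z (w : 'rV[R]_k) : linear (L z) -> L z w = \sum_i w 0 i *: L z (delta_mx 0 i).
  move=> lz; rewrite {1}(row_sum_delta w); pose Lz := mklin lz.
  by rewrite -[L z]/(Lz : _ -> _) linear_sum; apply: eq_bigr => i _; rewrite linearZ.
have dc i : differentiable (fun z => X z 0 i) y.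
  exact: (is_diff_diff (is_diff_comp (is_diff_der dX) (is_diff_linF (X y) (@fdim_mx R _ _) (@linear_coord _ 1 k 0 i)))).
have ds i : differentiable (fun z => X z 0 i *: L z (delta_mx 0 i)) y.
  exact: (is_diff_diff (is_diff_scale (is_diff_der (dc i)) (is_diff_der (dL _)))).
have -> : 'D_v (fun z => L z (X z)) y = 'D_v (fun z => \sum_i X z 0 i *: L z (delta_mx 0 i)) y.
  by apply: derive_near_eq; apply: filterS lL => z lz; exact: expand.
have -> : 'D_v (fun z => L z (X y)) y = 'D_v (fun z => \sum_i X y 0 i *: L z (delta_mx 0 i)) y.
  by apply: derive_near_eq; apply: filterS lL => z lz; exact: expand.
have dsum (g : 'I_k -> 'rV[R]_n -> W) : (forall i, differentiable (g i) y) ->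
    'D_v (fun z => \sum_i g i z) y = \sum_i 'D_v (g i) y.
  move=> dg; have -> : (fun z => \sum_i g i z) = \sum_i g i by apply/funext => z; rewrite fct_sumE.
  have := @derive_sum R ('rV[R]_n) W k g y v; apply => i; exact: diff_derivable.
rewrite !dsum//; last by move=> i; exact: (is_diff_diff (is_diff_scale (is_diff_cst _ _) (is_diff_der (dL _)))).
rewrite [in X in _ + X](expand y _ ly) -big_split /=; apply: eq_bigr => i _.
rewrite (@derive_scale _ _ _ (fun z => X z 0 i) (fun z => L z (delta_mx 0 i)))//.
rewrite (@derive_scale _ _ _ (fun=> X y 0 i) (fun z => L z (delta_mx 0 i)))//.
by rewrite derive_cst scale0r derive_coord// ?add0r ?addr0 addrC.
Qed.

Definition form_near n N (A : 'rV[R]_n -> 'rV[R]_n -> 'M[R]_N) (y : 'rV[R]_n) :=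
  (\forall z \near y, linear (A z)) /\ forall w, smooth_near y (fun z => A z w).

(** The value of dA + A /\ A on the constant fields [v] and [w], whose bracket is zero. *)
Definition curv n N (A : 'rV[R]_n -> 'rV[R]_n -> 'M[R]_N) (y v w : 'rV[R]_n) : 'M[R]_N :=
  'D_v (fun z => A z w) y - 'D_w (fun z => A z v) y + (A y v *m A y w - A y w *m A y v).

Lemma curv_near_eq n N (A B : 'rV[R]_n -> 'rV[R]_n -> 'M[R]_N) y v w :
  (\forall z \near y, forall u, A z u = B z u) -> curv A y v w = curv B y v w.
Proof.
move=> H; rewrite /curv !(nbhs_singleton H).
have E u u' : 'D_u (fun z => A z u') y = 'D_u (fun z => B z u') y.
  by apply: (@derive_near_eq _ _ _ (fun z => A z u')); apply: filterS H => z ->.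
by rewrite !E.
Qed.

(** Differentiating A(phi) (D phi) produces second derivatives of [phi], which cancel in the
    antisymmetrization. *)
Lemma curv_pullback n k N (A : 'rV[R]_n -> 'rV[R]_n -> 'M[R]_N) (phi : 'rV[R]_k -> 'rV[R]_n) y v w :
  smooth_near y phi -> form_near A (phi y) ->
  curv (fun z u => A (phi z) ('D_u phi z)) y v w = curv A (phi y) ('D_v phi y) ('D_w phi y).
Proof.
move=> sphi [lA sA]; have dphi := smooth_near_diff sphi.
have H v' w' : 'D_v' (fun z => A (phi z) ('D_w' phi z)) y =
    'D_('D_v' phi y) (fun z => A z ('D_w' phi y)) (phi y) + A (phi y) ('D_v' (fun z => 'D_w' phi z) y).
  rewrite (@derive_linfam _ _ _ (fun z u => A (phi z) u)).
  - have -> : 'D_v' (fun z => A (phi z) ('D_w' phi y)) y = 'D_('D_v' phi y) (fun z => A z ('D_w' phi y)) (phi y).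
      by apply: (@derive_comp _ _ _ _ phi (fun z => A z ('D_w' phi y))) => //; exact: smooth_near_diff (sA _).
    by [].
  - by have := smooth_near_cont sphi lA.
  - move=> u; exact: (smooth_near_diff (@smooth_near_comp _ _ _ _ phi (fun z => A z u) _ (@fdim_mx _ _ _) sphi (sA u))).
  - by apply: smooth_near_diff; exact: smooth_near_D.
rewrite /curv !H.
have [U [oO Oy sO]] := sphi; rewrite (schwarz _ _ oO Oy sO).
have alg (a b c d : 'M[R]_N) : a + c - (b + c) + d = a - b + d by rewrite opprD addrACA subrr addr0.
exact: alg.
Qed.

(** The hypothesis is the gauge relation [B] = k theta k^-1 - dk k^-1, multiplied by [k] to avoid
    inverses. It is differentiated and antisymmetrized; the second derivatives of [k] cancel and its
    first derivatives are eliminated by the relation itself. *)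
Lemma curv_gauge n N (th B : 'rV[R]_n -> 'rV[R]_n -> 'M[R]_N) (k : 'rV[R]_n -> 'M[R]_N) y v w :
  form_near th y -> form_near B y -> smooth_near y k ->
  (\forall z \near y, forall u, k z *m th z u = B z u *m k z + 'D_u k z) ->
  k y *m curv th y v w = curv B y v w *m k y.
Proof.
move=> [_ st] [_ sB] sk H; have dk := smooth_near_diff sk.
have dt u := smooth_near_diff (st u); have dB u := smooth_near_diff (sB u).
have E v' w' : 'D_v' k y *m th y w' + k y *m 'D_v' (fun z => th z w') y =
   'D_v' (fun z => B z w') y *m k y + B y w' *m 'D_v' k y + 'D_v' (fun z => 'D_w' k z) y.
  have := @derive_near_eq _ _ _ (fun z => k z *m th z w') (fun z => B z w' *m k z + 'D_w' k z) y v'.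
  rewrite derive_mulmx// derive_addf.
  - rewrite derive_mulmx// addrC => ->; first by rewrite [_ *m k y + _]addrC.
    by apply: filterS H => z ->.
  - exact: diff_mulmx.
  - by apply: smooth_near_diff; exact: smooth_near_D.
have Hy u : 'D_u k y = k y *m th y u - B y u *m k y by rewrite (nbhs_singleton H) addrC addKr.
have [U [oO Oy sO]] := sk.
have E1 := E v w; have E2 := E w v; rewrite (schwarz _ _ oO Oy sO) in E1.
move: E1 E2; move: ('D_w (fun z => 'D_v k z) y) => S.
rewrite /curv !Hy !(mulmxBl, mulmxBr, mulmxDl, mulmxDr, mulmxN, mulNmx) !mulmxA.
move: ('D_v (fun z => th z w) y) ('D_w (fun z => th z v) y) ('D_v (fun z => B z w) y) ('D_w (fun z => B z v) y) => a b c d.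
move: (k y *m th y v *m th y w) (k y *m th y w *m th y v) => e f.
move: (B y v *m B y w *m k y) (B y w *m B y v *m k y) (B y v *m k y *m th y w) (B y w *m k y *m th y v) => g h i j.
move: (k y *m a) (k y *m b) (c *m k y) (d *m k y) => a' b' c' d' E1 E2.
have -> : a' = c' + (j - h) + S - (e - i) by rewrite -E1 addrC addKr.
have -> : b' = d' + (i - g) + S - (f - j) by rewrite -E2 addrC addKr.
by mxring.
Qed.

End Curvature.

Section PairDerivative.
Context {R : realType} {V W1 W2 : normedModType R}.

Lemma derive_pair (f : V -> W1) (g : V -> W2) x v : differentiable f x -> differentiable g x ->
  'D_v (fun y => (f y, g y)) x = ('D_v f x, 'D_v g x).
Proof.
move=> df dg; rewrite !deriveE//; first by rewrite diff_pair.
exact: differentiable_pair.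
Qed.

End PairDerivative.

Lemma smooth_near_invmx (R : realType) (V : normedModType R) n (f : V -> 'M[R]_n) x :
  smooth_near x f -> f x \in unitmx -> smooth_near x (fun y => invmx (f y)).
Proof.
move=> sf fu; have [A [oA Ax HA]] := near_open (near_unitmx sf fu); have [B [oB Bx sB]] := sf.
exists (A `&` B); split => //; first exact: openI.
apply: smooth_invmx; first exact: openI.
  by apply: smooth_on_sub sB => y [].
by move=> y [/HA].
Qed.

Lemma smooth_near_mulmx (R : realType) (V : normedModType R) a b c (f : V -> 'M[R]_(a, b)) (g : V -> 'M[R]_(b, c)) x :
  smooth_near x f -> smooth_near x g -> smooth_near x (fun y => f y *m g y).
Proof. by apply: smooth_near2 => O oO; exact: smooth_mulmx. Qed.

(** * Consequences of the axioms of a Cartan geometry *)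

Section CartanGeometry.
Context {R : realType} {m : nat} {Q q : set (Lmat R m)}.
Variables (P N : manifold R) (p : P -> N) (act : P -> Lmat R m -> P).
Variable omega : forall u : P, tangent u -> Lmat R m.
Arguments omega : clear implicits.
Hypotheses (lieQ : lie_group Q q) (cart : cartan_geometry Q p act omega).

Let pb : principal_bundle Q p act. Proof. by case: cart. Qed.
Let sa : smooth_action Q act. Proof. by case: pb. Qed.

Lemma cartan_act1 u : act u 1%:M = u. Proof. by case: sa. Qed.

Lemma cartan_actM u k k' : Q k -> Q k' -> act (act u k) k' = act u (k *m k').
Proof. by case: sa => _ + _; apply. Qed.

Lemma cartan_proj_act u k : Q k -> p (act u k) = p u.
Proof. by case: pb => _ _ + _; apply. Qed.

Lemma smooth_at_proj u : smooth_at p u.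
Proof. by case: pb => /smooth_map_onP + _ _ _; apply. Qed.

Let grpQ : closed_group Q. Proof. by case: lieQ. Qed.
Let Q1 : Q 1%:M. Proof. by case: grpQ. Qed.
Let QM g h : Q g -> Q h -> Q (g *m h). Proof. by case: grpQ => _ + _ _; apply. Qed.
Let QV g : Q g -> Q (invmx g). Proof. by case: grpQ => _ _ + _; apply. Qed.
Let QU g : Q g -> g \in unitmx. Proof. by case: grpQ => _ _ _; apply. Qed.

Definition act_chart u k (A : set ('rV[R]_(mdim P) * Lmat R m)%type)
    (F : ('rV[R]_(mdim P) * Lmat R m)%type -> 'rV[R]_(mdim P)) :=
  [/\ open A, A (coo u, k), smooth_on A F &
      forall y g, A (y, g) -> Q g ->
        let w := act (cinv (chart_at u) y) g in
        cdom (chart_at (act u k)) w /\ cmap (chart_at (act u k)) w = F (y, g)].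

Lemma act_chartP u k : Q k -> exists A F, act_chart u k A F.
Proof. by case: sa => _ _ + Qk => /(_ u k Qk) [A [F H]]; exists A, F. Qed.

Section Translate.
Variables (B : manifold R) (s : B -> P) (h : B -> Lmat R m) (b : B).
Variables (A : set ('rV[R]_(mdim P) * Lmat R m)%type).
Variable F : ('rV[R]_(mdim P) * Lmat R m)%type -> 'rV[R]_(mdim P).
Hypotheses (ss : smooth_at s b) (sh : smooth_funat h b) (Qh : \forall z \near b, Q (h z)).
Hypothesis aF : act_chart (s b) (h b) A F.

Lemma act_chart_near : \forall z \near b,
  cdom (chart_at (act (s b) (h b))) (act (s z) (h z)) /\
  cmap (chart_at (act (s b) (h b))) (act (s z) (h z)) = F (cmap (chart_at (s b)) (s z), h z).
Proof.
case: aF => oA Ab sF HF.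
have ns : \forall z \near b, cdom (chart_at (s b)) (s z).
  by apply: near_map (near_dom (coo_dom _)); exact: ss.1.
have nA : \forall z \near b, A (cmap (chart_at (s b)) (s z), h z).
  have nAb : nbhs (coo (s b), h b) A by exact: open_nbhs_nbhs.
  have cc : {for b, continuous (fun z => cmap (chart_at (s b)) (s z))}.
    apply: continuous_comp; [exact: ss.1|apply: chart_cont; exact: coo_dom].
  have ch := smooth_funat_cont sh.
  exact: (cvg_pair cc ch nAb).
apply: filterS (filterI (filterI ns nA) Qh) => z [[dz Az] Qz].
by have := HF _ _ Az Qz; rewrite /= chartK.
Qed.

Let G : 'rV[R]_(mdim B) -> ('rV[R]_(mdim P) * Lmat R m)%type :=
  fun y => ((cmap (chart_at (s b)) \o s \o cinv (chart_at b)) y, (h \o cinv (chart_at b)) y).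

Let sG : smooth_near (coo b) G.
Proof. by apply: smooth_near_pair => //; [exact: fdim_mx|exact: fdim_mx|exact: ss.2]. Qed.

Let Gb : G (coo b) = (coo (s b), h b). Proof. by rewrite /G /= cooK. Qed.

Let eqF : \forall y \near coo b, F (G y) =
  (cmap (chart_at (act (s b) (h b))) \o (fun z => act (s z) (h z)) \o cinv (chart_at b)) y.
Proof. by apply: filterS (near_coo act_chart_near) => y /= [_ ->]. Qed.

Lemma smooth_at_translate : smooth_at (fun z => act (s z) (h z)) b.
Proof.
case: aF => oA Ab sF HF.
have sFG : smooth_near (coo b) (fun y => F (G y)).
  apply: smooth_near_comp => //; first by apply: fdim_pair; exact: fdim_mx.
  by rewrite Gb; exact: smooth_near_on sF.
split; last exact: smooth_near_eq eqF sFG.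
have nb := act_chart_near; set u := act (s b) (h b) in nb.
move=> U nU.
have nU' : \forall y \near coo u, U (cinv (chart_at u) y) by exact: near_coo.
have cF : {for b, continuous (fun z => F (G (cmap (chart_at b) z)))}.
  apply: (@continuous_comp _ _ _ (cmap (chart_at b)) (fun y => F (G y))).
    by apply: chart_cont; exact: coo_dom.
  exact: smooth_near_cont sFG.
have E0 : F (G (coo b)) = coo u by rewrite (nbhs_singleton eqF) /= cooK.
have := cF; rewrite /prop_for /continuous_at -/(coo b) E0 => {}cF.
have nd := near_dom (coo_dom b).
have H : \forall z \near b, U (act (s z) (h z)).
  have nF : \forall z \near b, U (cinv (chart_at u) (F (G (cmap (chart_at b) z)))) := cF _ nU'.
  apply: filterS (filterI (filterI nF nb) nd) => z [[]] /=.
  by rewrite /G /= => Uz [dz Ez] db; move: Uz; rewrite (chartK db) -Ez chartK.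
exact: H.
Qed.

(** [F] extends the action to an open set of matrices around the group, so the chain rule can be
    applied in the ambient matrix space. *)
Lemma tmap_translate (w : tangent b) :
  tmap (fun z => act (s z) (h z)) w = 'D_(tmap s w, dfun h w) F (coo (s b), h b).
Proof.
case: aF => oA Ab sF HF.
rewrite /tmap -(derive_near_eq w eqF) (@derive_comp _ _ _ _ G F).
- rewrite Gb /G derive_pair//; first exact: smooth_near_diff ss.2.
  exact: smooth_near_diff sh.
- exact: smooth_near_diff sG.
- by rewrite Gb; exact: smooth_on_diff sF _.
Qed.

End Translate.

Lemma smooth_at_act (B : manifold R) (s : B -> P) (h : B -> Lmat R m) b : smooth_at s b ->
  smooth_funat h b -> (\forall z \near b, Q (h z)) -> smooth_at (fun z => act (s z) (h z)) b.
Proof.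
move=> ss sh Qh; have [A [F aF]] := act_chartP (s b) (nbhs_singleton Qh).
exact: smooth_at_translate aF.
Qed.

Lemma smooth_funat_cst (B : manifold R) (W : normedModType R) (a : W) (b : B) : smooth_funat (fun=> a) b.
Proof. exact: smooth_near_cst. Qed.

Lemma smooth_at_cst (B B' : manifold R) (x : B') (b : B) : smooth_at (fun=> x) b.
Proof. by split; [exact: cst_continuous|exact: (@smooth_near_cst R _ _ (coo x) (coo b))]. Qed.

Lemma smooth_at_id (B : manifold R) (b : B) : smooth_at id b.
Proof.
split; first exact: cvg_id.
apply: transition_smooth; exact: coo_dom.
Qed.

Lemma omega_lin u (a : R) (v w : 'rV[R]_(mdim P)) : omega u (a *: v + w) = a *: omega u v + omega u w.
Proof. by case: cart => _ [+ _] _ _ _; apply. Qed.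

Lemma omega_add u (v w : 'rV[R]_(mdim P)) : omega u (v + w) = omega u v + omega u w.
Proof. by have := omega_lin u 1 v w; rewrite !scale1r. Qed.

(* The velocity of [u h] splits into the velocities for fixed [h] and for fixed [u]; these are
   governed by equivariance and by the values of [omega] on fundamental vector fields. *)
Lemma omega_act (B : manifold R) (s : B -> P) (h : B -> Lmat R m) b (w : tangent b) : smooth_at s b ->
  smooth_funat h b -> (\forall z \near b, Q (h z)) ->
  omega _ (tmap (fun z => act (s z) (h z)) w) =
    invmx (h b) *m omega _ (tmap s w) *m h b + invmx (h b) *m dfun h w.
Proof.
move=> ss sh Qh; have Qb := nbhs_singleton Qh; have [A [F aF]] := act_chartP (s b) Qb.
rewrite (tmap_translate ss sh Qh aF).
have [oA Ab sF HF] := aF; have dF : differentiable F (coo (s b), h b) by exact: smooth_on_diff sF _.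
have -> : (tmap s w, dfun h w) = (tmap s w, 0) + (0, dfun h w) :> ('rV[R]_(mdim P) * Lmat R m)%type.
  by apply: injective_projections => /=; rewrite ?addr0 ?add0r.
rewrite derive_addv// omega_add; congr (_ + _).
  have Qc : \forall z \near s b, Q (cst (h b) z) by near=> z.
  have := @tmap_translate P id (cst (h b)) (s b) A F (smooth_at_id _) (smooth_funat_cst _ _) Qc aF (tmap s w).
  rewrite tmap_id /dfun derive_cst => <-.
  by case: cart => _ _ _ + _; apply.
have [_ tang curves] := lieQ.
have qY : q (invmx (h b) *m dfun h w).
  have := tang _ (h \o cinv (chart_at b)) (coo b) w (smooth_near_diff sh) (near_coo Qh).
  by rewrite /= cooK.
(* The axiom on fundamental vector fields speaks of curves in [Q]; this one has the velocity (h
   b)^-1 dh(w). *)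
have [gamma [sg Qg g0 Dg]] := curves _ qY.
have [_ _ _ _ /(_ gamma (act (s b) (h b)) sg Qg g0)] := cart.
rewrite Dg => <-; congr (omega _).
pose K (t : R) : ('rV[R]_(mdim P) * Lmat R m)%type := (coo (s b), h b *m gamma t).
have dg : differentiable gamma 0 by exact: smooth_on_diff sg _.
have dK1 : differentiable (fun t : R => h b *m gamma t) 0 by exact: diff_cst_mulmx.
have dK : differentiable K 0 by apply: differentiable_pair.
have K0 : K 0 = (coo (s b), h b) by rewrite /K g0 mulmx1.
have DK1 : 'D_1 (fun t : R => h b *m gamma t) 0 = dfun h w.
  by rewrite derive_cst_mulmx// Dg mulmxA mulmxV ?mul1mx// QU.
have DK : 'D_1 K 0 = (0, dfun h w).
  rewrite -DK1 -(derive_cst (coo (s b)) (0 : R) (1 : R)); exact: derive_pair.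
have dFK : differentiable F (K 0) by rewrite K0.
have := derive_comp (1 : R) dK dFK; rewrite DK K0 => <-.
apply: derive_near_eq.
have nA : \forall t \near (0 : R), A (K t).
  apply: (differentiable_continuous dK); rewrite K0; exact: open_nbhs_nbhs.
apply: filterS nA => t At.
by have [] := HF _ _ At (QM Qb (Qg t)); rewrite /= cooK cartan_actM// => _ ->.
Unshelve. all: by end_near. Qed.

(** The type [tangent u] does not depend on [u] up to conversion, so vectors at two equal points can
    be compared as row vectors. *)
Lemma omega_congr u u' (v : tangent u) (v' : tangent u') : u = u' ->
  (v : 'rV[R]_(mdim P)) = v' -> omega u v = omega u' v'.
Proof. by move=> E; case: _ / E v' => v' ->. Qed.

Lemma tmap_congr (B B' : manifold R) (f : B -> B') u u' (v : tangent u) (v' : tangent u') : u = u' ->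
  (v : 'rV[R]_(mdim B)) = v' -> (tmap f v : 'rV[R]_(mdim B')) = tmap f v'.
Proof. by move=> E; case: _ / E v' => v' ->. Qed.

Lemma omega0 u : omega u (0 : 'rV[R]_(mdim P)) = 0.
Proof. by have := omega_add u 0 0; rewrite addr0 => /eqP; rewrite -subr_eq subrr => /eqP. Qed.

Lemma omega_sub u (v w : 'rV[R]_(mdim P)) : omega u (v - w) = omega u v - omega u w.
Proof. by have := omega_lin u (-1) w v; rewrite !scaleN1r addrC => ->; rewrite addrC. Qed.

Lemma omega_inj u : injective (omega u).
Proof. by have [_ _ /(_ u) [] ] := cart. Qed.

Lemma omega_surj u Y : lie_g Y -> exists v, omega u v = Y.
Proof. by have [_ _ /(_ u) [_ <-] _ _] := cart => -[v _ <-]; exists v. Qed.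

Lemma omega_skew u v : skew (omega u v).
Proof. by apply/lie_gP; have [_ _ /(_ u) [_ <-] _ _] := cart; exists v. Qed.

Lemma cartan_triv x : exists U s tau, [/\ U x, local_section p U s,
  forall u, U (p u) -> smooth_funat tau u,
  forall u, U (p u) -> Q (tau u) /\ act (s (p u)) (tau u) = u
  & forall y k, U y -> Q k -> tau (act (s y) k) = k].
Proof. by case: pb => _ _ _ /(_ x) [U [s [tau [h1 h2 h3 h4 h5]]]]; exists U, s, tau; split. Qed.

Lemma act_free u k k' : Q k -> Q k' -> act u k = act u k' -> k = k'.
Proof.
move=> Qk Qk' E; have [U [s [tau [Ux ls st H1 H2]]]] := cartan_triv (p u).
have [Qt Eu] := H1 u Ux.
have : tau (act u k) = tau (act u k') by rewrite E.
rewrite -Eu !cartan_actM// !H2//; try exact: QM.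
by move=> /(can_inj (mulKmx (QU Qt))).
Qed.

Lemma act_trans u v : p u = p v -> exists2 k, Q k & v = act u k.
Proof.
move=> E; have [U [s [tau [Ux ls st H1 H2]]]] := cartan_triv (p u).
have [Qu Eu] := H1 u Ux; have [Qv Ev] : Q (tau v) /\ act (s (p v)) (tau v) = v by apply: H1; rewrite -E.
exists (invmx (tau u) *m tau v); first by apply: QM => //; exact: QV.
rewrite -{1}Ev -E -{2}Eu cartan_actM//; last by apply: QM => //; exact: QV.
by rewrite mulmxA mulmxV ?mul1mx// QU.
Qed.

Lemma tmap0 (B B' : manifold R) (f : B -> B') x : smooth_at f x -> tmap f (0 : tangent x) = (0 : 'rV[R]_(mdim B')).
Proof.
move=> sf; have := tmap_linear 1 0 0 sf; rewrite scale1r addr0 scale1r => /eqP.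
by rewrite -subr_eq subrr => /eqP.
Qed.

Lemma tmap_near_cst (B B' : manifold R) (f : B -> B') x0 x (v : tangent x) :
  (\forall z \near x, f z = x0) -> tmap f v = (0 : 'rV[R]_(mdim B')).
Proof.
move=> H; rewrite (tmap_near_eq v H); rewrite /tmap.
by rewrite -[RHS](derive_cst (coo x0) (coo x) v).
Qed.

Lemma section_open U s : local_section p U s -> open U. Proof. by case. Qed.

Lemma section_smooth U s y : local_section p U s -> U y -> smooth_at s y.
Proof. by move=> [_ /smooth_map_onP + _] Uy; apply. Qed.

Lemma section_proj U s y : local_section p U s -> U y -> p (s y) = y.
Proof. by case=> _ _; apply. Qed.

Lemma section_near U s y : local_section p U s -> U y -> \forall z \near y, U z.
Proof. by move=> [oU _ _] Uy; exact: open_nbhs_nbhs. Qed.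

(** Near [u] the identity map is s(p u) tau(u). On a vertical vector the factor s o p does not move,
    and [omega_act] leaves only tau^-1 dtau, an element of [q]. *)
Lemma tmap_proj_ker1 u (v : tangent u) : tmap p v = (0 : 'rV[R]_(mdim N)) -> q (omega u v).
Proof.
move=> v0; have [U [s [tau [Ux ls st H1 H2]]]] := cartan_triv (p u).
have nU : \forall z \near u, U (p z) := near_map (smooth_at_proj u).1 (section_near ls Ux).
pose F z := act (s (p z)) (tau z).
have EF : \forall z \near u, F z = id z by apply: filterS nU => z Uz; exact: (H1 z Uz).2.
have sF : smooth_at (s \o p) u by apply: smooth_at_comp (smooth_at_proj u) (section_smooth ls Ux).
have sT := st u Ux.
have QT : \forall z \near u, Q (tau z) by apply: filterS nU => z Uz; exact: (H1 z Uz).1.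
have -> : omega u v = omega (F u) (tmap F v).
  apply: omega_congr; first by rewrite (nbhs_singleton EF).
  by rewrite (tmap_near_eq v EF) tmap_id.
rewrite (omega_act (s := s \o p) v sF sT QT) tmap_comp; first last.
- exact: (section_smooth ls Ux).
- exact: smooth_at_proj.
rewrite v0 tmap0 ?omega0 ?mulmx0 ?mul0mx ?add0r; last exact: (section_smooth ls Ux).
have [_ tang _] := lieQ.
have := tang _ (tau \o cinv (chart_at u)) (coo u) v (smooth_near_diff sT) (near_coo QT).
by rewrite /= cooK.
Qed.

(** Some curve u gamma(t) in the fibre has a velocity with the same value of [omega]; by injectivity
    this velocity is [v]. *)
Lemma tmap_proj_ker2 u (v : tangent u) : q (omega u v) -> tmap p v = (0 : 'rV[R]_(mdim N)).
Proof.
move=> qv; have [_ _ /(_ _ qv) [gamma [sg Qg g0 Dg]]] := lieQ.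
(* The curve parameter becomes the coordinate of the manifold [Rman 1], so that [omega_act] applies
   to the curve. *)
pose h (y : Rman 1) := gamma ((y : 'rV[R]_1) 0 0); pose b : Rman 1 := (0 : 'rV[R]_1); pose w : tangent b := (1%:M : 'rV[R]_1).
have sh : smooth_on [set: 'rV[R]_1] h.
  apply: (@smooth_comp _ _ _ _ setT setT (fun y : 'rV[R]_1 => y 0 0) gamma) => //; [exact: fdimR|exact: openT|exact: openT|].
  apply: (@smooth_linF _ _ _ setT (fun y : 'rV[R]_1 => y 0 0)); [exact: fdim_mx|exact: openT|exact: linear_coord].
have shb : smooth_funat h b by apply: smooth_Rman_funat; apply: (smooth_near_on openT I).
have Dh : dfun h w = omega u v.
  rewrite -Dg /dfun (_ : h \o cinv (chart_at b) = (fun y : 'rV[R]_1 => gamma (y 0 0)))//.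
  rewrite (@derive_comp _ _ _ _ (fun y : 'rV[R]_1 => y 0 0) gamma)//; last 2 first.
  - exact: (is_diff_diff (is_diff_linF _ (@fdim_mx _ _ _) (@linear_coord _ _ _ 0 0))).
  - exact: smooth_on_diff sg _.
  rewrite (is_diff_derive _ (is_diff_linF _ (@fdim_mx _ _ _) (@linear_coord _ _ _ 0 0))) /w.
  by rewrite /coo /= /b !mxE eqxx.
have hb : h b = 1%:M by rewrite /h /b mxE g0.
pose F (y : Rman 1) := act u (h y).
have sc : smooth_at (cst u : Rman 1 -> P) b by exact: smooth_at_cst.
have Qh : \forall z \near b, Q (h z) by near=> z; exact: Qg.
have tc : tmap (cst u : Rman 1 -> P) w = (0 : 'rV[R]_(mdim P)) by apply: (@tmap_near_cst _ _ _ u); near=> z.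
have := omega_act w sc shb Qh; rewrite hb invmx1 !mul1mx mulmx1 Dh tc.
rewrite omega0 add0r => E.
have Fb : F b = u by rewrite /F hb cartan_act1.
have Ev : (v : 'rV[R]_(mdim P)) = tmap F w.
  apply: (@omega_inj u); by rewrite -E; apply: omega_congr => //; rewrite /= cartan_act1.
have -> : tmap p v = tmap p (tmap F w) :> 'rV[R]_(mdim N) by apply: tmap_congr.
rewrite -tmap_comp; [|exact: smooth_at_act|exact: smooth_at_proj].
have H : \forall z \near b, (p \o F) z = p u by near=> z; rewrite /= cartan_proj_act//; exact: Qg.
exact: (tmap_near_cst w H).
Unshelve. all: by end_near. Qed.

Lemma tmap_section U s y (w : tangent y) : local_section p U s -> U y ->
  tmap p (tmap s w) = w :> 'rV[R]_(mdim N).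
Proof.
move=> ls Uy; rewrite -tmap_comp; [|exact: (section_smooth ls Uy)|exact: smooth_at_proj].
rewrite (tmap_near_eq (g := id)) ?tmap_id//.
by apply: filterS (section_near ls Uy) => z Uz; exact: (section_proj ls Uz).
Qed.

(** The kernel of the projection consists of the vectors with [omega] in [q]. With
    [section_form_surj] this makes the pull-back of [omega] along [s] an isomorphism of T_y N with
    g/q. *)
Lemma section_form_inj U s y (w : tangent y) : local_section p U s -> U y ->
  q (omega (s y) (tmap s w)) -> w = (0 : 'rV[R]_(mdim N)).
Proof. by move=> ls Uy /tmap_proj_ker2; rewrite (tmap_section w ls Uy). Qed.

Lemma tmap_sub (B B' : manifold R) (f : B -> B') x (v w : 'rV[R]_(mdim B)) : smooth_at f x ->
  tmap f (v - w : tangent x) = (tmap f (v : tangent x) : 'rV[R]_(mdim B')) - tmap f (w : tangent x).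
Proof. by move=> sf; have := tmap_linear (-1) w v sf; rewrite !scaleN1r addrC => ->; rewrite addrC. Qed.

Lemma section_form_surj U s y Y : local_section p U s -> U y -> lie_g Y ->
  exists w : tangent y, q (Y - omega (s y) (tmap s w)).
Proof.
move=> ls Uy /(omega_surj (s y)) [v <-]; exists (tmap p v : 'rV[R]_(mdim N)).
rewrite -omega_sub; apply: tmap_proj_ker1; rewrite tmap_sub; last exact: smooth_at_proj.
rewrite (tmap_section _ ls Uy); apply/eqP; rewrite subr_eq0; apply/eqP.
by apply: tmap_congr; rewrite ?(section_proj ls Uy).
Qed.

Lemma section_through u : exists U s, [/\ U (p u), local_section p U s & s (p u) = u].
Proof.
have [U [s [tau [Ux ls st H1 H2]]]] := cartan_triv (p u); have [Qt Eu] := H1 u Ux.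
exists U, (fun y => act (s y) (tau u)); split => //; split; first by case: ls.
- apply/smooth_map_onP => y Uy; apply: smooth_at_act (section_smooth ls Uy) _ _; first exact: smooth_funat_cst.
  by near=> z.
- by move=> y Uy; rewrite cartan_proj_act//; exact: (section_proj ls Uy).
Unshelve. all: by end_near. Qed.

(** Both maps are compared with one local section: k = tau(s)^-1 tau(s'). The source [B] is the base
    in one application and a coordinate space in the other. *)
Lemma section_transition (B : manifold R) (s s' : B -> P) b : smooth_at s b -> smooth_at s' b ->
  (\forall z \near b, p (s z) = p (s' z)) ->
  exists k : B -> Lmat R m, [/\ smooth_funat k b, \forall z \near b, Q (k z) &
    \forall z \near b, s' z = act (s z) (k z)].
Proof.
move=> ss ss' E; have [U [s0 [tau [Ux ls st H1 H2]]]] := cartan_triv (p (s b)).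
have nU : \forall z \near b, U (p (s z)).
  by apply: (near_map (f := p \o s)) (section_near ls Ux); exact: (smooth_at_comp ss (smooth_at_proj _)).1.
have nU' : \forall z \near b, U (p (s' z)) by apply: filterS (filterI nU E) => z [+ <-].
have Ux' := nbhs_singleton nU'.
exists (fun z => invmx (tau (s z)) *m tau (s' z)).
have H z : U (p (s z)) -> p (s z) = p (s' z) -> Q (invmx (tau (s z)) *m tau (s' z)) /\
    s' z = act (s z) (invmx (tau (s z)) *m tau (s' z)).
  move=> Uz Ez; have [Qz Es] := H1 _ Uz; have Uz' : U (p (s' z)) by rewrite -Ez.
  have [Qz' Es'] := H1 _ Uz'.
  have Qi : Q (invmx (tau (s z)) *m tau (s' z)) by apply: QM => //; exact: QV.
  split => //; rewrite -{1}Es cartan_actM// mulmxA mulmxV ?mul1mx ?Ez ?Es'//.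
  exact: QU.
split.
- apply: smooth_near_mulmx; last exact: (smooth_funat_comp ss' (st _ Ux')).
  apply: smooth_near_invmx; first exact: (smooth_funat_comp ss (st _ Ux)).
  by rewrite /= cooK; exact: QU (H1 _ Ux).1.
- by apply: filterS (filterI nU E) => z [Uz Ez]; have [] := H z Uz Ez.
- by apply: filterS (filterI nU E) => z [Uz Ez]; have [] := H z Uz Ez.
Qed.

End CartanGeometry.

Section FormPullback.
Context {R : realType} {m : nat}.
Variables (P : manifold R) (omega : forall u : P, tangent u -> Lmat R m).
Arguments omega : clear implicits.

(** The pull-back of [omega] along a map from coordinate space, in the shape expected by [curv]. *)
Definition pbf n (s : 'rV[R]_n -> P) (y w : 'rV[R]_n) : Lmat R m :=
  omega (s y) (tmap (s : Rman n -> P) (w : tangent (y : Rman n))).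

Hypothesis so : smooth_form omega.

Lemma form_near_pbf n (s : 'rV[R]_n -> P) y :
  (\forall z \near y, smooth_at (s : Rman n -> P) z) -> form_near (pbf s) y.
Proof.
move=> ss; split; last by move=> w; exact: pullback_form_smooth.
apply: filterS ss => z sz a u v; rewrite /pbf (tmap_linear _ _ _ sz).
by case: so => + _; apply.
Qed.

Lemma pbf_near_eq n (s s' : 'rV[R]_n -> P) y w :
  (\forall z \near y, s z = s' z) -> pbf s y w = pbf s' y w.
Proof.
move=> H; apply: omega_congr; first exact: nbhs_singleton H.
exact: (tmap_near_eq (M := Rman n) _ H).
Qed.

Lemma pbf_comp n k (s : 'rV[R]_n -> P) (phi : 'rV[R]_k -> 'rV[R]_n) y w : smooth_near y phi ->
  smooth_at (s : Rman n -> P) (phi y) -> pbf (s \o phi) y w = pbf s (phi y) ('D_w phi y).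
Proof.
move=> sphi ss; rewrite /pbf; congr (omega _).
exact: (@tmap_comp R (Rman k) (Rman n) P phi s y w (@smooth_at_Rman R (Rman k) n phi y sphi) ss).
Qed.

Lemma curv_pbf_comp n k (s : 'rV[R]_n -> P) (phi : 'rV[R]_k -> 'rV[R]_n) y v w : smooth_near y phi ->
  (\forall z \near phi y, smooth_at (s : Rman n -> P) z) ->
  curv (pbf (s \o phi)) y v w = curv (pbf s) (phi y) ('D_v phi y) ('D_w phi y).
Proof.
move=> sphi ss; rewrite -(@curv_pullback _ _ _ _ (pbf s) phi y v w sphi (form_near_pbf ss)).
apply: curv_near_eq; have nphi := smooth_near_near sphi.
have nss := smooth_near_cont sphi ss.
by apply: filterS (filterI nphi nss) => z [sz ssz] u; exact: pbf_comp.
Qed.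

Lemma pbf_coo (B : manifold R) (s : B -> P) x (w : tangent x) :
  pbf (s \o cinv (chart_at x)) (coo x) w = omega (s x) (tmap s w).
Proof.
rewrite /pbf /tmap; have E : (s \o cinv (chart_at x)) (coo x) = s x by rewrite /= cooK.
by rewrite E.
Qed.

End FormPullback.

Lemma curv0l (R : realType) n N (A : 'rV[R]_n -> 'rV[R]_n -> 'M[R]_N) y w : form_near A y -> curv A y 0 w = 0.
Proof.
move=> [lA sA].
have A0 z : linear (A z) -> A z 0 = 0.
  by move=> lz; have := lz (-1) 0 0; rewrite scaler0 addr0 scaleN1r addNr.
have -> : curv A y 0 w = 'D_0 (fun z => A z w) y - 'D_w (fun z => A z 0) y by rewrite /curv A0 ?mul0mx ?mulmx0 ?subr0 ?addr0//; exact: nbhs_singleton lA.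
have -> : 'D_w (fun z => A z 0) y = 'D_w (cst 0) y.
  by apply: derive_near_eq; apply: filterS lA => z; exact: A0.
have dA := smooth_near_diff (sA w).
have := derive_lin 1 0 0 dA; rewrite scale1r addr0 scale1r => /eqP; rewrite -subr_eq subrr => /eqP <-.
by rewrite derive_cst subr0.
Qed.

(** * The vector field Z *)

Section ReebField.
Context {R : realType} {m : nat}.
Local Notation L := (vec_l R m).
Variables (P N : manifold R) (p : P -> N) (act : P -> Lmat R m -> P).
Variable omega : forall u : P, tangent u -> Lmat R m.
Arguments omega : clear implicits.
Hypothesis cart : cartan_geometry (@grpH R m) p act omega.
Let lieH := @lie_group_H R m.

Lemma e0_skew : skew (lie_elt 1 0 0 0 : Lmat R m).
Proof. by apply/lie_gP; exists 1, 0, 0, 0; split => //; rewrite trmx0 oppr0. Qed.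

Lemma e0_l : (lie_elt 1 0 0 0 : Lmat R m) *m L = L.
Proof. by rewrite mul_lie_elt_l -vec_l_scale scale1r. Qed.

Lemma skewB (Y Y' : Lmat R m) : skew Y -> skew Y' -> skew (Y - Y').
Proof.
rewrite /skew => h h'; rewrite linearB /= mulmxBl mulmxBr addrACA h add0r -opprD h' oppr0.
by [].
Qed.

(** Within g the subalgebra h is the annihilator of [L], so the condition defining Z becomes
    omega(v) l = l. *)
Lemma lie_h_e0 Y : skew Y -> lie_h (Y - lie_elt 1 0 0 0) <-> Y *m L = L.
Proof.
move=> sY; split=> [/lie_hP [_]|YL]; first by rewrite mulmxBl e0_l => /eqP; rewrite subr_eq0 => /eqP.
by apply/lie_hP; split; [exact: skewB e0_skew|rewrite mulmxBl YL e0_l subrr].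
Qed.

(** [Zfield] is a choice, so its independence of the witness is at issue. Another witness lives at u
    h with h in H. Translating [v] there conjugates omega(v) by [h], which still fixes [L]; the
    difference of the two vectors has [omega] in h and is vertical. *)
Lemma Zfield_unique u (v : tangent u) : omega u v *m L = L -> tmap p v = Zfield p omega (p u).
Proof.
move=> vL; rewrite /Zfield; case: xgetP => [z0 _ [u' [v' [pu' <- hv']]]|/(_ (tmap p v)) []]; last first.
  by exists u, v; split => //; exact: (lie_h_e0 (omega_skew cart v)).2 vL.
have v'L := (lie_h_e0 (omega_skew cart v')).1 hv'.
have [h Hh Eu'] := act_trans lieH cart (esym pu').
have hL : h *m L = L by have [] := (grpHP h).1 Hh.
case: _ / (esym Eu') v' {hv'} v'L => v' v'L {Eu' pu'}.
have nH : \forall z \near u, grpH (cst h z : Lmat R m) by near=> z.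
have sid := smooth_at_id u.
have sh : smooth_funat (cst h : P -> Lmat R m) u by exact: smooth_funat_cst.
have := omega_act lieH cart v sid sh nH.
rewrite tmap_id /dfun derive_cst mulmx0 addr0 /= => Ew.
set w := tmap _ v in Ew.
have wL : omega _ w *m L = L.
  rewrite Ew -!mulmxA hL vL -[in LHS]hL mulmxA mulVmx ?mul1mx//; exact: grpH_unit.
have k0 : lie_h (omega (act u h) (v' - w : 'rV[R]_(mdim P))).
  rewrite (omega_sub cart); apply/lie_hP; split; last by rewrite mulmxBl v'L wL subrr.
  by apply: skewB; apply: (omega_skew cart).
have := tmap_proj_ker2 lieH cart k0; rewrite tmap_sub; last exact: (smooth_at_proj cart).
move=> /eqP; rewrite subr_eq0 => /eqP ->; rewrite /w -tmap_comp; [|exact: (smooth_at_act cart)|exact: (smooth_at_proj cart)].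
by apply: tmap_near_eq; near=> z; rewrite /= (cartan_proj_act cart).
Unshelve. all: by end_near. Qed.

Variables (U : set N) (s : N -> P) (x : N).
Hypotheses (ls : local_section p U s) (Ux : U x).

Lemma Zfield_section (w : tangent x) : omega (s x) (tmap s w) *m L = L -> (w : 'rV[R]_(mdim N)) = Zfield p omega x.
Proof.
move=> /Zfield_unique; rewrite (tmap_section cart w ls Ux) => ->.
by rewrite (section_proj ls Ux).
Qed.

Lemma Zfield_l : omega (s x) (tmap s (Zfield p omega x)) *m L = L.
Proof.
have gE : lie_g (lie_elt 1 0 0 0 : Lmat R m) by apply/lie_gP; exact: e0_skew.
have [w /lie_hP [_]] := section_form_surj lieH cart ls Ux gE.
rewrite mulmxBl e0_l => /eqP; rewrite subr_eq0 => /eqP wL.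
by rewrite -(@Zfield_section w).
Qed.

End ReebField.

(** * Correspondence spaces satisfy the curvature condition *)

Section ScalesToFlat.
Context {R : realType} {m : nat}.
Local Notation L := (vec_l R m).
Variables (P N : manifold R) (p : P -> N) (act : P -> Lmat R m -> P).
Variable omega : forall u : P, tangent u -> Lmat R m.
Arguments omega : clear implicits.
Hypothesis cart : cartan_geometry (@grpH R m) p act omega.

(** The condition is stated at the centre of the preferred chart, where the coordinate vector of Z
    is its value and [w] is an arbitrary tangent vector. *)
Definition curvature_vanishes := forall U s x w, local_section p U s -> U x ->
  curv (pbf omega (s \o cinv (chart_at x))) (coo x) (Zfield p omega x) w = 0.

Lemma cartan_form : smooth_form omega. Proof. by case: cart. Qed.

Lemma coo_smooth (B B' : manifold R) (f : B -> B') x : (\forall z \near x, smooth_at f z) ->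
  \forall y \near coo x, smooth_at (f \o cinv (chart_at x) : Rman (mdim B) -> B') y.
Proof.
move=> sf; apply: filterS (filterI (near_coo sf) (near_img (coo_dom x))) => y [sy iy].
exact: (smooth_at_comp (smooth_at_cinv iy) sy).
Qed.

(** With a local section [sg] of [pi] through f(s x), both f o s and sg o pi o f o s lift the same
    map to [M]. Their P-valued quotient [k] is the gauge transformation, and the second lift factors
    through [xt], the coordinates of pi o f o s. *)
Lemma scales_curvature_vanishes : locally_bundle_of_scales p act omega -> curvature_vanishes.
Proof.
move=> loc U s x w ls Ux.
have [U0 [oU0 U0x [E [M [S [pi [q [act' [omega' [W [_ cart' _ _ iso]]]]]]]]]]] := loc x.
have [f [f' [b [b' [[sf _ _ _] _ _ _ fom]]]]] := iso.
have lieP := @lie_group_P R m.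
have nU : \forall z \near x, U z /\ U0 z.
  by apply: filterI; [exact: section_near ls Ux|exact: open_nbhs_nbhs].
have ns : \forall z \near x, smooth_at s z by apply: filterS nU => z [Uz _]; exact: section_smooth ls Uz.
have nf : \forall z \near x, smooth_at f (s z).
  by apply: filterS nU => z [Uz U0z]; move/smooth_map_onP: sf; apply; rewrite /= (section_proj ls Uz).
have ne : \forall z \near x, smooth_at (f \o s) z.
  by apply: filterS (filterI ns nf) => z [? ?]; exact: smooth_at_comp.
pose st := s \o cinv (chart_at x); pose et := (f \o s) \o cinv (chart_at x).
have nst := coo_smooth ns; have net := coo_smooth ne.
pose e0 := f (s x); have [U' [sg [U'e lsg sge]]] := section_through cart' e0.
pose c := chart_at (pi e0).
have spe (z : N) : smooth_at (f \o s) z -> smooth_at (pi \o (f \o s)) z.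
  by move=> h; exact: smooth_at_comp h (smooth_at_proj cart' _).
have e0E : et (coo x) = e0 by rewrite /et /= cooK.
pose xt := cmap c \o (pi \o et).
have npe : \forall z \near x, cdom c (pi (f (s z))) /\ U' (pi (f (s z))).
  have cpe := (spe x (nbhs_singleton ne)).1.
  apply: (near_map (f := pi \o (f \o s)) (A := fun z => cdom c z /\ U' z)) => //.
  by apply: filterI; [exact: near_dom (coo_dom _)|exact: section_near lsg U'e].
have sxt : smooth_near (coo x) xt.
  have [_] := spe x (nbhs_singleton ne).
  by [].
have xt0 : xt (coo x) = coo (pi e0) by rewrite /xt /= e0E.
pose sgt := sg \o cinv c.
have nsgt : \forall y \near coo (pi e0), smooth_at (sgt : Rman (mdim M) -> E) y.
  by apply: coo_smooth; apply: filterS (section_near lsg U'e) => z U'z; exact: section_smooth lsg U'z.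
have nsx : \forall y \near coo x, smooth_at (sgt \o xt : Rman (mdim N) -> E) y.
  have := smooth_near_cont sxt; rewrite /prop_for /continuous_at xt0 => /(_ _ nsgt) nsgt'.
  apply: filterS (filterI (smooth_near_near sxt) nsgt') => y [h1 h2].
  exact: (@smooth_at_comp R (Rman (mdim N)) (Rman (mdim M)) E xt sgt y (@smooth_at_Rman R (Rman (mdim N)) _ xt y h1) h2).
have Epi : \forall y \near coo x, pi ((sgt \o xt) y) = pi (et y).
  apply: filterS (near_coo npe) => y [d1 d2]; rewrite /sgt /xt /et /= chartK//.
  by rewrite (section_proj lsg).
have [k [sk Pk Ek]] := section_transition lieP cart' (nbhs_singleton nsx) (nbhs_singleton net) Epi.
have thE : \forall y \near coo x, forall u, pbf omega st y u = pbf omega' et y u.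
  apply: filterS (filterI nst (near_coo (filterI nU nf))) => y [h1 [[h2 h2'] h3]] u.
  rewrite /pbf /et.
  rewrite -fom; last by rewrite (section_proj ls h2).
  congr (omega' _); exact: (esym (@tmap_comp R (Rman (mdim N)) P E st f y u h1 h3)).
have th2 : \forall y \near coo x, forall u,
    k y *m pbf omega st y u = pbf omega' (sgt \o xt) y u *m k y + 'D_u k y.
  have nn : \forall y \near coo x, \forall z \near y, et z = act' ((sgt \o xt) z) (k z).
    exact: (near_join (Ek)).
  have nk : \forall y \near coo x, smooth_near y k by exact: smooth_near_near.
  have nP : \forall y \near coo x, \forall z \near y, grpP (k z) by exact: near_join.
  apply: filterS (filterI (filterI thE nn) (filterI (filterI nk nP) nsx)) => y [[h1 h2] [[h3 h4] h5]] u.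
  rewrite h1 (pbf_near_eq _ _ h2).
  have := @omega_act _ _ _ _ _ _ _ _ _ lieP cart' (Rman (mdim N)) (sgt \o xt) k y u h5 h3 h4.
  rewrite /pbf => ->; rewrite mulmxDr !mulmxA mulmxV ?mul1mx//.
  exact: grpP_unit (nbhs_singleton h4).
have fth : form_near (pbf omega st) (coo x) := form_near_pbf cartan_form nst.
have [_ so' _ _ _] := cart'.
have fB := form_near_pbf so' nsx.
have G := curv_gauge (Zfield p omega x) w fth fB sk th2.
(* The connection form of [E] on the image of Z fixes [L], so it lies in the Lie algebra of P with
   eigenvalue 1; hence the image is vertical over [M]. *)
have Dx : 'D_(Zfield p omega x) xt (coo x) = 0.
  have := @tmap_comp R (Rman (mdim N)) E M et pi (coo x) (Zfield p omega x) (nbhs_singleton net) (smooth_at_proj cart' _).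
  have -> : tmap (pi \o et : Rman (mdim N) -> M) (Zfield p omega x : tangent (coo x : Rman (mdim N))) = 'D_(Zfield p omega x) xt (coo x).
    by rewrite /tmap /xt /c /= e0E.
  move=> ->; apply: (tmap_proj_ker2 lieP cart'); split; first exact: (omega_skew cart').
  exists 1; rewrite scale1r -[omega' _ _]/(pbf omega' et (coo x) (Zfield p omega x)).
  rewrite -(nbhs_singleton thE) pbf_coo; exact: (Zfield_l cart ls Ux).
rewrite (curv_pbf_comp so' _ _ sxt) ?xt0// Dx curv0l ?mul0mx in G; last exact: form_near_pbf.
by apply: (can_inj (mulKmx (grpP_unit (nbhs_singleton Pk)))); rewrite G mulmx0.
Qed.

End ScalesToFlat.

(** * The tractor connection *)

Section TractorClasses.
Context {R : realType} {m : nat}.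
Variables (P N : manifold R) (p : P -> N) (act : P -> Lmat R m -> P).
Variable omega : forall u : P, tangent u -> Lmat R m.
Arguments omega : clear implicits.
Hypothesis cart : cartan_geometry (@grpH R m) p act omega.
Let lieH := @lie_group_H R m.
Local Notation Vec := (Lvec R m).
Local Notation tcl := (@tclass R m P act).

Let actM u k k' : grpH k -> grpH k' -> act (act u k) k' = act u (k *m k').
Proof. exact: (cartan_actM cart). Qed.

Lemma tclass_move u h (v : Vec) : grpH h -> tcl (act u h) v = tcl u (h *m v).
Proof.
move=> Hh; have uh := grpH_unit Hh; apply/seteqP; split=> [w [g Hg ->]|w [g Hg ->]].
  exists (h *m g); first exact: grpH_mul.
  rewrite actM//; congr (_, _); have := grpH_unit (grpH_mul Hh Hg) => ug.
  apply: (can_inj (mulKmx ug)); rewrite [RHS]mulmxA mulmxV// mul1mx -mulmxA; congr (_ *m _).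
  by rewrite mulmxA mulmxV ?mul1mx// grpH_unit.
exists (invmx h *m g); first by apply: grpH_mul => //; exact: grpH_inv.
have Hi : grpH (invmx h *m g) by apply: grpH_mul => //; exact: grpH_inv.
rewrite actM// (mulmxA h) mulmxV// mul1mx; congr (_, _).
apply: (can_inj (mulKmx (grpH_unit Hi))); rewrite [RHS]mulmxA mulmxV ?grpH_unit// mul1mx.
by rewrite -mulmxA (mulmxA g) mulmxV ?grpH_unit// mul1mx mulmxA mulVmx// mul1mx.
Qed.

Lemma tclass_mem u (v v' : Vec) : tcl u v (u, v') -> v' = v.
Proof.
move=> [h Hh [E ->]].
have : 1%:M = h by apply: (act_free lieH cart (u := u)) => //; [exact: grpH1|rewrite (cartan_act1 cart)].
by move=> <-; rewrite invmx1 mul1mx.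
Qed.

Lemma tclass_refl u (v : Vec) : tcl u v (u, v).
Proof. by exists 1%:M; [exact: grpH1|rewrite (cartan_act1 cart) invmx1 mul1mx]. Qed.

Lemma tcoord_tclass u (v : Vec) : tcoord (tcl u v) u = v.
Proof.
rewrite /tcoord; case: xgetP => [v' _ /tclass_mem //|/(_ v) []]; exact: tclass_refl.
Qed.

Lemma tcoord_move u h (v : Vec) : grpH h -> tcoord (tcl u v) (act u h) = invmx h *m v.
Proof.
move=> Hh; rewrite -[in LHS](mulKVmx (grpH_unit Hh) v) -tclass_move//.
exact: tcoord_tclass.
Qed.

Lemma tsub_tclass u (a b : Vec) : tsub (tcl u a) (tcl u b) = tcl u (a - b).
Proof.
apply/seteqP; split=> [[u' v] [v1 [v2 [/= h1 h2 ->]]]|[u' v] [h Hh [-> ->]]].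
  move: h1 h2 => [h Hh [-> ->]] [h' Hh' [E ->]].
  rewrite -(act_free lieH cart Hh Hh' E); exists h => //.
  by rewrite mulmxBr.
exists (invmx h *m a), (invmx h *m b); split; [by exists h|by exists h|].
by rewrite /= mulmxBr.
Qed.

Lemma tzero_tclass u : tzero p (p u) = tcl u 0.
Proof.
apply/seteqP; split=> [[u' v] [/= pu /= ->]|[u' v] [h Hh [-> ->]]].
  have [h Hh ->] := act_trans lieH cart (esym pu).
  by exists h => //; rewrite mulmx0.
by split; rewrite /= ?(cartan_proj_act cart)// mulmx0.
Qed.

Lemma tclass_inj u (v v' : Vec) : tcl u v = tcl u v' -> v = v'.
Proof. by move=> E; apply/esym/(@tclass_mem u); rewrite E; exact: tclass_refl. Qed.

(** All members of the union in [nabla] coincide. A change of section by [k] multiplies the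
    components by k^-1 and adds k^-1 dk to the conjugated form; the Leibniz rule for k f' = f makes
    the additional terms cancel. *)
Lemma nablaE (W : vfield N) (T : N -> set (P * Vec)%type) U s (f : N -> Vec) x :
  local_section p U s -> U x -> (\forall y \near x, T y = tcl (s y) (f y)) -> smooth_funat f x ->
  nabla p act omega W T x = tcl (s x) (dfun f (W x) + omega (s x) (tmap s (W x)) *m f x).
Proof.
move=> ls Ux Tf sf.
have inv U' s' : local_section p U' s' -> U' x -> let f' y := tcoord (T y) (s' y) in
  tcl (s' x) (dfun f' (W x) + omega (s' x) (tmap s' (W x)) *m f' x) =
  tcl (s x) (dfun f (W x) + omega (s x) (tmap s (W x)) *m f x).
  move=> ls' U'x f'.
  have ss := section_smooth ls Ux; have ss' := section_smooth ls' U'x.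
  have E : \forall z \near x, p (s z) = p (s' z).
    apply: filterS (filterI (section_near ls Ux) (section_near ls' U'x)) => z [Uz U'z].
    by rewrite (section_proj ls Uz) (section_proj ls' U'z).
  have [k [sk Hk Ek]] := section_transition lieH cart ss ss' E.
  have Ef : \forall z \near x, k z *m f' z = f z.
    apply: filterS (filterI (filterI Hk Ek) Tf) => z [[Hz Ez] Tz].
    by rewrite /f' Tz Ez tcoord_move// mulKVmx ?grpH_unit.
  have Hkx := nbhs_singleton Hk; have ukx := grpH_unit Hkx.
  have sf' : smooth_funat f' x.
    apply: (@smooth_funat_near_eq _ _ _ (fun z => invmx (k z) *m f z)).
      by apply: filterS (filterI Hk Ef) => z [Hz <-]; rewrite mulKmx ?grpH_unit.
    apply: smooth_near_mulmx sf; apply: smooth_near_invmx sk _.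
    by rewrite /= cooK.
  have Df : dfun k (W x) *m f' x + k x *m dfun f' (W x) = dfun f (W x).
    rewrite -(dfun_near_eq (W x) Ef) /dfun.
    have := derive_mulmx (W x) (smooth_near_diff sk) (smooth_near_diff sf').
    by rewrite /= cooK => <-.
  rewrite (nbhs_singleton Ek) tclass_move//; congr (tcl _ _).
  have := omega_act lieH cart (W x) ss sk Hk.
  have -> : omega (act (s x) (k x)) (tmap (fun z => act (s z) (k z)) (W x)) = omega (s' x) (tmap s' (W x)).
    apply: omega_congr; first by rewrite (nbhs_singleton Ek).
    by apply: tmap_near_eq; apply: filterS Ek => z ->.
  rewrite (nbhs_singleton Ek) => ->.
  rewrite mulmxDr mulmxDl mulmxDr !mulmxA mulmxV// mul1mx -!mulmxA.
  by rewrite mul1mx -Df -(nbhs_singleton Ef) addrA addrC addrA addrAC -addrA.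
apply/seteqP; split=> [w [U' [s' [U'x ls']]]|w].
  by have := inv _ _ ls' U'x; cbv zeta => <-.
by move=> H; exists U, s; split => //; have := inv _ _ ls Ux; cbv zeta => ->.
Qed.

End TractorClasses.

(** * Families of linear maps and vector fields in coordinates *)

Section LinearFamilies.
Context {R : realType}.

Lemma smooth_near_sumf (V W : normedModType R) k (F : 'I_k -> V -> W) y :
  (forall i, smooth_near y (F i)) -> smooth_near y (fun z => \sum_i F i z).
Proof.
move=> sF; elim: (index_enum _) => [|i r IH].
  by apply: smooth_near_eq (smooth_near_cst _ y); near=> t; rewrite big_nil.
apply: (@smooth_near_eq _ _ _ (fun z => F i z + \sum_(i <- r) F i z)).
  by near=> t; rewrite big_cons.
by apply: smooth_near2 (sF i) IH => O' oO'; exact: smooth_add.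
Unshelve. all: by end_near. Qed.

Lemma smooth_near_linfam n k (W : normedModType R) (L : 'rV[R]_n -> 'rV[R]_k -> W) (X : 'rV[R]_n -> 'rV[R]_k) y :
  (\forall z \near y, linear (L z)) -> (forall w, smooth_near y (fun z => L z w)) ->
  smooth_near y X -> smooth_near y (fun z => L z (X z)).
Proof.
move=> lL sL sX.
apply: (@smooth_near_eq _ _ _ (fun z => \sum_i X z 0 i *: L z (delta_mx 0 i))).
  apply: filterS lL => z lz; rewrite [in RHS](row_sum_delta (X z)); pose Lz := mklin lz.
  by rewrite -[L z]/(Lz : _ -> _) linear_sum; apply: eq_bigr => i _; rewrite linearZ.
apply: smooth_near_sumf => i.
have sc : smooth_near y (fun z => X z 0 i) by apply: smooth_near1 sX => O' oO'; exact: smooth_coord.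
by apply: smooth_near2 sc (sL _) => O' oO'; exact: smooth_scale.
Qed.

End LinearFamilies.

Section VectorFieldCoordinates.
Context {R : realType}.
Variables (N : manifold R) (x : N).
Let c := chart_at x.

Lemma vfield_push (W : vfield N) y : (cmap c @` cdom c) y ->
  tmap (cinv c : Rman (mdim N) -> N) (vfield_in c W y : tangent (y : Rman (mdim N))) = W (cinv c y).
Proof.
move=> iy; have [dz zy] := chart_imgV iy; set z := cinv c y in dz zy *.
have s1 := smooth_at_chart dz; have s2 := smooth_at_cinv (chart_img dz).
have := @tmap_comp R N (Rman (mdim N)) N (cmap c) (cinv c) z (W z) s1 s2.
have -> : tmap (cinv c \o cmap c) (W z) = W z :> 'rV[R]_(mdim N).
  rewrite -[RHS](tmap_id (W z)); apply: tmap_near_eq.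
  by apply: filterS (near_dom dz) => z' dz'; rewrite /= chartK.
by move=> ->; apply: tmap_congr.
Qed.

Lemma vfield_in_coo (W : vfield N) : vfield_in c W (coo x) = W x.
Proof.
have H : vfield_in c W (coo x) = tmap (id : N -> N) (W x).
  by rewrite /vfield_in /tmap /c !cooK.
by rewrite H tmap_id.
Qed.

End VectorFieldCoordinates.

(** * The tractor curvature in a local frame *)

Section TractorCurvature.
Context {R : realType} {m : nat}.
Local Notation L := (vec_l R m).
Variables (P N : manifold R) (p : P -> N) (act : P -> Lmat R m -> P).
Variable omega : forall u : P, tangent u -> Lmat R m.
Arguments omega : clear implicits.
Hypothesis cart : cartan_geometry (@grpH R m) p act omega.
Let lieH := @lie_group_H R m.
Local Notation tcl := (@tclass R m P act).
Variables (U : set N) (s : N -> P) (x : N).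
Hypotheses (ls : local_section p U s) (Ux : U x).
Let c := chart_at x.
Let st := s \o cinv c.
Let A := pbf omega st.

Lemma near_section_coo : \forall y \near coo x, [/\ U (cinv c y), (cmap c @` cdom c) y & smooth_at (st : Rman (mdim N) -> P) y].
Proof.
have ns : \forall z \near x, smooth_at s z.
  by apply: filterS (section_near ls Ux) => z Uz; exact: section_smooth ls Uz.
have h1 := near_coo (section_near ls Ux); have h2 := near_img (coo_dom x); have h3 := coo_smooth ns.
by apply: filterS (filterI (filterI h1 h2) h3) => y [[? ?] ?].
Qed.

Lemma form_near_section : form_near A (coo x).
Proof.
by apply: form_near_pbf; [exact: cartan_form cart|apply: filterS near_section_coo => y []].
Qed.

Lemma pbf_push (W : vfield N) y : U (cinv c y) -> (cmap c @` cdom c) y ->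
  A y (vfield_in c W y) = omega (s (cinv c y)) (tmap s (W (cinv c y))).
Proof.
move=> Uy iy; rewrite /A /pbf; congr (omega _).
rewrite (@tmap_comp R (Rman (mdim N)) N P (cinv c) s y _ (smooth_at_cinv iy) (section_smooth ls Uy)).
by rewrite vfield_push.
Qed.

Lemma dfun_push (W : vfield N) (F : normedModType R) (f : N -> F) y : (cmap c @` cdom c) y ->
  smooth_funat f (cinv c y) ->
  dfun f (W (cinv c y)) = 'D_(vfield_in c W y) (f \o cinv c) y.
Proof.
move=> iy sf; rewrite -(vfield_push W iy).
by rewrite -(@dfun_comp R (Rman (mdim N)) N F (cinv c) f y _ (smooth_at_cinv iy) sf).
Qed.

Section Curv.
Variables (T : N -> set (P * Lvec R m)%type) (f : N -> Lvec R m).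
Hypotheses (Tf : forall y, U y -> T y = tcl (s y) (f y)) (sf : forall y, U y -> smooth_funat f y).
Let ft := f \o cinv c.
(** The covariant derivative in the frame [s], with the direction as a separate linear argument;
    [derive_linfam] then splits off the derivatives of the vector fields. *)
Let Lf y w := 'D_w ft y + A y w *m ft y.
Let g (X : vfield N) z := dfun f (X z) + omega (s z) (tmap s (X z)) *m f z.

Let nablag X z : U z -> nabla p act omega X T z = tcl (s z) (g X z).
Proof.
move=> Uz; apply: (nablaE cart _ ls Uz _ (sf Uz)).
by apply: filterS (section_near ls Uz) => y; exact: Tf.
Qed.

Let gE X : \forall y \near coo x, g X (cinv c y) = Lf y (vfield_in c X y).
Proof.
apply: filterS near_section_coo => y [Uy iy _].
by rewrite /g /Lf (dfun_push _ iy (sf Uy)) pbf_push.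
Qed.

Let sft : smooth_near (coo x) ft. Proof. exact: sf Ux. Qed.

Let linL : \forall z \near coo x, linear (Lf z).
Proof.
apply: filterS (filterI (form_near_section).1 (smooth_near_near sft)) => y [lA sy] a u v.
by rewrite /Lf lA (derive_lin _ _ _ (smooth_near_diff sy)) mulmxDl -scalemxAl scalerDr addrACA.
Qed.

Let sL w : smooth_near (coo x) (fun y => Lf y w).
Proof.
have s1 := smooth_near_D w sft; have s2 := smooth_near_mulmx ((form_near_section).2 w) sft.
by apply: smooth_near2 s1 s2 => O' oO'; exact: smooth_add.
Qed.

Let sg X : smooth_vfield X -> smooth_funat (g X) x.
Proof.
move=> sX; apply: (@smooth_near_eq _ _ _ (fun y => Lf y (vfield_in c X y))).
  by apply: filterS (gE X) => y /= <-.
by apply: smooth_near_linfam => //; exact: sX.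
Qed.

Let Dg X v : smooth_vfield X ->
  dfun (g X) (v : tangent x) = 'D_v (fun y => Lf y (X x)) (coo x) + Lf (coo x) ('D_v (vfield_in c X) (coo x)).
Proof.
move=> sX; have E2 := @derive_linfam _ _ _ _ Lf (vfield_in c X) (coo x) v linL (fun w => smooth_near_diff (sL w)) (smooth_near_diff (sX x)).
rewrite vfield_in_coo in E2; exact: etrans (derive_near_eq v (gE X)) E2.
Qed.

(** The derivatives of the vector fields enter through [Lf] and cancel against the bracket term. The
    derivatives of the components [f] cancel as well, the second ones by symmetry, and the curvature
    matrix acting on [f] remains. *)
Lemma tractor_curvatureE (V W : vfield N) : smooth_vfield V -> smooth_vfield W ->
  tractor_curvature p act omega V W T x = tcl (s x) (curv A (coo x) (V x) (W x) *m f x).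
Proof.
move=> sV sW; rewrite /tractor_curvature.
have nab X Y : smooth_vfield Y -> nabla p act omega X (nabla p act omega Y T) x =
    tcl (s x) (dfun (g Y) (X x) + omega (s x) (tmap s (X x)) *m g Y x).
  move=> sY; apply: (nablaE cart _ ls Ux _ (sg sY)).
  by apply: filterS (section_near ls Ux) => y Uy; exact: nablag.
rewrite !nab// nablag// !(tsub_tclass cart); congr (tcl _ _).
have gx X : g X x = Lf (coo x) (X x).
  by rewrite -(vfield_in_coo x X) -(nbhs_singleton (gE X)) /c cooK.
have Ax (v : tangent x) : omega (s x) (tmap s v) = A (coo x) v by rewrite /A pbf_coo.
have DL v w : 'D_v (fun y => Lf y w) (coo x) = 'D_v (fun y => 'D_w ft y) (coo x) +
    ('D_v (fun y => A y w) (coo x) *m f x + A (coo x) w *m 'D_v ft (coo x)).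
  have dA := smooth_near_diff ((form_near_section).2 w).
  have df := smooth_near_diff sft.
  have d1 := smooth_near_diff (smooth_near_D w sft); have d2 := diff_mulmx dA df.
  apply: (etrans (derive_addf v d1 d2)); congr (_ + _).
  by rewrite derive_mulmx// /ft /= cooK.
have Lfx w : Lf (coo x) w = 'D_w ft (coo x) + A (coo x) w *m f x by rewrite /Lf {2}/ft /= cooK.
have lL := nbhs_singleton linL.
have [U0 [oO Oy sO]] := sft; have sch v w := schwarz v w oO Oy sO.
have DgV := Dg (V x) sW; have DgW := Dg (W x) sV; have gL := gx (lie_bracket V W).
have gV := gx V; have gW := gx W; have AV := Ax (V x); have AW := Ax (W x).
clear nab gx Ax.
clearbody g Lf.
rewrite DgV DgW gL gV gW AV AW.
rewrite /lie_bracket -/c.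
have LB (a b : 'rV[R]_(mdim N)) : Lf (coo x) (a - b) = Lf (coo x) a - Lf (coo x) b.
  by rewrite -(scaleN1r b) (addrC a) lL scaleN1r addrC.
rewrite LB.
move: ('D_(V x) (vfield_in c W) (coo x)) ('D_(W x) (vfield_in c V) (coo x)) => dVW dWV.
move: (Lf (coo x) dVW) (Lf (coo x) dWV) => LdVW LdWV {dVW dWV}.
rewrite !DL !Lfx (sch (V x) (W x)) /curv.
move: ('D_(W x) (fun y => 'D_(V x) ft y) (coo x)) => S.
move: ('D_(V x) (fun y => A y (W x)) (coo x)) ('D_(W x) (fun y => A y (V x)) (coo x)) => DA1 DA2.
move: ('D_(V x) ft (coo x)) ('D_(W x) ft (coo x)) (A (coo x) (V x)) (A (coo x) (W x)) => dfV dfW aV aW.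
rewrite !(mulmxDl, mulmxDr, mulNmx, mulmxBl) !mulmxA.
move: (DA1 *m f x) (DA2 *m f x) (aW *m dfV) (aV *m dfW) (aV *m aW *m f x) (aW *m aV *m f x) => a1 a2 a3 a4 a5 a6.
by mxring.
Qed.

End Curv.

End TractorCurvature.

(** * Smoothness of Z *)

Section ReebSmooth.
Context {R : realType} {m : nat}.
Local Notation L := (vec_l R m).

(* As Y + h |-> Y l is well defined and injective, [red (Y l)] represents Y + h in g/h = R * R^m. *)
Definition red (v : Lvec R m) : 'rV[R]_(1 + m) := row_mx (usubmx v)^T (usubmx (dsubmx v))^T.

Lemma red_linear : linear red.
Proof. by move=> a u v; apply/rowP => j; rewrite !mxE; case: fintype.split => k; rewrite !mxE. Qed.

Lemma red_lie_elt a X (z : 'rV[R]_m) A : red (lie_elt a X z A *m L) = row_mx a%:M X^T.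
Proof. by rewrite mul_lie_elt_l /red col_mxKu col_mxKd col_mxKu tr_scalar_mx. Qed.

Lemma red_inj Y : skew Y -> red (Y *m L) = 0 -> Y *m L = 0.
Proof.
move=> /lie_gP [a [X [z [A [_ ->]]]]]; rewrite red_lie_elt => /eqP; rewrite row_mx_eq0 => /andP[/eqP a0 /eqP X0].
by rewrite mul_lie_elt_l a0 -(trmxK X) X0 trmx0 !col_mx0.
Qed.

Lemma red_l : red L = row_mx 1%:M 0.
Proof. by rewrite /red /vec_l col_mxKu col_mxKd raddf0 trmx0 trmx1. Qed.

Lemma red_surj (r : 'rV[R]_(1 + m)) : exists2 Y : Lmat R m, lie_g Y & red (Y *m L) = r.
Proof.
exists (lie_elt (lsubmx r 0 0) (rsubmx r)^T 0 0); first by apply: ex_intro; do 3 apply: ex_intro; split; [|reflexivity]; rewrite trmx0 oppr0.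
by rewrite red_lie_elt -mx11_scalar trmxK hsubmxK.
Qed.

Variables (P N : manifold R) (p : P -> N) (act : P -> Lmat R m -> P).
Variable omega : forall u : P, tangent u -> Lmat R m.
Arguments omega : clear implicits.
Hypothesis cart : cartan_geometry (@grpH R m) p act omega.
Let lieH := @lie_group_H R m.
Variables (U : set N) (s : N -> P) (x : N).
Hypotheses (ls : local_section p U s) (Ux : U x).
Let c := chart_at x.
Let st := s \o cinv c.
Let A := pbf omega st.

(** The matrix, in chart coordinates, of the isomorphism of the tangent space with g/h given by the
    pulled-back form. *)
Definition frame_mx y : 'M[R]_(mdim N, 1 + m) := \matrix_(i, j) red (A y (delta_mx 0 i) *m L) 0 j.

Lemma mul_frame_mx y w : linear (A y) -> w *m frame_mx y = red (A y w *m L).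
Proof.
move=> lA; have lr : linear (fun w => red (A y w *m L)).
  by move=> a u v; rewrite lA mulmxDl -scalemxAl red_linear.
apply/rowP => j; rewrite mxE {2}(row_sum_delta w); pose Lr := mklin lr.
rewrite -[red _]/(Lr _) linear_sum summxE; apply: eq_bigr => i _.
by rewrite linearZ /= !mxE.
Qed.

Lemma smooth_frame_mx : smooth_near (coo x) frame_mx.
Proof.
have [lA sA] := form_near_section cart ls Ux.
have H i j : smooth_near (coo x) (fun y => frame_mx y i j).
  apply: (@smooth_near_eq _ _ _ (fun y => red (A y (delta_mx 0 i) *m L) 0 j)).
    by near=> y; rewrite [RHS]mxE.
  have s1 : smooth_near (coo x) (fun y => A y (delta_mx 0 i) *m L).
    by apply: smooth_near_mulmx; [exact: sA|exact: smooth_near_cst].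
  apply: smooth_near1 s1 => V oV sV; apply: smooth_coord => //.
  by apply: (smooth_comp_lin _ oV red_linear sV); exact: fdim_mx.
have /near_open [V [oV Vx HV]] : \forall y \near coo x, forall ij : 'I_(mdim N) * 'I_(1 + m), smooth_near y (fun y => frame_mx y ij.1 ij.2).
  apply: (@filter_forall _ _ (fun ij y => smooth_near y (fun y => frame_mx y ij.1 ij.2)) (nbhs (coo x)) _) => ij.
  exact: (@smooth_near_near _ _ _ (fun y => frame_mx y ij.1 ij.2) (coo x) (H _ _)).
exists V; split => //; apply: smooth_mx => // i j sq y Vy.
by have [V' [oV' V'y]] := HV y Vy (i, j); apply.
Unshelve. all: by end_near. Qed.

Lemma frame_mx_inj (w : 'rV[R]_(mdim N)) : w *m frame_mx (coo x) = 0 -> w = 0.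
Proof.
rewrite mul_frame_mx; last exact: nbhs_singleton (form_near_section cart ls Ux).1.
rewrite /A /st pbf_coo => h; apply: (section_form_inj lieH cart ls Ux).
apply/lie_hP; split; first exact: (omega_skew cart).
by apply: red_inj => //; exact: (omega_skew cart).
Qed.

(** [mdim N] and [1 + m] are not convertible, so the frame matrix is rectangular and both one-sided
    inverse identities are recorded. *)
Lemma frame_mx_inv : exists B : 'M[R]_(1 + m, mdim N),
  B *m frame_mx (coo x) = 1%:M /\ frame_mx (coo x) *m B = 1%:M.
Proof.
have H (j : 'I_(1 + m)) : exists w : 'rV[R]_(mdim N), w *m frame_mx (coo x) = delta_mx 0 j.
  have [Y gY Yr] := red_surj (delta_mx 0 j).
  have [w hw] := section_form_surj lieH cart ls Ux gY; exists w.
  rewrite mul_frame_mx; last exact: nbhs_singleton (form_near_section cart ls Ux).1.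
  rewrite /A /st pbf_coo -Yr; congr red; have [_] := (lie_hP _).1 hw.
  by rewrite mulmxBl => /eqP; rewrite subr_eq0 => /eqP.
pose w j := sval (cid (H j)); pose B : 'M[R]_(1 + m, mdim N) := \matrix_j w j.
have E : B *m frame_mx (coo x) = 1%:M.
  apply/row_matrixP => j; rewrite row_mul rowK row1; exact: svalP (cid (H j)).
exists B; split => //; apply/row_matrixP => i.
apply/eqP; rewrite -subr_eq0; apply/eqP; apply: frame_mx_inj.
by rewrite mulmxBl -!row_mul -mulmxA E mulmx1 mul1mx subrr.
Qed.

(** The coordinates of Z solve a linear system with coefficient matrix [frame_mx] and right-hand
    side [red L]. With [B] the inverse at the base point, both products of [B] and the frame matrix
    are invertible nearby, which solves the system smoothly. *)
Lemma smooth_Zfield : smooth_near (coo x) (vfield_in c (Zfield p omega)).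
Proof.
have [B [BF FB]] := frame_mx_inv; have sF := smooth_frame_mx.
have sBF : smooth_near (coo x) (fun y => B *m frame_mx y) by apply: smooth_near_mulmx sF; exact: smooth_near_cst.
have sFB : smooth_near (coo x) (fun y => frame_mx y *m B) by apply: smooth_near_mulmx sF _; exact: smooth_near_cst.
have u1 : B *m frame_mx (coo x) \in unitmx by rewrite BF unitmx1.
have u2 : frame_mx (coo x) *m B \in unitmx by rewrite FB unitmx1.
apply: (@smooth_near_eq _ _ _ (fun y => red L *m (invmx (B *m frame_mx y) *m B))); last first.
  apply: smooth_near_mulmx; first exact: smooth_near_cst.
  by apply: smooth_near_mulmx; [exact: smooth_near_invmx|exact: smooth_near_cst].
apply: filterS (filterI (filterI (near_unitmx sBF u1) (near_unitmx sFB u2)) (filterI (form_near_section cart ls Ux).1 (near_section_coo ls Ux))) => y [[v1 v2] [lA [Uy iy _]]].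
have Zl : vfield_in c (Zfield p omega) y *m frame_mx y = red L.
  by rewrite mul_frame_mx// /A /st /c (pbf_push _ ls _ Uy iy) (Zfield_l cart ls Uy).
apply: (can_inj (mulmxK v2)); rewrite [RHS]mulmxA Zl -!mulmxA; congr (_ *m _).
by rewrite (mulmxA B) mulKmx.
Qed.

End ReebSmooth.

(** * The tractor condition and the vanishing of the curvature matrix *)

Section CurvatureCondition.
Context {R : realType} {m : nat}.
Variables (P N : manifold R) (p : P -> N) (act : P -> Lmat R m -> P).
Variable omega : forall u : P, tangent u -> Lmat R m.
Arguments omega : clear implicits.
Hypothesis cart : cartan_geometry (@grpH R m) p act omega.
Let lieH := @lie_group_H R m.

Lemma smooth_vfield_Z : smooth_vfield (Zfield p omega).
Proof.
move=> x; have [U [s [tau [Ux ls _ _ _]]]] := cartan_triv cart x.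
exact: (smooth_Zfield cart ls Ux).
Qed.

Lemma tractor_section_rep (T : N -> set (P * Lvec R m)%type) u : tractor_section p act T ->
  T (p u) = tclass act u (tcoord (T (p u)) u).
Proof.
move=> [/(_ (p u)) [u' [v [pu ->]]] _]; have [h Hh ->] := act_trans lieH cart pu.
by rewrite (tcoord_move cart)// (tclass_move cart)// mulKVmx ?grpH_unit.
Qed.

Lemma curvature_vanishes_tractor : curvature_vanishes p omega ->
  forall (V : vfield N) (T : N -> set (P * Lvec R m)%type),
     smooth_vfield V -> tractor_section p act T ->
     forall x : N, tractor_curvature p act omega (Zfield p omega) V T x = tzero p x.
Proof.
move=> cv V T sV sT x; have [U [s [tau [Ux ls _ _ _]]]] := cartan_triv cart x.
have Tf y : U y -> T y = tclass act (s y) (tcoord (T y) (s y)).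
  by move=> Uy; have := tractor_section_rep (s y) sT; rewrite (section_proj ls Uy).
have sf y : U y -> smooth_funat (fun y => tcoord (T y) (s y)) y by case: sT => _ /(_ U s ls) h; exact: h.
apply: etrans (tractor_curvatureE cart ls Ux Tf sf smooth_vfield_Z sV) _.
by rewrite (cv U s x (V x) ls Ux) mul0mx -(tzero_tclass cart) (section_proj ls Ux).
Qed.

(** A cut-off in the chart at [x0], extended by zero. The image [K] of the closed ball outside which
    it vanishes is compact, hence closed as [N] is Hausdorff, so the extension is zero on an open
    set containing every point outside [O]. *)
Lemma manifold_bump (x0 : N) (O : set N) : open O -> O x0 -> exists b : N -> R,
  [/\ forall x, smooth_funat (b : N -> R) x, b x0 = 1, forall x, ~ O x -> b x = 0
    & forall x, ~ O x -> \forall z \near x, b z = 0].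
Proof.
move=> oO Ox0; pose c := chart_at x0; pose n := mdim N.
have nO : \forall y \near coo x0, (cmap c @` cdom c) y /\ O (cinv c y).
  by apply: filterI; [exact: near_img (coo_dom _)|apply: near_coo; exact: open_nbhs_nbhs].
have [d d0 Hd] := nbhs_norm nO.
(* The cut-off vanishes outside the ball of radius 2 r = d/2, which lies inside the ball where the
   chart and [O] are under control. *)
pose r := d / 4; have r0 : 0 < r by rewrite divr_gt0.
pose h (y : 'rV[R]_n) := bump r (y - coo x0).
have sh : smooth_on [set: 'rV[R]_n] h.
  apply: (@smooth_compT _ _ _ _ (fun y : 'rV[R]_n => y - coo x0)); first exact: openT.
    apply: smooth_sub; [exact: openT| |by apply: smooth_cst; exact: openT].
    by apply: smooth_linF => //; [exact: fdim_mx|exact: openT].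
  by apply: smooth_bump; exact: openT.
pose b z := if asbool (cdom c z) then h (cmap c z) else 0.
have bE z : cdom c z -> b z = h (cmap c z) by move=> dz; rewrite /b asboolT.
pose C : set 'rV[R]_n := [set y | `|y - coo x0| <= 2 * r].
have Cimg y : C y -> (cmap c @` cdom c) y /\ O (cinv c y).
  by move=> Cy; apply: Hd; apply: le_lt_trans Cy _; rewrite /r; lra.
have cC : compact C.
  have cB : compact [set y : 'rV[R]_n | `|y| <= 2 * r].
    apply: bounded_closed_compact.
      by exists (2 * r); split; [exact: num_real|move=> e re y /= yr; exact: le_trans yr (ltW re)].
    apply: (@preimage_closed _ _ (fun y : 'rV[R]_n => `|y|) [set e : R | e <= 2 * r]); last exact: closed_le.
    by move=> y _; exact: norm_continuous.
  have -> : C = (fun y => y + coo x0) @` [set y : 'rV[R]_n | `|y| <= 2 * r].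
    apply/seteqP; split=> [y Cy|_ [y yr <-]]; last by rewrite /C /= addrK.
    by exists (y - coo x0) => //; rewrite subrK.
  apply: continuous_compact => //; apply: continuous_subspaceT.
  apply: (@smooth_cont _ _ _ (fun y : 'rV[R]_n => y + coo x0)); apply: smooth_add; first exact: openT.
    by apply: smooth_linF => //; [exact: fdim_mx|exact: openT].
  by apply: smooth_cst; exact: openT.
pose K := cinv c @` C.
have cK : compact K.
  apply: continuous_compact => //; apply: continuous_subspaceW (cinv_cont (c := c)).
  by move=> y /Cimg [].
have oK : open (~` K) by rewrite openC; apply: compact_closed => //; exact: manifold_hausdorff.
have b0 z : ~ K z -> b z = 0.
  move=> nK; rewrite /b; case: asboolP => // dz; apply: bump_0 => //; rewrite leNgt; apply/negP => lt2.
  by apply: nK; exists (cmap c z); rewrite /= ?chartK//; exact: ltW.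
have KO z : K z -> cdom c z /\ O z.
  by move=> [y Cy <-]; have [iy Oy] := Cimg y Cy; have [] := chart_imgV iy.
have nb x : ~ O x -> \forall z \near x, b z = 0.
  move=> nOx; have nK : (~` K) x by move=> /KO [].
  by apply: filterS (open_nbhs_nbhs (conj oK nK)) => z; exact: b0.
exists b; split => //.
- move=> x; have [dx|nd] := pselect (cdom c x).
    apply: (@smooth_funat_near_eq _ _ _ (fun z => h (cmap c z))).
      by apply: filterS (near_dom dx) => z dz; rewrite bE.
    apply: (smooth_funat_post (F := cmap c) (G := h)); first exact: fdim_mx.
      by have [] := smooth_at_chart dx.
    exact: (smooth_near_on openT).
  have nK : (~` K) x by move=> /KO [].
  apply: (@smooth_funat_near_eq _ _ _ (fun=> 0)); last exact: smooth_funat_cst.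
  by apply: filterS (open_nbhs_nbhs (conj oK nK)) => z /b0 ->.
- by rewrite bE ?/h -/(coo x0) ?subrr ?bump_1 ?normr0 ?ltW//; exact: coo_dom.
- by move=> x nO'; exact: nbhs_singleton (nb x nO').
Qed.

(** The constant coordinate field [w] of the chart at [x], multiplied by [b]. The arbitrary values
    of the chart maps off the domain are harmless since [b] vanishes near every such point. *)
Lemma bump_vfield (x : N) (w : tangent x) (b : N -> R) : (forall z, smooth_funat b z) -> b x = 1 ->
  (forall z, ~ cdom (chart_at x) z -> \forall z' \near z, b z' = 0) ->
  exists V : vfield N, smooth_vfield V /\ V x = w.
Proof.
move=> sb bx nb; pose c := chart_at x.
pose V : vfield N := fun z => b z *: ('D_w (cmap (chart_at z) \o cinv c) (cmap c z) : 'rV[R]_(mdim N)).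
exists V; split; last first.
  rewrite /V bx scale1r -[RHS](tmap_id w); apply: derive_near_eq; near=> y.
  by [].
move=> x1; have [dx1|nd] := pselect (cdom c x1); last first.
  apply: (@smooth_near_eq _ _ _ (fun=> 0)); last exact: smooth_near_cst.
  have H1 : \forall z \near x1, b z = 0 /\ cdom (chart_at x1) z.
    by apply: filterI; [exact: nb|exact: near_dom (coo_dom x1)].
  apply: filterS (near_coo H1) => y [bz dz]; rewrite /vfield_in /V bz scale0r.
  exact: (esym (tmap0 (smooth_at_chart dz))).
set c1 := chart_at x1.
have H : \forall y \near coo x1, (b \o cinv c1) y *: 'D_w (cmap c1 \o cinv c) ((cmap c \o cinv c1) y) = vfield_in c1 V y.
  have H1 : \forall z \near x1, cdom c z /\ cdom c1 z.
    by apply: filterI; [exact: near_dom dx1|exact: near_dom (coo_dom x1)].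
  apply: filterS (near_coo H1) => y [dz dz1]; set z := cinv c1 y in dz dz1 *.
  have s1 := smooth_at_chart dz1; have s2 := smooth_at_cinv (chart_img dz).
  have -> : vfield_in c1 V y = tmap (cmap c1 : N -> Rman _) (V z) by [].
  have := tmap_linear (b z) ('D_w (cmap (chart_at z) \o cinv c) (cmap c z) : 'rV[R]_(mdim N)) 0 s1.
  rewrite addr0 (tmap0 s1) addr0 => ->; apply: (congr1 (fun v : 'rV[R]_(mdim N) => b z *: v)).
  have E : tmap (cinv c : Rman (mdim N) -> N) (w : tangent (cmap c z : Rman (mdim N))) = 'D_w (cmap (chart_at z) \o cinv c) (cmap c z) :> 'rV[R]_(mdim N).
    by rewrite /tmap chartK.
  have E2 : tmap (cmap c1 : N -> Rman (mdim N)) ('D_w (cmap (chart_at z) \o cinv c) (cmap c z) : tangent z) =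
     tmap (cmap c1 : N -> Rman (mdim N)) (tmap (cinv c : Rman (mdim N) -> N) (w : tangent (cmap c z : Rman (mdim N)))) :> 'rV[R]_(mdim N).
    exact: (@tmap_congr R N (Rman (mdim N)) (cmap c1) z _ _ _ (esym (chartK dz)) (esym E)).
  have s1' : smooth_at (cmap c1 : N -> Rman (mdim N)) (cinv c (cmap c z)) by rewrite chartK.
  exact: etrans (@tmap_comp R (Rman (mdim N)) N (Rman (mdim N)) (cinv c) (cmap c1) (cmap c z) w s2 s1') (esym E2).
apply: smooth_near_eq H _.
have st := transition_smooth (coo_dom x1) dx1.
apply: (@smooth_near2 _ _ _ _ _ (b \o cinv c1) (fun y => 'D_w (cmap c1 \o cinv c) ((cmap c \o cinv c1) y))).
- by move=> O' oO' ; exact: smooth_scale.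
- exact: sb.
apply: (@smooth_near_comp _ _ _ _ (cmap c \o cinv c1) (fun y => 'D_w (cmap c1 \o cinv c) y)) => //; first exact: fdim_mx.
by rewrite /= cooK; exact: (@smooth_near_D _ _ _ (cmap c1 \o cinv c) _ w (transition_smooth dx1 (coo_dom x1))).
Unshelve. all: by end_near. Qed.

(** The section with components b v in the frame [s], continued by zero; as [b] vanishes near every
    point outside [U], the continuation is smooth. *)
Lemma bump_tractor (U : set N) (s : N -> P) (v : Lvec R m) (b : N -> R) : local_section p U s ->
  (forall z, smooth_funat b z) -> (forall z, ~ U z -> b z = 0) ->
  (forall z, ~ U z -> \forall z' \near z, b z' = 0) ->
  exists T : N -> set (P * Lvec R m)%type,
    tractor_section p act T /\ forall z, U z -> T z = tclass act (s z) (b z *: v).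
Proof.
move=> ls sb b0 nb.
pose T z : set (P * Lvec R m)%type := if asbool (U z) then tclass act (s z) (b z *: v) else tzero p z.
have TU z : U z -> T z = tclass act (s z) (b z *: v) by move=> Uz; rewrite /T asboolT.
have T0 z : b z = 0 -> T z = tzero p z.
  rewrite /T; case: asboolP => // Uz ->; rewrite scale0r -(tzero_tclass cart) (section_proj ls Uz).
  by [].
exists T; split => //; split=> [z|U' s' ls' x1 U'x1].
  have [Uz|nUz] := pselect (U z).
    by exists (s z), (b z *: v); rewrite (section_proj ls Uz) TU.
  have [U0 [s0 [tau [U0z ls0 _ _ _]]]] := cartan_triv cart z.
  by exists (s0 z), 0; rewrite -(tzero_tclass cart) (section_proj ls0 U0z) T0 ?b0.
have nU' := section_near ls' U'x1.
have [Ux1|nUx1] := pselect (U x1); last first.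
  apply: (@smooth_funat_near_eq _ _ _ (fun=> 0)); last exact: smooth_funat_cst.
  apply: filterS (filterI nU' (nb _ nUx1)) => z [U'z bz].
  by rewrite T0// -(section_proj ls' U'z) (tzero_tclass cart) (section_proj ls' U'z) (tcoord_tclass cart).
have nU := section_near ls Ux1.
have E : \forall z \near x1, p (s z) = p (s' z).
  by apply: filterS (filterI nU nU') => z [Uz U'z]; rewrite (section_proj ls Uz) (section_proj ls' U'z).
have [k [sk Hk Ek]] := section_transition lieH cart (section_smooth ls Ux1) (section_smooth ls' U'x1) E.
apply: (@smooth_funat_near_eq _ _ _ (fun z => invmx (k z) *m (b z *: v))).
  apply: filterS (filterI (filterI Hk Ek) nU) => z [[Hz ->] Uz].
  by rewrite TU// (tcoord_move cart).
apply: smooth_near_mulmx; first by apply: smooth_near_invmx; [exact: sk|rewrite /= cooK; exact: grpH_unit (nbhs_singleton Hk)].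
apply: smooth_near1 (sb x1) => O' oO' sO; apply: smooth_scale => //; exact: smooth_cst.
Qed.

(** Cut-offs provide a global vector field and a global tractor section with arbitrary values at
    [x], and by [tractor_curvatureE] only these values matter. Letting [v] run over the basis
    vectors makes every column of the curvature matrix vanish. *)
Lemma tractor_curvature_vanishes : 
  (forall (V : vfield N) (T : N -> set (P * Lvec R m)%type),
     smooth_vfield V -> tractor_section p act T ->
     forall x : N, tractor_curvature p act omega (Zfield p omega) V T x = tzero p x) ->
  curvature_vanishes p omega.
Proof.
move=> H U s x w ls Ux.
have oO : open (U `&` cdom (chart_at x)) by apply: openI; [exact: section_open ls|exact: cdom_open].
have [b [sb bx b0 nb]] := manifold_bump oO (conj Ux (coo_dom x)).
have [|V [sV Vx]] := bump_vfield w sb bx.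
  by move=> z nz; apply: nb => -[].
suff Hv (v : Lvec R m) : curv (pbf omega (s \o cinv (chart_at x))) (coo x) (Zfield p omega x) w *m v = 0.
  apply/matrixP => i j; have := Hv (delta_mx j 0) => /matrixP/(_ i 0); rewrite -colE !mxE.
  by [].
have [||T [sT TU]] := bump_tractor v ls sb.
- by move=> z nz; apply: b0 => -[].
- by move=> z nz; apply: nb => -[].
have sf y : U y -> smooth_funat (fun z => b z *: v) y.
  by move=> _; apply: smooth_near1 (sb y) => O' oO' sO; apply: smooth_scale => //; exact: smooth_cst.
have := tractor_curvatureE cart ls Ux TU sf smooth_vfield_Z sV.
rewrite (H _ _ sV sT x) Vx bx scale1r -{1}(section_proj ls Ux) (tzero_tclass cart) => /(tclass_inj cart).
by move=> <-.
Qed.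

End CurvatureCondition.

Lemma open_preimage_smooth (R : realType) (V W : normedModType R) (A : set V) (B : set W) (f : V -> W) :
  open A -> open B -> smooth_on A f -> open (A `&` f @^-1` B).
Proof.
move=> oA oB sf; rewrite openE => y [Ay By]; apply: filterI; first exact: open_nbhs_nbhs.
have cf := differentiable_continuous (smooth_on_diff sf Ay).
exact: (cf _ (open_nbhs_nbhs (conj oB By))).
Qed.

(** * Cartan geometries on the trivial bundle R^m * P *)

Section Submanifold.
Context {R : realType} {V : normedModType R} {n : nat}.
(* [SE] is a submanifold of [V]: [Phi e] and [Psi e] are mutually inverse between [SE `&` G e] and
   [H e]. *)
Variables (SE : set V) (Phi : V -> V -> 'rV[R]_n) (Psi : V -> 'rV[R]_n -> V).
Variables (G : V -> set V) (H : V -> set 'rV[R]_n).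
Hypotheses (fV : fdim V) (oG : forall e, SE e -> open (G e)) (oH : forall e, SE e -> open (H e)).
Hypotheses (Ge : forall e, SE e -> G e e) (sPhi : forall e, SE e -> smooth_on (G e) (Phi e)).
Hypothesis sPsi : forall e, SE e -> smooth_on (H e) (Psi e).
Hypothesis PhiP : forall e v, SE e -> SE v -> G e v -> H e (Phi e v) /\ Psi e (Phi e v) = v.
Hypothesis PsiP : forall e y, SE e -> H e y -> [/\ SE (Psi e y), G e (Psi e y) & Phi e (Psi e y) = y].

Definition subm_carrier : topologicalType := set_type SE.
Local Notation T := subm_carrier.
Definition sval_ (e : T) : V := set_val e.

Lemma svalP (e : T) : SE (sval_ e). Proof. exact: set_valP. Qed.

Lemma sval_inj : injective sval_. Proof. exact: val_inj. Qed.

(** The default [d] serves for [v] outside [SE]; maps into the submanifold can thus be written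
    without carrying membership proofs. *)
Definition smk (d : T) (v : V) : T :=
  match pselect (SE v) with left h => exist _ v (mem_set h) | right _ => d end.

Lemma smkE d v : SE v -> sval_ (smk d v) = v.
Proof. by move=> Sv; rewrite /smk; case: pselect => // h; rewrite /sval_ set_valE. Qed.

Lemma sval_cont : continuous sval_.
Proof. exact: initial_continuous. Qed.

Lemma sval_nbhs (e : T) (A : set T) : nbhs e A -> exists2 B, nbhs (sval_ e) B & sval_ @^-1` B `<=` A.
Proof.
move=> /(@nbhs_interior _ e A); rewrite nbhsE => -[_ [[B oB <-] Be] BA].
exists B; first exact: open_nbhs_nbhs.
by move=> z /BA /interior_subset.
Qed.

Lemma cont_sub (S : topologicalType) (f : S -> T) x : {for x, continuous (fun z => sval_ (f z))} -> {for x, continuous f}.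
Proof. by move=> cf A /= /sval_nbhs [B nB BA]; apply: filterS BA _; exact: (cf B nB). Qed.

Section OneChart.
Variable e : T.
Let e' := sval_ e.
Let D := sval_ @^-1` (G e').
Let cm (z : T) := Phi e' (sval_ z).
Let ci y := smk e (Psi e' y).
Let Se : SE e' := svalP e.

Let img : cm @` D = H e'.
Proof.
apply/seteqP; split=> [_ [z Gz <-]|y Hy]; first by have [] := PhiP Se (svalP z) Gz.
have [Sy Gy Py] := PsiP Se Hy; exists (ci y); rewrite /D /cm /ci /= ?smkE//.
Qed.

Let oD : open D. Proof. by apply: open_comp; [move=> z _; exact: sval_cont|exact: oG]. Qed.
Let oI : open (cm @` D). Proof. by rewrite img; exact: oH. Qed.

Let cmK : {in D, cancel cm ci}.
Proof.
move=> z; rewrite inE => Gz; apply: sval_inj; rewrite /ci /cm.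
by have [_ ->] := PhiP Se (svalP z) Gz; rewrite smkE//; exact: svalP.
Qed.

Let cmc : {within D, continuous cm}.
Proof.
rewrite continuous_open_subspace// => z; rewrite inE => Gz; apply: continuous_comp; first exact: sval_cont.
exact: differentiable_continuous (smooth_on_diff (sPhi Se) Gz).
Qed.

Let cic : {within cm @` D, continuous ci}.
Proof.
rewrite img continuous_open_subspace; last exact: oH.
move=> y; rewrite inE => Hy; apply: cont_sub.
have cP : {for y, continuous (Psi e')} := differentiable_continuous (smooth_on_diff (sPsi Se) Hy).
have E : \forall z \near y, Psi e' z = sval_ (ci z).
  by apply: filterS (open_nbhs_nbhs (conj (oH Se) Hy)) => z Hz; rewrite /ci smkE//; have [] := PsiP Se Hz.
rewrite /prop_for /continuous_at -(nbhs_singleton E) => A nA.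
have nA' : \forall z \near y, A (Psi e' z) := cP A nA.
have h : \forall z \near y, A (sval_ (ci z)) by apply: filterS (filterI E nA') => z [<-].
exact: h.
Qed.

Definition subm_chart : chart R T n := Chart oD oI cmK cmc cic.

Lemma subm_img : cmap subm_chart @` cdom subm_chart = H (sval_ e). Proof. exact: img. Qed.

End OneChart.

Lemma subm_cinvE (e : T) y : H (sval_ e) y -> sval_ (cinv (subm_chart e) y) = Psi (sval_ e) y.
Proof. by move=> Hy; rewrite /= smkE//; have [] := PsiP (svalP e) Hy. Qed.

Let compat (x y : T) : smooth_on (cmap (subm_chart x) @` (cdom (subm_chart x) `&` cdom (subm_chart y)))
              (cmap (subm_chart y) \o cinv (subm_chart x)).
Proof.
have oO := open_preimage_smooth (oH (svalP x)) (oG (svalP y)) (sPsi (svalP x)).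
apply: (@smooth_on_sub _ _ _ (H (sval_ x) `&` Psi (sval_ x) @^-1` G (sval_ y))).
  move=> _ [z [/= Gx Gy] <-]; have [Hz Ez] := PhiP (svalP x) (svalP z) Gx.
  by split => //; rewrite /= Ez.
apply: (smooth_on_eq (f := fun z => Phi (sval_ y) (Psi (sval_ x) z))) => //.
  by move=> z [Hz Gz] /=; rewrite smkE//; have [] := PsiP (svalP x) Hz.
apply: (@smooth_comp _ _ _ _ _ (G (sval_ y)) (Psi (sval_ x)) (Phi (sval_ y))) => //.
- by apply: oG; exact: svalP.
- by move=> z [].
- by apply: smooth_on_sub (sPsi (svalP x)) => z [].
- by apply: sPhi; exact: svalP.
Qed.

Let hd : hausdorff_space T.
Proof.
move=> x y xy; apply: sval_inj; apply: norm_hausdorff => A B nA nB.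
by have [z [Az Bz]] := xy _ _ (sval_cont nA) (sval_cont nB); exists (sval_ z).
Qed.

Let sc : @second_countable T.
Proof. exact: second_countable_initial fV sval_cont sval_nbhs. Qed.

Definition subm : manifold R := @Manifold R T n subm_chart (fun e => Ge (svalP e)) compat hd sc.

Lemma subm_coo_H (e : subm) : H (sval_ e) (coo e).
Proof. by have := chart_img (coo_dom e); rewrite subm_img. Qed.

Let near_H (e : subm) : \forall y \near coo e, H (sval_ e) y.
Proof. by apply: open_nbhs_nbhs; split; [apply: oH; exact: svalP|exact: subm_coo_H]. Qed.

Lemma smooth_funat_sval (e : subm) : smooth_funat (sval_ : subm -> V) e.
Proof.
apply: (@smooth_near_eq _ _ _ (Psi (sval_ e))).
  by apply: filterS (near_H e) => y Hy; rewrite /= -/(subm_chart e) subm_cinvE.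
apply: smooth_near_on (sPsi (svalP e)); first by apply: oH; exact: svalP.
exact: subm_coo_H.
Qed.

Lemma smooth_at_subm (B : manifold R) (F : B -> subm) b : smooth_funat (fun z => sval_ (F z)) b -> smooth_at F b.
Proof.
move=> sF; split; first by apply: cont_sub; exact: smooth_funat_cont sF.
apply: (@smooth_near_comp _ _ _ _ (fun y => sval_ (F (cinv (chart_at b) y))) (Phi (sval_ (F b)))) => //.
rewrite cooK; apply: smooth_near_on (sPhi (svalP _)); first by apply: oG; exact: svalP.
by apply: Ge; exact: svalP.
Qed.

(** [Phi] is smooth on an open subset of [V] and undoes [Psi], so its derivative is a left inverse
    of the derivative of the inclusion. *)
Lemma dfun_sval_inj (e : subm) : injective (@dfun R subm V sval_ e).
Proof.
have K (v : tangent e) : 'D_(dfun (sval_ : subm -> V) v) (Phi (sval_ e)) (sval_ e) = v.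
  have dP : differentiable (Phi (sval_ e)) (sval_ e) := smooth_on_diff (sPhi (svalP e)) (Ge (svalP e)).
  have dv := smooth_near_diff (smooth_funat_sval e).
  have E0 : (sval_ \o cinv (chart_at e)) (coo e) = sval_ e := congr1 sval_ (cooK e).
  rewrite -[X in 'D__ _ X]E0 /dfun -(derive_comp v dv); last by rewrite E0.
  rewrite -[RHS](derive_id (coo e) v); apply: derive_near_eq.
  by apply: filterS (near_H e) => y Hy; rewrite /= -/(subm_chart e) subm_cinvE//; have [] := PsiP (svalP e) Hy.
by move=> v w E; rewrite -(K v) -(K w) E.
Qed.

End Submanifold.

(** * The adjoint action of P and linear coordinates on its Lie algebra *)

Section AdjointAction.
Context {R : realType} {m : nat}.
Local Notation J := (gram R m).
Local Notation L := (vec_l R m).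
Local Notation Mat := (Lmat R m).

Lemma skewD (Y Y' : Mat) : skew Y -> skew Y' -> skew (Y + Y').
Proof. by rewrite /skew => h h'; rewrite linearD /= mulmxDl mulmxDr addrACA h h' addr0. Qed.

Lemma skew_Ad k (Y : Mat) : isoJ k -> skew Y -> skew (invmx k *m Y *m k).
Proof.
move=> ik sY; rewrite /skew !trmx_mul.
have e1 : J *m invmx k = k^T *m J by rewrite isoJ_inv// !mulmxA gram_sq mul1mx.
have e2 : (invmx k)^T *m J = J *m k by rewrite -[LHS]trmxK trmx_mul trmxK tr_gram e1 trmx_mul trmxK tr_gram.
have -> : J *m (invmx k *m Y *m k) = k^T *m (J *m Y) *m k by rewrite !mulmxA e1.
have -> : k^T *m (Y^T *m (invmx k)^T) *m J = k^T *m (Y^T *m J) *m k by rewrite -!mulmxA e2 !mulmxA.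
by rewrite -mulmxDl -mulmxDr sY mulmx0 mul0mx.
Qed.

Lemma lie_p_Ad k (Y : Mat) : grpP k -> lie_p Y -> lie_p (invmx k *m Y *m k).
Proof.
move=> /grpPP [ik [c c0 kL]] [sY [a YL]]; split; first exact: skew_Ad.
exists a; rewrite -!mulmxA kL -!scalemxAr YL; apply: (can_inj (mulKmx (isoJ_unit ik))).
by rewrite !scalemxAr !mulmxA mulmxV ?(isoJ_unit ik)// mul1mx -!scalemxAr kL !scalerA mulrC.
Qed.

Lemma lie_pN (Y : Mat) : lie_p Y -> lie_p (- Y).
Proof.
move=> [sY [a YL]]; split; last by exists (- a); rewrite mulNmx YL scaleNr.
by rewrite -[- Y]sub0r; apply: skewB => //; rewrite /skew trmx0 mul0mx mulmx0 addr0.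
Qed.

(** As [L] is the first basis vector, the upper left entry is the factor by which [k] scales it. *)
Lemma grpP00 k : grpP k -> 0 < k 0 0 /\ k *m L = k 0 0 *: L.
Proof.
move=> /grpPP [_ [c c0 kL]].
have E : (k *m L) 0 0 = k 0 0.
  rewrite mxE (bigD1 0)//= vec_l00 mulr1 big1 ?addr0// => i i0.
  rewrite (_ : L i 0 = 0) ?mulr0// /vec_l mxE; case: fintype.splitP => j ij; last by rewrite mxE.
  by move: i0; rewrite (_ : i = 0) ?eqxx//; apply: val_inj; rewrite /= ij ord1.
by rewrite -E kL mxE vec_l00 mulr1.
Qed.

(* The kernel of [lie_p_eqs] is the Lie algebra of [grpP], on which [to_p] is a linear chart. *)
Definition lie_p_eqs (Y : Mat) : 'rV[R]_((1 + (m + 1)) * (1 + (m + 1)) + (m + 1)) :=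
  row_mx (mxvec (Y^T *m J + J *m Y)) (dsubmx (Y *m L))^T.

Lemma lie_p_eqs_linear : linear (lie_p_eqs \o vec_mx).
Proof.
move=> a u v; rewrite /lie_p_eqs /=; set A := vec_mx u; set B := vec_mx v.
have -> : vec_mx (a *: u + v) = a *: A + B by rewrite linearP.
have -> : (a *: A + B)^T *m J + J *m (a *: A + B) = a *: (A^T *m J + J *m A) + (B^T *m J + J *m B).
  rewrite linearP /= mulmxDl mulmxDr -scalemxAl -scalemxAr scalerDr.
  by rewrite addrACA.
have -> : dsubmx ((a *: A + B) *m L) = a *: dsubmx (A *m L) + dsubmx (B *m L).
  by rewrite mulmxDl -scalemxAl linearP.
by rewrite !linearP /= scale_row_mx add_row_mx.
Qed.

Lemma lie_p_eqsP Y : lie_p Y <-> lie_p_eqs Y = 0.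
Proof.
rewrite /lie_p_eqs; split=> [[sY [a YL]]|/eqP].
  by rewrite sY YL /vec_l scale_col_mx scaler0 col_mxKd trmx0 linear0 row_mx0.
rewrite row_mx_eq0 => /andP[/eqP h1 /eqP h2]; split.
  by apply: (can_inj mxvecK); rewrite h1 linear0.
exists (usubmx (Y *m L) 0 0); rewrite -[LHS]vsubmxK -[dsubmx _]trmxK h2 trmx0 /vec_l scale_col_mx scaler0.
by rewrite {1}[usubmx _]mx11_scalar scale_scalar_mx mulr1.
Qed.

Let eqs_mx := lin1_mx (mklin lie_p_eqs_linear).
Let basis_p := row_base (kermx eqs_mx).
Definition dim_p := \rank (kermx eqs_mx).
Definition of_p (y : 'rV[R]_dim_p) : Mat := vec_mx (y *m basis_p).
Definition to_p (Y : Mat) : 'rV[R]_dim_p := mxvec Y *m pinvmx basis_p.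

Let kerP u : (u <= kermx eqs_mx)%MS <-> lie_p (vec_mx u).
Proof.
split=> [/sub_kermxP h|/lie_p_eqsP h].
  by apply/lie_p_eqsP; rewrite -h mul_rV_lin1.
by apply/sub_kermxP; rewrite mul_rV_lin1.
Qed.

Lemma of_p_lie y : lie_p (of_p y).
Proof. by apply/kerP; apply: submx_trans (submxMl _ _) _; rewrite eq_row_base. Qed.

Lemma of_pK : cancel of_p to_p.
Proof. by move=> y; rewrite /of_p /to_p vec_mxK mulmxKp// row_base_free. Qed.

Lemma to_pK Y : lie_p Y -> of_p (to_p Y) = Y.
Proof.
move=> pY; rewrite /of_p /to_p mulmxKpV ?mxvecK//.
by rewrite eq_row_base; apply/kerP; rewrite mxvecK.
Qed.

Lemma of_p_linear : linear of_p.
Proof. by move=> a u v; rewrite /of_p mulmxDl -scalemxAl linearP. Qed.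

Lemma to_p_linear : linear to_p.
Proof. by move=> a u v; rewrite /to_p linearP /= mulmxDl -scalemxAl. Qed.

End AdjointAction.

Section ModelSpace.
Context {R : realType} {m : nat}.
Local Notation J := (gram R m).
Local Notation L := (vec_l R m).
Local Notation Mat := (Lmat R m).
Local Notation V := ('rV[R]_m * Mat)%type.
Local Notation d := (@dim_p R m).

(* The trivial bundle R^m * P, with the charts (x, e cay(Y)) |-> (x, Y) around [e]. *)
Definition model_set : set V := [set v | grpP v.2].
Definition model_Phi (e v : V) : 'rV[R]_(m + d) := row_mx v.1 (to_p (icay (invmx e.2 *m v.2))).
Definition model_Psi (e : V) (y : 'rV[R]_(m + d)) : V := (lsubmx y, e.2 *m cay (of_p (rsubmx y))).
Definition model_G (e : V) : set V := [set v | invmx e.2 *m v.2 + 1%:M \in unitmx].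
(** The entry (Y l) 0 0 is the eigenvalue a of Y on [L]. The second condition is |a| < 2, which by
    [cay_P] places the Cayley transform of Y in P. *)
Definition model_H (e : V) : set 'rV[R]_(m + d) := [set y | let Y := of_p (rsubmx y) in
  cayU Y \in unitmx /\ 0 < (1 - (Y *m L) 0 0 / 2) * (1 + (Y *m L) 0 0 / 2)].

Lemma model_fdim : fdim V. Proof. by apply: fdim_pair; exact: fdim_mx. Qed.

Lemma smooth_fst (W1 W2 U : normedModType R) (O : set U) (f : U -> W1 * W2) : fdim W1 -> fdim W2 ->
  open O -> smooth_on O f -> smooth_on O (fun y => (f y).1).
Proof. by move=> f1 f2 oO; apply: (@smooth_comp_lin _ _ _ _ _ fst) => //; exact: fdim_pair. Qed.

Lemma smooth_snd (W1 W2 U : normedModType R) (O : set U) (f : U -> W1 * W2) : fdim W1 -> fdim W2 ->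
  open O -> smooth_on O f -> smooth_on O (fun y => (f y).2).
Proof. by move=> f1 f2 oO; apply: (@smooth_comp_lin _ _ _ _ _ snd) => //; exact: fdim_pair. Qed.

Lemma smooth_on_id (U : normedModType R) (O : set U) : fdim U -> open O -> smooth_on O (fun y => y).
Proof. by move=> fU oO; apply: smooth_linF. Qed.

Lemma open_unitmx (U : normedModType R) k (f : U -> 'M[R]_k) : smooth_on setT f -> open [set y | f y \in unitmx].
Proof.
move=> sf; rewrite openE => y fy; apply: near_unitmx => //.
exact: (smooth_near_on openT).
Qed.

Lemma model_oG e : open (model_G e).
Proof.
apply: (@open_unitmx _ _ (fun v : V => invmx e.2 *m v.2 + 1%:M)).
apply: smooth_add; [exact: openT| |by apply: smooth_cst; exact: openT].
apply: smooth_mulmx; [exact: openT|by apply: smooth_cst; exact: openT|].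
apply: smooth_snd; [exact: fdim_mx|exact: fdim_mx|exact: openT|].
by apply: smooth_on_id; [exact: model_fdim|exact: openT].
Qed.

Let sY : smooth_on setT (fun y : 'rV[R]_(m + d) => of_p (rsubmx y)).
Proof.
apply: (@smooth_linF _ _ _ setT (fun y : 'rV[R]_(m + d) => of_p (rsubmx y))); [exact: fdim_mx|exact: openT|].
by move=> a u v; rewrite linearP /= of_p_linear.
Qed.

Let sU : smooth_on setT (fun y : 'rV[R]_(m + d) => cayU (of_p (rsubmx y))).
Proof.
apply: smooth_sub; [exact: openT|by apply: smooth_cst; exact: openT|].
by apply: smooth_scale; [exact: openT|apply: smooth_cst; exact: openT|exact: sY].
Qed.

Lemma model_oH e : open (model_H e).
Proof.
pose f (y : 'rV[R]_(m + d)) := (of_p (rsubmx y) *m L) 0 0.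
have oT : open [set: 'rV[R]_(m + d)] := openT.
have sf : smooth_on setT (fun y => f y / 2).
  apply: smooth_mul => //; last exact: smooth_cst.
  by apply: smooth_coord => //; apply: smooth_mulmx => //; exact: smooth_cst.
have sg : smooth_on setT (fun y => (1 - f y / 2) * (1 + f y / 2)).
  by apply: smooth_mul => //; [apply: smooth_sub|apply: smooth_add] => //; exact: smooth_cst.
rewrite openE => y [h1 h2]; apply: filterI.
  exact: (near_unitmx (f := fun y => cayU (of_p (rsubmx y))) (smooth_near_on oT I sU) h1).
exact: (near_gt0 (smooth_near_on oT I sg) h2).
Qed.

Lemma model_Ge e : model_set e -> model_G e e.
Proof.
move=> Pe; have ue := grpP_unit Pe; rewrite /model_G /= mulVmx// -mulr2n -scaler_nat.
by rewrite unitmxZ ?unitmx1// unitfE pnatr_eq0.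
Qed.

Lemma model_sPhi e : model_set e -> smooth_on (model_G e) (model_Phi e).
Proof.
move=> Pe; have oG := @model_oG e; have sid := smooth_on_id model_fdim oG.
apply: smooth_row_mx => //; first by apply: smooth_fst => //; exact: fdim_mx.
apply: (@smooth_comp_lin _ _ _ _ _ (@to_p R m)) => //; [exact: fdim_mx|exact: to_p_linear|].
apply: smooth_icay => //; apply: smooth_mulmx => //; first exact: smooth_cst.
by apply: smooth_snd => //; exact: fdim_mx.
Qed.

Lemma smooth_pair (W1 W2 U : normedModType R) (O : set U) (f : U -> W1) (g : U -> W2) : fdim W1 -> fdim W2 ->
  open O -> smooth_on O f -> smooth_on O g -> smooth_on O (fun y => (f y, g y)).
Proof.
move=> f1 f2 oO sf sg.
have l1 : linear (fun u : W1 => (u, 0 : W2)).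
  by move=> k u v; apply: injective_projections => //=; rewrite scaler0 addr0.
have l2 : linear (fun u : W2 => (0 : W1, u)).
  by move=> k u v; apply: injective_projections => //=; rewrite scaler0 addr0.
have s1 := smooth_comp_lin f1 oO l1 sf; have s2 := smooth_comp_lin f2 oO l2 sg.
apply: (smooth_on_eq oO _ (smooth_add oO s1 s2)) => y _.
by apply: injective_projections => /=; rewrite ?addr0 ?add0r.
Qed.

Lemma model_sPsi e : model_set e -> smooth_on (model_H e) (model_Psi e).
Proof.
move=> Pe; have oH := @model_oH e; apply: smooth_pair => //; [exact: fdim_mx|exact: fdim_mx| |].
  apply: (@smooth_linF _ _ _ _ (fun y : 'rV[R]_(m + d) => lsubmx y)) => //; [exact: fdim_mx|exact: linear_lsubmx].
apply: smooth_mulmx => //; first exact: smooth_cst.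
by apply: smooth_cay => //; [apply: smooth_on_sub sY|move=> y []].
Qed.

Lemma model_PhiP e v : model_set e -> model_set v -> model_G e v ->
  model_H e (model_Phi e v) /\ model_Psi e (model_Phi e v) = v.
Proof.
move=> Pe Pv Gv; have ue := grpP_unit Pe.
have Pk : grpP (invmx e.2 *m v.2) by apply: grpP_mul => //; exact: grpP_inv.
have [ik [c c0 kL]] := (grpPP _).1 Pk; have [_ [uU cK]] := icayK Gv.
have pY : lie_p (icay (invmx e.2 *m v.2)).
  by split; [exact: icay_skew|eexists; exact: icay_l kL].
rewrite /model_H /model_Psi /model_Phi /= row_mxKl row_mxKr to_pK// cK mulKVmx//; split; last by case: v {Pv Gv Pk ik kL uU cK pY}.
split => //; rewrite (icay_l Gv c0 kL) mxE vec_l00 mulr1.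
have c1 : c + 1 != 0 by rewrite gt_eqF// ltr_wpDl// ltW.
(* For the eigenvalue a = 2 (c - 1) / (c + 1) of the inverse Cayley transform the two factors are 2
   / (c + 1) and 2 c / (c + 1). *)
have -> : (1 - 2 * (c - 1) / (c + 1) / 2) * (1 + 2 * (c - 1) / (c + 1) / 2) = 4 * c / (c + 1) ^+ 2 by field.
by apply: divr_gt0; [apply: mulr_gt0|apply: exprn_gt0; rewrite ltr_wpDl// ltW].
Qed.

Lemma model_PsiP e y : model_set e -> model_H e y ->
  [/\ model_set (model_Psi e y), model_G e (model_Psi e y) & model_Phi e (model_Psi e y) = y].
Proof.
move=> Pe [uU a0]; have [sYy [a Ya]] := of_p_lie (rsubmx y); have ue := grpP_unit Pe.
have Ea : (of_p (rsubmx y) *m L) 0 0 = a by rewrite Ya mxE vec_l00 mulr1.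
rewrite Ea in a0; have [u1 cK] := cayK uU.
rewrite /model_set /model_G /model_Phi /model_Psi /= mulKmx// cK of_pK hsubmxK; split => //.
by apply: grpP_mul => //; exact: cay_P Ya a0.
Qed.

Definition model : manifold R :=
  subm model_fdim (fun e _ => @model_oG e) (fun e _ => @model_oH e) model_Ge model_sPhi model_sPsi model_PhiP model_PsiP.

End ModelSpace.

(** * The Cartan geometry of type (G, P) and its correspondence space *)

Section ModelGeometry.
Context {R : realType} {m : nat}.
Local Notation J := (gram R m).
Local Notation L := (vec_l R m).
Local Notation Mat := (Lmat R m).
Local Notation V := ('rV[R]_m * Mat)%type.
Local Notation d := (@dim_p R m).
Local Notation E := (@model R m).
Local Notation ev := (@sval_ R V (@model_set R m)).

Definition model_pt (x : 'rV[R]_m) (k : Mat) : E :=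
  smk (exist _ ((0 : 'rV[R]_m), (1%:M : Mat)) (mem_set (grpH_P (@grpH1 R m)))) (x, k).

Lemma model_ptE x k : grpP k -> ev (model_pt x k) = (x, k).
Proof. by move=> Pk; exact: smkE. Qed.

Lemma model_P (e : E) : grpP (ev e).2. Proof. exact: (svalP e). Qed.

Lemma model_ptK (e : E) : model_pt (ev e).1 (ev e).2 = e.
Proof. by apply: sval_inj; rewrite model_ptE; [case: (ev e)|exact: model_P]. Qed.

Definition model_act (e : E) (g : Mat) : E := smk e ((ev e).1, (ev e).2 *m g).

Lemma model_actE e g : grpP g -> ev (model_act e g) = ((ev e).1, (ev e).2 *m g).
Proof. by move=> Pg; apply: smkE; apply: grpP_mul => //; exact: model_P. Qed.

Definition model_proj (e : E) : @Rman R m := (ev e).1.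

(* Over each point, k H |-> ln (k 0 0) identifies P/H with R. *)
Definition model_scale (e : E) : @Rman R (1 + m) := row_mx (ln ((ev e).2 0 0))%:M (ev e).1.

Lemma smooth_ev (e : E) : smooth_funat (ev : E -> V) e.
Proof. exact: smooth_funat_sval. Qed.

Lemma smooth_at_model (B : manifold R) (F : B -> E) b : smooth_funat (fun z => ev (F z)) b -> smooth_at F b.
Proof. exact: smooth_at_subm. Qed.

Lemma smooth_near_fst (U W1 W2 : normedModType R) (f : U -> W1 * W2) y : fdim W1 -> fdim W2 ->
  smooth_near y f -> smooth_near y (fun z => (f z).1).
Proof. by move=> f1 f2; apply: smooth_near1 => O oO; exact: smooth_fst. Qed.

Lemma smooth_near_snd (U W1 W2 : normedModType R) (f : U -> W1 * W2) y : fdim W1 -> fdim W2 ->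
  smooth_near y f -> smooth_near y (fun z => (f z).2).
Proof. by move=> f1 f2; apply: smooth_near1 => O oO; exact: smooth_snd. Qed.

Lemma smooth_ev1 (e : E) : smooth_funat (fun z : E => (ev z).1) e.
Proof. by apply: smooth_near_fst (smooth_ev e); exact: fdim_mx. Qed.

Lemma smooth_ev2 (e : E) : smooth_funat (fun z : E => (ev z).2) e.
Proof. by apply: smooth_near_snd (smooth_ev e); exact: fdim_mx. Qed.

Lemma model_coo_H (e : E) : model_H (ev e) (coo e).
Proof. exact: subm_coo_H. Qed.

Lemma model_cinvE (e : E) y : model_H (ev e) y -> ev (cinv (chart_at e) y) = model_Psi (ev e) y.
Proof. exact: subm_cinvE. Qed.

Lemma model_Psi_coo (e : E) : model_Psi (ev e) (coo e) = ev e.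
Proof. by rewrite -model_cinvE ?cooK//; exact: model_coo_H. Qed.

(** Used with [Q] = P for the bundle over R^m and with [Q] = H for the correspondence space. In
    charts the action is right multiplication by an arbitrary matrix, restricted to the open set
    where the result stays in the target chart. *)
Lemma model_smooth_action (Q : set Mat) : (forall k, Q k -> grpP k) -> (forall k k', Q k -> Q k' -> Q (k *m k')) ->
  smooth_action Q model_act.
Proof.
move=> QP QM; split.
- move=> u; apply: sval_inj; rewrite model_actE; last exact: grpH_P grpH1.
  by rewrite mulmx1; case: (ev u).
- move=> u k k' Qk Qk'; apply: sval_inj; rewrite !model_actE//=; try by apply: QP => //; exact: QM.
  by rewrite mulmxA.
move=> u k Qk; pose e := ev u; pose e1 := ev (model_act u k).
pose f (w : 'rV[R]_(mdim E) * Mat) : V := ((model_Psi e w.1).1, (model_Psi e w.1).2 *m w.2).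
pose O1 : set ('rV[R]_(mdim E) * Mat) := [set w | model_H e w.1].
have fW : fdim ('rV[R]_(mdim E) * Mat)%type by apply: fdim_pair; exact: fdim_mx.
have oO1 : open O1.
  by apply: open_comp; [move=> w _; exact: cvg_fst|exact: model_oH].
have sf1 : smooth_on O1 (fun w => w.1) by apply: smooth_fst; [exact: fdim_mx|exact: fdim_mx|exact: oO1|exact: smooth_on_id].
have sf2 : smooth_on O1 (fun w => w.2) by apply: smooth_snd; [exact: fdim_mx|exact: fdim_mx|exact: oO1|exact: smooth_on_id].
have sP : smooth_on O1 (fun w => model_Psi e w.1).
  apply: (@smooth_comp _ _ _ _ O1 (model_H e) (fun w : 'rV[R]_(mdim E) * Mat => w.1) (model_Psi e)) => //; [exact: fdim_mx|exact: model_oH|].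
  exact: model_sPsi (model_P u).
have sf : smooth_on O1 f.
  apply: smooth_pair; [exact: fdim_mx|exact: fdim_mx|by []| |].
    by apply: smooth_fst sP => //; exact: fdim_mx.
  by apply: smooth_mulmx => //; apply: smooth_snd sP => //; exact: fdim_mx.
have fu : f (coo u, k) = e1.
  rewrite -[LHS]/((model_Psi e (coo u)).1, (model_Psi e (coo u)).2 *m k) model_Psi_coo /e1 model_actE//.
  exact: QP.
exists (O1 `&` f @^-1` model_G e1), (fun w => model_Phi e1 (f w)); split.
- by apply: open_preimage_smooth => //; exact: model_oG.
- split; first exact: model_coo_H.
  by rewrite /= fu; apply: model_Ge; exact: (model_P (model_act u k)).
- apply: (@smooth_comp _ _ _ _ _ (model_G e1) f (model_Phi e1)).
  + exact: model_fdim.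
  + by apply: open_preimage_smooth => //; exact: model_oG.
  + exact: model_oG.
  + by move=> w [].
  + by apply: smooth_on_sub sf => w [].
  + exact: model_sPhi (model_P (model_act u k)).
move=> y g [Hy Gy] Qg w.
have Ew : ev w = f (y, g) by rewrite /w model_actE ?model_cinvE//; exact: QP.
split; first by rewrite /= /subm_chart /= Ew.
by rewrite /= Ew.
Qed.

Lemma model_bundle : principal_bundle (@grpP R m) model_proj model_act.
Proof.
split.
- by apply/smooth_map_onP => e _; apply: smooth_at_Rman; exact: smooth_ev1.
- by apply: model_smooth_action => //; exact: grpP_mul.
- by move=> u k Pk; rewrite /model_proj model_actE.
move=> x; exists setT, (fun y => model_pt y 1%:M), (fun e => (ev e).2).
have P1 : grpP (1%:M : Mat) := grpH_P grpH1.
split => //.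
- split => //; first exact: openT.
    apply/smooth_map_onP => y _; apply: smooth_at_model; apply: smooth_Rman_funat.
    apply: (@smooth_near_eq _ _ _ (fun z => (z, 1%:M : Mat))).
      by near=> z; rewrite model_ptE.
    apply: smooth_near_pair; [exact: fdim_mx|exact: fdim_mx| |exact: smooth_near_cst].
    by apply: smooth_near_lin => //; exact: fdim_mx.
  by move=> y _; rewrite /model_proj model_ptE.
- by move=> u _; exact: smooth_ev2.
- move=> u _; split; first exact: model_P.
  have Pu := model_P u; apply: sval_inj; rewrite model_actE// model_ptE// mul1mx /model_proj.
  by case: (ev u).
- by move=> y k _ Pk; rewrite model_actE// model_ptE//= mul1mx.
Unshelve. all: by end_near. Qed.

(** The one-parameter group generated by [lie_elt 1 0 0 0]. It is a global section of P over P/H: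
    each k in P is the boost of ln (k 0 0) times an element of H. *)
Definition boost (t : R) : Mat := block_mx (expR t)%:M 0 0 (block_mx 1%:M 0 0 (expR (- t))%:M).

Lemma boost_l t : boost t *m L = expR t *: L.
Proof.
rewrite /boost /vec_l mul_block_col !mulmx0 !addr0 mulmx1 mul0mx scale_col_mx scaler0.
by rewrite scale_scalar_mx mulr1.
Qed.

Lemma boost_P t : grpP (boost t).
Proof.
apply/grpPP; split; last by exists (expR t); [exact: expR_gt0|exact: boost_l].
rewrite /isoJ -mulmxA /boost -[block_mx (expR t)%:M 0 0 _]/(boost t).
have -> : J *m boost t = block_mx 0 (row_mx 0 (expR (- t))%:M) (col_mx 0 (expR t)%:M) (block_mx 1%:M 0 0 0).
  by rewrite /boost -(row_mx0 _ 1 m 1) -(col_mx0 _ m 1 1) gram_mul.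
rewrite /boost tr_block_mx !trmx0 tr_block_mx !trmx0 trmx1 !tr_scalar_mx /gram mulmx_block.
rewrite !mul0mx !addr0 !add0r mulmx0 mul_mx_row mulmx0 mul_block_col !mul0mx !add0r mulmx0 addr0.
rewrite mulmx_block !mulmx0 !mul0mx !addr0 mulmx1 -!scalar_mxM -!expRD addrN addNr expR0.
by rewrite ?mulmx0 ?add0r.
Qed.

Lemma boost00 t : boost t 0 0 = expR t.
Proof.
have [_ E] := grpP00 (boost_P t).
have S (a : R) : (a *: L) 0 0 = a by rewrite mxE vec_l00 mulr1.
by have := congr1 (fun A : Lvec R m => A 0 0) (boost_l t); rewrite E !S.
Qed.

(** This form exhibits the smooth dependence on [t]; [lie_elt 0 0 0 1%:M] merely denotes the matrix
    with the identity as middle block. *)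
Lemma boostE t : boost t = lie_elt 0 0 0 1%:M + expR t *: block_mx 1%:M 0 0 0 + expR (- t) *: block_mx 0 0 0 (block_mx 0 0 0 1%:M).
Proof.
rewrite /boost /lie_elt !scale_block_mx !add_block_mx !scaler0 !scale_scalar_mx !mulr1 raddf0 !trmx0 !oppr0.
by rewrite row_mx0 col_mx0 !addr0 !add0r add_block_mx !addr0 !add0r.
Qed.

Lemma smooth_near_boost (U : normedModType R) (f : U -> R) y : smooth_near y f ->
  smooth_near y (fun z => boost (f z)).
Proof.
apply: smooth_near1 => O oO sf.
have sc (k : Lmat R m) (g : U -> R) : smooth_on O g -> smooth_on O (fun y => expR (g y) *: k).
  move=> sg; apply: smooth_scale => //; last exact: smooth_cst.
  by apply: (@smooth_comp _ _ _ _ O setT g (@expR R)) => //; [exact: fdimR|exact: openT|exact: smooth_expR].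
apply: (@smooth_on_eq _ _ _ _ (fun y => lie_elt 0 0 0 1%:M + expR (f y) *: block_mx 1%:M 0 0 0 + expR (- f y) *: block_mx 0 0 0 (block_mx 0 0 0 1%:M))) => //.
  by move=> z _; rewrite boostE.
apply: smooth_add => //; last by apply: sc; exact: smooth_opp.
by apply: smooth_add => //; [exact: smooth_cst|exact: sc].
Qed.

Lemma smooth_scale_coord (e : E) : smooth_funat (fun z : E => ln ((ev z).2 0 0)) e.
Proof.
have s1 : smooth_near (coo e) (fun y => (ev (cinv (chart_at e) y)).2 0 0).
  by apply: smooth_near1 (smooth_ev2 e) => O oO; exact: smooth_coord.
have p0 : 0 < (ev (cinv (chart_at e) (coo e))).2 0 0 by have [] := grpP00 (model_P (cinv (chart_at e) (coo e))).
apply: (@smooth_near_comp _ _ _ _ (fun y => (ev (cinv (chart_at e) y)).2 0 0) (@ln R)) => //; first exact: fdimR.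
exact: (@smooth_near_on _ _ _ _ _ _ (@open_gt R 0) p0 (@smooth_ln R)).
Qed.

Lemma grpH_scale00 (k h : Mat) : grpP k -> grpH h -> (k *m h) 0 0 = k 0 0.
Proof.
move=> Pk Hh; have [_ kL] := grpP00 Pk; have [_ hL] := (grpHP h).1 Hh.
have [_ khL] := grpP00 (grpP_mul Pk (grpH_P Hh)).
have S (a : R) : (a *: L) 0 0 = a by rewrite mxE vec_l00 mulr1.
by rewrite -(S ((k *m h) 0 0)) -khL -mulmxA hL kL S.
Qed.

Lemma boost_invH (k : Mat) : grpP k -> grpH (invmx (boost (ln (k 0 0))) *m k).
Proof.
move=> Pk; have [k0 kL] := grpP00 Pk; apply/grpHP; split.
  by apply: isoJ_mul; [apply: isoJ_invmx; apply: grpG_isoJ; case: (boost_P (ln (k 0 0)))|apply: grpG_isoJ; case: Pk].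
have u := grpP_unit (boost_P (ln (k 0 0))).
by apply: (can_inj (mulKmx u)); rewrite !mulmxA mulmxV// mul1mx kL boost_l lnK.
Qed.

Lemma model_correspondence : correspondence_space model_scale model_act.
Proof.
split.
- apply/smooth_map_onP => e _; apply: smooth_at_Rman.
  apply: (@smooth_near2 _ _ _ _ _ (fun y => (ln ((ev (cinv (chart_at e) y)).2 0 0))%:M : 'rV[R]_1)  (fun y => (ev (cinv (chart_at e) y)).1)).
  + by move=> O oO; exact: smooth_row_mx.
  + by apply: smooth_near1 (smooth_scale_coord e) => O oO; exact: smooth_scalar_mx.
  + exact: smooth_ev1.
- by apply: model_smooth_action; [exact: grpH_P|exact: grpH_mul].
- move=> u k Hk; have Pk := grpH_P Hk; rewrite /model_scale model_actE//=.
  by rewrite grpH_scale00//; exact: model_P.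
move=> x; exists setT, (fun y : 'rV[R]_(1 + m) => model_pt (rsubmx y) (boost (coord0 y))).
exists (fun e => invmx (boost (ln ((ev e).2 0 0))) *m (ev e).2); split => //.
- split => //; first exact: openT.
    apply/smooth_map_onP => y _; apply: smooth_at_model; apply: smooth_Rman_funat.
    apply: (@smooth_near_eq _ _ _ (fun z : 'rV[R]_(1 + m) => (rsubmx z, boost (coord0 z)))).
      by near=> z; rewrite model_ptE//; exact: boost_P.
    apply: smooth_near_pair; [exact: fdim_mx|exact: fdim_mx| |].
      by apply: smooth_near_lin; [exact: fdim_mx|exact: linear_rsubmx].
    apply: smooth_near_boost; apply: smooth_near_lin; [exact: fdim_mx|exact: linear_coord0].
  move=> y _; rewrite /model_scale model_ptE ?boost00 ?expRK; last exact: boost_P.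
  by rewrite /= /coord0 -mx11_scalar hsubmxK.
- move=> u _; apply: smooth_near_mulmx; last exact: smooth_ev2.
  apply: smooth_near_invmx; last by apply: grpP_unit; exact: boost_P.
  by apply: smooth_near_boost; exact: smooth_scale_coord.
- move=> u _; have Pu := model_P u; have Hu := boost_invH Pu; split => //.
  apply: sval_inj; rewrite model_actE; last exact: grpH_P.
  rewrite model_ptE; last exact: boost_P.
  rewrite /model_scale /= row_mxKr /coord0 row_mxKl mxE eqxx mulr1n mulKVmx; last by apply: grpP_unit; exact: boost_P.
  by case: (ev u).
- move=> y k _ Hk; have Pk := grpH_P Hk; have Pb := boost_P (coord0 y).
  rewrite model_actE// model_ptE//= grpH_scale00// boost00 expRK mulKmx//.
  exact: grpP_unit.
Unshelve. all: by end_near. Qed.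

Variable bt : 'rV[R]_m -> 'rV[R]_m -> Mat.
Hypotheses (bt_lin : forall x, linear (bt x)) (bt_smooth : forall w, smooth_on setT (fun x => bt x w)).
Hypotheses (bt_skew : forall x w, skew (bt x w)) (bt_inj : forall x w, lie_p (bt x w) -> w = 0).
Hypothesis bt_surj : forall x Y, lie_g Y -> exists w, lie_p (Y - bt x w).

(* The Cartan connection whose pull-back along the section x |-> (x, 1) is [bt]. *)
Definition model_omega (e : E) (v : tangent e) : Mat :=
  let k := (ev e).2 in let w := dfun (ev : E -> V) v in
  invmx k *m bt (ev e).1 w.1 *m k + invmx k *m w.2.

Lemma model_omegaE (e : E) (v : tangent e) (w : V) : dfun (ev : E -> V) v = w ->
  model_omega v = invmx (ev e).2 *m bt (ev e).1 w.1 *m (ev e).2 + invmx (ev e).2 *m w.2.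
Proof. by rewrite /model_omega => ->. Qed.

Lemma bt0 x : bt x 0 = 0.
Proof. by have := bt_lin x (-1) 0 0; rewrite scaler0 addr0 scaleN1r addNr. Qed.

Lemma smooth_model_omega (B : manifold R) (F : B -> E) b (v : tangent b) : smooth_funat (fun z => ev (F z)) b ->
  model_omega (tmap F v) = invmx (ev (F b)).2 *m bt (ev (F b)).1 (dfun (fun z => ev (F z)) v).1 *m (ev (F b)).2
     + invmx (ev (F b)).2 *m (dfun (fun z => ev (F z)) v).2.
Proof.
move=> sF; apply: model_omegaE.
by rewrite -(@dfun_comp R B E V F ev b v (smooth_at_model sF) (smooth_ev (F b))).
Qed.

(** The group component of a point always lies in P, so its logarithmic derivative lies in the Lie
    algebra of P. *)
Lemma model_tangent (e : E) (v : tangent e) : lie_p (invmx (ev e).2 *m (dfun (ev : E -> V) v).2).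
Proof.
have [_ tang _] := @lie_group_P R m.
have s2 := smooth_ev2 e.
have := tang _ (fun y => (ev (cinv (chart_at e) y)).2) (coo e) v (smooth_near_diff s2).
rewrite cooK; have -> : 'D_v (fun y => (ev (cinv (chart_at e) y)).2) (coo e) = (dfun (ev : E -> V) v).2.
  rewrite /dfun (@derive_comp_lin _ _ _ _ snd (fun y => ev (cinv (chart_at e) y)))//; first exact: model_fdim.
  exact: smooth_near_diff (smooth_ev e).
by apply; near=> y; exact: model_P.
Unshelve. all: by end_near. Qed.

Lemma model_omega_form : smooth_form model_omega.
Proof.
split=> [e a v w|e0 w].
  have := dfun_linear a v w (smooth_ev e) => E1.
  rewrite /model_omega E1 /= bt_lin !(mulmxDr, mulmxDl) -!(scalemxAr, scalemxAl) scalerDr.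
  exact: addrACA.
have nH : \forall y \near coo e0, model_H (ev e0) y.
  by apply: open_nbhs_nbhs; split; [exact: model_oH|exact: model_coo_H].
pose Ps := model_Psi (ev e0).
have sPs : smooth_near (coo e0) Ps.
  exact: (smooth_near_on (@model_oH R m (ev e0)) (model_coo_H e0) (model_sPsi (model_P e0))).
apply: (@smooth_near_eq _ _ _ (fun y => invmx (Ps y).2 *m bt (Ps y).1 ('D_w Ps y).1 *m (Ps y).2 + invmx (Ps y).2 *m ('D_w Ps y).2)).
  apply: filterS (filterI nH (filterI (smooth_near_near sPs) (near_img (coo_dom e0)))) => y [Hy [sy iy]].
  have Ey : ev (cinv (chart_at e0) y) = Ps y by exact: model_cinvE.
  have nHy : \forall z \near y, model_H (ev e0) z by apply: open_nbhs_nbhs; split; [exact: model_oH|].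
  have Ez : \forall z \near y, Ps z = ev (cinv (chart_at e0) z).
    by apply: filterS nHy => z Hz; rewrite model_cinvE.
  have s1 : smooth_funat (fun z : Rman _ => ev (cinv (chart_at e0) z)) (y : Rman (mdim E)).
    by apply: smooth_Rman_funat; exact: smooth_near_eq Ez sy.
  have := @smooth_model_omega (Rman (mdim E)) (cinv (chart_at e0)) y w s1.
  have -> : dfun (fun z : Rman _ => ev (cinv (chart_at e0) z)) (w : tangent (y : Rman (mdim E))) = 'D_w Ps y.
    exact: (esym (derive_near_eq w Ez)).
  by rewrite Ey => <-.
have s1 : smooth_near (coo e0) (fun y => (Ps y).1) by apply: smooth_near_fst => //; exact: fdim_mx.
have s2 : smooth_near (coo e0) (fun y => (Ps y).2) by apply: smooth_near_snd => //; exact: fdim_mx.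
have sD := smooth_near_D w sPs.
have si : smooth_near (coo e0) (fun y => invmx (Ps y).2).
  apply: smooth_near_invmx s2 _; rewrite /Ps model_Psi_coo; exact: grpP_unit (model_P e0).
have sb : smooth_near (coo e0) (fun y => bt (Ps y).1 ('D_w Ps y).1).
  apply: (@smooth_near_linfam _ _ _ _ (fun y => bt (Ps y).1)).
  - by near=> y; exact: bt_lin.
  - move=> u; apply: (@smooth_near_comp _ _ _ _ (fun y => (Ps y).1) (fun x => bt x u)) => //; first exact: fdim_mx.
    exact: (smooth_near_on openT I (bt_smooth u)).
  - by apply: smooth_near_fst sD; exact: fdim_mx.
apply: (@smooth_near2 _ _ _ _ _ (fun y => invmx (Ps y).2 *m bt (Ps y).1 ('D_w Ps y).1 *m (Ps y).2) (fun y => invmx (Ps y).2 *m ('D_w Ps y).2)).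
- by move=> O oO; exact: smooth_add.
- by apply: smooth_near_mulmx s2; exact: smooth_near_mulmx.
- by apply: smooth_near_mulmx => //; apply: smooth_near_snd => //; exact: fdim_mx.
Unshelve. all: by end_near. Qed.

Lemma invmx_prod (k g : Mat) : k \in unitmx -> g \in unitmx -> invmx (k *m g) = invmx g *m invmx k.
Proof.
move=> uk ug; have u : k *m g \in unitmx by rewrite unitmx_mul uk.
by apply: (can_inj (mulKmx u)); rewrite mulmxV// mulmxA mulmxK// mulmxV.
Qed.

Lemma mulVmxK (k A : Mat) : k \in unitmx -> k *m (invmx k *m A *m k) *m invmx k = A.
Proof. by move=> u; rewrite !mulmxA mulmxV// mul1mx -mulmxA mulmxV// mulmx1. Qed.

(** Solves the formula of [model_omega] for the group component: with b the value of [bt] on the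
    base component, the displayed vector yields the prescribed value [Y]. *)
Lemma Ad_split (k Y b : Mat) : k \in unitmx ->
  invmx k *m b *m k + invmx k *m (k *m (invmx k *m (k *m Y *m invmx k - b) *m k)) = Y.
Proof.
move=> u; rewrite mulKmx// mulmxBr mulmxBl addrC subrK.
by rewrite !mulmxA mulVmx// mul1mx mulmxKV.
Qed.

Lemma lie_p_AdV k (Y : Mat) : grpP k -> lie_p (invmx k *m Y *m k) -> lie_p Y.
Proof.
move=> Pk pY; have u := grpP_unit Pk.
rewrite -(mulVmxK Y u) -{1}(invmxK k); apply: lie_p_Ad => //; exact: grpP_inv.
Qed.

(** If the form vanishes on a vector, [bt] of its base component is conjugate to an element of p, so
    [bt_inj] kills that component and then the other. Conversely, [bt_surj] chooses the base
    component for the conjugate of Y, and a curve in P realizes the remaining element of p. *)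
Lemma model_omega_bij (e : E) : injective (@model_omega e) /\ range (@model_omega e) = @lie_g R m.
Proof.
set k := (ev e).2; set x := (ev e).1; have Pk : grpP k := model_P e; have uk := grpP_unit Pk.
have ik := grpG_isoJ Pk.1; split.
  have inj0 (v : tangent e) : model_omega v = 0 -> v = (0 : 'rV[R]_(mdim E)).
    rewrite /model_omega -/k -/x => /eqP; rewrite addr_eq0 => /eqP E0.
    have w1 : (dfun (ev : E -> V) v).1 = 0.
      by apply: (bt_inj (x := x)); apply: (lie_p_AdV Pk); rewrite E0; apply: lie_pN; exact: model_tangent.
    have w2 : (dfun (ev : E -> V) v).2 = 0.
      move: E0; rewrite w1 bt0 mulmx0 mul0mx => /esym/eqP; rewrite oppr_eq0 => /eqP h.
      by rewrite -(mulKVmx uk (dfun _ _).2) h mulmx0.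
    apply: (@dfun_sval_inj _ _ _ _ _ _ _ _ (@model_fdim R m) (fun e _ => @model_oG R m e) (fun e _ => @model_oH R m e) (@model_Ge R m) (@model_sPhi R m) (@model_sPsi R m) (@model_PhiP R m) (@model_PsiP R m) e).
    transitivity (0 : V); first by apply: injective_projections.
    have := dfun_linear (-1) 0 0 (smooth_ev e); rewrite !scaleN1r oppr0 addr0 addNr => E1.
    exact: esym E1.
  move=> v w E1; have [lin _] := model_omega_form.
  have := inj0 (v - w : 'rV[R]_(mdim E)); have := lin e (-1) w v.
  rewrite scaleN1r addrC => ->; rewrite E1 scaleN1r addNr => /(_ erefl) /eqP.
  by rewrite subr_eq0 => /eqP.
apply/seteqP; split=> [_ [v _ <-]|Y gY].
  apply/lie_gP; apply: skewD; first by apply: skew_Ad.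
  by have [] := model_tangent v.
have gAd : lie_g (k *m Y *m invmx k).
  apply/lie_gP; rewrite -{1}(invmxK k); apply: skew_Ad; first exact: isoJ_invmx.
  exact/lie_gP.
have [u pu] := bt_surj x gAd.
have [_ _ curves] := @lie_group_P R m.
have pY2 := lie_p_Ad Pk pu; have [gamma [sg Pg g0 Dg]] := curves _ pY2.
pose g (z : 'rV[R]_1) : V := (x + z 0 0 *: u, k *m gamma (z 0 0)).
pose F (z : Rman 1) : E := model_pt (g z).1 (g z).2.
have evF (z : Rman 1) : ev (F z) = g z by rewrite /F model_ptE//; exact: grpP_mul.
have lc : linear (fun z : 'rV[R]_1 => z 0 0 : R) by exact: linear_coord.
have oT1 : open [set: 'rV[R]_1] by exact: openT.
have sc : smooth_on [set: 'rV[R]_1] (fun z : 'rV[R]_1 => z 0 0) by apply: smooth_linF => //; exact: fdim_mx.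
have sg1 : smooth_on [set: 'rV[R]_1] (fun z : 'rV[R]_1 => x + z 0 0 *: u).
  by apply: smooth_add => //; [exact: smooth_cst|apply: smooth_scale => //; exact: smooth_cst].
have sgam : smooth_on [set: 'rV[R]_1] (fun z : 'rV[R]_1 => gamma (z 0 0)).
  by apply: (@smooth_comp _ _ _ _ setT setT (fun z : 'rV[R]_1 => z 0 0) gamma) => //; [exact: fdimR|exact: openT].
have sg2 : smooth_on [set: 'rV[R]_1] (fun z : 'rV[R]_1 => k *m gamma (z 0 0)).
  by apply: smooth_mulmx => //; exact: smooth_cst.
have sgg : smooth_on [set: 'rV[R]_1] g by apply: smooth_pair => //; exact: fdim_mx.
pose b : Rman 1 := (0 : 'rV[R]_1).
pose w1 : tangent b := (1%:M : 'rV[R]_1).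
have sF : smooth_funat (fun z => ev (F z)) b.
  apply: (@smooth_near_eq _ _ _ g); first by near=> z; rewrite -evF.
  exact: (smooth_near_on oT1).
have Fb : F b = e.
  by apply: sval_inj; rewrite evF /g /b !mxE g0 mulmx1 scale0r addr0 /x /k; case: (ev e).
have := @smooth_model_omega (Rman 1) F b w1 sF.
have D1 : 'D_(1%:M : 'rV[R]_1) (fun z : 'rV[R]_1 => z 0 0 : R) 0 = 1.
  by rewrite (is_diff_derive _ (is_diff_linF _ (@fdim_mx _ _ _) lc)) mxE eqxx.
have dd : differentiable (fun z : 'rV[R]_1 => z 0 0 : R) 0 := smooth_on_diff sc I.
have -> : dfun (fun z => ev (F z)) w1 = (u, k *m (invmx k *m (k *m Y *m invmx k - bt x u) *m k)).
  transitivity ('D_(1%:M : 'rV[R]_1) g 0).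
    by apply: (@derive_near_eq _ _ _ _ g); near=> z; rewrite -evF.
  rewrite derive_pair; [|exact: (smooth_on_diff sg1)|exact: (smooth_on_diff sg2)].
  congr (_, _).
    rewrite derive_addf; [|exact: differentiable_cst|]; last first.
      by apply: (smooth_on_diff (O := setT)) => //; apply: smooth_scale => //; exact: smooth_cst.
    rewrite derive_cst add0r (@derive_scale _ _ _ (fun z : 'rV[R]_1 => z 0 0) (fun=> u))//.
    by rewrite derive_cst D1 scaler0 scale1r ?addr0 ?add0r.
  rewrite derive_cst_mulmx; last exact: (smooth_on_diff sgam).
  rewrite (@derive_comp _ _ _ _ (fun z : 'rV[R]_1 => z 0 0) gamma)//; last exact: (smooth_on_diff sg).
  by rewrite D1 mxE Dg.
rewrite /= Fb -/k -/x => E1.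
exists (tmap F w1) => //; exact: etrans E1 (Ad_split _ _ uk).
Unshelve. all: by end_near. Qed.

Lemma model_cartan : cartan_geometry (@grpP R m) model_proj model_act model_omega.
Proof.
split; [exact: model_bundle|exact: model_omega_form|exact: model_omega_bij| |].
  move=> e g v Pg; have ug := grpP_unit Pg; have uk := grpP_unit (model_P e).
  have sF : smooth_funat (fun z => ev (model_act z g)) e.
    apply: (@smooth_near_eq _ _ _ (fun y => ((ev (cinv (chart_at e) y)).1, (ev (cinv (chart_at e) y)).2 *m g))).
      by near=> y; rewrite /= model_actE.
    apply: smooth_near_pair; [exact: fdim_mx|exact: fdim_mx|exact: smooth_ev1|].
    by apply: smooth_near_mulmx; [exact: smooth_ev2|exact: smooth_near_cst].
  rewrite (smooth_model_omega v sF).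
  have -> : dfun (fun z => ev (model_act z g)) v = ((dfun (ev : E -> V) v).1, (dfun (ev : E -> V) v).2 *m g).
    transitivity ('D_v (fun y => ((ev (cinv (chart_at e) y)).1, (ev (cinv (chart_at e) y)).2 *m g)) (coo e)).
      by apply: derive_near_eq; near=> y; rewrite /= model_actE.
    pose T (w : V) : V := (w.1, w.2 *m g).
    apply: (@derive_comp_lin _ _ _ _ T (fun y => ev (cinv (chart_at e) y))); first exact: model_fdim.
      by move=> a w w'; apply: injective_projections => //=; rewrite mulmxDl -scalemxAl.
    exact: smooth_near_diff (smooth_ev e).
  rewrite model_actE//= /model_omega invmx_prod//.
  by rewrite mulmxDr mulmxDl !mulmxA.
move=> gamma e sg Pg g0; set k := (ev e).2; set x := (ev e).1.
have Pk : grpP k := model_P e; have uk := grpP_unit Pk.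
pose c (t : R) : V := (x, k *m gamma t).
have oTR : open [set: R] by exact: openT.
have sc : smooth_on [set: R] c.
  apply: smooth_pair => //; [exact: fdim_mx|exact: fdim_mx|exact: smooth_cst|].
  by apply: smooth_mulmx => //; exact: smooth_cst.
have c0 : c 0 = ev e by rewrite /c g0 mulmx1 /x /k; case: (ev e).
have Dc : 'D_1 c 0 = (0, k *m 'D_1 gamma 0).
  rewrite derive_pair; [|exact: differentiable_cst|by apply: diff_cst_mulmx; exact: (smooth_on_diff sg)].
  by rewrite derive_cst derive_cst_mulmx//; exact: (smooth_on_diff sg).
set v := (X in model_omega X).
have Ev : v = 'D_1 (fun t : R => model_Phi (ev e) (c t)) 0.
  by apply: (@derive_near_eq R R^o); near=> t; rewrite /= model_actE.
suff Dv : dfun (ev : E -> V) (v : tangent e) = (0, k *m 'D_1 gamma 0).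
  by rewrite (model_omegaE Dv) /= bt0 mulmx0 mul0mx add0r mulKmx.
have oG := @model_oG R m (ev e); have Gc : model_G (ev e) (c 0) by rewrite c0; exact: model_Ge (model_P e).
have dPhi : differentiable (model_Phi (ev e)) (c 0) := smooth_on_diff (model_sPhi (model_P e)) Gc.
have dc : differentiable c 0 := smooth_on_diff sc I.
have E0 : model_Phi (ev e) (c 0) = coo e.
  by rewrite c0.
have dPc : differentiable (fun t : R => model_Phi (ev e) (c t)) 0 by exact: differentiable_comp.
have De := smooth_near_diff (smooth_ev e).
rewrite /dfun Ev -Dc.
have := @derive_comp _ _ _ _ (fun t : R => model_Phi (ev e) (c t)) (ev \o cinv (chart_at e)) 0 1 dPc.
rewrite E0 => /(_ De) <-; apply: derive_near_eq.
have nG : \forall t \near (0 : R), model_G (ev e) (c t).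
  exact: (differentiable_continuous dc (open_nbhs_nbhs (conj oG Gc))).
apply: filterS nG => t Gt.
have Pc : model_set (c t) by rewrite /model_set /=; exact: grpP_mul.
have [Ht Et] := model_PhiP (model_P e) Pc Gt.
by rewrite /= model_cinvE.
Unshelve. all: by end_near. Qed.

End ModelGeometry.

(** * Descent of the Cartan connection *)

Section ParallelTransport.
Context {R : realType}.
Variable m : nat.
Local Notation e0 := (row_mx 1%:M 0 : 'rV[R]_(1 + m)).

Lemma row_mx_e0 (z : 'rV[R]_(1 + m)) : z = row_mx 0 (rsubmx z) + coord0 z *: e0.
Proof.
rewrite scale_row_mx add_row_mx scaler0 addr0 add0r scale_scalar_mx mulr1 /coord0 -mx11_scalar.
by rewrite hsubmxK.
Qed.

Lemma norm_slice (z : 'rV[R]_(1 + m)) : `|row_mx (0 : 'rV[R]_1) (rsubmx z)| <= `|z|.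
Proof. by apply: norm_row_mx_le; [rewrite normr0|exact: norm_rsubmx]. Qed.

Lemma line_const a b (f : 'rV[R]_(1 + m) -> 'M[R]_(a, b)) (r : R) z :
  (forall z, `|z| < r -> differentiable f z) -> (forall z, `|z| < r -> 'D_e0 f z = 0) ->
  `|z| < r -> f z = f (row_mx 0 (rsubmx z)).
Proof.
move=> df Df zr; apply/eqP; rewrite -subr_eq0 -normr_le0 {1}[z]row_mx_e0.
have Hr (t : R) : 0 <= t <= 1 -> `|row_mx 0 (rsubmx z) + t *: (coord0 z *: e0)| < r.
  move=> /andP[t0 t1]; apply: le_lt_trans zr.
  rewrite !scale_row_mx add_row_mx !scaler0 addr0 add0r; apply: norm_row_mx_le; last exact: norm_rsubmx.
  rewrite !normrZ (ger0_norm t0); apply: le_trans (_ : `|coord0 z| * `|1%:M : 'rV[R]_1| <= _); first by rewrite ler_piMl// mulr_ge0.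
  apply: le_trans (_ : `|coord0 z| <= _); first by rewrite ler_piMr//; apply: mx_norm_le => // i j; rewrite !ord1 mxE eqxx normr1.
  by rewrite /coord0; apply: le_trans (mx_norm_entry _ _ _) (norm_lsubmx _).
apply: mvt_norm => // t t01; first by apply: df; exact: Hr.
by rewrite derive_scalev ?Df ?scaler0 ?normr0//; [exact: Hr|apply: df; exact: Hr].
Qed.

Lemma norm_mulmx_le a b c (A : 'M[R]_(a, b)) (B : 'M[R]_(b, c)) : `|A *m B| <= b%:R * `|A| * `|B|.
Proof.
apply: mx_norm_le => [|i j]; first by rewrite !mulr_ge0.
rewrite mxE; apply: le_trans (ler_norm_sum _ _ _) _.
apply: le_trans (_ : \sum_(k < b) `|A| * `|B| <= _).
  by apply: ler_sum => k _; rewrite normrM; apply: ler_pM => //; exact: mx_norm_entry.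
by rewrite sumr_const card_ord -mulrA mulr_natl.
Qed.

Lemma norm_mxvec_le a b (A : 'M[R]_(a, b)) : `|mxvec A| <= `|A|.
Proof.
apply: mx_norm_le => // i j; rewrite ord1.
by case/mxvec_indexP: j => k l; rewrite mxvecE; exact: mx_norm_entry.
Qed.

Lemma norm_vec_mx_le a b (v : 'rV[R]_(a * b)) : `|vec_mx v| <= `|v|.
Proof. by apply: mx_norm_le => // i j; rewrite mxE; exact: mx_norm_entry. Qed.

(** For the pair (z, K) the equation is autonomous, with field (e0, K a(z)). This field has linear
    growth because [a] is bounded, and its flow starts on the slice with K = 1, the first coordinate
    being the time. *)
Lemma parallel_transport N (a : 'rV[R]_(1 + m) -> 'M[R]_N) (C : R) : smooth_on setT a -> 0 <= C -> (forall z, `|a z| <= C) ->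
  exists K : 'rV[R]_(1 + m) -> 'M[R]_N, [/\ smooth_on setT K, forall x, K (row_mx 0 x) = 1%:M
    & forall z, 'D_e0 K z = K z *m a z].
Proof.
move=> sa C0 aC.
pose Wf (y : 'rV[R]_((1 + m) + N * N)) := row_mx e0 (mxvec (vec_mx (rsubmx y) *m a (lsubmx y))).
have oT : open [set: 'rV[R]_((1 + m) + N * N)] by exact: openT.
have oT1 : open [set: 'rV[R]_(1 + m)] by exact: openT.
have sl : smooth_on setT (@lsubmx R 1 (1 + m) (N * N)) by apply: smooth_linF; [exact: fdim_mx|exact: oT|exact: linear_lsubmx].
have sr : smooth_on setT (@rsubmx R 1 (1 + m) (N * N)) by apply: smooth_linF; [exact: fdim_mx|exact: oT|exact: linear_rsubmx].
have lv k l : linear (@vec_mx R k l) by move=> c u v; rewrite linearP.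
have lm k l : linear (@mxvec R k l) by move=> c u v; rewrite linearP.
have sW : smooth_on setT Wf.
  apply: smooth_row_mx => //; first exact: smooth_cst.
  apply: (@smooth_comp_lin _ _ _ _ _ (@mxvec R N N)); [exact: fdim_mx|exact: oT|exact: lm|].
  apply: smooth_mulmx => //; last exact: (smooth_compT (f := @lsubmx R 1 (1 + m) (N * N))).
  by apply: (@smooth_comp_lin _ _ _ _ _ (@vec_mx R N N)); [exact: fdim_mx|exact: oT|exact: lv|].
(* The factor [N] comes from the product estimate for the maximum norm on N by N matrices. *)
pose D := `|e0| + N%:R * C; have D0 : 0 <= D by rewrite addr_ge0// mulr_ge0.
have gW y : `|Wf y| <= D * (1 + `|y|).
  apply: norm_row_mx_le.
    apply: le_trans (_ : D <= _); first by rewrite lerDl mulr_ge0.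
    by rewrite ler_peMr// lerDl.
  apply: le_trans (norm_mxvec_le _) _; apply: le_trans (norm_mulmx_le _ _) _.
  apply: le_trans (_ : N%:R * (1 + `|y|) * C <= _).
    apply: ler_pM => //.
    rewrite ler_wpM2l//; apply: le_trans (norm_vec_mx_le _) _; apply: le_trans (norm_rsubmx _) _.
    by rewrite lerDr.
  rewrite mulrAC; apply: ler_wpM2r; first by rewrite addr_ge0.
  by rewrite lerDr.
pose y0 (z : 'rV[R]_(1 + m)) : 'rV[R]_((1 + m) + N * N) := row_mx (row_mx (0 : 'rV[R]_1) (rsubmx z)) (mxvec (1%:M : 'M[R]_N)).
have sy0 : smooth_on setT y0.
  apply: smooth_row_mx => //; last exact: smooth_cst.
  apply: smooth_row_mx => //; first exact: smooth_cst.
  by apply: smooth_linF => //; [exact: fdim_mx|exact: linear_rsubmx].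
have sc0 : smooth_on setT (@coord0 R m) by apply: smooth_linF => //; [exact: fdim_mx|exact: linear_coord0].
pose F z := flow Wf (coord0 z) (y0 z).
have sF : smooth_on setT F by exact: (smooth_flow sW D0 gW).
have dF z : differentiable F z by exact: (smooth_on_diff sF).
have DF z : 'D_e0 F z = Wf (F z).
  rewrite /F (@derive_flow R _ Wf _ sW D0 gW _ (@coord0 R m) y0 z _ 1 0).
  - by rewrite addr0 scale1r.
  - exact: (smooth_on_diff sc0).
  - exact: (smooth_on_diff sy0).
  - rewrite (is_diff_derive _ (is_diff_linF z (@fdim_mx R 1 (1 + m)) (@linear_coord0 R m))).
    by rewrite /coord0 row_mxKl mxE.
  - have ly z' : y0 z' = row_mx (row_mx 0 (rsubmx z')) 0 + row_mx 0 (mxvec 1%:M).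
      by rewrite add_row_mx addr0 add0r.
    have l1 : linear (fun z' : 'rV[R]_(1 + m) => row_mx (row_mx (0 : 'rV[R]_1) (rsubmx z')) (0 : 'rV[R]_(N * N))).
      by move=> c u v; rewrite linearP !scale_row_mx !add_row_mx !scaler0 !addr0.
    have dl := is_diff_linF z (@fdim_mx R 1 (1 + m)) l1.
    have -> : y0 = (fun z' => row_mx (row_mx 0 (rsubmx z')) 0 + row_mx 0 (mxvec 1%:M)) by apply/funext.
    rewrite derive_addf; [|exact: is_diff_diff dl|exact: differentiable_cst].
    by rewrite derive_cst (is_diff_derive _ dl) row_mxKr !row_mx0 addr0 scale0r.
have F0 x : F (row_mx 0 x) = row_mx (row_mx 0 x) (mxvec 1%:M).
  by rewrite /F /coord0 row_mxKl mxE (flow0 sW D0 gW) /y0 row_mxKr.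
have sFl : smooth_on setT (fun z => lsubmx (F z)) by exact: (@smooth_compT _ _ _ _ F (@lsubmx R 1 (1 + m) (N * N))).
have sFr : smooth_on setT (fun z => rsubmx (F z)) by exact: (@smooth_compT _ _ _ _ F (@rsubmx R 1 (1 + m) (N * N))).
(* The base component of the solution is the point [z] itself: the difference is constant along [e0]
   and zero on the slice. *)
have pos z : lsubmx (F z) = z.
  pose g z := lsubmx (F z) - z.
  have sid : smooth_on setT (fun z : 'rV[R]_(1 + m) => z) by apply: smooth_on_id => //; exact: fdim_mx.
  have sg : smooth_on setT g by exact: smooth_sub.
  have Dg z' : 'D_e0 g z' = 0.
    rewrite derive_subf; [|exact: (smooth_on_diff sFl)|exact: (smooth_on_diff sid)].
    rewrite (@derive_comp_lin _ _ _ _ (@lsubmx R 1 (1 + m) (N * N)) F)//; [|exact: fdim_mx|exact: linear_lsubmx].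
    by rewrite DF /Wf row_mxKl derive_id subrr.
  have := @line_const _ _ g (`|z| + 1) z (fun z _ => smooth_on_diff sg I) (fun z _ => Dg z).
  rewrite /g ltrDl ltr01 => /(_ isT); rewrite F0 row_mxKl subrr => /eqP.
  by rewrite subr_eq0 => /eqP.
exists (fun z => vec_mx (rsubmx (F z))); split.
- by apply: (@smooth_comp_lin _ _ _ _ _ (@vec_mx R N N)); [exact: fdim_mx|exact: oT1|exact: lv|].
- by move=> x; rewrite F0 row_mxKr mxvecK.
move=> z; rewrite (@derive_comp_lin _ _ _ _ (fun y => vec_mx (rsubmx y)) F)//; [|exact: fdim_mx|].
  by rewrite DF /Wf row_mxKr mxvecK pos.
by move=> c u v; rewrite linearP /= linearP.
Qed.

End ParallelTransport.

Section TransportInGroup.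
Context {R : realType} {m : nat}.
Local Notation J := (gram R m).
Local Notation L := (vec_l R m).
Local Notation Mat := (Lmat R m).
Local Notation e0 := (row_mx 1%:M 0 : 'rV[R]_(1 + m)).

Lemma isoJ_right (k : Mat) : k *m J *m k^T = J -> isoJ k.
Proof.
move=> h; have h1 : k *m (J *m k^T *m J) = 1%:M by rewrite !mulmxA h gram_sq.
by have := mulmx1C h1 => h2; rewrite /isoJ -[RHS]mulmx1 -h2 !mulmxA gram_sq mul1mx.
Qed.

(** Since [a] multiplies [K] from the right, the conserved quantity is K J K^T, with derivative K (a
    J + J a^T) K^T = 0; [isoJ_right] converts this into the isometry condition. Likewise e^(-t) K l
    is constant because a l = l. *)
Lemma transport_grpP (a K : 'rV[R]_(1 + m) -> Mat) : smooth_on setT K -> (forall x, K (row_mx 0 x) = 1%:M) ->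
  (forall z, 'D_e0 K z = K z *m a z) -> (forall z, skew (a z)) -> (forall z, a z *m L = L) ->
  forall z, grpP (K z) /\ K z *m L = expR (coord0 z) *: L.
Proof.
move=> sK K0 DK sa aL z; have dK z' : differentiable K z' by exact: (smooth_on_diff sK).
have oT : open [set: 'rV[R]_(1 + m)] by exact: openT.
have iso : isoJ (K z).
  pose G z := K z *m J *m (K z)^T.
  have d1 z' : differentiable (fun z => K z *m J) z' by exact: diff_mulmx_cst.
  have d2 z' : differentiable (fun z => (K z)^T) z' by exact: diff_trmx.
  have dG z' : differentiable G z' by exact: diff_mulmx.
  have DG z' : 'D_e0 G z' = 0.
    rewrite derive_mulmx// derive_mulmx_cst// derive_trmx// DK trmx_mul.
    have E : a z' *m J + J *m (a z')^T = 0.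
      have h : J *m ((a z')^T *m J + J *m a z') *m J = 0 by rewrite sa mulmx0 mul0mx.
      move: h; rewrite mulmxDr mulmxDl !mulmxA gram_sq mul1mx -(mulmxA _ J J) gram_sq mulmx1 addrC.
      by [].
    have -> : K z' *m a z' *m J *m (K z')^T + K z' *m J *m ((a z')^T *m (K z')^T) = K z' *m (a z' *m J + J *m (a z')^T) *m (K z')^T.
      by rewrite mulmxDr mulmxDl !mulmxA.
    by rewrite E mulmx0 mul0mx.
  have := @line_const _ _ _ _ G (`|z| + 1) z (fun z _ => dG z) (fun z _ => DG z).
  rewrite ltrDl ltr01 => /(_ isT); rewrite /G K0 mul1mx trmx1 mulmx1 => h.
  exact: isoJ_right.
have KL : K z *m L = expR (coord0 z) *: L.
  pose h z := expR (- coord0 z) *: (K z *m L).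
  have sc0 : smooth_on setT (fun z => - @coord0 R m z).
    by apply: smooth_opp => //; apply: smooth_linF => //; [exact: fdim_mx|exact: linear_coord0].
  have se : smooth_on setT (fun z => expR (- @coord0 R m z)).
    by apply: (@smooth_comp _ _ _ _ setT setT (fun z => - @coord0 R m z) (@expR R)) => //; [exact: fdimR|exact: openT|exact: smooth_expR].
  have sKL : smooth_on setT (fun z => K z *m L) by apply: smooth_mulmx => //; exact: smooth_cst.
  have sh : smooth_on setT h by exact: smooth_scale.
  have Dh z' : 'D_e0 h z' = 0.
    rewrite (@derive_scale _ _ _ (fun z => expR (- @coord0 R m z)) (fun z => K z *m L)); [|exact: (smooth_on_diff se)|exact: (smooth_on_diff sKL)].
    rewrite derive_mulmx_cst// DK -mulmxA aL.
    rewrite (@derive_comp _ _ _ _ (fun z => - @coord0 R m z) (@expR R)); [|exact: (smooth_on_diff sc0)|exact: is_diff_diff (is_diff_expR _)].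
    have lc : linear (fun z => - @coord0 R m z) by move=> c u v; rewrite linear_coord0 opprD scalerN.
    rewrite (is_diff_derive _ (is_diff_linF z' (@fdim_mx R 1 (1 + m)) lc)) (is_diff_derive _ (is_diff_expR _)).
    have -> : coord0 e0 = 1 by rewrite /coord0 row_mxKl mxE.
    by rewrite mulN1r scaleNr addNr.
  have := @line_const _ _ _ _ h (`|z| + 1) z (fun z _ => smooth_on_diff sh I) (fun z _ => Dh z).
  rewrite ltrDl ltr01 => /(_ isT); rewrite /h K0 mul1mx {2}/coord0 row_mxKl mxE oppr0 expR0 scale1r => hE.
  have := congr1 (fun v => expR (coord0 z) *: v) hE; rewrite scalerA -expRD subrr expR0 scale1r.
  by [].
split => //; apply/grpPP; split => //; exists (expR (coord0 z)) => //; exact: expR_gt0.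
Qed.

End TransportInGroup.

(** * Normal form of the connection form along Z *)

Section NormalForm.
Context {R : realType} {m : nat}.
Local Notation J := (gram R m).
Local Notation L := (vec_l R m).
Local Notation Mat := (Lmat R m).
Local Notation e0 := (row_mx 1%:M 0 : 'rV[R]_(1 + m)).

Lemma smooth_on_near (V W : normedModType R) (O : set V) (f : V -> W) :
  (forall x, O x -> smooth_near x f) -> smooth_on O f.
Proof. by move=> H s x /H [A [_ Ax sf]]; exact: sf. Qed.

Variables (theta : 'rV[R]_(1 + m) -> 'rV[R]_(1 + m) -> Mat) (rho : R).
Hypothesis rho0 : 0 < rho.
Hypothesis ft : forall z, `|z| < rho -> form_near theta z.
Hypothesis st : forall z w, `|z| < rho -> skew (theta z w).
Hypothesis tL : forall z, `|z| < rho -> theta z e0 *m L = L.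
Hypothesis tc : forall z w, `|z| < rho -> curv theta z e0 w = 0.
Hypothesis tinj : forall z w, `|z| < rho -> lie_h (theta z w) -> w = 0.
Hypothesis tsurj : forall z Y, `|z| < rho -> lie_g Y -> exists w, lie_h (Y - theta z w).

(* [K] is the parallel transport along the lines in direction [e0]; the gauge transform of [theta]
   by [K] kills [e0], hence by the curvature condition does not depend on the first coordinate. *)
Lemma normal_form : exists (r : R) (K : 'rV[R]_(1 + m) -> Mat) (bt : 'rV[R]_m -> 'rV[R]_m -> Mat),
  [/\ 0 < r <= rho, smooth_on setT K /\ (forall z, grpP (K z) /\ K z *m L = expR (coord0 z) *: L),
     (forall x, linear (bt x)) /\ (forall w, smooth_on setT (fun x => bt x w)),
     [/\ forall x w, skew (bt x w), forall x w, lie_p (bt x w) -> w = 0 &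
        forall x Y, lie_g Y -> exists w, lie_p (Y - bt x w)]
   & forall z w, `|z| < r -> K z *m theta z w = bt (rsubmx z) (rsubmx w) *m K z + 'D_w K z].
Proof.
pose O : set 'rV[R]_(1 + m) := [set z | `|z| < rho].
have oO : open O.
  by apply: (@open_comp _ _ (fun z : 'rV[R]_(1 + m) => `|z|) [set y : R | y < rho]); [move=> z _; exact: norm_continuous|exact: open_lt].
have O0 : O 0 by rewrite /O /= normr0.
have oT : open [set: 'rV[R]_(1 + m)] by exact: openT.
have oTm : open [set: 'rV[R]_m] by exact: openT.
have stO w : smooth_on O (fun z => theta z w).
  by apply: smooth_on_near => z /ft [_]; apply.
have svO : smooth_on O (fun z => mxvec (theta z e0)).
  by apply: (@smooth_comp_lin _ _ _ _ _ (@mxvec R _ _)); [exact: fdim_mx|exact: oO|move=> c u v; rewrite linearP|exact: stO].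
have [r0 r00 Hr] := smooth_extend oO O0 svO.
pose r := Num.min r0 rho.
have r_gt0 : 0 < r by rewrite lt_min r00.
have rr0 : 0 < r <= r0 by rewrite r_gt0 ge_min lexx.
have [Or _ [C C0 HC]] := Hr r rr0.
(* A bounded coefficient on the whole space, equal to theta(e0) on the ball of radius [r]. *)
pose a z := theta (retract r z) e0.
have sret w : smooth_on setT (fun z => theta (retract r z) w).
  apply: (@smooth_comp _ _ _ _ setT O (@retract R _ r) (fun z => theta z w)) => //; first exact: fdim_mx.
  exact: smooth_retract.
have aC z : `|a z| <= C.
  by rewrite /a -(mxvecK (theta _ _)); apply: le_trans (norm_vec_mx_le _) (HC z).
have [K [sK K0 DK]] := parallel_transport (sret e0) C0 aC.
have KP := transport_grpP sK K0 DK (fun z => st e0 (Or z)) (fun z => tL (Or z)).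
(* On the slice K is 1 and its derivatives along the slice vanish, so there the gauge transform is
   [theta] itself; [retract] makes its restriction to the slice global. *)
pose bt x u := theta (retract r (row_mx (0 : 'rV[R]_1) x)) (row_mx (0 : 'rV[R]_1) u).
have lin_z z : O z -> linear (theta z) by move=> /ft [/nbhs_singleton].
have dK z : differentiable K z by exact: (smooth_on_diff sK).
exists r, K, bt; split.
- by rewrite r_gt0 ge_min lexx orbT.
- by [].
- split=> [x c u v|w].
    rewrite /bt; have -> : row_mx (0 : 'rV[R]_1) (c *: u + v) = c *: row_mx 0 u + row_mx 0 v.
      by rewrite scale_row_mx add_row_mx scaler0 addr0.
    exact: lin_z.
  apply: (@smooth_comp _ _ _ _ setT setT (fun x : 'rV[R]_m => row_mx (0 : 'rV[R]_1) x) (fun z => theta (retract r z) (row_mx 0 w))) => //; first exact: fdim_mx.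
  by apply: smooth_row_mx => //; [exact: smooth_cst|apply: smooth_on_id => //; exact: fdim_mx].
- split=> [x w|x w [_ [c bL]]|x Y gY]; first exact: st (Or _).
    have Oz := Or (row_mx (0 : 'rV[R]_1) x); set z := retract r _ in Oz bL.
    (* An element of p that scales [L] by [c] falls into h after subtraction of c theta(e0), because
       theta(e0) fixes [L]. *)
    have : lie_h (theta z (row_mx 0 w - c *: e0)).
      apply/lie_hP; split; first exact: st.
      rewrite [X in theta z X]addrC -scaleNr (lin_z z Oz).
      by rewrite mulmxDl -scalemxAl tL// scaleNr; apply/eqP; rewrite addrC subr_eq0; apply/eqP; exact: bL.
    move=> /(tinj Oz) /eqP; rewrite scale_row_mx scaler0 opp_row_mx add_row_mx oppr0 addr0 row_mx_eq0.
    by move=> /andP[_ /eqP].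
  have Oz := Or (row_mx (0 : 'rV[R]_1) x); set z := retract r _ in Oz.
  have [w /lie_hP [sw wL]] := tsurj Oz gY; exists (rsubmx w).
  split; first by apply: skewB; [exact/lie_gP|exact: st].
  exists (coord0 w); rewrite /bt -/z.
  (* Dropping the [e0]-component of [w] changes theta(w) by a multiple of theta(e0), an element of
     p. *)
  have Ew : row_mx 0 (rsubmx w) = - coord0 w *: e0 + w by rewrite {3}(row_mx_e0 w) scaleNr addrC addrK.
  rewrite Ew (lin_z z Oz) mulmxBl mulmxDl -scalemxAl tL// opprD addrA addrAC -mulmxBl wL add0r.
  by rewrite scaleNr opprK.
pose th z w := (K z *m theta z w - 'D_w K z) *m invmx (K z).
have uK z : K z \in unitmx by apply: grpP_unit; exact: (KP z).1.
have rrho (z : 'rV[R]_(1 + m)) : `|z| < r -> `|z| < rho by move=> zr; apply: lt_le_trans zr _; rewrite ge_min lexx orbT.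
have gauge z w : K z *m theta z w = th z w *m K z + 'D_w K z by rewrite /th mulmxKV// subrK.
have lin_th z : `|z| < rho -> linear (th z).
  move=> zr c u v; rewrite /th (lin_z z zr) (derive_lin _ _ _ (dK z)).
  have alg (k ki X Y X' Y' : Mat) : (k *m (c *: X + Y) - (c *: X' + Y')) *m ki =
      c *: ((k *m X - X') *m ki) + (k *m Y - Y') *m ki.
    rewrite mulmxDr -scalemxAr opprD addrACA -scalerBr.
    by move: (k *m X - X') (k *m Y - Y') => S T; rewrite mulmxDl -scalemxAl.
  exact: alg.
have oB : open [set z : 'rV[R]_(1 + m) | `|z| < r].
  by apply: (@open_comp _ _ (fun z : 'rV[R]_(1 + m) => `|z|) [set y : R | y < r]); [move=> z _; exact: norm_continuous|exact: open_lt].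
have sth z w : `|z| < r -> smooth_near z (fun z => th z w).
  move=> zr; have sKz : smooth_near z K by exact: (smooth_near_on oT).
  have [_ /(_ w) s1] := ft (rrho _ zr); have s2 := smooth_near_D w sKz.
  have s3 : smooth_near z (fun z => K z *m theta z w - 'D_w K z).
    by apply: smooth_near2 (smooth_near_mulmx sKz s1) s2 => A oA; exact: smooth_sub.
  exact: smooth_near_mulmx s3 (smooth_near_invmx sKz (uK z)).
have fth z : `|z| < r -> form_near th z.
  move=> zr; split; last by move=> w; exact: sth.
  by apply: filterS (open_nbhs_nbhs (conj oB zr)) => z' zr'; exact: lin_th (rrho _ zr').
have the0 z : `|z| < r -> th z e0 = 0.
  by move=> zr; rewrite /th DK /a retract_id ?subrr ?mul0mx// ltW.
have thE z w : th z w = (K z *m theta z w - 'D_w K z) *m invmx (K z) by [].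
clearbody th.
(* The curvature of the gauge transform in direction [e0] also vanishes; since the transform kills
   [e0], this curvature is just the derivative along [e0]. *)
have Dth z w : `|z| < r -> 'D_e0 (fun z => th z w) z = 0.
  move=> zr; have nz := open_nbhs_nbhs (conj oB zr).
  have G := @curv_gauge _ _ _ theta th K z e0 w (ft (rrho _ zr)) (fth z zr) (smooth_near_on oT I sK).
  have H : \forall z' \near z, forall u, K z' *m theta z' u = th z' u *m K z' + 'D_u K z'.
    by near=> z' => u; exact: gauge.
  have := G H; rewrite (tc w (rrho _ zr)) mulmx0 => /esym E.
  have : curv th z e0 w = 0 by rewrite -[LHS](mulmxK (uK z)) E mul0mx.
  rewrite /curv (the0 z zr) mul0mx mulmx0 subrr addr0.
  have -> : 'D_w (fun z => th z e0) z = 0.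
    rewrite -[RHS](derive_cst (0 : Mat) z w); apply: derive_near_eq.
    by apply: filterS nz => z'; exact: the0.
  by rewrite subr0.
move=> z w zr; rewrite gauge; congr (_ *m _ + _).
have zs := le_lt_trans (norm_slice z) zr.
rewrite (@line_const _ _ _ _ (fun z => th z w) r z) //; last 2 first.
- by move=> z' zr'; exact: smooth_near_diff (sth z' w zr').
- by move=> z' zr'; exact: Dth.
set x := rsubmx z in zs *.
have -> : th (row_mx 0 x) w = th (row_mx 0 x) (row_mx 0 (rsubmx w)).
  rewrite {1}[w]row_mx_e0 addrC (lin_th _ (rrho _ zs)) the0// scaler0 add0r.
  by [].
rewrite thE K0 mul1mx invmx1 mulmx1 /bt retract_id; [|exact: r_gt0|exact: ltW].
have -> : 'D_(row_mx 0 (rsubmx w)) K (row_mx 0 x) = 0.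
  pose i (y : 'rV[R]_m) := row_mx (0 : 'rV[R]_1) y.
  have li : linear i by move=> c u v; rewrite /i scale_row_mx add_row_mx scaler0 addr0.
  have di := is_diff_linF x (@fdim_mx R 1 m) li.
  have := derive_comp (rsubmx w) (is_diff_diff di) (dK (i x)).
  rewrite (is_diff_derive _ di) => <-.
  rewrite -[RHS](derive_cst (1%:M : Mat) x (rsubmx w)); apply: derive_near_eq.
  by near=> y; rewrite /= /i K0.
by rewrite subr0.
Unshelve. all: by end_near. Qed.

End NormalForm.

(** * Coordinates in which Z is constant *)

Section Straightening.
Context {R : realType} {m : nat}.
Local Notation L := (vec_l R m).
Local Notation e0 := (row_mx 1%:M 0 : 'rV[R]_(1 + m)).
Variables (P N : manifold R) (p : P -> N) (act : P -> Lmat R m -> P).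
Variable omega : forall u : P, tangent u -> Lmat R m.
Arguments omega : clear implicits.
Hypothesis cart : cartan_geometry (@grpH R m) p act omega.
Let lieH := @lie_group_H R m.
Variables (U : set N) (s : N -> P) (x0 : N).
Hypotheses (ls : local_section p U s) (Ux0 : U x0).
Let c := chart_at x0.

(** The affine coordinates [io] built from the frame at [x0] put [x0] at the origin and turn Z(x0)
    into [e0], the normalization asked for by [flow_box]; they also convert between the dimensions
    [mdim N] and [1 + m]. As the box maps are global diffeomorphisms, [a] is defined on the whole
    chart domain, and only the straightening is confined to a ball. *)
Lemma straighten_Zfield : exists (rho : R) (b : 'rV[R]_(1 + m) -> N) (a : N -> 'rV[R]_(1 + m)),
  [/\ 0 < rho, a x0 = 0,
      forall z, `|z| < rho -> [/\ U (b z), smooth_at (b : Rman (1 + m) -> N) z, cdom c (b z) & a (b z) = z],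
      forall x, cdom c x -> smooth_at (a : N -> Rman (1 + m)) x /\ b (a x) = x
    & forall z, `|z| < rho -> tmap (b : Rman (1 + m) -> N) (e0 : tangent (z : Rman (1 + m))) = Zfield p omega (b z) :> 'rV[R]_(mdim N)].
Proof.
have [B [BF FB]] := frame_mx_inv cart ls Ux0.
set y0 := coo x0 in BF FB; set F := frame_mx _ _ _ y0 in BF FB.
pose io (z : 'rV[R]_(1 + m)) := y0 + z *m B.
have oT : open [set: 'rV[R]_(1 + m)] by exact: openT.
have oTn : open [set: 'rV[R]_(mdim N)] by exact: openT.
have lB : linear (fun z : 'rV[R]_(1 + m) => z *m B) by exact: linear_mulmxr.
have lF : linear (fun y : 'rV[R]_(mdim N) => y *m F) by exact: linear_mulmxr.
have sB : smooth_on setT (fun z : 'rV[R]_(1 + m) => z *m B) by apply: smooth_linF => //; exact: fdim_mx.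
have sio : smooth_on setT io by apply: smooth_add => //; exact: smooth_cst.
have [A0 [oA0 A0y sZ]] := smooth_vfield_Z cart x0.
have [A1 [oA1 A1y HA1]] := near_open (near_section_coo ls Ux0).
pose O := io @^-1` (A0 `&` A1).
have oO : open O.
  have := open_preimage_smooth oT (openI oA0 oA1) sio; by rewrite setTI.
have io0 : io 0 = y0 by rewrite /io mul0mx addr0.
have O0 : O 0 by rewrite /O /= io0.
pose Zz z := vfield_in c (Zfield p omega) (io z) *m F.
have sZz : smooth_on O Zz.
  apply: (@smooth_comp_lin _ _ _ _ _ (fun y => y *m F)) => //; first exact: fdim_mx.
  apply: (@smooth_comp _ _ _ _ O A0 io (vfield_in c (Zfield p omega))) => //; first exact: fdim_mx.
    by move=> z [].
  exact: smooth_on_sub sio.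
have ZF : Zfield p omega x0 *m F = e0.
  rewrite /F mul_frame_mx; last exact: nbhs_singleton (form_near_section cart ls Ux0).1.
  by rewrite pbf_coo (Zfield_l cart ls Ux0) red_l.
have Z0 : coord0 (Zz 0) = 1.
  by rewrite /Zz io0 vfield_in_coo ZF /coord0 row_mxKl mxE.
have [psi [chi [e [spsi schi psiK chiK [psi0 e_gt0 Oe Dpsi]]]]] := flow_box oO O0 sZz Z0.
have npsi : \forall z \near (0 : 'rV[R]_(1 + m)), `|psi z| < e.
  have cpsi := smooth_cont spsi (x := 0).
  have nb : \forall y \near psi 0, `|y| < e.
    by apply: (norm_nbhs e_gt0) => y; rewrite psi0 subr0.
  exact: cpsi nb.
have [rho rho0 Hrho] := nbhs_norm npsi.
pose b z := cinv c (io (psi z)); pose a x := chi ((cmap c x - y0) *m F).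
have Hz z : `|z| < rho -> (cmap c @` cdom c) (io (psi z)) /\ U (b z).
  move=> zr; have [] : (A0 `&` A1) (io (psi z)) by apply: Oe; apply: Hrho; rewrite subr0.
  by move=> _ /HA1 [].
pose iop : 'rV[R]_(1 + m) -> 'rV[R]_(mdim N) := fun z => io (psi z).
have siop : smooth_on setT iop by apply: (smooth_compT (f := psi)).
have sb z : `|z| < rho -> smooth_at (b : Rman (1 + m) -> N) z.
  move=> /Hz [iz _].
  have s1 : smooth_at (iop : Rman (1 + m) -> Rman (mdim N)) (z : Rman (1 + m)).
    by apply: smooth_at_Rman; apply: smooth_Rman_funat; exact: (smooth_near_on oT).
  exact: (@smooth_at_comp R (Rman (1 + m)) (Rman (mdim N)) N iop (cinv c) z s1 (smooth_at_cinv iz)).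
exists rho, b, a; split => //.
- rewrite /a -/(coo x0) subrr mul0mx; have := psiK 0; rewrite psi0.
  by [].
- move=> z zr; have [iz Uz] := Hz z zr; have [dz ez] := chart_imgV iz; split => //; first exact: sb.
  by rewrite /a /b ez /io addrAC subrr add0r -mulmxA BF mulmx1 psiK.
- move=> x dx; split.
    have sg : smooth_on setT (fun y => chi ((y - y0) *m F)).
      apply: (smooth_compT (f := fun y => (y - y0) *m F)) => //.
      apply: (@smooth_comp_lin _ _ _ _ _ (fun y => y *m F)) => //; first exact: fdim_mx.
      by apply: smooth_sub => //; [apply: smooth_on_id => //; exact: fdim_mx|exact: smooth_cst].
    apply: smooth_at_Rman; apply: (smooth_funat_post (F := cmap c) (G := fun y => chi ((y - y0) *m F))); first exact: fdim_mx.
      by have [] := smooth_at_chart dx.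
    exact: (smooth_near_on oTn).
  by rewrite /b /a chiK /io -mulmxA FB mulmx1 addrC subrK chartK.
move=> z zr; have [iz Uz] := Hz z zr.
have s1 : smooth_at (iop : Rman (1 + m) -> Rman (mdim N)) (z : Rman (1 + m)).
  by apply: smooth_at_Rman; apply: smooth_Rman_funat; exact: (smooth_near_on oT).
have := @tmap_comp R (Rman (1 + m)) (Rman (mdim N)) N iop (cinv c) z e0 s1 (smooth_at_cinv iz).
have -> : tmap (iop : Rman (1 + m) -> Rman (mdim N)) (e0 : tangent (z : Rman (1 + m))) = vfield_in c (Zfield p omega) (io (psi z)).
  have -> : tmap (iop : Rman (1 + m) -> Rman (mdim N)) (e0 : tangent (z : Rman (1 + m))) = 'D_e0 iop z by [].
  rewrite /iop (@derive_comp _ _ _ _ psi io); [|exact: (smooth_on_diff spsi)|exact: (smooth_on_diff sio)].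
  rewrite Dpsi; last by apply: Hrho; rewrite subr0.
  rewrite /io derive_addf; [|exact: differentiable_cst|exact: (smooth_on_diff sB)].
  rewrite derive_cst add0r (is_diff_derive _ (is_diff_linF _ (@fdim_mx R 1 (1 + m)) lB)).
  by rewrite /Zz -mulmxA FB mulmx1.
by move=> ->; rewrite vfield_push.
Qed.

End Straightening.

(** * From the curvature condition to a bundle of scales *)

Section FlatToScales.
Context {R : realType} {m : nat}.
Local Notation L := (vec_l R m).
Local Notation e0 := (row_mx 1%:M 0 : 'rV[R]_(1 + m)).
Variables (P N : manifold R) (p : P -> N) (act : P -> Lmat R m -> P).
Variable omega : forall u : P, tangent u -> Lmat R m.
Arguments omega : clear implicits.
Hypothesis cart : cartan_geometry (@grpH R m) p act omega.
Let lieH := @lie_group_H R m.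

(** The space is the union of the lines through 0. *)
Lemma connected_rV n : connected [set: 'rV[R]_n].
Proof.
have -> : [set: 'rV[R]_n] = \bigcup_(x in [set: 'rV[R]_n]) ((fun t : R => t *: x) @` setT).
  by apply/seteqP; split=> // x _; exists x => //; exists 1 => //; rewrite scale1r.
apply: bigcup_connected => [|x _]; first by exists 0 => x _; exists 0 => //; rewrite scale0r.
apply: connected_continuous_connected; first by apply/connected_intervalP.
apply: continuous_subspaceT; apply: smooth_cont; apply: smooth_scale; first exact: openT.
  exact: smooth_idR.
by apply: smooth_cst; exact: openT.
Qed.

Section InCoordinates.
Variables (U : set N) (s : N -> P) (rho : R) (b : 'rV[R]_(1 + m) -> N) (a : N -> 'rV[R]_(1 + m)).
Hypothesis ls : local_section p U s.
Hypothesis Ub : forall z, `|z| < rho -> U (b z).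
Hypothesis sb : forall z, `|z| < rho -> smooth_at (b : Rman (1 + m) -> N) z.
Hypothesis sa : forall z, `|z| < rho -> smooth_at (a : N -> Rman (1 + m)) (b z).
Hypothesis baK : forall z, `|z| < rho -> \forall x \near b z, b (a x) = x.
Hypothesis abK : forall z, `|z| < rho -> a (b z) = z.
Hypothesis bZ : forall z, `|z| < rho ->
  tmap (b : Rman (1 + m) -> N) (e0 : tangent (z : Rman (1 + m))) = Zfield p omega (b z) :> 'rV[R]_(mdim N).

Let th := pbf omega (s \o b).

Lemma near_ball (z : 'rV[R]_(1 + m)) : `|z| < rho -> \forall y \near z, `|y| < rho.
Proof.
move=> zr; apply: (norm_nbhs (d := rho - `|z|)); first by rewrite subr_gt0.
by move=> y; rewrite ltrBrDr; apply: le_lt_trans; rewrite -{1}(subrK z y); exact: ler_normD.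
Qed.

Let ssb z : `|z| < rho -> smooth_at (s \o b : Rman (1 + m) -> P) z.
Proof. by move=> zr; apply: (@smooth_at_comp R (Rman (1 + m)) N P b s z (sb zr)); exact: section_smooth ls (Ub zr). Qed.

Lemma coord_formE z w : `|z| < rho ->
  th z w = omega (s (b z)) (tmap s (tmap (b : Rman (1 + m) -> N) (w : tangent (z : Rman (1 + m))))).
Proof.
move=> zr; rewrite /th /pbf; congr (omega _).
exact: (@tmap_comp R (Rman (1 + m)) N P b s z w (sb zr) (section_smooth ls (Ub zr))).
Qed.

Lemma coord_form_near z : `|z| < rho -> form_near th z.
Proof.
move=> zr; apply: form_near_pbf; first exact: cartan_form cart.
by apply: filterS (near_ball zr) => y yr; exact: ssb.
Qed.

Lemma coord_form_skew z w : `|z| < rho -> skew (th z w).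
Proof. by move=> zr; exact: (omega_skew cart). Qed.

Lemma coord_form_l z : `|z| < rho -> th z e0 *m L = L.
Proof.
move=> zr; rewrite coord_formE//.
have -> : tmap (b : Rman (1 + m) -> N) (e0 : tangent (z : Rman (1 + m))) = Zfield p omega (b z) by exact: bZ.
exact: (Zfield_l cart ls (Ub zr)).
Qed.

Let tmap_ab z (w : 'rV[R]_(1 + m)) : `|z| < rho ->
  tmap (a : N -> Rman (1 + m)) (tmap (b : Rman (1 + m) -> N) (w : tangent (z : Rman (1 + m)))) = w :> 'rV[R]_(1 + m).
Proof.
move=> zr; have := @tmap_comp R (Rman (1 + m)) N (Rman (1 + m)) b a z w (sb zr) (sa zr) => <-.
rewrite -[RHS](@tmap_id R (Rman (1 + m)) z w).
apply: (@tmap_near_eq R (Rman (1 + m)) (Rman (1 + m)) (a \o b) id z w).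
by apply: filterS (near_ball zr) => y yr /=; exact: abK.
Qed.

Let tmap_ba z (v : tangent (b z)) : `|z| < rho ->
  tmap (b : Rman (1 + m) -> N) (tmap (a : N -> Rman (1 + m)) v : tangent (z : Rman (1 + m))) = v :> 'rV[R]_(mdim N).
Proof.
move=> zr; have sb' : smooth_at (b : Rman (1 + m) -> N) (a (b z)) by rewrite abK//; exact: sb.
rewrite -[RHS](tmap_id v) -(tmap_near_eq v (baK zr)).
apply: etrans (esym (@tmap_comp R N (Rman (1 + m)) N a b (b z) v (sa zr) sb')).
by apply: (@tmap_congr R (Rman (1 + m)) N b); rewrite ?abK.
Qed.

Lemma coord_form_inj z w : `|z| < rho -> lie_h (th z w) -> w = 0.
Proof.
move=> zr; rewrite coord_formE// => h.
have b0 := section_form_inj lieH cart ls (Ub zr) h.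
have := tmap_ab w zr; rewrite b0 => <-; exact: (tmap0 (sa zr)).
Qed.

Lemma coord_form_surj z Y : `|z| < rho -> lie_g Y -> exists w, lie_h (Y - th z w).
Proof.
move=> zr gY; have [v hv] := section_form_surj lieH cart ls (Ub zr) gY.
exists (tmap (a : N -> Rman (1 + m)) v).
have -> : th z (tmap (a : N -> Rman (1 + m)) v) = omega (s (b z)) (tmap s v); last exact: hv.
apply: etrans (coord_formE _ zr) _; congr (omega _ (tmap s _)); exact: tmap_ba.
Qed.

(** The curvature condition is given at centres of preferred charts; naturality under the coordinate
    change [phi] transports it, and [phi] sends [e0] to Z. *)
Lemma coord_form_curv z w : curvature_vanishes p omega -> `|z| < rho -> curv th z e0 w = 0.
Proof.
move=> cv zr; pose c := chart_at (b z); pose phi y := cmap c (b y).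
have sphi : smooth_near z phi by have [_] := sb zr.
have nc : \forall y \near z, cdom c (b y).
  by have [cb _] := sb zr; exact: (near_map (f := (b : Rman (1 + m) -> N)) cb (near_dom (coo_dom _))).
have E : \forall y \near z, (s \o b) y = ((s \o cinv c) \o phi) y.
  by apply: filterS nc => y dy; rewrite /= /phi chartK.
have -> : curv th z e0 w = curv (pbf omega ((s \o cinv c) \o phi)) z e0 w.
  apply: curv_near_eq; have := near_join E; apply: filterS => y Ey u; exact: pbf_near_eq.
have ns : \forall y \near phi z, smooth_at (s \o cinv c : Rman (mdim N) -> P) y.
  by apply: filterS (near_section_coo ls (Ub zr)) => y [].
rewrite (curv_pbf_comp (cartan_form cart) _ _ sphi ns).
have -> : 'D_e0 phi z = Zfield p omega (b z) by rewrite -bZ.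
exact: (cv _ _ _ _ ls (Ub zr)).
Qed.

End InCoordinates.

(** [model_scale] takes the logarithm of the factor by which the group component scales l: K(z)
    contributes the first coordinate of z and the H-component nothing. Hence the bundle map covers
    [a] and its inverse covers [b]. *)
Lemma curvature_vanishes_scales : curvature_vanishes p omega -> locally_bundle_of_scales p act omega.
Proof.
move=> cv x0; have [U0 [s [tau [U0x ls stau Htau tauK]]]] := cartan_triv cart x0.
have [rho [b [a [rho0 ax0 Hb Ha bZ]]]] := straighten_Zfield cart ls U0x.
set c := chart_at x0 in Hb Ha.
have Ub z : `|z| < rho -> U0 (b z) by move=> /Hb [].
have sb z : `|z| < rho -> smooth_at (b : Rman (1 + m) -> N) z by move=> /Hb [].
have db z : `|z| < rho -> cdom c (b z) by move=> /Hb [].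
have abK z : `|z| < rho -> a (b z) = z by move=> /Hb [].
have sa z : `|z| < rho -> smooth_at (a : N -> Rman (1 + m)) (b z) by move=> /db /Ha [].
have baK z : `|z| < rho -> \forall x \near b z, b (a x) = x.
  by move=> zr; apply: filterS (near_dom (db z zr)) => x /Ha [].
have [r [K [bt [/andP[r0 rrho] [sK KP] [lbt sbt] [kbt ibt jbt] gauge]]]] := normal_form rho0
  (fun z zr => coord_form_near ls Ub sb zr) (fun z w zr => coord_form_skew s b w zr) (fun z zr => coord_form_l ls Ub sb bZ zr)
  (fun z w zr => coord_form_curv ls Ub sb bZ w cv zr)
  (fun z w zr => coord_form_inj ls Ub sb sa abK zr) (fun z Y zr => coord_form_surj ls Ub sb sa baK abK zr).
have uK z : K z \in unitmx by apply: grpP_unit; exact: (KP z).1.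
have S (t : R) : (t *: L) 0 0 = t by rewrite mxE vec_l00 mulr1.
have K00 z : (K z) 0 0 = expR (coord0 z).
  by have [KPz Kl] := KP z; have [_ Kl'] := grpP00 KPz; rewrite -[LHS]S -Kl' Kl S.
(* On the chart domain b o a is the identity, and for |a x| < r the normal form holds. *)
pose U x := cdom c x /\ `|a x| < r.
have U0U x : U x -> U0 x.
  by move=> [dx ar]; have [_ <-] := Ha x dx; apply: Ub; exact: lt_le_trans rrho.
have bU x : U x -> b (a x) = x by move=> [dx _]; have [] := Ha x dx.
have arho x : U x -> `|a x| < rho by move=> [_ ar]; exact: lt_le_trans rrho.
have nU x : U x -> \forall x' \near x, U x'.
  move=> [dx ar]; apply: filterI; first exact: near_dom dx.
  by have [[ca _] _] := Ha x dx; exact: (near_map (f := (a : N -> Rman (1 + m))) ca (near_ball ar)).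
have nUp u : U (p u) -> \forall u' \near u, U (p u').
  by move=> /nU; exact: (near_map (f := p) (smooth_at_proj cart u).1).
pose f u : @model R m := model_pt (rsubmx (a (p u))) (K (a (p u)) *m tau u).
(* For z = model_scale e, the group component of [e] and K(z) scale [L] by the same factor, so their
   quotient lies in H. *)
pose f' (e : @model R m) := act (s (b (model_scale e))) (invmx (K (model_scale e)) *m (sval_ e).2).
have Pf u : U (p u) -> grpP (K (a (p u)) *m tau u).
  by move=> /U0U /Htau [Ht _]; apply: grpP_mul; [exact: (KP _).1|exact: grpH_P].
have evf u : U (p u) -> sval_ (f u) = (rsubmx (a (p u)), K (a (p u)) *m tau u).
  by move=> /Pf; exact: model_ptE.
have qf u : U (p u) -> model_scale (f u) = a (p u).
  move=> Uu; have [Ht _] := Htau u (U0U _ Uu).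
  rewrite /model_scale evf//= grpH_scale00//; last exact: (KP _).1.
  by rewrite K00 expRK /coord0 -mx11_scalar hsubmxK.
have Hf' e : grpH (invmx (K (model_scale e)) *m (sval_ e).2).
  have Pe := model_P e; have [k0 kL] := grpP00 Pe; have [KPz Kl] := KP (model_scale e).
  apply/grpHP; split.
    by apply: isoJ_mul; [apply: isoJ_invmx; apply: grpG_isoJ; case: KPz|apply: grpG_isoJ; case: Pe].
  apply: (can_inj (mulKmx (uK (model_scale e)))); rewrite !mulmxA mulmxV// mul1mx kL Kl.
  by rewrite /coord0 row_mxKl mxE eqxx mulr1n lnK.
have rr z : `|z| < r -> `|z| < rho by move=> zr; exact: lt_le_trans rrho.
have pf' e : `|model_scale e| < r -> p (f' e) = b (model_scale e).
  by move=> /rr /Ub Uz; rewrite /f' (cartan_proj_act cart)// (section_proj ls).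
have sap u : U (p u) -> smooth_at (a \o p : P -> Rman (1 + m)) u.
  move=> [du _]; have [sap _] := Ha _ du.
  exact: (@smooth_at_comp R P N (Rman (1 + m)) p a u (smooth_at_proj cart u) sap).
have sKap u : U (p u) -> smooth_funat (fun u => K (a (p u))) u.
  move=> /sap [_ sap']; apply: (smooth_funat_post (F := a \o p) (G := K)) => //; first exact: fdim_mx.
  by apply: (smooth_near_on (@openT _)).
have sev u : U (p u) -> smooth_funat (fun u => (rsubmx (a (p u)), K (a (p u)) *m tau u)) u.
  move=> Uu; apply: smooth_near_pair; [exact: fdim_mx|exact: fdim_mx| |].
    have [_ sap'] := sap u Uu.
    apply: (smooth_funat_post (F := a \o p) (G := rsubmx)) => //; first exact: fdim_mx.
    by apply: smooth_near_lin; [exact: fdim_mx|exact: linear_rsubmx].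
  by apply: smooth_near_mulmx; [exact: sKap|exact: (stau _ (U0U _ Uu))].
have nev u : U (p u) -> \forall u' \near u, sval_ (f u') = (rsubmx (a (p u')), K (a (p u')) *m tau u').
  by move=> /nUp; apply: filterS => u'; exact: evf.
have sevf u : U (p u) -> smooth_funat (fun u' => sval_ (f u')) u.
  move=> Uu; apply: (smooth_funat_near_eq _ (sev u Uu)).
  by apply: filterS (nev u Uu) => u'.
exists U; split.
- by rewrite openE => x /nU.
- by split; [exact: chart_atP|rewrite ax0 normr0].
exists (@model R m), (@Rman R m), (@Rman R (1 + m)), (@model_proj R m), (@model_scale R m), (@model_act R m).
exists (@model_omega R m bt), [set z | `|z| < r]; split.
- exact: connected_rV.
- exact: model_cartan.
- exact: model_correspondence.
- by rewrite openE => z; exact: near_ball.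
exists f, f', a, b; split.
- split.
  + apply/smooth_map_onP => u Uu; apply: smooth_at_model; exact: sevf.
  + apply/smooth_map_onP => e /rr er; apply: (smooth_at_act cart).
    * have se : smooth_at (@model_scale R m) e.
        by have [/smooth_map_onP /(_ e I)] := @model_correspondence R m.
      have sbe := @smooth_at_comp R (@model R m) (Rman (1 + m)) N (@model_scale R m) b e se (sb _ er).
      exact: (@smooth_at_comp R (@model R m) N P (b \o @model_scale R m) s e sbe (section_smooth ls (Ub _ er))).
    * have se : smooth_at (@model_scale R m) e.
        by have [/smooth_map_onP /(_ e I)] := @model_correspondence R m.
      apply: smooth_near_mulmx; last exact: smooth_ev2.
      apply: smooth_near_invmx; last exact: uK.
      apply: (smooth_funat_post (F := @model_scale R m) (G := K)); first exact: fdim_mx.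
        by have [_] := se.
      exact: (smooth_near_on (@openT _)).
    * by near=> e'; exact: Hf'.
  + move=> u Uu; rewrite /f' qf// evf//= mulKmx// bU//.
    by have [_] := Htau u (U0U _ Uu).
  + move=> e er; have pe := pf' e er; rewrite /f pe abK; last exact: rr.
    rewrite /f' tauK; [|by apply: Ub; exact: rr|exact: Hf'].
    by rewrite mulKVmx// /model_scale row_mxKr model_ptK.
- split.
  + by apply/smooth_map_onP => x [dx _]; have [] := Ha x dx.
  + by apply/smooth_map_onP => z /rr; exact: sb.
  + by move=> x Ux; split; [case: Ux|exact: bU].
  + by move=> z zr; split; [split; [apply: db; exact: rr|rewrite abK//; exact: rr]|apply: abK; exact: rr].
- by split=> [u|e]; [exact: qf|exact: pf'].
- move=> u k Uu Hk; have pk : p (act u k) = p u by rewrite (cartan_proj_act cart).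
  have [Ht tE] := Htau u (U0U _ Uu).
  have tk : tau (act u k) = tau u *m k.
    rewrite -{1}tE (cartan_actM cart)// tauK//; first exact: U0U.
    exact: grpH_mul.
  apply: sval_inj; rewrite model_actE; last exact: grpH_P.
  by rewrite !evf ?pk// tk mulmxA.
(* Compatibility with the connection forms: both sides are computed in the trivializations, where
   the group component of df(v) is DK tau + K dtau and the form upstairs is the conjugate of the
   pulled-back form by tau plus tau^-1 dtau. *)
move=> u v Uu; pose z := a (p u); pose ze : 'rV[R]_(1 + m) := tmap (a \o p : P -> Rman (1 + m)) v.
have zr : `|z| < r by case: Uu.
have [_ sapu] := sap u Uu; have dg := smooth_near_diff sapu.
have dK y : differentiable K y := smooth_on_diff sK I.
have stu := smooth_near_diff (stau u (U0U _ Uu)).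
have Dev : dfun (fun u' => sval_ (f u')) v = (rsubmx ze, 'D_ze K z *m tau u + K z *m dfun tau v).
  apply: etrans (dfun_near_eq v (nev u Uu)) _.
  pose g := (a \o p) \o cinv (chart_at u); pose tc := tau \o cinv (chart_at u).
  have dg' : differentiable g (coo u) := dg.
  have gz : g (coo u) = z by rewrite /g /= cooK.
  have tz : tc (coo u) = tau u by rewrite /tc /= cooK.
  have dKg : differentiable (fun y => K (g y)) (coo u) by exact: (differentiable_comp dg' (dK _)).
  have lr : linear (fun w : 'rV[R]_(1 + m) => rsubmx w) by exact: linear_rsubmx.
  have drg : differentiable (fun y => rsubmx (g y)) (coo u).
    exact: (differentiable_comp dg' (is_diff_diff (is_diff_linF _ (@fdim_mx R 1 (1 + m)) lr))).
  have D2 : 'D_v (fun y => K (g y) *m tc y) (coo u) = 'D_ze K z *m tau u + K z *m dfun tau v.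
    apply: etrans (derive_mulmx v dKg stu) _.
    by rewrite (derive_comp v dg' (dK (g (coo u)))) gz -tz.
  have D1 : 'D_v (fun y => rsubmx (g y)) (coo u) = rsubmx ze.
    exact: (@derive_comp_lin _ _ _ _ (fun w : 'rV[R]_(1 + m) => rsubmx w) g _ v (@fdim_mx R 1 (1 + m)) lr dg').
  have dm : differentiable (fun y => K (g y) *m tc y) (coo u) by exact: smooth_near_diff (smooth_near_mulmx (sKap u Uu) (stau u (U0U _ Uu))).
  by rewrite -D1 -D2; exact: derive_pair.
have om : omega u v = invmx (tau u) *m pbf omega (s \o b) z ze *m tau u + invmx (tau u) *m dfun tau v.
  have ssp : smooth_at (s \o p) u.
    exact: (@smooth_at_comp R P N P p s u (smooth_at_proj cart u) (section_smooth ls (U0U _ Uu))).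
  have nt : \forall u' \near u, act (s (p u')) (tau u') = u'.
    by apply: filterS (nUp u Uu) => u' /U0U /Htau [].
  have Ht : \forall u' \near u, grpH (tau u').
    by apply: filterS (nUp u Uu) => u' /U0U /Htau [].
  have := omega_act lieH cart v ssp (stau u (U0U _ Uu)) Ht.
  have -> : omega _ (tmap (fun u' => act ((s \o p) u') (tau u')) v) = omega u v.
    apply: (omega_congr omega); first exact: nbhs_singleton nt.
    by rewrite (tmap_near_eq v nt) tmap_id.
  have -> : omega _ (tmap (s \o p) v) = pbf omega (s \o b) z ze.
    have nb : \forall u' \near u, s (p u') = ((s \o b) \o (a \o p)) u'.
      by apply: filterS (nUp u Uu) => u' Uu'; rewrite /= bU.
    apply: (omega_congr omega); first exact: nbhs_singleton nb.
    rewrite (tmap_near_eq v nb).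
    have ssb : smooth_at (s \o b : Rman (1 + m) -> P) ((a \o p) u).
      apply: (@smooth_at_comp R (Rman (1 + m)) N P b s); first by apply: sb; exact: arho.
      by apply: (section_smooth ls); apply: Ub; exact: arho.
    exact: (@tmap_comp R P (Rman (1 + m)) P (a \o p) (s \o b) u v (sap u Uu) ssb).
  by [].
have := @smooth_model_omega R m bt P f u v (sevf u Uu); rewrite Dev evf//= -/z om => ->.
(* The terms tau^-1 dtau agree on both sides. What remains is the gauge relation K theta = bt K +
   DK, conjugated by tau. *)
have := gauge z ze zr; have ut : tau u \in unitmx by apply: grpP_unit; apply: grpH_P; exact: (Htau u (U0U _ Uu)).1.
move: (pbf omega (s \o b) z ze) ('D_ze K z) (bt _ _) (dfun tau v) ut (uK z) => T D B dt.
move: (K z) (tau u) => k t ut uk gE.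
rewrite invmx_prod// mulmxDr !mulmxA mulmxKV// addrA; congr (_ + _).
rewrite -mulmxDl; congr (_ *m t).
by rewrite -!mulmxA -!mulmxDr -gE mulKmx.
Unshelve. all: by end_near. Qed.

End FlatToScales.

Theorem mainTheorem8 (R : realType) (m : nat) (hm : (2 <= m)%N)
    (N P : manifold R) (p : P -> N) (act : P -> Lmat R m -> P)
    (omega : forall u : P, tangent u -> Lmat R m)
    (hN : connected [set: N])
    (hC : cartan_geometry (@grpH R m) p act omega) :
  locally_bundle_of_scales p act omega <->
  (forall (V : vfield N) (T : N -> set (P * Lvec R m)%type),
     smooth_vfield V -> tractor_section p act T ->
     forall x : N,
       tractor_curvature p act omega (Zfield p omega) V T x = tzero p x).
Proof.
split=> [h|H].
  exact: (curvature_vanishes_tractor hC (scales_curvature_vanishes hC h)).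
exact: (curvature_vanishes_scales hC (tractor_curvature_vanishes hC H)).
Qed.
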